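(* Let $(U_\varphi,C)$ be a neighborhood formally equivalent to $(U_{1,0,0},C)$, and let $G\subset\mathbb C^*\times\mathbb C^*$ be the subgroup corresponding to its group of (convergent) automorphisms inducing translations on $C$. Then the subgroup $G\subset\mathbb C^*\times\mathbb C^*$ is algebraic. In particular, we are in one of the following cases: 1. $G$ is finite and $G=\{(a,b)\ ;\ a^pb^q=a^{p'}b^{q'}=1\}$ for some non proportional $(p,q),(p',q')\in\mathbb Z^2\setminus\{(0,0)\}$; 2. $G=\{(a,b)\ ;\ a^pb^q=1\}$ for some $(p,q)\in\mathbb Z^2\setminus\{(0,0)\}$; in particular, a finite index subgroup of $G$ is generated by the flow of the rational vector field $qX\partial_X-pY\partial_Y$; 3. $G=\mathbb C^*\times\mathbb C^*$ and $(U_\varphi,C)$ is analytically equivalent to $(U_{1,0,0},C)$. Moreover, in the first two cases, up to the equivalence $\approx$, the cocycle takes the form $$\varphi_{i,i+1}(X,Y)=(X\cdot u_{i,i+1},\ Y\cdot v_{i,i+1})$$ where $u_{i,i+1},v_{i,i+1}$ are Laurent series in $X^pY^q$ and $X^{p'}Y^{q'}$ (resp. in $X^pY^q$), and the action of $G$ is linear in each chart $(V_i,L_i)$.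
   Context: Fix $\tau\in\mathbb C$, $\Im\tau>0$, $\varpi=\arg\tau\in]0,\pi[$, $q_0=e^{2i\pi\tau}$, $C=\mathbb C^*_z/\langle z\mapsto q_0z\rangle$, $\tilde C=\{y=0\}\subset\mathbb C^*_z\times\mathbb C_y$, $\xi=1/y$. $(U_{1,0,0},C)$ is the quotient of the germ $(\mathbb C^*_z\times\mathbb C_y,\tilde C)$ by $F_{1,0,0}(z,\xi)=(q_0z,\xi-1)$. A neighborhood $(U,C)$ (germ of smooth surface along $C$) formally equivalent to it (formal isomorphism inducing the identity on $C$) can be written $(\mathbb C^*_z\times\mathbb C_y,\tilde C)/\langle F\rangle$ with $F(z,y)=(q_0z+O(y^2),y+y^2+y^3+O(y^4))$, and there is a formal diffeomorphism $\hat\Psi=(z+\sum_{n\ge1}a_n(z)y^n,y+\sum_{n\ge2}b_n(z)y^n)$, $a_n,b_n\in\mathcal O(\mathbb C^* )$, with $\hat\Psi\circ F=F_{1,0,0}\circ\hat\Psi$. Analytic equivalence of neighborhoods: biholomorphism of germs inducing the identity on $C$. Lines: in $\mathbb P^1_X\times\mathbb P^1_Y$ set $L_1=\{Y=0\}$, $L_2=\{X=\infty\}$, $L_3=\{Y=\infty\}$, $L_4=\{X=0\}$, $D=\bigcup L_i$, $p_{i,i+1}=L_i\cap L_{i+1}$ ($i\in\mathbb Z_4$); $(V_i,L_i)$ is the germ of $\mathbb P^1\times\mathbb P^1$ along $L_i$. $\mathrm{Diff}^1(V_{i,i+1},p_{i,i+1})$: germs of biholomorphisms at $p_{i,i+1}$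 preserving the two branches of $D$ and tangent to the identity at $p_{i,i+1}$; $\mathrm{Diff}^1(V_i,L_i)$: germs of biholomorphisms along $L_i$ preserving $D\cap V_i$ and tangent to the identity along $L_i$. A cocycle is $\varphi=(\varphi_{i,i+1})_{i\in\mathbb Z_4}$, $\varphi_{i,i+1}\in\mathrm{Diff}^1(V_{i,i+1},p_{i,i+1})$. $\varphi\approx\varphi'$ if there are $t\in\mathbb C$, $\varphi_i\in\mathrm{Diff}^1(V_i,L_i)$ with $\varphi'_{i,i+1}=\phi^t\circ\varphi_i\circ\varphi_{i,i+1}\circ\varphi_{i+1}^{-1}\circ\phi^{-t}$, $\phi^t(X,Y)=(e^{2i\pi t}X,e^{2i\pi\tau t}Y)$. $(U_\varphi,C)$ denotes a neighborhood formally equivalent to $(U_{1,0,0},C)$ whose cocycle is $\varphi$: let $I_1=]-\varpi,\pi-\varpi[$, $I_2=]-\pi,0[$, $I_3=I_1+\pi$, $I_4=I_2+\pi$ (values of $\arg\xi$ mod $2\pi$); for each $i$ there is a biholomorphism onto its image $\Psi_i$ on a transversely sectorial open set of opening $I_i=]\theta_1,\theta_2[$ (i.e. containing, for all large $c$ and small $\varepsilon$, some $\{\arg\xi\in]\theta_1+\varepsilon,\theta_2-\varepsilon[,|\xi|>R,e^{-c}<|z|<e^c\}$), with asymptotic expansion $\hat\Psi$ and $\Psi_i\circ F=F_{1,0,0}\circ\Psi_i$; with $\Pi(z,\xi)=(e^{2i\pi\xi},ze^{2i\pi\tau\xi})$ the cocycle is given by $\Pi\circ\Psi_i=\varphi_{i,i+1}\circ\Pi\circ\Psi_{i+1}$.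 The maps $\Pi\circ\Psi_i$ identify $U_\varphi\setminus C$ with $V_\varphi\setminus D$, where $V_\varphi$ is the patching of the $(V_i,L_i)$ by $\varphi_{i,i+1}:(V_{i+1},p_{i,i+1})\to(V_i,p_{i,i+1})$; the action of automorphisms in the chart $(V_i,L_i)$ is understood through this identification. Group $G$: via $\hat\Psi$, formal automorphisms of $(U_\varphi,C)$ restricting to translations on $C$ correspond to those of $(U_{1,0,0},C)$, which are the maps $(z,\xi)\mapsto(cz,\xi+t)$, $c\in\mathbb C^*$, $t\in\mathbb C$; through $\Pi$ these become $(X,Y)\mapsto(aX,bY)$ with $a=e^{2i\pi t}$, $b=c\,e^{2i\pi\tau t}$. $G$ is the set of $(a,b)\in\mathbb C^*\times\mathbb C^*$ corresponding to the convergent automorphisms of $(U_\varphi,C)$ restricting to translations on $C$. *)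

(* Defs.v *)
(* MathComp-Analysis over an arbitrary realType R, complex numbers being R[i]. *)
From mathcomp Require Import all_boot all_order all_algebra.
From mathcomp Require Import all_classical all_reals all_analysis.
From mathcomp Require Import complex finmap.
From mathcomp Require Import showcase.summability.

Set Implicit Arguments.
Unset Strict Implicit.
Unset Printing Implicit Defensive.

Import Order.TTheory GRing.Theory Num.Theory.
Import numFieldNormedType.Exports.
Local Open Scope classical_set_scope.
Local Open Scope ring_scope.

(* Seen as a numClosedFieldType, R[i] gets the topology and the norm that
   MathComp-Analysis puts on every numFieldType; the norm is C-valued, and
   [differentiable], [derivable] are then complex differentiability. *)
Definition Cx (R : realType) : numClosedFieldType := R[i].

Section Exponential.
Variable R : realType.
Local Notation C := (Cx R).

Definition ofR (x : R) : C := (x%:C)%C.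

Definition cexp (z : C) : C :=
  (ofR (expR (complex.Re z)) * (cos (complex.Im z) +i* sin (complex.Im z))%C : C).

(* exp (2 i pi z) *)
Definition e2ipi (z : C) : C := cexp ((0 +i* (2 * pi))%C * z).

End Exponential.

Section Germs.
Variables (T : topologicalType) (holo : (T -> T) -> T -> Prop).

(* f represents an isomorphism of the germ of T along A; [set_nbhs A] is the
   filter of neighbourhoods of A. *)
Definition germ_biholo (A : set T) (f : T -> T) : Prop :=
  exists g : T -> T,
    [/\ set_nbhs A [set p | holo f p] /\ set_nbhs A [set p | holo g p],
        f @` A `<=` A,
        g @` A `<=` A
      & set_nbhs A [set p | g (f p) = p /\ f (g p) = p]].

End Germs.

Section EllipticNeighbourhoods.
Variable R : realType.
Local Notation C := (Cx R).

(* (z, y) with z in C^*, y in C; xi = 1 / y. *)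
Definition Ctilde : set (C * C) := [set p | p.1 != 0 /\ p.2 = 0].

Definition torus : set (C * C) := [set p | p.1 != 0 /\ p.2 != 0].

Definition holo2 (f : C * C -> C * C) (p : C * C) : Prop := differentiable f p.

(* h = O(y^k), locally uniformly with respect to z in C^*. *)
Definition bigOy (k : nat) (h : C * C -> C) : Prop :=
  forall z : C, z != 0 ->
    exists K : C, \forall p \near nbhs ((z, 0) : C * C),
      `|h p| <= K * `|p.2| ^+ k.

(* (z, xi) |-> (c z, xi + t), written in the coordinates (z, y). *)
Definition model (c t : C) (p : C * C) : C * C :=
  (c * p.1, p.2 / (1 + t * p.2)).

Definition q0 (tau : C) : C := e2ipi tau.

Definition F100 (tau : C) : C * C -> C * C := model (q0 tau) (- 1).

Definition neighbourhood_germ (tau : C) (F : C * C -> C * C) : Prop :=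
  [/\ germ_biholo holo2 Ctilde F,
      bigOy 2 (fun p => (F p).1 - q0 tau * p.1)
    & bigOy 4 (fun p => (F p).2 - (p.2 + p.2 ^+ 2 + p.2 ^+ 3))].

(* Coefficients of hatPsi = (z + sum_(n >= 1) a_n(z) y^n,
                             y + sum_(n >= 2) b_n(z) y^n);
   the values a 0, b 0, b 1 are not used. *)
Definition holomorphic_coefs (a b : nat -> C -> C) : Prop :=
  forall (n : nat) (z : C), z != 0 ->
    differentiable (a n) z /\ differentiable (b n) z.

Definition trunc (a b : nat -> C -> C) (N : nat) (p : C * C) : C * C :=
  (p.1 + \sum_(1 <= n < N.+1) a n p.1 * p.2 ^+ n,
   p.2 + \sum_(2 <= n < N.+1) b n p.1 * p.2 ^+ n).

(* The formal identity hatPsi o H = model c t o hatPsi, that is equality modulo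
   y^(N+1) for all N. As the second component of H is O(y), both sides modulo
   y^(N+1) only depend on the truncation of hatPsi at order N. *)
Definition formal_conj (a b : nat -> C -> C) (H : C * C -> C * C) (c t : C) :
    Prop :=
  forall N : nat,
    bigOy N.+1 (fun p => (trunc a b N (H p)).1 - (model c t (trunc a b N p)).1)
 /\ bigOy N.+1 (fun p => (trunc a b N (H p)).2 - (model c t (trunc a b N p)).2).

(* Germs of maps between the quotients by <F> are given by germs along Ctilde
   that are compatible with the generators. *)

(* Lift of an automorphism of (U, C) inducing the translation z |-> c z on C. *)
Definition automorphism (F : C * C -> C * C) (c : C) (Th : C * C -> C * C) :
    Prop :=
  [/\ c != 0,
      germ_biholo holo2 Ctilde Th,
      set_nbhs Ctilde [set p | Th (F p) = F (Th p)]
    & forall z : C, z != 0 -> Th (z, 0) = (c * z, 0)].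

(* The lift of a map inducing the identity on C induces a power of
   z |-> q0 z on C^*. *)
Definition analytically_equivalent_100 (tau : C) (F : C * C -> C * C) : Prop :=
  exists Phi : C * C -> C * C,
    [/\ germ_biholo holo2 Ctilde Phi,
        set_nbhs Ctilde [set p | Phi (F p) = F100 tau (Phi p)]
      & exists k : int, forall z : C, z != 0 -> Phi (z, 0) = (q0 tau ^ k * z, 0)].

(* Th corresponds, via hatPsi, to (z, xi) |-> (c z, xi + t). *)
Definition convergent_aut (F : C * C -> C * C) (a b : nat -> C -> C) (c t : C)
    (Th : C * C -> C * C) : Prop :=
  automorphism F c Th /\ formal_conj a b Th c t.

Definition multipliers (tau c t : C) : C * C :=
  (e2ipi t, c * e2ipi (tau * t)).

Definition aut_group (tau : C) (F : C * C -> C * C) (a b : nat -> C -> C) :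
    set (C * C) :=
  [set g | exists c t Th, convergent_aut F a b c t Th
                          /\ g = multipliers tau c t].

(* L_i has index i in Z/4, so that L_4 is line 0 and p_{4,1} is corner 0;
   corner i is p_{i,i+1}. *)
Definition P1 : topologicalType := one_point_compactification C.
Definition P1xP1 : topologicalType := (P1 * P1)%type.

(* Affine charts of P^1: the coordinate x if s = false, 1 / x if s = true. *)
Definition chart_dom (s : bool) : set P1 :=
  [set x : P1 | if s then x <> Some 0 else x <> None].

Definition p1coord (s : bool) (x : P1) : C :=
  if x is Some u then (if s then u^-1 else u) else 0.

Definition p1param (s : bool) (u : C) : P1 :=
  if s then (if u == 0 then None else Some u^-1) else Some u.

Definition chart_dom2 (s : bool * bool) : set P1xP1 :=
  [set p | chart_dom s.1 p.1 /\ chart_dom s.2 p.2].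

Definition p1coord2 (s : bool * bool) (p : P1xP1) : C * C :=
  (p1coord s.1 p.1, p1coord s.2 p.2).

Definition p1param2 (s : bool * bool) (u : C * C) : P1xP1 :=
  (p1param s.1 u.1, p1param s.2 u.2).

Definition in_charts (s s' : bool * bool) (f : P1xP1 -> P1xP1) :
    C * C -> C * C :=
  fun u => p1coord2 s' (f (p1param2 s u)).

Definition holoP (f : P1xP1 -> P1xP1) (p : P1xP1) : Prop :=
  {for p, continuous f} /\
  forall s s', chart_dom2 s p -> chart_dom2 s' (f p) ->
    differentiable (in_charts s s' f) (p1coord2 s p).

Definition line (i : 'Z_4) : set P1xP1 :=
  match val i with
  | 1%N => [set p | p.2 = Some 0]
  | 2%N => [set p | p.1 = None]
  | 3%N => [set p | p.2 = None]
  | _ => [set p | p.1 = Some 0]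
  end.

Definition corner (i : 'Z_4) : P1xP1 :=
  match val i with
  | 1%N => (None, Some 0)
  | 2%N => (None, None)
  | 3%N => (Some 0, None)
  | _ => (Some 0, Some 0)
  end.

Definition Dcycle : set P1xP1 := \bigcup_(i in [set: 'Z_4]) line i.

(* The chart centred at corner i. *)
Definition corner_chart (i : 'Z_4) : bool * bool :=
  (~~ isSome (corner i).1, ~~ isSome (corner i).2).

Definition Diff1_corner (i : 'Z_4) (f : P1xP1 -> P1xP1) : Prop :=
  [/\ germ_biholo holoP [set corner i] f,
      set_nbhs [set corner i]
        [set p | (line i p -> line i (f p))
                 /\ (line (i + 1) p -> line (i + 1) (f p))]
    & 'd (in_charts (corner_chart i) (corner_chart i) f) (0 : C * C) = id
        :> (C * C -> C * C)].

(* Coordinate transverse to L_i. *)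
Definition normal_part (i : 'Z_4) (v : C * C) : C := if odd i then v.2 else v.1.

(* Tangent to the identity along L_i: f is the identity on L_i and acts
   trivially on its normal bundle. For f preserving D, hence of the form
   (X u, Y v) with u, v holomorphic and nonvanishing, this says u = v = 1 on
   L_i, in the same way as tangency at the corner says u = v = 1 at the corner.
   Mixed terms such as X (1 + Y) for L_1 = {Y = 0} are allowed: they are
   produced by two sectorial normalizations with the same expansion hatPsi. *)
Definition Diff1_line (i : 'Z_4) (f : P1xP1 -> P1xP1) : Prop :=
  [/\ germ_biholo holoP (line i) f,
      set_nbhs (line i) [set p | Dcycle p -> Dcycle (f p)],
      forall p, line i p -> f p = p
    & forall p s, line i p -> chart_dom2 s p ->
        forall v : C * C,
          normal_part i ('d (in_charts s s f) (p1coord2 s p) v)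
          = normal_part i v].

Definition is_cocycle (phi : 'Z_4 -> P1xP1 -> P1xP1) : Prop :=
  forall i, Diff1_corner i (phi i).

(* (X, Y) |-> (a X, b Y) *)
Definition lin (a b : C) (p : P1xP1) : P1xP1 :=
  (omap ( *%R a) p.1, omap ( *%R b) p.2).

Definition phit (tau t : C) : P1xP1 -> P1xP1 :=
  lin (e2ipi t) (e2ipi (tau * t)).

(* phi' = phi^t o phi_i o phi_{i,i+1} o phi_{i+1}^-1 o phi^-t as germs at
   p_{i,i+1}, composed on the right with phi^t o phi_{i+1}. *)
Definition cocycle_equiv_by (tau t : C) (phil : 'Z_4 -> P1xP1 -> P1xP1)
    (phi phi' : 'Z_4 -> P1xP1 -> P1xP1) : Prop :=
  (forall i, Diff1_line i (phil i)) /\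
  forall i, set_nbhs [set corner i]
    [set p | phi' i (phit tau t (phil (i + 1) p))
             = phit tau t (phil i (phi i p))].

(* Lower end of I_i, modulo 2 pi; all I_i have length pi. *)
Definition arc_start (varpi : R) (i : 'Z_4) : R :=
  match val i with
  | 1%N => - varpi
  | 2%N => - pi
  | 3%N => pi - varpi
  | _ => 0
  end.

(* arg xi belongs, modulo 2 pi, to I_i shrunk by eps at both ends. *)
Definition arc (varpi : R) (i : 'Z_4) (eps : R) : set C :=
  [set xi | exists th : R,
     [/\ arc_start varpi i + eps < th, th < arc_start varpi i + pi - eps
       & xi = `|xi| * cexp (ofR th * (0 +i* 1)%C)]].

Definition sector (A : set C) (c r : R) : set (C * C) :=
  [set p | [/\ p.2 != 0, A p.2^-1, ofR r < `|p.2^-1|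
             & ofR (expR (- c)) < `|p.1| < ofR (expR c)]].

(* P holds at the points of {arg xi in A eps, |xi| > r, e^-c < |z| < e^c}, for
   all c, eps and some r = r(c, eps). *)
Definition sectorially (A : R -> set C) (P : set (C * C)) : Prop :=
  forall c eps : R, 0 < c -> 0 < eps ->
    exists r : R, sector (A eps) c r `<=` P.

Definition biholo_onto_image (S : set (C * C)) (f : C * C -> C * C) : Prop :=
  [/\ forall p, S p -> holo2 f p,
      open (f @` S)
    & exists g : C * C -> C * C,
        (forall q, (f @` S) q -> holo2 g q) /\ (forall p, S p -> g (f p) = p)].

Definition asymptotic (varpi : R) (i : 'Z_4) (a b : nat -> C -> C)
    (Psi : C * C -> C * C) : Prop :=
  forall (N : nat) (delta : R), 0 < delta ->
    sectorially (arc varpi i)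
      [set p | `|Psi p - trunc a b N p| <= ofR delta * `|p.2| ^+ N].

Definition sectorial_normalization (tau : C) (varpi : R) (F : C * C -> C * C)
    (a b : nat -> C -> C) (i : 'Z_4) (S : set (C * C))
    (Psi : C * C -> C * C) : Prop :=
  [/\ [/\ open S, S `<=` torus & sectorially (arc varpi i) S],
      biholo_onto_image S Psi,
      Psi @` S `<=` torus,
      asymptotic varpi i a b Psi
    & sectorially (arc varpi i)
        [set p | S (F p) -> Psi (F p) = F100 tau (Psi p)]].

(* Pi (z, xi) = (e^(2 i pi xi), z e^(2 i pi tau xi)), for y <> 0. *)
Definition Pimap (tau : C) (p : C * C) : P1xP1 :=
  (Some (e2ipi p.2^-1), Some (p.1 * e2ipi (tau / p.2))).

Definition has_cocycle (tau : C) (varpi : R) (Psi : 'Z_4 -> C * C -> C * C)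
    (phi : 'Z_4 -> P1xP1 -> P1xP1) : Prop :=
  forall i, sectorially (fun eps => arc varpi i eps `&` arc varpi (i + 1) eps)
    [set p | Pimap tau (Psi i p) = phi i (Pimap tau (Psi (i + 1) p))].

(* The regular functions on C^* x C^* are the Laurent polynomials, which define
   the same subsets as the polynomials; P.[b%:P].[a] is P evaluated at (a, b). *)
Definition algebraic_subgroup (G : set (C * C)) : Prop :=
  [/\ G `<=` torus,
      G (1, 1),
      forall g h, G g -> G h -> G (g.1 * h.1, g.2 * h.2),
      forall g, G g -> G (g.1^-1, g.2^-1)
    & exists s : seq {poly {poly C}}, forall g, torus g ->
        (G g <-> forall P, P \in s -> P.[g.2%:P].[g.1] = 0)].

Definition char_kernel (p q : int) : set (C * C) :=
  [set g | torus g /\ g.1 ^ p * g.2 ^ q = 1].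

Definition is_flow (v : C * C -> C * C) (Phi : C -> C * C -> C * C) : Prop :=
  forall x, Phi 0 x = x /\
    forall s : C, is_derive s (1 : C) (fun s' : C => Phi s' x) (v (Phi s x)).

(* Elements of C^* x C^*, acting by (X, Y) |-> (g_1 X, g_2 Y), of a flow. *)
Definition flow_group (Phi : C -> C * C -> C * C) : set (C * C) :=
  [set g | torus g /\
     exists s : C, forall x, Phi s x = (g.1 * x.1, g.2 * x.2)].

Definition finite_index (H G : set (C * C)) : Prop :=
  H `<=` G /\
  exists T : set (C * C), [/\ finite_set T, T `<=` G
    & forall g, G g -> exists t h, [/\ T t, H h
                                     & g = (t.1 * h.1, t.2 * h.2)]].

Definition flow_has_finite_index (p q : int) (G : set (C * C)) : Prop :=
  exists Phi : C -> C * C -> C * C,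
    is_flow (fun x => (q%:~R * x.1, - (p%:~R * x.2))) Phi
    /\ finite_index (flow_group Phi) G.

(* Near p_{i,i+1} and off D, u is the sum of a Laurent series in the given
   monomials: sum_k cf_k mon_k(X, Y), unconditionally convergent. *)
Definition laurent_at (I : choiceType) (mon : I -> C -> C -> C) (i : 'Z_4)
    (u : C -> C -> C) : Prop :=
  exists cf : I -> C,
    set_nbhs [set corner i] [set p : P1xP1 | forall X Y : C,
      X != 0 -> Y != 0 -> p = (Some X, Some Y) ->
      (partial_sum (fun k => cf k * mon k X Y) : {fset I} -> C)
        @ totally --> u X Y].

Definition mon2 (p q p' q' : int) (k : int * int) (X Y : C) : C :=
  (X ^ p * Y ^ q) ^ k.1 * (X ^ p' * Y ^ q') ^ k.2.

Definition mon1 (p q k : int) (X Y : C) : C := (X ^ p * Y ^ q) ^ k.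

Definition laurent_cocycle (I : choiceType) (mon : I -> C -> C -> C)
    (phi : 'Z_4 -> P1xP1 -> P1xP1) : Prop :=
  forall i, exists u v : C -> C -> C,
    [/\ laurent_at mon i u, laurent_at mon i v
      & set_nbhs [set corner i] [set p : P1xP1 | forall X Y : C,
          X != 0 -> Y != 0 -> p = (Some X, Some Y) ->
          phi i p = (Some (X * u X Y), Some (Y * v X Y))]].

(* If phi' is equivalent to phi by t and phil, the charts of V_{phi'} on U \ C
   are phi^t o phil_i o Pi o Psi_i. In each of them the automorphism with
   multipliers (g_1, g_2) is required to be (X, Y) |-> (g_1 X, g_2 Y). *)
Definition linear_action (tau : C) (varpi : R) (F : C * C -> C * C)
    (a b : nat -> C -> C) (Psi : 'Z_4 -> C * C -> C * C)
    (t : C) (phil : 'Z_4 -> P1xP1 -> P1xP1) : Prop :=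
  forall (c s : C) (Th : C * C -> C * C), convergent_aut F a b c s Th ->
    let g := multipliers tau c s in
    forall i, let chi p := phit tau t (phil i (Pimap tau (Psi i p))) in
      sectorially (arc varpi i) [set p | chi (Th p) = lin g.1 g.2 (chi p)].

Definition normalizable (tau : C) (varpi : R) (F : C * C -> C * C)
    (a b : nat -> C -> C) (Psi : 'Z_4 -> C * C -> C * C)
    (phi : 'Z_4 -> P1xP1 -> P1xP1)
    (I : choiceType) (mon : I -> C -> C -> C) : Prop :=
  exists (t : C) (phil phi' : 'Z_4 -> P1xP1 -> P1xP1),
    [/\ is_cocycle phi', cocycle_equiv_by tau t phil phi phi',
        laurent_cocycle mon phi' & linear_action tau varpi F a b Psi t phil].

End EllipticNeighbourhoods.

(* Main.v *)
Require Import Defs.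
From HB Require Import structures.
From mathcomp Require Import all_boot all_order all_algebra.
From mathcomp Require Import all_classical all_reals all_analysis.
From mathcomp Require Import complex finmap.
From mathcomp Require Import ring lra zify.
From mathcomp Require Import showcase.summability.
Set Implicit Arguments.
Unset Strict Implicit.
Unset Printing Implicit Defensive.
Import Order.TTheory GRing.Theory Num.Theory.
Import numFieldNormedType.Exports.
Local Open Scope classical_set_scope.
Local Open Scope ring_scope.

(** Each sectorial chart is first corrected along [L_i] by [(X A(w_i), Y B(w_i))], where [A, B] are the multipliers
   of the cocycle at [w_{i+1} = 0]; the cocycle becomes [(w_i, w_{i+1}) |-> (w_i u_i, w_{i+1} v_i)] with
   [u_i = v_i = 1] on [w_{i+1} = 0].  In these charts compare a convergent automorphism with the linear map it should
   be.  The ratio [1 + E] is a function of [xi] and [eta = log z / (2 i pi) + tau xi], holomorphic and invariant under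
   integer translations on tubes over larger and larger sectors of a half plane, and it tends to [1]; only characters
   that are small on these tubes occur in its Fourier series, so [E = O(w_i)] on the sector of index [i].  On the
   overlap of two consecutive sectors the shape of the cocycle yields [E = O(w_{i+1})] as well, which no such
   character satisfies, so [E = 0].  Hence the group acts linearly in every chart and fixes all [u_i, v_i]: it lies in
   the annihilator of the set of exponents of their Laurent monomials.  Conversely a torus element fixing all
   [u_i, v_i] defines automorphisms of the sectors which glue, extend across [y = 0] by Riemann's theorem and have
   the right asymptotic expansion.  So the group is the annihilator of a subgroup of [Z^2], and such a subgroup is
   generated by some [(d, f)] and [(0, n)].  Dually, the exponents lie in the lattice of characters trivial on the
   group, which gives the form of the cocycle. *)

(** The sector of index [i] is the half plane where [w_i] is small, so a bounded invariant function
    on its subsectors sees only the powers [w_i^n], [n >= 0], and the limit [E -> 0] removes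
    [n = 0]. On a ray close to the edge of this half plane, inside the overlap with the next one,
    [w_{i+1}] is smaller than any prescribed power of [w_i]: this is why a bound [O(w_{i+1})] kills
    all these powers. Such a bound depends on the preliminary correction along [L_i]. The transition
    relates [E] in the charts [i] and [i + 1] through a quotient of two values of [u_i] or [v_i],
    and [u_i = v_i = 1] on [w_{i+1} = 0] makes this quotient [1 + O(w_{i+1})]. Estimates are uniform
    only on shrunk sectors, each with its own radius, so there is no single tube but one for each
    slope [M]. Integrals are limits of dyadic means, and Fourier analysis enters through the
    inequality [fejer], which bounds a periodic function by the moduli of its coefficients.
    Vanishing, Taylor remainders and Laurent sums are read off from it after subtracting finitely
    many terms. *)

Arguments ofR : simpl never.
Arguments cexp : simpl never.
Arguments e2ipi : simpl never.

(** * Real-valued norm, complex differentiability and exponentials *)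

Section ComplexNorm.
Variable R : realType.
Local Notation C := (Cx R).

(** The norm of [Cx R] takes its values in [Cx R]; estimates by [lra] and [nra] call for a norm with
    values in [R]. *)
Definition nm (z : C) : R := Normc.normc z.

Arguments nm : simpl never.

Lemma nmE (z : C) : `|z| = ofR (nm z). Proof. by case: z. Qed.

Lemma nm_ge0 z : 0 <= nm z. Proof. by case: z => a b; exact: sqrtr_ge0. Qed.
Lemma nm0 : nm 0 = 0. Proof. exact: Normc.normc0. Qed.
Lemma nm1 : nm 1 = 1. Proof. exact: Normc.normc1. Qed.
Lemma nmM x y : nm (x * y) = nm x * nm y. Proof. exact: Normc.normcM. Qed.
Lemma nmV x : nm x^-1 = (nm x)^-1. Proof. exact: Normc.normcV. Qed.
Lemma nmD x y : nm (x + y) <= nm x + nm y.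
Proof. have := ler_normD x y; rewrite !nmE -rmorphD; exact: (etrans (esym (lecR _ _))). Qed.
Lemma nmN x : nm (- x) = nm x.
Proof. by have := normrN x; rewrite !nmE => -[]. Qed.
Lemma nmB x y : nm (x - y) <= nm x + nm y.
Proof. by rewrite -(nmN y) nmD. Qed.
Lemma nmC x y : nm (x - y) = nm (y - x).
Proof. by rewrite -nmN opprB. Qed.
Lemma nm_eq0 x : (nm x == 0) = (x == 0).
Proof.
by apply/eqP/eqP => [/Normc.eq0_normc //|->]; exact: nm0.
Qed.
Lemma nm_gt0 x : (0 < nm x) = (x != 0).
Proof. by rewrite lt_def nm_ge0 andbT nm_eq0. Qed.
Lemma nmX x n : nm (x ^+ n) = nm x ^+ n.
Proof. by elim: n => [|n IH]; rewrite ?expr0 ?nm1// !exprS nmM IH. Qed.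
Lemma nm_ofR x : nm (ofR x) = `|x|.
Proof. by rewrite /nm /ofR /= expr0n/= addr0 sqrtr_sqr. Qed.
Lemma nm_subr x y z : nm (x - z) <= nm (x - y) + nm (y - z).
Proof. by rewrite (le_trans _ (nmD _ _))// addrA subrK. Qed.
Lemma nm_lb x y : nm x - nm y <= nm (x - y).
Proof. by rewrite lerBlDr -{1}(subrK y x) nmD. Qed.
Lemma nm_lbD x y : nm x - nm y <= nm (x + y).
Proof. by rewrite -(nmN y) -{2}(opprK y) nm_lb. Qed.
Lemma nm_sum (I : Type) (r : seq I) (P : pred I) (F : I -> C) :
  nm (\sum_(i <- r | P i) F i) <= \sum_(i <- r | P i) nm (F i).
Proof.
elim/big_ind2: _ => //; first by rewrite nm0.
by move=> x1 x2 y1 y2 h1 h2; rewrite (le_trans (nmD _ _))// lerD.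
Qed.

Lemma ofRD x y : ofR (x + y) = ofR x + ofR y :> C. Proof. exact: rmorphD. Qed.
Lemma ofRM x y : ofR (x * y) = ofR x * ofR y :> C. Proof. exact: rmorphM. Qed.
Lemma ofRN x : ofR (- x) = - ofR x :> C. Proof. exact: rmorphN. Qed.
Lemma ofRB x y : ofR (x - y) = ofR x - ofR y :> C. Proof. exact: rmorphB. Qed.
Lemma ofRV x : ofR x^-1 = (ofR x)^-1 :> C. Proof. exact: fmorphV. Qed.
Lemma ofRX x n : ofR (x ^+ n) = ofR x ^+ n :> C. Proof. exact: rmorphXn. Qed.
Lemma ofR_nat n : ofR n%:R = n%:R :> C. Proof. exact: rmorph_nat. Qed.
Lemma ofR_int n : ofR n%:~R = n%:~R :> C. Proof. exact: rmorph_int. Qed.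
Lemma ofR0 : ofR 0 = 0 :> C. Proof. by []. Qed.
Lemma ofR1 : ofR 1 = 1 :> C. Proof. by []. Qed.
Lemma ofR_eq0 x : (ofR x == 0 :> C) = (x == 0).
Proof. by apply/eqP/eqP => [[]//|->]. Qed.
Lemma ofR_le x y : (ofR x <= ofR y :> C) = (x <= y). Proof. exact: lecR. Qed.
Lemma ofR_lt x y : (ofR x < ofR y :> C) = (x < y). Proof. exact: ltcR. Qed.

Definition rE (z : C) : R := complex.Re z.
Definition iM (z : C) : R := complex.Im z.
Definition ii : C := (0 +i* 1)%C.

Arguments rE : simpl never.
Arguments iM : simpl never.
Arguments ii : simpl never.

Lemma rEiM z : z = ofR (rE z) + ofR (iM z) * ii.
Proof. by case: z => a b; rewrite /ofR /ii; apply/eqP; rewrite eq_complex /=; simpc. Qed.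
Lemma cx_eq (z w : C) : rE z = rE w -> iM z = iM w -> z = w.
Proof. by case: z w => a b [c d]; rewrite /rE /iM /= => -> ->. Qed.
Lemma ii2 : ii * ii = -1. Proof. by apply: cx_eq; rewrite /rE /iM /ii /=; ring. Qed.
Lemma rED x y : rE (x + y) = rE x + rE y. Proof. by case: x y => ? ? []. Qed.
Lemma iMD x y : iM (x + y) = iM x + iM y. Proof. by case: x y => ? ? []. Qed.
Lemma rEN x : rE (- x) = - rE x. Proof. by case: x. Qed.
Lemma iMN x : iM (- x) = - iM x. Proof. by case: x. Qed.
Lemma rEB x y : rE (x - y) = rE x - rE y. Proof. by rewrite rED rEN. Qed.
Lemma iMB x y : iM (x - y) = iM x - iM y. Proof. by rewrite iMD iMN. Qed.
Lemma rEM x y : rE (x * y) = rE x * rE y - iM x * iM y.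
Proof. by case: x y => ? ? []. Qed.
Lemma iMM x y : iM (x * y) = rE x * iM y + iM x * rE y.
Proof. by case: x y => a b [c d]; rewrite /iM /rE /=; ring. Qed.
Lemma rE_ofR x : rE (ofR x) = x. Proof. by []. Qed.
Lemma iM_ofR x : iM (ofR x) = 0. Proof. by []. Qed.
Lemma rE_ii : rE ii = 0. Proof. by []. Qed.
Lemma iM_ii : iM ii = 1. Proof. by []. Qed.
Lemma nm2 z : nm z ^+ 2 = rE z ^+ 2 + iM z ^+ 2.
Proof. by case: z => a b; rewrite /nm /= sqr_sqrtr// addr_ge0// sqr_ge0. Qed.
Lemma rE_le z : `|rE z| <= nm z.
Proof. by rewrite -(@ler_pXn2r _ 2)// ?nnegrE ?nm_ge0// nm2 real_normK ?num_real// lerDl sqr_ge0. Qed.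
Lemma iM_le z : `|iM z| <= nm z.
Proof. by rewrite -(@ler_pXn2r _ 2)// ?nnegrE ?nm_ge0// nm2 real_normK ?num_real// lerDr sqr_ge0. Qed.
Lemma nm_le z : nm z <= `|rE z| + `|iM z|.
Proof.
rewrite {1}(rEiM z) (le_trans (nmD _ _))// nmM !nm_ofR lerD2l.
by rewrite /nm /= expr0n/= add0r expr1n sqrtr1 mulr1.
Qed.
Lemma nm_ii : nm ii = 1.
Proof. by rewrite /nm /= expr0n/= add0r expr1n sqrtr1. Qed.
Lemma ii_neq0 : ii != 0. Proof. by rewrite -nm_gt0 nm_ii. Qed.

Lemma nbhsCP (z : C) (P : set C) :
  nbhs z P <-> exists2 e : R, 0 < e & forall w : C, nm (w - z) < e -> P w.
Proof.
split.
- move=> /nbhs_ballP[e /= e0 eP]; exists (rE e).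
    by move: e0; rewrite ltcE => /andP[].
  move=> w h; apply: eP; rewrite /ball /= distrC nmE.
  move: e0; rewrite !ltcE /= => /andP[/eqP -> _]; rewrite eqxx /=; exact: h.
- move=> [e e0 eP]; apply/nbhs_ballP; exists (ofR e); first by rewrite /= ltcR.
  by move=> w; rewrite /ball /= distrC nmE ltcR; exact: eP.
Qed.

Lemma nbhsRP (z : R) (P : set R) :
  nbhs z P <-> exists2 e : R, 0 < e & forall w : R, `|w - z| < e -> P w.
Proof.
split.
- move=> /nbhs_ballP[e /= e0 eP]; exists e => // w h.
  by apply: eP; rewrite /ball /= distrC.
- move=> [e e0 eP]; apply/nbhs_ballP; exists e => //.
  by move=> w; rewrite /ball /= distrC; exact: eP.
Qed.

Lemma nbhsC2P (p : C * C) (P : set (C * C)) :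
  nbhs p P <-> exists2 e : R, 0 < e & forall w : C * C,
     nm (w.1 - p.1) < e -> nm (w.2 - p.2) < e -> P w.
Proof.
split.
- case: p => p1 p2 [[A B] /= [/nbhsCP[e1 e10 h1] /nbhsCP[e2 e20 h2]] AB].
  exists (Num.min e1 e2); first by rewrite lt_min e10.
  by move=> [w1 w2] /=; rewrite !lt_min => /andP[? _] /andP[_ ?]; apply: AB; split; [exact: h1|exact: h2].
- case: p => p1 p2 [e e0 h].
  exists ([set w : C | nm (w - p1) < e], [set w : C | nm (w - p2) < e]).
    by split; apply/nbhsCP; exists e.
  by move=> [w1 w2] [/= ? ?]; exact: h.
Qed.

Lemma cvgCP (T : Type) (F : set_system T) (FF : Filter F) (f : T -> C) (l : C) :
  f @ F --> l <-> forall e : R, 0 < e -> F [set x | nm (f x - l) < e].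
Proof.
split=> [h e e0|h A /nbhsCP[e e0 eA]].
  by apply: (h [set w | nm (w - l) < e]); apply/nbhsCP; exists e.
by suff: F (f @^-1` A) by []; apply: filterS (h _ e0) => x /eA.
Qed.

Lemma cvgC2P (T : Type) (F : set_system T) (FF : Filter F) (f : T -> C * C) (l : C * C) :
  f @ F --> l <-> forall e : R, 0 < e -> F [set x | nm ((f x).1 - l.1) < e /\ nm ((f x).2 - l.2) < e].
Proof.
split=> [h e e0|h A /nbhsC2P[e e0 eA]].
  by apply: (h [set w | nm (w.1 - l.1) < e /\ nm (w.2 - l.2) < e]); apply/nbhsC2P; exists e.
by suff: F (f @^-1` A) by []; apply: filterS (h _ e0) => x [? ?]; exact: eA.
Qed.

End ComplexNorm.

Arguments nm : simpl never.
Arguments rE : simpl never.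
Arguments iM : simpl never.
Arguments ii : simpl never.

Section Diff.
Variable R : realType.
Local Notation C := (Cx R).

Lemma diff1_eps (K : numFieldType) (f : K -> K) x : differentiable f x ->
  forall e : K, 0 < e -> \forall h \near (0 : K), `|f (h + x) - f x - h * 'd f x 1| <= e * `|h|.
Proof.
move=> /diff_locallyP[_ /eqaddoP h] e e0; apply: filterS (h e e0) => t.
rewrite /= !fctE /= => ht; have <- : 'd f x t = t * 'd f x 1.
  by rewrite -{1}[t]mulr1; exact: linearZ.
by move: ht; rewrite opprD addrA.
Qed.

Lemma diffRP (f : R -> R) x d : is_derive x (1 : R) f d ->
  forall e : R, 0 < e -> exists2 r, 0 < r & forall h, `|h| < r -> `|f (x + h) - f x - d * h| <= e * `|h|.
Proof.
move=> fd e e0; have /derivable1_diffP df : derivable f x 1 by [].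
have /nbhsRP[r r0 hr] := diff1_eps df e0; exists r => // h hh.
have := hr h; rewrite subr0 => /(_ hh); rewrite addrC.
by rewrite -deriveE// derive_val [h * d]mulrC [h + x]addrC [- _ + _]addrC.
Qed.

(** With real radii and no little-o, so that derivatives can be established by hand, as for [cexp]
    and [clog]. *)
Lemma diffCP (f : C -> C) z : differentiable f z <-> exists d : C,
  forall e : R, 0 < e -> exists2 r, 0 < r & forall h, nm h < r -> nm (f (z + h) - f z - d * h) <= e * nm h.
Proof.
split=> [df|[d hd]].
  exists ('d f z 1) => e e0.
  have e0' : 0 < (ofR e : C) by rewrite ltcR.
  have /nbhsCP[r r0 hr] := diff1_eps df e0'; exists r => // h hh.
  have := hr h; rewrite subr0 => /(_ hh); rewrite addrC [h * _]mulrC !nmE -ofRM.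
  by rewrite ofR_le [h + z]addrC [- _ + _]addrC.
have lin : linear (fun h : C => d * h).
  by move=> k u v /=; rewrite mulrDr; congr (_ + _); rewrite mulrCA.
pose df : {linear C -> C} := HB.pack (fun h : C => d * h) (GRing.isLinear.Build _ _ _ _ _ lin).
have cdf : continuous df by move=> x; exact: mulrl_continuous.
have hdf : f \o shift z = cst (f z) + df +o_ (0 : C) id.
  apply/eqaddoP => e e0; have e0' : 0 < rE e by move: e0; rewrite ltcE => /andP[].
  have eE : e = ofR (rE e) by apply/esym/RRe_real/gtr0_real.
  have [r r0 hr] := hd _ e0'; apply/nbhsCP; exists r => // h; rewrite subr0 => hh.
  rewrite !fctE /= !nmE eE -ofRM ofR_le [h + z]addrC opprD addrA; exact: hr.
apply/diff_locallyP; rewrite (diff_unique cdf hdf); split => //; exact: hdf.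
Qed.

Lemma diffC2P (f : C * C -> C) (p : C * C) : differentiable f p <-> exists d1 d2 : C,
  forall e : R, 0 < e -> exists2 r, 0 < r & forall h k, nm h < r -> nm k < r ->
   nm (f (p.1 + h, p.2 + k) - f p - d1 * h - d2 * k) <= e * Num.max (nm h) (nm k).
Proof.
have nE (w : C * C) : `|w| = ofR (Num.max (nm w.1) (nm w.2)) :> C.
  by rewrite prod_normE !nmE; case: (leP (nm w.1)) => [h|/ltW h]; [rewrite max_r|rewrite max_l]; rewrite ?ofR_le.
split=> [/diff_locallyP[_ /eqaddoP df]|[d1 [d2 hd]]].
  exists ('d f p (1, 0)), ('d f p (0, 1)) => e e0.
  have e0' : 0 < (ofR e : C) by rewrite ltcR.
  have /nbhsC2P[r r0 hr] := df _ e0'; exists r => // h k hh hk.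
  have := hr (h, k); rewrite /= !subr0 => /(_ hh hk).
  rewrite !fctE /= nE !nmE -ofRM ofR_le /=.
  have -> : 'd f p (h, k) = 'd f p (1, 0) * h + 'd f p (0, 1) * k.
    have -> : (h, k) = h *: ((1, 0) : C * C) + k *: ((0, 1) : C * C).
      by congr pair; rewrite /= ?scaler0 ?addr0 ?add0r -[_ *: _]/(_ * 1) mulr1.
    by rewrite linearD !linearZ /= [h *: _]mulrC [k *: _]mulrC.
  by rewrite opprD addrA opprD addrA -[(h, k) + p]/(h + p.1, k + p.2) [h + _]addrC [k + _]addrC.
have lin : linear (fun h : C * C => d1 * h.1 + d2 * h.2).
  move=> k u v /=; rewrite !mulrDr scalerDr addrACA; congr (_ + _ + _); exact: mulrCA.
pose df : {linear (C * C)%type -> C} := HB.pack (fun h : C * C => d1 * h.1 + d2 * h.2) (GRing.isLinear.Build _ _ _ _ _ lin).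
have cdf : continuous df.
  move=> x; apply: (@continuousD _ _ _ (fun h : C * C => d1 * h.1) (fun h => d2 * h.2)).
    by apply: continuousM; [exact: cst_continuous|exact: cvg_fst].
  by apply: continuousM; [exact: cst_continuous|exact: cvg_snd].
have hdf : f \o shift p = cst (f p) + df +o_ (0 : C * C) id.
  apply/eqaddoP => e e0; have e0' : 0 < rE e by move: e0; rewrite ltcE => /andP[].
  have eE : e = ofR (rE e) by apply/esym/RRe_real/gtr0_real.
  have [r r0 hr] := hd _ e0'; apply/nbhsC2P; exists r => // -[h k] /=; rewrite !subr0 => hh hk.
  rewrite !fctE /= nE !nmE eE -ofRM ofR_le /=.
  have := hr _ _ hh hk; congr (_ <= _); congr (nm _).
  by rewrite opprD addrA opprD addrA -[(h, k) + p]/(h + p.1, k + p.2) [h + _]addrC [k + _]addrC.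
apply/diff_locallyP; rewrite (diff_unique cdf hdf); split => //; exact: hdf.
Qed.

Lemma diff_pairP (V : normedModType C) (f : V -> C * C) x :
  differentiable f x <-> differentiable (fun p => (f p).1) x /\ differentiable (fun p => (f p).2) x.
Proof.
split=> [df|[d1 d2]].
  split; apply: (@differentiable_comp _ _ _ _ f) => //; apply: linear_differentiable => y; [exact: cvg_fst|exact: cvg_snd].
have -> : f = fun p => ((f p).1, (f p).2) by apply/funext => p; case: (f p).
exact: differentiable_pair.
Qed.

Lemma diff_fst (p : C * C) : differentiable (@fst C C) p.
Proof. by apply: linear_differentiable => y; exact: cvg_fst. Qed.
Lemma diff_snd (p : C * C) : differentiable (@snd C C) p.
Proof. by apply: linear_differentiable => y; exact: cvg_snd. Qed.

Lemma near_diffC2 (f g : C * C -> C) p : (\forall q \near p, f q = g q) ->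
  differentiable f p -> differentiable g p.
Proof.
move=> /nbhsC2P[e e0 he] /diffC2P[d1 [d2 hd]]; apply/diffC2P; exists d1, d2 => t t0.
have [r r0 hr] := hd _ t0; exists (Num.min e r); first by rewrite lt_min e0.
move=> h k; rewrite !lt_min => /andP[h1 h2] /andP[k1 k2].
have s (u v : C) : u + v - u = v by rewrite addrAC subrr add0r.
have <- : f (p.1 + h, p.2 + k) = g (p.1 + h, p.2 + k) by apply: he; rewrite /= s.
have <- : f p = g p by apply: he; rewrite subrr nm0.
exact: hr.
Qed.

Lemma near_diffC (f g : C -> C) p : (\forall q \near p, f q = g q) ->
  differentiable f p -> differentiable g p.
Proof.
move=> /nbhsCP[e e0 he] /diffCP[d hd]; apply/diffCP; exists d => t t0.
have [r r0 hr] := hd _ t0; exists (Num.min e r); first by rewrite lt_min e0.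
move=> h; rewrite !lt_min => /andP[h1 h2].
have s (u v : C) : u + v - u = v by rewrite addrAC subrr add0r.
have <- : f (p + h) = g (p + h) by apply: he; rewrite s.
have <- : f p = g p by apply: he; rewrite subrr nm0.
exact: hr.
Qed.

Lemma near_diff2 (f g : C * C -> C * C) p : (\forall q \near p, f q = g q) ->
  differentiable f p -> differentiable g p.
Proof.
move=> fg /diff_pairP[d1 d2]; apply/diff_pairP; split; [move: d1|move: d2];
  by apply: near_diffC2; apply: filterS fg => q ->.
Qed.

End Diff.

Section Cexp.
Variable R : realType.
Local Notation C := (Cx R).

Lemma rE_cexp z : rE (cexp z) = expR (rE z) * cos (iM z) :> R.
Proof. by rewrite /cexp rEM rE_ofR iM_ofR mul0r subr0. Qed.
Lemma iM_cexp z : iM (cexp z) = expR (rE z) * sin (iM z) :> R.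
Proof. by rewrite /cexp iMM rE_ofR iM_ofR mul0r addr0. Qed.

Lemma nm_cexp (z : C) : nm (cexp z) = expR (rE z).
Proof.
apply/eqP; rewrite -(@eqrXn2 _ 2)// ?nm_ge0 ?expR_ge0// nm2 rE_cexp iM_cexp.
by rewrite !exprMn -mulrDr cos2Dsin2 mulr1.
Qed.

Lemma cexp_neq0 (z : C) : cexp z != 0.
Proof. by rewrite -nm_gt0 nm_cexp expR_gt0. Qed.

Lemma cexp0 : cexp 0 = 1 :> C.
Proof. by apply: cx_eq; rewrite ?rE_cexp ?iM_cexp/= expR0 ?cos0 ?sin0 ?mulr1 ?mulr0. Qed.

Lemma cexpD (z w : C) : cexp (z + w) = cexp z * cexp w.
Proof.
apply: cx_eq.
  by rewrite rE_cexp rEM !rE_cexp !iM_cexp rED iMD expRD cosD; ring.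
by rewrite iM_cexp iMM !rE_cexp !iM_cexp rED iMD expRD sinD; ring.
Qed.

Lemma cexpN (z : C) : cexp (- z) = (cexp z)^-1.
Proof. by apply: (mulfI (cexp_neq0 z)); rewrite -cexpD subrr cexp0 mulfV ?cexp_neq0. Qed.

Lemma cexp_small (e : R) : 0 < e -> exists2 r : R, 0 < r &
  forall h : C, nm h < r -> nm (cexp h - 1 - h) <= e * nm h.
Proof.
(* The errors in the real and imaginary parts are at most [3 t |h|] and [4 t |h|], whence the 8;
   [t <= 1] bounds [1 + x] by 2. *)
move=> e0; pose t := Num.min (e / 8) 1.
have t0 : 0 < t by rewrite lt_min ltr01 divr_gt0.
have t1 : t <= 1 by rewrite ge_min lexx orbT.
have te : t <= e / 8 by rewrite ge_min lexx.
clearbody t.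
have [r1 r10 h1] := diffRP (is_derive_expR 0) t0.
have [r2 r20 h2] := diffRP (is_derive_cos 0) t0.
have [r3 r30 h3] := diffRP (is_derive_sin 0) t0.
exists (Num.min (Num.min r1 r2) (Num.min r3 t)); first by rewrite !lt_min r10 r20 r30 t0.
move=> h; rewrite !lt_min => /andP[/andP[hr1 hr2] /andP[hr3 ht]].
pose x := rE h; pose y := iM h; have xh : `|x| <= nm h := rE_le h; have yh : `|y| <= nm h := iM_le h.
have := h1 _ (le_lt_trans xh hr1); have := h2 _ (le_lt_trans yh hr2); have := h3 _ (le_lt_trans yh hr3).
rewrite !add0r sin0 cos0 expR0 oppr0 mul0r !subr0 mul1r mul1r => b3 b2 b1; rewrite addr0 in b3.
rewrite (le_trans (nm_le _))// !rEB !iMB rE_cexp iM_cexp -/x -/y.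
rewrite -[1]/(ofR 1) rE_ofR iM_ofR subr0.
have nh := nm_ge0 h.
have A : `|expR x * cos y - 1 - x| <= t * nm h + 2 * (t * nm h).
  have -> : expR x * cos y - 1 - x = (expR x - 1 - x) * cos y + (1 + x) * (cos y - 1) by ring.
  rewrite (le_trans (ler_normD _ _))// lerD// normrM.
    rewrite -[leRHS]mulr1 ler_pM//; last by rewrite ler_norml cos_geN1 cos_le1.
    by rewrite (le_trans b1)// ler_pM2l.
  rewrite ler_pM//; last by rewrite (le_trans b2)// ler_pM2l.
  rewrite (le_trans (ler_normD _ _))// normr1 lerD2l (le_trans xh)// ltW// (lt_le_trans ht)//.
have B : `|expR x * sin y - y| <= 2 * nm h * t + t * nm h + t * nm h.
  have -> : expR x * sin y - y = (expR x - 1 - x) * sin y + x * sin y + (sin y - y) by ring.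
  have s : `|sin y| <= 2 * nm h.
    rewrite -[sin y](subrK y) (le_trans (ler_normD _ _))// mulr_natl mulr2n lerD//.
    by rewrite (le_trans b3)// (le_trans _ yh)// ler_piMl.
  rewrite (le_trans (ler_normD _ _))// lerD//; last by rewrite (le_trans b3)// ler_pM2l.
  rewrite (le_trans (ler_normD _ _))// !normrM.
  have b1' : `|expR x - 1 - x| <= t * nm h by rewrite (le_trans b1)// ler_pM2l.
  have s1 : `|sin y| <= 1 by rewrite ler_norml sin_geN1 sin_le1.
  rewrite addrC lerD//; first by rewrite mulrC ler_pM// (le_trans xh)// ltW.
  by rewrite -[leRHS]mulr1 ler_pM.
rewrite (le_trans (lerD A B))//; nra.
Qed.

Lemma diff_cexp (z : C) : differentiable (@cexp R) z.
Proof.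
apply/diffCP; exists (cexp z) => e e0.
have e0' : 0 < e / nm (cexp z) by rewrite divr_gt0// nm_gt0 cexp_neq0.
have [r r0 hr] := cexp_small e0'; exists r => // h /hr.
have -> : cexp (z + h) - cexp z - cexp z * h = cexp z * (cexp h - 1 - h) by rewrite cexpD; ring.
rewrite nmM => hh.
by rewrite mulrC -ler_pdivlMr ?nm_gt0 ?cexp_neq0// mulrAC.
Qed.

End Cexp.

Section E2ipi.
Variable R : realType.
Local Notation C := (Cx R).

Definition twopi : R := 2 * pi.
Lemma twopi_gt0 : 0 < twopi. Proof. by rewrite mulr_gt0 ?pi_gt0. Qed.

Lemma e2ipiE (z : C) : e2ipi z = cexp (ofR twopi * ii R * z).
Proof.
rewrite /e2ipi; have -> // : ((0 +i* (2 * pi))%C : C) = ofR twopi * ii R.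
by apply/eqP; rewrite eq_complex /= !mul0r mulr0 mulr1 subrr addr0 !eqxx.
Qed.

Lemma rE_twopi_ii (z : C) : rE (ofR twopi * ii R * z) = - (twopi * iM z).
Proof. by rewrite !rEM iMM rE_ii iM_ii rE_ofR iM_ofR; ring. Qed.
Lemma iM_twopi_ii (z : C) : iM (ofR twopi * ii R * z) = twopi * rE z.
Proof. by rewrite !iMM rEM rE_ii iM_ii rE_ofR iM_ofR; ring. Qed.

Lemma e2ipi0 : e2ipi 0 = 1 :> C. Proof. by rewrite e2ipiE mulr0 cexp0. Qed.
Lemma e2ipiD (z w : C) : e2ipi (z + w) = e2ipi z * e2ipi w.
Proof. by rewrite !e2ipiE mulrDr cexpD. Qed.
Lemma e2ipiN (z : C) : e2ipi (- z) = (e2ipi z)^-1.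
Proof. by rewrite !e2ipiE mulrN cexpN. Qed.
Lemma e2ipiB (z w : C) : e2ipi (z - w) = e2ipi z / e2ipi w.
Proof. by rewrite e2ipiD e2ipiN. Qed.
Lemma e2ipi_neq0 (z : C) : e2ipi z != 0.
Proof. by rewrite e2ipiE cexp_neq0. Qed.
Lemma nm_e2ipi (z : C) : nm (e2ipi z) = expR (- (twopi * iM z)).
Proof. by rewrite e2ipiE nm_cexp rE_twopi_ii. Qed.

Lemma cos_nat n : cos (n%:R * twopi) = 1 :> R.
Proof.
elim: n => [|n IH]; first by rewrite mul0r cos0.
have E : twopi = pi *+ 2 by rewrite /twopi mulr_natl.
by rewrite -natr1 mulrDl mul1r {2}E cosD2pi.
Qed.
Lemma sin_nat n : sin (n%:R * twopi) = 0 :> R.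
Proof.
elim: n => [|n IH]; first by rewrite mul0r sin0.
have E : twopi = pi *+ 2 by rewrite /twopi mulr_natl.
by rewrite -natr1 mulrDl mul1r {2}E sinD2pi.
Qed.
Lemma e2ipi_nat n : e2ipi n%:R = 1 :> C.
Proof.
rewrite e2ipiE; apply: cx_eq; rewrite ?rE_cexp ?iM_cexp rE_twopi_ii iM_twopi_ii -ofR_nat rE_ofR iM_ofR.
  by rewrite mulr0 oppr0 expR0 mul1r mulrC cos_nat.
by rewrite mulr0 oppr0 expR0 mul1r mulrC sin_nat.
Qed.
Lemma e2ipi_int (n : int) : e2ipi n%:~R = 1 :> C.
Proof.
case: n => n; first exact: e2ipi_nat.
by rewrite NegzE mulrNz e2ipiN -pmulrn e2ipi_nat invr1.
Qed.
Lemma e2ipiX (z : C) n : e2ipi z ^+ n = e2ipi (z *+ n).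
Proof. by elim: n => [|n IH]; rewrite ?expr0 ?mulr0n ?e2ipi0// exprS mulrS e2ipiD IH. Qed.
Lemma e2ipiXz (z : C) (n : int) : e2ipi z ^ n = e2ipi (z * n%:~R).
Proof.
case: n => n; first by rewrite -exprnP e2ipiX -mulr_natr pmulrn.
by rewrite NegzE -exprnN e2ipiX mulrNz mulrN e2ipiN -pmulrn mulr_natr.
Qed.

Lemma diff_e2ipi (z : C) : differentiable (@e2ipi R) z.
Proof.
have -> : @e2ipi R = fun z => cexp (ofR twopi * ii R * z) by apply/funext => ?; rewrite e2ipiE.
apply: (@differentiable_comp _ _ _ _ (fun z => ofR twopi * ii R * z)); last exact: diff_cexp.
by apply: differentiableM; [exact: differentiable_cst|exact: ex_diff].
Qed.
End E2ipi.

(** * Dyadic means *)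

Section Mean.
Variable R : realType.
Local Notation C := (Cx R).
Implicit Types (g h : R -> C) (n m : nat).

Definition lft (x : R) : R := x / 2.
Definition rgt (x : R) : R := (1 + x) / 2.

(** The Riemann sum of [g] over [[0, 1]] at the left ends of the [2^n] dyadic intervals. The
    recursion by halves is what makes integrals along a bisected segment add up. *)
Fixpoint dm n g : C :=
  if n is n'.+1 then (dm n' (g \o lft) + dm n' (g \o rgt)) / 2 else g 0.

Definition on01 (x : R) := 0 <= x <= 1.
Lemma lft01 x : on01 x -> on01 (lft x).
Proof. by rewrite /on01 /lft => /andP[? ?]; lra. Qed.
Lemma rgt01 x : on01 x -> on01 (rgt x).
Proof. by rewrite /on01 /rgt => /andP[? ?]; lra. Qed.
Lemma on010 : on01 0. Proof. by rewrite /on01 lexx ler01. Qed.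

Lemma two_neq0 : (2 : C) != 0. Proof. by rewrite pnatr_eq0. Qed.
Lemma nm_half : nm (2^-1 : C) = 2^-1.
Proof. by rewrite nmV -ofR_nat nm_ofR normr_nat. Qed.

Lemma dm_eq n g h : (forall x, on01 x -> g x = h x) -> dm n g = dm n h.
Proof.
elim: n g h => [|n IH] g h gh /=; first exact/gh/on010.
by congr ((_ + _) / 2); apply: IH => x xx; apply: gh; [exact: lft01|exact: rgt01].
Qed.
Lemma dmD n g h : dm n (fun x => g x + h x) = dm n g + dm n h.
Proof.
elim: n g h => [|n IH] g h //=.
rewrite -mulrDl; congr (_ / 2); rewrite addrACA.
by rewrite -(IH (g \o lft)) -(IH (g \o rgt)).
Qed.
Lemma dmZ n (c : C) g : dm n (fun x => c * g x) = c * dm n g.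
Proof.
elim: n g => [|n IH] g //=.
by rewrite mulrA mulrDr; congr (_ / 2); rewrite -(IH (g \o lft)) -(IH (g \o rgt)).
Qed.
Lemma dm_cst n (c : C) : dm n (fun=> c) = c.
Proof.
elim: n => [|n IH] //=; have -> : (fun=> c) \o lft = (fun=> c) by [].
have -> : (fun=> c) \o rgt = (fun=> c) by [].
by rewrite IH; field.
Qed.
Lemma dm_le n g h : (forall x, on01 x -> nm (g x) <= rE (h x)) -> nm (dm n g) <= rE (dm n h).
Proof.
elim: n g h => [|n IH] g h gh /=; first exact/gh/on010.
have -> : (2 : C)^-1 = ofR (2^-1) by rewrite ofRV ofR_nat.
rewrite nmM nm_ofR rEM iM_ofR mulr0 subr0 rE_ofR ger0_norm ?invr_ge0// ler_pM2r ?invr_gt0//.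
rewrite (le_trans (nmD _ _))// rED lerD//; apply: IH => x xx; apply: gh; [exact: lft01|exact: rgt01].
Qed.
Lemma dm_swap n m (g : R -> R -> C) :
  dm n (fun s => dm m (g s)) = dm m (fun t => dm n (g^~ t)).
Proof.
elim: n g => [|n IH] g //=.
have -> : dm n ((fun s => dm m (g s)) \o lft) = dm m (fun t => dm n (fun s => g (lft s) t)) by rewrite -IH.
have -> : dm n ((fun s => dm m (g s)) \o rgt) = dm m (fun t => dm n (fun s => g (rgt s) t)) by rewrite -IH.
rewrite -dmD mulrC -dmZ; apply: dm_eq => t _; rewrite mulrC; congr ((_ + _) / 2).
Qed.

Definition osc g (d e : R) := forall x y, on01 x -> on01 y -> `|x - y| <= d -> nm (g x - g y) <= e.

Lemma osc_lft g d e : osc g (d / 2) e -> osc (g \o lft) d e.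
Proof.
move=> og x y x1 y1 xy; apply: og; [exact: lft01|exact: lft01|].
by rewrite /lft -mulrBl normrM [X in _ * X]ger0_norm// ler_pM2r.
Qed.
Lemma osc_rgt g d e : osc g (d / 2) e -> osc (g \o rgt) d e.
Proof.
move=> og x y x1 y1 xy; apply: og; [exact: rgt01|exact: rgt01|].
by rewrite /rgt -mulrBl normrM [X in _ * X]ger0_norm// ler_pM2r// opprD addrACA subrr add0r.
Qed.

(** On each dyadic interval of length [2^-n] the refined mean is compared with the value at the left
    end. *)
Lemma dm_osc n k g e : osc g (2^-1 ^+ n) e -> nm (dm (n + k) g - dm n g) <= e.
Proof.
elim: n g => [|n IH] g og /=.
  rewrite -{1}(dm_cst k (g 0)).
  have -> : dm k g - dm k (fun=> g 0) = dm k (fun x => g x + -1 * g 0).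
    by rewrite dmD dmZ mulN1r.
  rewrite -[e]/(rE (ofR e)) -(dm_cst k (ofR e)); apply: dm_le => x xx.
  by rewrite rE_ofR mulN1r; apply: og => //; [exact: on010|rewrite subr0 expr0 ger0_norm; case/andP: xx].
have -> : (dm (n + k) (g \o lft) + dm (n + k) (g \o rgt)) / 2 - (dm n (g \o lft) + dm n (g \o rgt)) / 2
  = ((dm (n + k) (g \o lft) - dm n (g \o lft)) + (dm (n + k) (g \o rgt) - dm n (g \o rgt))) * 2^-1 by rewrite -mulrBl; congr (_ / _); ring.
rewrite nmM nm_half ler_pdivrMr// (le_trans (nmD _ _))// mulr_natr mulr2n.
by rewrite lerD//; apply: IH; [apply: osc_lft|apply: osc_rgt]; rewrite exprS mulrC in og.
Qed.

Definition ct01 g := forall x, on01 x -> {for x, continuous g}.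

(** Only [x] has to lie in [K]: continuity at the points of [K] also controls nearby points outside,
    which [cts2_unif] uses. *)
Lemma heine (T : pseudoMetricType R) (K : set T) (f : T -> C) : compact K ->
  (forall x, K x -> {for x, continuous f}) -> forall e, 0 < e ->
  exists2 d, 0 < d & forall x y, K x -> ball x d y -> nm (f x - f y) < e.
Proof.
move=> /compact_near_coveringP cK cf e e0.
pose P (d : R) (x : T) := forall y, ball x d y -> nm (f x - f y) < e.
have : \forall d \near (0 : R)^'+, K `<=` P d.
  apply: cK => x Kx.
  have e2 : 0 < e / 2 by rewrite divr_gt0.
  have /nbhs_ballP[r /= r0 hr] : nbhs x [set y | nm (f y - f x) < e / 2].
    by have /cvgCP := cf x Kx; apply.
  have r2 : 0 < r / 2 by rewrite divr_gt0.
  exists (ball x (r / 2), [set d | 0 < d < r / 2]).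
    split; first exact: nbhsx_ballx.
    by near=> d; apply/andP; split; near: d; [exact: nbhs_right_gt|exact: nbhs_right_lt].
  move=> [x' d] [/= xx' /andP[d0 dr]] y x'y.
  have h1 := hr x' (le_ball _ xx'); have h2 : nm (f y - f x) < e / 2.
    apply: hr; rewrite [r]splitr; apply: ball_triangle xx' _; exact: le_ball (ltW dr) _ x'y.
  rewrite (le_lt_trans (nm_subr _ (f x) _))// [e]splitr ltrD ?[nm (f x - f y)]nmC//.
  by apply: h1; rewrite ler_pdivrMr// ler_peMr ?ler1n// ltW.
move=> h; have [d [d0 Pd]] : exists d, 0 < d /\ K `<=` P d.
  near (0 : R)^'+ => d; exists d; split; near: d => //; exact: nbhs_right_gt.
by exists d => // x y Kx; exact: Pd.
Unshelve. all: by end_near. Qed.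

Lemma half_small (d : R) : 0 < d -> exists N, forall n, (N <= n)%N -> (2^-1 : R) ^+ n < d.
Proof.
move=> d0; have := @cvg_geometric R 1 2^-1; rewrite ger0_norm// => /(_ _)/cvgrPdist_lt /(_ d d0)[].
  by rewrite invf_lt1// ltr1n.
move=> N _ hN; exists N => n /hN /=; rewrite sub0r normrN /geometric /= mul1r ger0_norm ?exprn_ge0//.
Qed.

Lemma dm_dist n g h (B : R) : (forall x, on01 x -> nm (g x - h x) <= B) -> nm (dm n g - dm n h) <= B.
Proof.
move=> gh; have -> : dm n g - dm n h = dm n (fun x => g x + -1 * h x) by rewrite dmD dmZ mulN1r.
rewrite -[B]/(rE (ofR B)) -(dm_cst n (ofR B)); apply: dm_le => x xx.
by rewrite mulN1r rE_ofR gh.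
Qed.

Lemma ct01_osc g : ct01 g -> forall e, 0 < e -> exists N, forall n, (N <= n)%N -> osc g (2^-1 ^+ n) e.
Proof.
move=> cg e e0; have := @heine R^o `[(0 : R), (1 : R)]%classic g (@segment_compact _ 0 1) _ e e0.
have h x : `[(0 : R), (1 : R)]%classic x -> {for x, continuous g} by rewrite /= in_itv; exact: cg.
move=> /(_ h)[d d0 hd].
have [N hN] := half_small d0.
exists N => n /hN hn x y x1 y1 xy; apply/ltW/hd; first by rewrite /= in_itv.
by rewrite /ball /= (le_lt_trans xy).
Qed.

Lemma dm_lim g : ct01 g -> exists l : C, forall e, 0 < e -> exists N, forall n, (N <= n)%N -> nm (dm n g - l) <= e.
Proof.
move=> cg.
(* Completeness is that of [R], so the real and imaginary parts converge separately. *)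
have cau (f : C -> R) (fB : forall x y, f (x - y) = f x - f y) (fl : forall x, `|f x| <= nm x) :
    cvgn (fun n => f (dm n g)).
  apply/cauchy_cvgP.
  apply/cauchy_exP => e e0.
  have [N hN] := ct01_osc cg (divr_gt0 e0 (ltr0n _ 2)).
  exists (f (dm N g)); exists N => // n /= Nn; rewrite /ball /= distrC -fB (le_lt_trans (fl _))//.
  rewrite -(subnKC Nn) (le_lt_trans (dm_osc _ (hN N (leqnn _))))//.
  by rewrite ltr_pdivrMr// ltr_pMr// ltr1n.
have c1 := cau (@rE R) (@rEB R) (@rE_le R); have c2 := cau (@iM R) (@iMB R) (@iM_le R).
exists (ofR (limn (fun n => rE (dm n g))) + ofR (limn (fun n => iM (dm n g))) * ii R) => e e0.
have e2 := divr_gt0 e0 (ltr0n _ 2).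
move/cvgrPdist_le : c1 => /(_ _ e2)[N1 _ h1]; move/cvgrPdist_le : c2 => /(_ _ e2)[N2 _ h2].
exists (maxn N1 N2) => n; rewrite geq_max => /andP[n1 n2].
rewrite (le_trans (nm_le _))// [e]splitr rEB iMB.
have E (a b : R) : rE (ofR a + ofR b * ii R) = a /\ iM (ofR a + ofR b * ii R) = b.
  by rewrite rED iMD rEM iMM !rE_ofR !iM_ofR rE_ii iM_ii; split; ring.
have [-> ->] := E (limn (fun n => rE (dm n g))) (limn (fun n => iM (dm n g))).
by rewrite lerD// distrC; [exact: h1|exact: h2].
Qed.

Definition is_mean g (l : C) :=
  forall e : R, 0 < e -> exists N, forall n, (N <= n)%N -> nm (dm n g - l) <= e.

Lemma is_mean_unique g l l' : is_mean g l -> is_mean g l' -> l = l'.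
Proof.
move=> h h'; apply/eqP; rewrite -subr_eq0 -nm_eq0 eq_le nm_ge0 andbT.
apply/ler_addgt0Pr => e e0; rewrite add0r; have e2 := divr_gt0 e0 (ltr0n _ 2).
have [N1 H1] := h _ e2; have [N2 H2] := h' _ e2.
rewrite (le_trans (nm_subr _ (dm (maxn N1 N2) g) _))// [e]splitr lerD//.
  by rewrite nmC H1// leq_maxl.
by rewrite H2// leq_maxr.
Qed.

(** Plays the role of the integral over [[0, 1]]; the value 0 is the default when the dyadic means
    do not converge. *)
Definition mean g : C := xget 0 [set l | is_mean g l].

Lemma meanP g : ct01 g -> is_mean g (mean g).
Proof. by move=> /dm_lim[l hl]; rewrite /mean; case: xgetP => [? ->//|/(_ l)]. Qed.

Lemma mean_unique g l : is_mean g l -> mean g = l.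
Proof.
move=> hl; rewrite /mean; case: xgetP => [x -> hx|/(_ l)//].
exact: is_mean_unique hx hl.
Qed.

Lemma mean_osc n g e : ct01 g -> osc g (2^-1 ^+ n) e -> nm (dm n g - mean g) <= e.
Proof.
move=> cg og; apply/ler_addgt0Pr => d d0; have [N hN] := meanP cg d0.
rewrite (le_trans (nm_subr _ (dm (n + N) g) _))// lerD//.
  by rewrite nmC dm_osc.
by rewrite hN// leq_addl.
Qed.

Lemma mean_eq g h : (forall x, on01 x -> g x = h x) -> mean g = mean h.
Proof.
by move=> gh; rewrite /mean; congr xget; apply/funext => l; rewrite /is_mean /=;
  apply/propext; split=> H e /H[N hN]; exists N => n /hN; rewrite (dm_eq n gh).
Qed.

Lemma meanD g h : ct01 g -> ct01 h -> mean (fun x => g x + h x) = mean g + mean h.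
Proof.
move=> cg ch; apply: mean_unique => e e0; have e2 := divr_gt0 e0 (ltr0n _ 2).
have [N1 H1] := meanP cg e2; have [N2 H2] := meanP ch e2.
exists (maxn N1 N2) => n; rewrite geq_max => /andP[n1 n2].
rewrite dmD opprD addrACA (le_trans (nmD _ _))// [e]splitr lerD//; [exact: H1|exact: H2].
Qed.

Lemma meanZ c g : ct01 g -> mean (fun x => c * g x) = c * mean g.
Proof.
move=> cg; apply: mean_unique => e e0.
have p : 0 < nm c + 1 by rewrite ltr_wpDl// nm_ge0.
have [N H] := meanP cg (divr_gt0 e0 p).
exists N => n /H h; rewrite dmZ -mulrBr nmM (le_trans (ler_wpM2l (nm_ge0 _) h))//.
by rewrite mulrCA ler_piMr ?(ltW e0)// ler_pdivrMr// mul1r lerDl.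
Qed.

Lemma mean_cst c : mean (fun=> c) = c.
Proof. by apply: mean_unique => e e0; exists 0%N => n _; rewrite dm_cst subrr nm0 ltW. Qed.

Lemma mean_le g h : ct01 g -> ct01 h -> (forall x, on01 x -> nm (g x) <= rE (h x)) ->
  nm (mean g) <= rE (mean h).
Proof.
move=> cg ch gh; apply/ler_addgt0Pr => e e0; have e2 := divr_gt0 e0 (ltr0n _ 2).
have [N1 H1] := meanP cg e2; have [N2 H2] := meanP ch e2.
pose n := maxn N1 N2; have h1 := H1 n (leq_maxl _ _); have h2 := H2 n (leq_maxr _ _).
have h3 := dm_le n gh; have h4 := nm_lb (mean g) (dm n g); rewrite nmC in h4.
have h5 := le_trans (rE_le _) h2; rewrite rEB ler_norml in h5; move/andP: h5 => [h5 h6].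
lra.
Qed.

Lemma ct01_cst c : ct01 (fun=> c). Proof. by move=> x _; exact: cst_continuous. Qed.

Lemma mean_bound g (B : R) : ct01 g -> (forall x, on01 x -> nm (g x) <= B) -> nm (mean g) <= B.
Proof.
move=> cg gB; have -> : B = rE (mean (fun=> ofR B)) by rewrite mean_cst rE_ofR.
by apply: mean_le; [exact: cg|exact: ct01_cst|move=> x xx; rewrite rE_ofR gB].
Qed.

Lemma lft_cts : continuous lft.
Proof.
by move=> x; apply: (@cvgM R R (nbhs x) _ id (cst 2^-1) x 2^-1); [exact: cvg_id|exact: cvg_cst].
Qed.
Lemma rgt_cts : continuous rgt.
Proof.
move=> x; apply: (@cvgM R R (nbhs x) _ (fun x => 1 + x) (cst 2^-1) (1 + x) 2^-1); last exact: cvg_cst.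
by apply: (@cvgD R R^o R (nbhs x) _ (cst 1) id 1 x); [exact: cvg_cst|exact: cvg_id].
Qed.
Lemma ct01_lft g : ct01 g -> ct01 (g \o lft).
Proof. by move=> cg x xx; apply: continuous_comp; [exact: lft_cts|exact/cg/lft01]. Qed.
Lemma ct01_rgt g : ct01 g -> ct01 (g \o rgt).
Proof. by move=> cg x xx; apply: continuous_comp; [exact: rgt_cts|exact/cg/rgt01]. Qed.

Lemma mean_half g : ct01 g -> mean g = (mean (g \o lft) + mean (g \o rgt)) / 2.
Proof.
move=> cg; apply: mean_unique => e e0; have cl := ct01_lft cg; have cr := ct01_rgt cg.
have [N1 H1] := meanP cl e0; have [N2 H2] := meanP cr e0.
exists (maxn N1 N2).+1 => -[//|n]; rewrite ltnS geq_max => /andP[n1 n2] /=.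
rewrite -mulrBl nmM nm_half ler_pdivrMr// opprD addrACA (le_trans (nmD _ _))//.
by rewrite mulr_natr mulr2n lerD//; [exact: H1|exact: H2].
Qed.

Lemma pair_cts (s t : R) : continuous (fun t : R => (s, t)) /\ continuous (fun s : R => (s, t)).
Proof.
split=> x A [[U V] /= [hU hV] UV].
  by apply: filterS hV => y Vy; apply: UV; split=> //=; exact: nbhs_singleton hU.
by apply: filterS hU => y Vy; apply: UV; split=> //=; exact: nbhs_singleton hV.
Qed.

Definition cts2 (g : R -> R -> C) := forall s t, {for (s, t), continuous (fun p : R * R => g p.1 p.2)}.

Lemma cts2_l (g : R -> R -> C) (s : R) : cts2 g -> ct01 (g s).
Proof.
move=> cg t t1; apply: (@continuous_comp _ _ _ (fun t => (s, t)) (fun p => g p.1 p.2)); last exact: cg.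
have [h _] := pair_cts s t; exact: h.
Qed.
Lemma cts2_swap (g : R -> R -> C) : cts2 g -> cts2 (fun s t => g t s).
Proof.
move=> cg s t; apply: (@continuous_comp _ _ _ (fun p : R * R => (p.2, p.1)) (fun p => g p.1 p.2)); last exact: cg.
move=> A [[U V] /= [hU hV] UV]; exists (V, U) => //= -[x y] [/= ? ?]; exact: (UV (y, x)).
Qed.

Lemma cts2_unif (g : R -> R -> C) : cts2 g -> forall e, 0 < e -> exists2 d : R, 0 < d &
  forall s t s' t', on01 s -> on01 t -> `|s - s'| < d -> `|t - t'| < d -> nm (g s t - g s' t') < e.
Proof.
move=> cg e e0.
have cK : compact (`[(0 : R), (1 : R)]%classic `*` `[(0 : R), (1 : R)]%classic) by apply: compact_setX; exact: segment_compact.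
have [|d d0 hd] := @heine (R^o * R^o)%type _ (fun p => g p.1 p.2) cK _ e e0.
  by move=> [s t] _; exact: cg.
exists d => // s t s' t' s1 t1 h1 h2.
by apply: (hd (s, t) (s', t')); [split; rewrite /= in_itv|split].
Qed.

Lemma mean_dist g h (B : R) : ct01 g -> ct01 h -> (forall x, on01 x -> nm (g x - h x) <= B) ->
  nm (mean g - mean h) <= B.
Proof.
move=> cg ch gh; have cN : ct01 (fun x => -1 * h x).
  by move=> x xx; apply: (@cvgM C R (nbhs x) _ (cst (-1)) h); [exact: cvg_cst|exact: ch].
have -> : mean g - mean h = mean (fun x => g x + -1 * h x) by rewrite meanD// meanZ// mulN1r.
apply: mean_bound => [x xx|x xx]; last by rewrite mulN1r gh.
by apply: (@cvgD C C R (nbhs x) _ g (fun x => -1 * h x)); [exact: cg|exact: cN].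
Qed.

Lemma mean_cts (g : R -> R -> C) : cts2 g -> ct01 (fun s => mean (g s)).
Proof.
move=> cg s s1; apply/cvgCP => e e0; have [d d0 hd] := cts2_unif cg (divr_gt0 e0 (ltr0n _ 2)).
apply/nbhsRP; exists d => // s' hs'.
rewrite /= (le_lt_trans (y := e / 2))//; last by rewrite ltr_pdivrMr// ltr_pMr// ltr1n.
rewrite nmC; apply: mean_dist; [exact: cts2_l|exact: cts2_l|move=> x xx].
by apply/ltW/hd => //; rewrite ?subrr ?normr0// distrC.
Qed.

(** Fubini: finite dyadic means commute by [dm_swap], and uniform continuity bounds the three errors
    by [e / 3] at one and the same mesh. *)
Lemma mean_swap (g : R -> R -> C) : cts2 g ->
  mean (fun s => mean (g s)) = mean (fun t => mean (g^~ t)).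
Proof.
move=> cg; have cg' := cts2_swap cg.
apply: is_mean_unique (meanP (mean_cts cg)) _ => e e0.
have e3 : 0 < e / 3 by rewrite divr_gt0.
have [d d0 hd] := cts2_unif cg e3; have [N hN] := half_small d0.
exists N => n /hN hn.
have A : nm (dm n (fun s => mean (g s)) - dm n (fun s => dm n (g s))) <= e / 3.
  apply: dm_dist => s s1; rewrite nmC; apply: mean_osc; first exact: cts2_l.
  by move=> x y x1 y1 xy; apply/ltW/hd => //; rewrite ?subrr ?normr0//; exact: le_lt_trans hn.
have B : nm (dm n (fun t => dm n (g^~ t)) - dm n (fun t => mean (g^~ t))) <= e / 3.
  apply: dm_dist => s s1; apply: mean_osc; first exact: (@cts2_l (fun s t => g t s) s cg').
  by move=> x y x1 y1 xy; apply/ltW/hd => //; rewrite ?subrr ?normr0//; exact: le_lt_trans hn.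
have D : nm (dm n (fun t => mean (g^~ t)) - mean (fun t => mean (g^~ t))) <= e / 3.
  apply: mean_osc; first exact: (mean_cts cg').
  move=> x y x1 y1 xy; apply: mean_dist; [exact: (@cts2_l (fun s t => g t s) x cg')|exact: (@cts2_l (fun s t => g t s) y cg')|move=> s s1].
  by apply/ltW/hd => //; rewrite ?subrr ?normr0//; exact: le_lt_trans hn.
rewrite dm_swap in A.
rewrite (le_trans (nm_subr _ (dm n (fun t => dm n (g^~ t))) _))//.
have := le_trans (nm_subr _ _ _) (lerD B D); lra.
Qed.

(** Self-similarity: splitting the interval gives [m = (m / 2 + (1 / 2 + m / 2)) / 2], which
    determines [m]. *)
Lemma mean_id : mean (@ofR R) = 2^-1.
Proof.
have c : ct01 (@ofR R).
  by move=> x _; apply/cvgCP => e e0; apply/nbhsRP; exists e => // w; rewrite /= -(ofRB w x) nm_ofR.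
have E := mean_half c.
have two0 := two_neq0.
have h2 : ct01 (fun x => 2^-1 * ofR x).
  by move=> x xx; apply: (@cvgM C R (nbhs x) _ (cst 2^-1) (@ofR R)); [exact: cvg_cst|exact: c].
have e1 : mean (@ofR R \o lft) = 2^-1 * mean (@ofR R).
  by rewrite -meanZ//; apply: mean_eq => x _; rewrite /lft /= ofRM ofRV ofR_nat mulrC.
have e2 : mean (@ofR R \o rgt) = 2^-1 + 2^-1 * mean (@ofR R).
  have -> : mean (@ofR R \o rgt) = mean (fun x => 2^-1 + 2^-1 * ofR x).
    by apply: mean_eq => x _; rewrite /rgt /= ofRM ofRV ofR_nat ofRD ofR1 mulrDl mul1r [_ * 2^-1]mulrC.
  have c0 : ct01 (fun=> 2^-1 : C) by exact: ct01_cst.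
  by rewrite (meanD c0 h2) mean_cst (meanZ _ c).
rewrite e1 e2 in E; set m := mean _ in E *.
have : m = m / 2 + 4^-1 by rewrite {1}E; field.
move=> F; have : m / 2 = 4^-1 by apply: (addrI (m / 2)); rewrite -F; field.
by move=> G; apply: (mulIf (x := 2^-1)); rewrite ?invr_neq0// G; field.
Qed.

Lemma ct01D g h : ct01 g -> ct01 h -> ct01 (fun x => g x + h x).
Proof. by move=> cg ch x xx; apply: (@cvgD C C R (nbhs x) _ g h); [exact: cg|exact: ch]. Qed.
Lemma ct01M g h : ct01 g -> ct01 h -> ct01 (fun x => g x * h x).
Proof. by move=> cg ch x xx; apply: (@cvgM C R (nbhs x) _ g h); [exact: cg|exact: ch]. Qed.
Lemma ct01_ofR : ct01 (@ofR R).
Proof. by move=> x _; apply/cvgCP => e e0; apply/nbhsRP; exists e => // w; rewrite /= -(ofRB w x) nm_ofR. Qed.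

End Mean.

(** * Cauchy's theorem for parallelograms *)

Section Goursat.
Variable R : realType.
Local Notation C := (Cx R).
Implicit Types (f : C -> C) (z d e : C).

Lemma seg_cts z d : continuous (fun t : R => z + ofR t * d).
Proof.
move=> t; apply/cvgCP => e e0; apply/nbhsRP; have p : 0 < nm d + 1 by rewrite ltr_wpDl// nm_ge0.
exists (e / (nm d + 1)); first by rewrite divr_gt0.
move=> w hw /=; have -> : z + ofR w * d - (z + ofR t * d) = ofR (w - t) * d by rewrite ofRB; ring.
rewrite nmM nm_ofR; rewrite ltr_pdivlMr// in hw; apply: le_lt_trans hw.
by rewrite ler_wpM2l// lerDl.
Qed.

Definition seg_in (f : C -> C) z d := forall t, on01 t -> {for z + ofR t * d, continuous f}.

Lemma seg_ct f z d : seg_in f z d -> ct01 (fun t => f (z + ofR t * d)).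
Proof.
move=> h t t1; apply: (@continuous_comp _ _ _ (fun t => z + ofR t * d) f); [exact: seg_cts|exact: h].
Qed.

(** The integral of [f dz] along the segment from [z] to [z + d]; [rect] is then the integral along
    the boundary of the parallelogram at [z] with sides [d], [e]. *)
Definition side f z d := mean (fun t => f (z + ofR t * d)) * d.
Definition rect f z d e := side f z d + side f (z + d) e - side f (z + e) d - side f z e.

Lemma side_half f z d : seg_in f z (d + d) -> side f z (d + d) = side f z d + side f (z + d) d.
Proof.
move=> h; rewrite /side mean_half; last exact: seg_ct.
have -> : mean ((fun t => f (z + ofR t * (d + d))) \o lft (R:=R)) = mean (fun t => f (z + ofR t * d)).
  by apply: mean_eq => t _ /=; congr f; rewrite /lft ofRM ofRV ofR_nat; field.
have -> : mean ((fun t => f (z + ofR t * (d + d))) \o rgt (R:=R)) = mean (fun t => f (z + d + ofR t * d)).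
  by apply: mean_eq => t _ /=; congr f; rewrite /rgt ofRM ofRV ofR_nat ofRD ofR1; field.
by field.
Qed.

(** The mean of an affine function over a segment is its value at the midpoint, by [mean_id]. *)
Lemma side_affine f z d (a c : C) (B : R) : seg_in f z d ->
  (forall t, on01 t -> nm (f (z + ofR t * d) - (a + c * (z + ofR t * d))) <= B) ->
  nm (side f z d - (a + c * (z + d / 2)) * d) <= B * nm d.
Proof.
move=> hf hB; rewrite /side -mulrBl nmM ler_wpM2r ?nm_ge0//.
have c1 : ct01 (fun t : R => c * d * ofR t) by apply: ct01M; [exact: ct01_cst|exact: ct01_ofR].
have c2 : ct01 (fun t : R => (a + c * z) + c * d * ofR t) by apply: ct01D c1; exact: ct01_cst.
have -> : a + c * (z + d / 2) = mean (fun t => (a + c * z) + c * d * ofR t).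
  have c0 : ct01 (fun=> a + c * z : C) by exact: ct01_cst.
  by rewrite (meanD c0 c1) mean_cst (meanZ _ (@ct01_ofR R)) mean_id; ring.
apply: mean_dist c2 _; first exact: seg_ct.
by move=> t t1; rewrite (_ : a + c * z + _ = a + c * (z + ofR t * d)) ?hB//; ring.
Qed.

Definition par z d e (s t : R) := z + ofR s * d + ofR t * e.

(** The midpoint values cancel around the parallelogram, so only the distance [B] from [f] to an
    affine function contributes. *)
Lemma rect_affine f z d e (a c : C) (B : R) :
  (forall s t, on01 s -> on01 t -> {for par z d e s t, continuous f}) ->
  (forall s t, on01 s -> on01 t -> nm (f (par z d e s t) - (a + c * par z d e s t)) <= B) ->
  nm (rect f z d e) <= 2 * B * (nm d + nm e).
Proof.
move=> cf hB; have o0 := @on010 R; have o1 : on01 (1 : R) by rewrite /on01 ler01 lexx.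
have p1 t : par z d e t 0 = z + ofR t * d by rewrite /par ofR0; ring.
have p2 t : par z d e 1 t = z + d + ofR t * e by rewrite /par ofR1; ring.
have p3 t : par z d e t 1 = z + e + ofR t * d by rewrite /par ofR1; ring.
have p4 t : par z d e 0 t = z + ofR t * e by rewrite /par ofR0; ring.
have S1 : nm (side f z d - (a + c * (z + d / 2)) * d) <= B * nm d.
  by apply: side_affine => t t1; rewrite -p1; [exact: cf|exact: hB].
have S2 : nm (side f (z + d) e - (a + c * (z + d + e / 2)) * e) <= B * nm e.
  by apply: side_affine => t t1; rewrite -p2; [exact: cf|exact: hB].
have S3 : nm (side f (z + e) d - (a + c * (z + e + d / 2)) * d) <= B * nm d.
  by apply: side_affine => t t1; rewrite -p3; [exact: cf|exact: hB].
have S4 : nm (side f z e - (a + c * (z + e / 2)) * e) <= B * nm e.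
  by apply: side_affine => t t1; rewrite -p4; [exact: cf|exact: hB].
rewrite /rect; set A1 := side f z d in S1 *; set A2 := side f (z + d) e in S2 *.
set A3 := side f (z + e) d in S3 *; set A4 := side f z e in S4 *.
have -> : A1 + A2 - A3 - A4 = ((A1 - (a + c * (z + d / 2)) * d) + (A2 - (a + c * (z + d + e / 2)) * e))
  - ((A3 - (a + c * (z + e + d / 2)) * d) + (A4 - (a + c * (z + e / 2)) * e)) by ring.
have := nmB ((A1 - (a + c * (z + d / 2)) * d) + (A2 - (a + c * (z + d + e / 2)) * e))
  ((A3 - (a + c * (z + e + d / 2)) * d) + (A4 - (a + c * (z + e / 2)) * e)).
have := nmD (A1 - (a + c * (z + d / 2)) * d) (A2 - (a + c * (z + d + e / 2)) * e).
have := nmD (A3 - (a + c * (z + e + d / 2)) * d) (A4 - (a + c * (z + e / 2)) * e).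
lra.
Qed.

(** Each inner side is run through twice, in opposite directions. *)
Lemma rect_quarter f z d e :
  (forall s t, on01 s -> on01 t -> {for par z (d + d) (e + e) s t, continuous f}) ->
  rect f z (d + d) (e + e) = rect f z d e + rect f (z + d) d e + rect f (z + e) d e + rect f (z + d + e) d e.
Proof.
move=> cf; have o0 := @on010 R; have o1 : on01 (1 : R) by rewrite /on01 ler01 lexx.
have oh : on01 (2^-1 : R) by rewrite /on01 invr_ge0 ler0n invf_le1// ler1n.
have p1 t : par z (d + d) (e + e) t 0 = z + ofR t * (d + d) by rewrite /par ofR0; ring.
have p2 t : par z (d + d) (e + e) 1 t = z + (d + d) + ofR t * (e + e) by rewrite /par ofR1; ring.
have p3 t : par z (d + d) (e + e) t 1 = z + (e + e) + ofR t * (d + d) by rewrite /par ofR1; ring.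
have p4 t : par z (d + d) (e + e) 0 t = z + ofR t * (e + e) by rewrite /par ofR0; ring.
rewrite /rect !side_half => [||||].
- have -> : z + (d + d) = z + d + d by ring.
  have -> : z + (e + e) = z + e + e by ring.
  have -> : z + e + e + d = z + d + e + e by ring.
  have -> : z + e + d = z + d + e by ring.
  have -> : z + d + e + d = z + d + d + e by ring.
  ring.
- by move=> t t1; rewrite -p4; exact: cf.
- by move=> t t1; rewrite -p3; exact: cf.
- by move=> t t1; rewrite -p2; exact: cf.
- by move=> t t1; rewrite -p1; exact: cf.
Qed.

Lemma quarter_bounds (a H k x : R) : 0 <= a -> a + H <= 1 -> H = k + k -> 0 < k ->
  a <= x -> x <= a + k -> [/\ 0 <= x, x + k <= 1 & x + k <= a + H].
Proof. by move=> ? ? ? ? ? ?; split; lra. Qed.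

(** Bisection: at scale [h n = 2^-n] some parallelogram keeps at least [q * h n ^+ 2] of the
    boundary integral, whereas differentiability at the limit point makes this integral
    [o(h n ^+ 2)]. *)
Lemma goursat f z d e :
  (forall s t, on01 s -> on01 t -> differentiable f (par z d e s t)) -> rect f z d e = 0.
Proof.
move=> df; have cf s t : on01 s -> on01 t -> {for par z d e s t, continuous f}.
  by move=> ? ?; apply: differentiable_continuous; exact: df.
apply/eqP; rewrite -nm_eq0 eq_le nm_ge0 andbT leNgt; apply/negP => q0; set q := nm _ in q0.
pose h n : R := 2^-1 ^+ n.
have h0 n : 0 < h n by rewrite exprn_gt0// invr_gt0.
have hS n : h n = h n.+1 + h n.+1 by rewrite /h exprS; lra.
pose rn n (p : R * R) := rect f (par z d e p.1 p.2) (ofR (h n) * d) (ofR (h n) * e).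
pose good n (p : R * R) := [/\ 0 <= p.1, 0 <= p.2, p.1 + h n <= 1, p.2 + h n <= 1 & q * h n ^+ 2 <= nm (rn n p)].
pose nxt n (p p' : R * R) := [/\ good n.+1 p', p.1 <= p'.1, p.2 <= p'.2, p'.1 + h n.+1 <= p.1 + h n & p'.2 + h n.+1 <= p.2 + h n].
have parE (a : R) (p : R * R) s t : par (par z d e p.1 p.2) (ofR a * d) (ofR a * e) s t = par z d e (p.1 + s * a) (p.2 + t * a).
  by rewrite /par !ofRD !ofRM; ring.
have in01 n p s : 0 <= p -> p + h n <= 1 -> on01 s -> on01 (p + s * h n).
  move=> p0 p1 /andP[s0 s1]; rewrite /on01 addr_ge0 ?mulr_ge0 ?(ltW (h0 n))//= (le_trans _ p1)//.
  by rewrite lerD2l ler_piMl// ltW.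
have cn n p : good n p -> forall s t, on01 s -> on01 t -> {for par (par z d e p.1 p.2) (ofR (h n) * d) (ofR (h n) * e) s t, continuous f}.
  by move=> [a1 a2 b1 b2 _] s t s1 t1; rewrite parE; apply: cf; exact: in01.
have step n p : good n p -> exists p', nxt n p p'.
  move=> gp; have := cn _ _ gp; move: gp => [a1 a2 b1 b2 qp].
  have dd (x : C) : ofR (h n) * x = ofR (h n.+1) * x + ofR (h n.+1) * x by rewrite hS ofRD mulrDl.
  move=> cp; rewrite /rn !dd rect_quarter in qp; last by move=> s t; rewrite -!dd; exact: cp.
  have E1 : par z d e p.1 p.2 + ofR (h n.+1) * d = par z d e (p.1 + h n.+1) p.2 by rewrite /par ofRD; ring.
  have E2 : par z d e p.1 p.2 + ofR (h n.+1) * e = par z d e p.1 (p.2 + h n.+1) by rewrite /par ofRD; ring.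
  have E3 : par z d e (p.1 + h n.+1) p.2 + ofR (h n.+1) * e = par z d e (p.1 + h n.+1) (p.2 + h n.+1) by rewrite /par ofRD; ring.
  rewrite E1 E2 E3 in qp.
  have hp := h0 n.+1; have hSn := hS n.
  pose p2 := (p.1 + h n.+1, p.2); pose p3 := (p.1, p.2 + h n.+1); pose p4 := (p.1 + h n.+1, p.2 + h n.+1).
  have qp' : q * h n ^+ 2 <= nm (rn n.+1 p) + nm (rn n.+1 p2) + nm (rn n.+1 p3) + nm (rn n.+1 p4).
    by apply: (le_trans qp); do 3 (apply: le_trans (nmD _ _) _; rewrite lerD2r); exact: lexx.
  have hq : q * h n ^+ 2 = 4 * (q * h n.+1 ^+ 2) by rewrite hSn; ring.
  rewrite hq in qp'.
  have fin x y : p.1 <= x -> x <= p.1 + h n.+1 -> p.2 <= y -> y <= p.2 + h n.+1 ->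
      q * h n.+1 ^+ 2 <= nm (rn n.+1 (x, y)) -> nxt n p (x, y).
    move=> x1 x2 y1 y2 hxy.
    have [u1 u2 u3] := quarter_bounds a1 b1 hSn hp x1 x2.
    have [v1 v2 v3] := quarter_bounds a2 b2 hSn hp y1 y2.
    by split=> //; split.
  have l1 (x : R) : x <= x + h n.+1 by rewrite lerDl ltW.
  have [g1|g1] := leP (q * h n.+1 ^+ 2) (nm (rn n.+1 p)).
    by exists (p.1, p.2); apply: fin => //; case: (p) g1.
  have [g2|g2] := leP (q * h n.+1 ^+ 2) (nm (rn n.+1 p2)); first by exists p2; apply: fin.
  have [g3|g3] := leP (q * h n.+1 ^+ 2) (nm (rn n.+1 p3)); first by exists p3; apply: fin.
  have [g4|g4] := leP (q * h n.+1 ^+ 2) (nm (rn n.+1 p4)); first by exists p4; apply: fin.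
  by exfalso; move: (ltrD (ltrD (ltrD g1 g2) g3) g4); rewrite ltNge (le_trans _ qp')//; clear; lra.
(* Corners, in the parameters of the parallelogram, of the successive bad quarters. A good corner
   always has a successor by [step], so the default of [xget] does not occur. *)
pose sq := fix sq n := if n is n'.+1 then xget (0, 0) (nxt n' (sq n')) else (0 : R, 0 : R).
have gs0 : good 0%N (0, 0).
  split=> //=; rewrite ?add0r /h ?expr0// expr1n mulr1 /rn /= ofR1 !mul1r.
  by rewrite /par ofR0 !mul0r !addr0.
have sqN n : good n (sq n) /\ nxt n (sq n) (sq n.+1).
  have key m : good m (sq m) -> nxt m (sq m) (sq m.+1).
    by move=> /step[p' np] /=; case: xgetP => [x -> //|/(_ p')].
  elim: n => [|n [_ [IH _ _ _ _]]]; first by split=> //; exact: (key 0%N).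
  by split=> //; exact: key.
have mono n k : [/\ (sq n).1 <= (sq (n + k)%N).1, (sq n).2 <= (sq (n + k)%N).2,
   (sq (n + k)%N).1 + h (n + k)%N <= (sq n).1 + h n & (sq (n + k)%N).2 + h (n + k)%N <= (sq n).2 + h n].
  elim: k => [|k [i1 i2 i3 i4]]; first by rewrite addn0.
  have [_ [_ j1 j2 j3 j4]] := sqN (n + k)%N; rewrite addnS; split.
  - exact: le_trans i1 j1. - exact: le_trans i2 j2. - exact: le_trans j3 i3. - exact: le_trans j4 i4.
have lim (g : R * R -> R) : (forall n k, g (sq n) <= g (sq (n + k)%N) /\ g (sq (n + k)%N) + h (n + k)%N <= g (sq n) + h n) ->
   exists s, forall n, g (sq n) <= s <= g (sq n) + h n.
  move=> hg; exists (sup (range (fun n => g (sq n)))) => n.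
  have ubm m : ubound (range (fun n => g (sq n))) (g (sq m) + h m).
    move=> _ [k _ <-]; case: (leqP k m) => [km|/ltnW mk].
      have [+ _] := hg k (m - k)%N; rewrite subnKC// => H; rewrite (le_trans H)// lerDl; exact/ltW/h0.
    have [_] := hg m (k - m)%N; rewrite subnKC// => H; rewrite (le_trans _ H)// lerDl; exact/ltW/h0.
  apply/andP; split; last by apply: ge_sup; [exists (g (sq 0%N)); exists 0%N|exact: ubm].
  apply: ub_le_sup; last by exists n.
  by exists (g (sq 0%N) + h 0%N); exact: ubm.
have [s hs] : exists s, forall n, (sq n).1 <= s <= (sq n).1 + h n.
  by apply: lim => n k; have [] := mono n k.
have [t ht] : exists t, forall n, (sq n).2 <= t <= (sq n).2 + h n.
  by apply: (lim snd) => n k; have [] := mono n k.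
have s01 : on01 s by have := hs 0%N; rewrite /= add0r.
have t01 : on01 t by have := ht 0%N; rewrite /= add0r.
have /diffCP[c hc] := df s t s01 t01; set w := par z d e s t in hc.
(* The parallelogram of scale [h N] lies within [h N * D] of the limit point [w]; with
   [eps = q / (4 * D ^+ 2)] the main term [2 * eps * (h N * D) ^+ 2] of the bound is half of
   [q * h N ^+ 2]. *)
pose D := nm d + nm e + 1.
have D0 : 0 < D by rewrite ltr_wpDl// addr_ge0// nm_ge0.
have eps0 : 0 < q / (4 * D ^+ 2) by rewrite divr_gt0// mulr_gt0// exprn_gt0.
have [r r0 hr] := hc _ eps0; set eps := q / _ in eps0 hr.
have [N hN] := half_small (divr_gt0 r0 D0).
have hND : h N * D < r by rewrite -ltr_pdivlMr//; exact: (hN N (leqnn _)).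
have [gN _] := sqN N; have cN := cn _ _ gN; have [a1 a2 b1 b2 qN] := gN.
have ab s' t' (p : R) : on01 s' -> (p <= t' <= p + h N) -> `|p + s' * h N - t'| <= h N.
  move=> /andP[x0 x1] /andP[y0 y1]; rewrite ler_norml; have := h0 N => hN0.
  by apply/andP; split; nra.
have := @rect_affine f (par z d e (sq N).1 (sq N).2) (ofR (h N) * d) (ofR (h N) * e) (f w - c * w) c (eps * (h N * D)) cN.
have close s' t' : on01 s' -> on01 t' -> nm (par (par z d e (sq N).1 (sq N).2) (ofR (h N) * d) (ofR (h N) * e) s' t' - w) <= h N * D.
  move=> s1 t1; rewrite parE /w /par.
  set u1 := (sq N).1 + _; set u2 := (sq N).2 + _.
  have -> : z + ofR u1 * d + ofR u2 * e - (z + ofR s * d + ofR t * e) = ofR (u1 - s) * d + ofR (u2 - t) * e by rewrite !ofRB; ring.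
  rewrite (le_trans (nmD _ _))// !nmM !nm_ofR /D.
  have B1 : `|u1 - s| <= h N by exact: ab.
  have B2 : `|u2 - t| <= h N by exact: ab.
  have n1 := nm_ge0 d; have n2 := nm_ge0 e; have := h0 N.
  have B3 := ler_wpM2r n1 B1; have B4 := ler_wpM2r n2 B2; lra.
move=> H.
have {}H : nm (rn N (sq N)) <= 2 * (eps * (h N * D)) * (nm (ofR (h N) * d) + nm (ofR (h N) * e)).
  apply: H => s' t' s1 t1; have cl := close s' t' s1 t1; set x := par _ _ _ s' t' in cl *.
  have -> : f x - (f w - c * w + c * x) = f (w + (x - w)) - f w - c * (x - w).
    by rewrite [w + _]addrC subrK; ring.
  by rewrite (le_trans (hr _ (le_lt_trans cl hND)))// ler_pM2l.
have := le_trans qN H; rewrite !nmM !nm_ofR ger0_norm ?(ltW (h0 N))// -mulrDr leNgt => /negP; apply.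
have hp := h0 N.
apply: (@le_lt_trans _ _ (2 * (eps * (h N * D)) * (h N * D))).
  apply: ler_wpM2l; first by do ?[exact: ler0n|exact: ltW|apply: mulr_ge0].
  by apply: ler_wpM2l; [exact: ltW|rewrite lerDl].
have -> : 2 * (eps * (h N * D)) * (h N * D) = (eps * (4 * D ^+ 2)) * h N ^+ 2 / 2 by field.
rewrite /eps mulfVK; last by rewrite mulf_neq0// ?expf_neq0// lt0r_neq0.
by rewrite ltr_pdivrMr// ltr_pMr ?ltr1n// mulr_gt0// exprn_gt0.
Qed.

End Goursat.

(** * Fourier series on tubes *)

Section Fejer.
Variable R : realType.
Local Notation C := (Cx R).
Implicit Types (f : R -> C).

(** Goursat on the parallelogram with sides 1 and [e]: the two sides along [e] cancel by
    periodicity. *)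
Lemma strip_mean (f : C -> C) (z e : C) :
  (forall s t, on01 t -> differentiable f (z + ofR s + ofR t * e)) ->
  (forall t, on01 t -> f (z + ofR t * e + 1) = f (z + ofR t * e)) ->
  mean (fun s => f (z + ofR s)) = mean (fun s => f (z + e + ofR s)).
Proof.
move=> df pf; have : rect f z 1 e = 0.
  by apply: goursat => s t _ t1; rewrite /par mulr1; exact: df.
rewrite /rect /side !mulr1.
have E (w : C) : mean (fun t => f (w + ofR t * 1)) = mean (fun t => f (w + ofR t)).
  by apply: mean_eq => t _; rewrite mulr1.
rewrite !E; have -> : mean (fun t => f (z + 1 + ofR t * e)) = mean (fun t => f (z + ofR t * e)).
  by apply: mean_eq => t t1; rewrite -pf//; congr f; ring.
move=> H; apply/eqP; rewrite -subr_eq0; apply/eqP; rewrite -[RHS]H; ring.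
Qed.

Definition ek (k : int) (s : R) : C := e2ipi (ofR s * k%:~R).

Lemma ekD j k s : ek (j + k) s = ek j s * ek k s.
Proof. by rewrite /ek intrD mulrDr e2ipiD. Qed.
Lemma ek0 s : ek 0 s = 1. Proof. by rewrite /ek mulr0z mulr0 e2ipi0. Qed.
Lemma ekN k s : ek (- k) s = (ek k s)^-1. Proof. by rewrite /ek mulrNz mulrN e2ipiN. Qed.
Lemma nm_ek k s : nm (ek k s) = 1.
Proof. by rewrite /ek nm_e2ipi iMM iM_ofR -ofR_int iM_ofR mulr0 mul0r addr0 mulr0 oppr0 expR0. Qed.
Lemma ek_nat (n : nat) s : ek n s = ek 1 s ^+ n.
Proof. by elim: n => [|n IH]; rewrite ?ek0 ?expr0// exprS -IH -ekD -intS. Qed.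

Lemma ek_cts k : continuous (ek k).
Proof.
have : continuous (fun s : R => e2ipi (0 + ofR s * k%:~R)).
  move=> t; apply: (@continuous_comp _ _ _ (fun s : R => 0 + ofR s * k%:~R) (@e2ipi R)); first exact: seg_cts.
  by apply: differentiable_continuous; exact: diff_e2ipi.
by have -> : ek k = (fun s : R => e2ipi (0 + ofR s * k%:~R)) by apply/funext => x; rewrite add0r.
Qed.

(** For [k] nonzero, moving the path by [i / (2 pi)] does not change the mean but multiplies it by
    [q], whose modulus [exp (- k)] is not 1. *)
Lemma mean_ek k : mean (ek k) = if k == 0 then 1 else 0.
Proof.
case: eqP => [->|/eqP k0].
  by rewrite (mean_eq (h := fun=> 1)) ?mean_cst// => x _; rewrite ek0.
pose f (z : C) := e2ipi (z * k%:~R).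
have := @strip_mean f 0 (ofR (twopi R)^-1 * ii R).
have E1 : mean (fun s : R => f (0 + ofR s)) = mean (ek k) by apply: mean_eq => s _; rewrite /f add0r.
have c1 : ct01 (ek k) by move=> x _; exact: ek_cts.
pose q := e2ipi (ofR (twopi R)^-1 * ii R * k%:~R).
have E2 : mean (fun s : R => f (0 + ofR (twopi R)^-1 * ii R + ofR s)) = q * mean (ek k).
  rewrite -(meanZ _ c1); apply: mean_eq => s _; rewrite /f /q /ek -e2ipiD; congr e2ipi; ring.
rewrite E1 E2 => H; have {}H : mean (ek k) = q * mean (ek k).
  apply: H => [s t _|t _].
    apply: (@differentiable_comp _ _ _ _ (fun z : C => z * k%:~R)); last exact: diff_e2ipi.
    by apply: differentiableM; [exact: ex_diff|exact: differentiable_cst].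
  by rewrite /f mulrDl mul1r e2ipiD e2ipi_int mulr1.
have nq : nm q = expR (- k%:~R).
  rewrite /q nm_e2ipi !(iMM, rEM) -ofR_int !(rE_ofR, iM_ofR, rE_ii, iM_ii).
  by congr (expR (- _)); have := lt0r_neq0 (twopi_gt0 R) => ?; field.
have /eqP : (q - 1) * mean (ek k) = 0 by rewrite mulrBl mul1r -H subrr.
rewrite mulf_eq0 => /orP[|/eqP//]; rewrite subr_eq0 => /eqP q1.
have /expR_inj/eqP : expR (- k%:~R) = expR 0 :> R by rewrite expR0 -nq q1 nm1.
by rewrite oppr_eq0 intr_eq0 (negbTE k0).
Qed.

Lemma mean_sum n (c : nat -> C) (g : nat -> R -> C) : (forall j, ct01 (g j)) ->
  mean (fun s => \sum_(j < n) c j * g j s) = \sum_(j < n) c j * mean (g j) /\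
  ct01 (fun s => \sum_(j < n) c j * g j s).
Proof.
move=> cg; elim: n => [|n [IH cI]].
  rewrite big_ord0; split; last first.
    by have -> : (fun s => \sum_(j < 0) c j * g j s) = (fun=> 0) by [apply/funext => s; rewrite big_ord0]; exact: ct01_cst.
  by rewrite (mean_eq (h := fun=> 0)) ?mean_cst// => x _; rewrite big_ord0.
have c1 : ct01 (fun s => c n * g n s) by apply: ct01M; [exact: ct01_cst|exact: cg].
have E : (fun s => \sum_(j < n.+1) c j * g j s) = (fun s => \sum_(j < n) c j * g j s + c n * g n s).
  by apply/funext => s; rewrite big_ord_recr.
rewrite E; split; last exact: ct01D.
by rewrite (meanD cI c1) IH (meanZ _ (cg n)) big_ord_recr.
Qed.

(** This is [cos (pi s) ^ 2]. Its powers are nonnegative trigonometric polynomials which concentrate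
    at the integers, and their coefficients are binomial. *)
Definition ker (s : R) : R := (1 + cos (twopi R * s)) / 2.

Lemma ker_ge0 s : 0 <= ker s.
Proof. by rewrite /ker divr_ge0// -lerBlDl sub0r cos_geN1. Qed.
Lemma kerE s : ofR (ker s) = ek (-1) s * ((1 + ek 1 s) ^+ 2 / 4).
Proof.
have e1 : ek 1 s != 0 by rewrite -nm_gt0 nm_ek.
have eE : ek 1 s = ofR (cos (twopi R * s)) + ofR (sin (twopi R * s)) * ii R.
  rewrite /ek mulr1 e2ipiE; apply: cx_eq.
    by rewrite rE_cexp rE_twopi_ii iM_twopi_ii iM_ofR rE_ofR mulr0 oppr0 expR0 mul1r !(rED, rEM, rE_ofR, iM_ofR, rE_ii, iM_ii); ring.
  by rewrite iM_cexp rE_twopi_ii iM_twopi_ii iM_ofR rE_ofR mulr0 oppr0 expR0 mul1r !(iMD, iMM, rE_ofR, iM_ofR, rE_ii, iM_ii); ring.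
have eN : (ek 1 s)^-1 = ofR (cos (twopi R * s)) - ofR (sin (twopi R * s)) * ii R.
  apply: (mulfI e1); rewrite mulfV// eE.
  set c := ofR _; set t := ofR _; have -> : (c + t * ii R) * (c - t * ii R) = c ^+ 2 - t ^+ 2 * (ii R * ii R) by ring.
  by rewrite ii2 mulrN1 opprK -!ofRX -ofRD cos2Dsin2.
rewrite ekN; have -> : (ek 1 s)^-1 * ((1 + ek 1 s) ^+ 2 / 4) = (2 + ek 1 s + (ek 1 s)^-1) / 4 by field.
by rewrite eN eE /ker ofRM ofRV ofR_nat ofRD ofR1; field.
Qed.

Definition kc N j : C := 'C(N.*2, j)%:R / 4 ^+ N.

Lemma kerX N s : ofR (ker s ^+ N) = \sum_(j < N.*2.+1) kc N j * ek (j%:Z - N%:Z) s.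
Proof.
rewrite ofRX kerE exprMn expr_div_n -exprM mul2n exprDn.
rewrite ekN exprVn -ek_nat -ekN mulrA mulr_sumr mulr_suml; apply: eq_bigr => j _.
rewrite expr1n mul1r -ek_nat addrC ekD /kc -mulr_natl; ring.
Qed.

Lemma ker_cts N : ct01 (fun s => ofR (ker s ^+ N)).
Proof.
have [_] := @mean_sum N.*2.+1 (kc N) (fun j s => ek (j%:Z - N%:Z) s) (fun j x _ => @ek_cts _ x).
by congr ct01; apply/funext => s; rewrite kerX.
Qed.

Lemma mean_real (g : R -> R) : ct01 (fun s => ofR (g s)) -> iM (mean (fun s => ofR (g s))) = 0.
Proof.
move=> cg; apply/eqP; rewrite -normr_le0; apply/ler_addgt0Pr => e e0; rewrite add0r.
have [N hN] := meanP cg e0; have dr n (k : R -> R) : iM (dm n (fun s => ofR (k s))) = 0.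
  elim: n k => [|n IH] k; first by rewrite /= iM_ofR.
  have E : (2 : C)^-1 = ofR (2^-1) by rewrite ofRV ofR_nat.
  by rewrite /= E iMM iMD (IH (k \o lft (R:=R))) (IH (k \o rgt (R:=R))) iM_ofR; ring.
have := le_trans (iM_le _) (hN N (leqnn N)); by rewrite iMB dr sub0r normrN.
Qed.

Definition kw N := mean (fun s => ofR (ker s ^+ N)).

(** A coefficient of a nonnegative kernel is at most its mass [kw N]: after normalization all
    weights are at most 1. *)
Lemma kc_le N j : (j < N.*2.+1)%N -> nm (kc N j) <= rE (kw N).
Proof.
move=> jN; have -> : kc N j = mean (fun s => ofR (ker s ^+ N) * ek (N%:Z - j%:Z) s).
  have -> : (fun s => ofR (ker s ^+ N) * ek (N%:Z - j%:Z) s) = (fun s => \sum_(i < N.*2.+1) kc N i * ek (i%:Z - j%:Z) s).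
    apply/funext => s; rewrite kerX mulr_suml; apply: eq_bigr => i _; by rewrite -mulrA -ekD addrA subrK.
  have [-> _] := @mean_sum N.*2.+1 (kc N) (fun i s => ek (i%:Z - j%:Z) s) (fun i x _ => @ek_cts _ x).
  rewrite (bigD1 (Ordinal jN))//= subrr mean_ek eqxx mulr1 big1 ?addr0// => i /negP ij.
  rewrite mean_ek subr_eq0 eqz_nat; case: eqP; rewrite ?mulr0// => ijE; case: ij; exact/eqP/val_inj.
apply: mean_le; [apply: ct01M; [exact: ker_cts|by move=> x _; exact: ek_cts]|exact: ker_cts|].
by move=> s _; rewrite nmM nm_ek mulr1 nm_ofR rE_ofR ger0_norm// exprn_ge0// ker_ge0.
Qed.

(** The initial dyadic interval of length [2^-d] alone contributes this much; it bounds the mass of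
    the kernel from below. *)
Lemma mean_lower (d : nat) (g : R -> R) (c : R) : ct01 (fun s => ofR (g s)) -> 0 <= c ->
  (forall s, on01 s -> 0 <= g s) -> (forall s, on01 s -> s <= 2^-1 ^+ d -> c <= g s) ->
  2^-1 ^+ d * c <= rE (mean (fun s => ofR (g s))).
Proof.
elim: d g => [|d IH] g cg c0 g0 gc.
  rewrite expr0 mul1r -[leLHS](ger0_norm c0) -nm_ofR -(mean_cst (ofR c)); apply: mean_le.
  - exact: ct01_cst. - exact: cg.
  by move=> s /[dup] s01 /andP[_ s1]; rewrite nm_ofR rE_ofR ger0_norm// gc// expr0.
rewrite mean_half//; have cl := ct01_lft cg; have cr := ct01_rgt cg.
have -> : (2 : C)^-1 = ofR (2^-1) by rewrite ofRV ofR_nat.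
rewrite rEM iM_ofR mulr0 subr0 rE_ofR exprS -mulrA mulrC ler_pM2r ?invr_gt0// rED -[leLHS]addr0 lerD//.
  apply: (IH (g \o lft (R:=R))); [exact: cl|exact: c0|by move=> s s1; exact/g0/lft01|].
  move=> s s1 sd; apply: gc; [exact: lft01|rewrite /= /lft exprS mulrC ler_pM2l// invr_gt0//].
rewrite -(nm0 R) -(mean_cst 0); apply: mean_le; [exact: ct01_cst|exact: cr|move=> s s1].
by rewrite nm0 rE_ofR; exact/g0/rgt01.
Qed.

Lemma pow_small (x d : R) : 0 <= x < 1 -> 0 < d -> exists N, forall n, (N <= n)%N -> x ^+ n < d.
Proof.
move=> /andP[x0 x1] d0; have := @cvg_geometric R 1 x; rewrite ger0_norm// => /(_ x1)/cvgrPdist_lt /(_ d d0)[].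
by move=> N _ hN; exists N => n /hN /=; rewrite sub0r normrN /geometric /= mul1r ger0_norm ?exprn_ge0.
Qed.

Definition fc f (k : int) := mean (fun s => f s * ek (- k) s).

(** Smoothing at 0 with the normalized kernel [ker ^ N]. Only the inequality with the moduli of the
    coefficients is kept, so convergence of the Fourier series is never at stake. *)
Lemma fejer f : continuous f -> (forall s, f (s + 1) = f s) -> forall e, 0 < e ->
  exists N0, forall N, (N0 <= N)%N -> nm (f 0) <= \sum_(j < N.*2.+1) nm (fc f (N%:Z - j%:Z)) + e.
Proof.
move=> cf pf e e0; have cf1 : ct01 f by move=> x _; exact: cf.
have e2 : 0 < e / 2 by rewrite divr_gt0.
(* On [[0, 1]], [f] is within 1 of its values at the points [j / 2^N], so the sum of their moduli,
   each increased by 1, bounds it. *)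
have [B B0 hB] : exists2 B, 0 <= B & forall s, on01 s -> nm (f s) <= B.
  have [N hN] := ct01_osc cf1 ltr01; have := hN N (leqnn _) => oN.
  exists (\sum_(j < (2 ^ N).+1) (nm (f (j%:R / 2 ^+ N)) + 1)).
    by apply: sumr_ge0 => i _; rewrite addr_ge0// nm_ge0.
  move=> s s1; have p2 : 0 < (2 : R) ^+ N by rewrite exprn_gt0.
  have s2 : 0 <= s * 2 ^+ N by case/andP: s1 => s0 _; rewrite mulr_ge0// ltW.
  have /andP[t1 t2] := Num.Theory.truncn_itv s2; set k := Num.truncn _ in t1 t2.
  have kN : (k < (2 ^ N).+1)%N.
    rewrite ltnS -(ler_nat R) (le_trans t1)// natrX ler_piMl ?(ltW p2)//; by case/andP: s1.
  rewrite (bigD1 (Ordinal kN))//= (le_trans (y := nm (f (k%:R / 2 ^+ N)) + 1))//; last first.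
    by rewrite lerDl sumr_ge0// => i _; rewrite addr_ge0// nm_ge0.
  rewrite -lerBlDl (le_trans (nm_lb _ _))// oN//.
    by rewrite /on01 divr_ge0 ?(ltW p2)//= ler_pdivrMr// mul1r -natrX ler_nat -ltnS.
  have -> : s - k%:R / 2 ^+ N = (s * 2 ^+ N - k%:R) / 2 ^+ N by rewrite mulrBl mulfK// lt0r_neq0.
  rewrite normrM [X in _ * X]ger0_norm ?invr_ge0 ?(ltW p2)// exprVn ler_piMl ?invr_ge0 ?(ltW p2)//.
  by rewrite ger0_norm ?subr_ge0// lerBlDl natr1 ltW.
(* By periodicity the end 1 of the interval is also close to 0, hence two cases; [d < 1 / 2] keeps
   the comparison of cosines on half a period. *)
have [d [d0 d14 hd]] : exists d : R, [/\ 0 < d, d < 1 / 2 & forall s, on01 s -> (s < d \/ 1 - d < s) -> nm (f s - f 0) <= e / 2].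
  have /cvgCP/(_ _ e2)/nbhsRP[d d0 hd] := cf 0.
  exists (Num.min d (1 / 4)); split; first by rewrite lt_min d0 divr_gt0.
    by rewrite gt_min; apply/orP; right; lra.
  move=> s /andP[s0 s1] [|]; rewrite ?lt_min => h; apply: ltW.
    by apply: hd; rewrite subr0 ger0_norm//; case/andP: h.
  have -> : f s = f (s - 1) by rewrite -(pf (s - 1)) subrK.
  apply: hd; rewrite subr0 ler0_norm; last by rewrite subr_le0.
  have : Num.min d (1 / 4) <= d by rewrite ge_min lexx.
  lra.
have [D hD] := half_small d0; have {}hD := hD D (leqnn _).
have tp := twopi_gt0 R.
have cosd x y : 0 <= x -> x < y -> y <= 1 / 2 -> cos (twopi R * y) < cos (twopi R * x).
  move=> x0 xy y1; rewrite ltr_cos ?ltr_pM2l// in_itv /= mulr_ge0 ?(ltW tp)// ?(le_trans x0 (ltW xy))//= /twopi.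
    have := pi_gt0 R; nra.
  have := pi_gt0 R; nra.
(* [q] bounds the kernel outside the peak and [q'] bounds it from below on the first dyadic
   interval, which lies inside the peak; [q < q'] makes the outer part negligible for large [N]. *)
pose q := ker d; pose q' := ker (2^-1 ^+ D).
have qq' : q < q' by rewrite /q /q' /ker ltr_pM2r ?invr_gt0// ltrD2l cosd// ?exprn_ge0 ?invr_ge0// ltW.
have q0 : 0 <= q by exact: ker_ge0.
have q'0 : 0 < q' by exact: le_lt_trans qq'.
have kq s : on01 s -> s <= 2^-1 ^+ D -> q' <= ker s.
  move=> /andP[s0 s1]; rewrite le_eqVlt => /orP[/eqP->//|sD].
  by rewrite /q' /ker ler_pM2r ?invr_gt0// lerD2l ltW// cosd// ltW// (lt_trans hD).
have kq2 s : d <= s -> s <= 1 - d -> ker s <= q.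
  move=> ds sd; rewrite /q /ker ler_pM2r ?invr_gt0// lerD2l.
  have [s1|s1] := leP s (1 / 2).
    by move: ds; rewrite le_eqVlt => /orP[/eqP->//|ds]; rewrite ltW// cosd// ltW.
  have -> : cos (twopi R * s) = cos (twopi R * (1 - s)).
    rewrite -[RHS]cosN -[RHS]cosD2pi; congr cos; rewrite /twopi; ring.
  have : d <= 1 - s by lra.
  rewrite le_eqVlt => /orP[/eqP->//|ds2]; rewrite ltW// cosd ?(ltW d0)//; lra.
have rr : 0 <= q / q' < 1 by rewrite divr_ge0 ?(ltW q'0)//= ltr_pdivrMr// mul1r.
(* Chosen so that [(q / q') ^ N < c0] gives [2 B q^N <= (e / 2) kw N] in [A3], the mass being at
   least [2^-D q'^N]. *)
pose c0 := 2^-1 ^+ D * (e / 2) / (2 * B + 1).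
have B1 : 0 < 2 * B + 1 by rewrite ltr_wpDl// mulr_ge0.
have c00 : 0 < c0 by rewrite /c0 divr_gt0// mulr_gt0// exprn_gt0// invr_gt0.
have [N0 hN0] := pow_small rr c00.
exists N0 => N /hN0 hN.
have kw0 : 2^-1 ^+ D * q' ^+ N <= rE (kw N).
  apply: mean_lower; [exact: ker_cts|by rewrite exprn_ge0// ltW|by move=> s _; rewrite exprn_ge0// ker_ge0|].
  by move=> s s1 sD; rewrite lerXn2r ?nnegrE ?ker_ge0 ?(ltW q'0)//; exact: kq.
have kwp : 0 < rE (kw N) by rewrite (lt_le_trans _ kw0)// mulr_gt0// exprn_gt0// invr_gt0.
have cfk : ct01 (fun s => f s * ofR (ker s ^+ N)) by apply: ct01M; [exact: cf1|exact: ker_cts].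
have c1 : ct01 (fun s => f 0 * ofR (ker s ^+ N)) by apply: ct01M; [exact: ct01_cst|exact: ker_cts].
have kwE : kw N = ofR (rE (kw N)).
  apply: cx_eq; rewrite ?rE_ofR ?iM_ofR//; rewrite /kw.
  exact: (@mean_real (fun s => ker s ^+ N) (@ker_cts N)).
have A1 : nm (f 0 * kw N - mean (fun s => f s * ofR (ker s ^+ N))) <= e / 2 * rE (kw N) + 2 * B * q ^+ N.
  have ck := @ker_cts N.
  have cr : ct01 (fun s : R => ofR (e / 2) * ofR (ker s ^+ N)) by apply: ct01M; [exact: ct01_cst|exact: ck].
  have cr2 : ct01 (fun s : R => ofR (e / 2) * ofR (ker s ^+ N) + ofR (2 * B * q ^+ N)) by apply: ct01D; [exact: cr|exact: ct01_cst].
  have cN : ct01 (fun s => -1 * (f s * ofR (ker s ^+ N))) by apply: ct01M; [exact: ct01_cst|exact: cfk].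
  have -> : f 0 * kw N - mean (fun s => f s * ofR (ker s ^+ N)) = mean (fun s => f 0 * ofR (ker s ^+ N) + -1 * (f s * ofR (ker s ^+ N))).
    by rewrite (meanD c1 cN) (meanZ _ ck) (meanZ _ cfk) mulN1r.
  have -> : e / 2 * rE (kw N) + 2 * B * q ^+ N = rE (mean (fun s : R => ofR (e / 2) * ofR (ker s ^+ N) + ofR (2 * B * q ^+ N))).
    rewrite (meanD cr (@ct01_cst _ _)) mean_cst (meanZ _ ck) rED rE_ofR rEM iM_ofR mul0r subr0 rE_ofR//.
  apply: mean_le; [exact: ct01D|exact: cr2|move=> s s1].
  have -> : f 0 * ofR (ker s ^+ N) + -1 * (f s * ofR (ker s ^+ N)) = (f 0 - f s) * ofR (ker s ^+ N) by ring.
  have kp : 0 <= ker s ^+ N by rewrite exprn_ge0// ker_ge0.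
  rewrite -ofRM -ofRD rE_ofR nmM nm_ofR ger0_norm//.
  have [sd|sd] := ltP s d.
    by rewrite (le_trans (y := e / 2 * ker s ^+ N)) ?lerDl ?mulr_ge0 ?exprn_ge0// ler_wpM2r// nmC hd//; left.
  have [sd2|sd2] := ltP (1 - d) s.
    by rewrite (le_trans (y := e / 2 * ker s ^+ N)) ?lerDl ?mulr_ge0 ?exprn_ge0// ler_wpM2r// nmC hd//; right.
  apply: (@le_trans _ _ (2 * B * q ^+ N)); last by rewrite lerDr mulr_ge0 ?(ltW e2).
  apply: ler_pM; [exact: nm_ge0|exact: kp| |by rewrite lerXn2r ?nnegrE ?ker_ge0// kq2].
  by rewrite (le_trans (nmB _ _))// mulr_natl mulr2n lerD// hB// on010.
have A2 : nm (mean (fun s => f s * ofR (ker s ^+ N))) <= rE (kw N) * \sum_(j < N.*2.+1) nm (fc f (N%:Z - j%:Z)).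
  have -> : mean (fun s => f s * ofR (ker s ^+ N)) = \sum_(j < N.*2.+1) kc N j * fc f (N%:Z - j%:Z).
    have -> : (fun s => f s * ofR (ker s ^+ N)) = (fun s => \sum_(j < N.*2.+1) kc N j * (f s * ek (- (N%:Z - j%:Z)) s)).
      by apply/funext => s; rewrite kerX mulr_sumr; apply: eq_bigr => j _; rewrite opprB mulrCA.
    have cj (j : nat) : ct01 (fun s => f s * ek (- (N%:Z - j%:Z)) s).
      by apply: ct01M; [exact: cf1|move=> x _; exact: ek_cts].
    by have [-> _] := @mean_sum N.*2.+1 (kc N) (fun j s => f s * ek (- (N%:Z - j%:Z)) s) cj.
  rewrite (le_trans (nm_sum _ _ _))// mulr_sumr ler_sum// => j _; rewrite nmM ler_wpM2r ?nm_ge0//.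
  exact: kc_le.
have A3 : 2 * B * q ^+ N <= e / 2 * rE (kw N).
  have : q ^+ N <= c0 * q' ^+ N.
    move: hN; rewrite expr_div_n ltr_pdivrMr ?exprn_gt0// => /ltW //.
  rewrite /c0 => hq.
  have qn : 0 <= q ^+ N by rewrite exprn_ge0.
  rewrite (le_trans (y := (2 * B + 1) * q ^+ N)) ?ler_wpM2r ?lerDl//.
  rewrite (le_trans (ler_wpM2l (ltW B1) hq))//.
  apply: (@le_trans _ _ (e / 2 * (2^-1 ^+ D * q' ^+ N))); last by rewrite ler_pM2l.
  by rewrite le_eqVlt; apply/orP; left; apply/eqP; have := lt0r_neq0 B1 => ?; field.
have : nm (f 0) * rE (kw N) <= rE (kw N) * \sum_(j < N.*2.+1) nm (fc f (N%:Z - j%:Z)) + e * rE (kw N).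
  have -> : nm (f 0) * rE (kw N) = nm (f 0 * kw N) by rewrite nmM {2}kwE nm_ofR gtr0_norm.
  have := nm_lb (f 0 * kw N) (mean (fun s => f s * ofR (ker s ^+ N))).
  lra.
by rewrite [rE _ * _]mulrC -mulrDl ler_pM2r.
Qed.

End Fejer.

(** * Fourier coefficients of two-variable functions on tubes *)

Section TubeCoef.
Variable R : realType.
Local Notation C := (Cx R).
Implicit Types (H K : C * C -> C) (p q : C * C) (D : R -> R -> Prop) (m n : int).

(** [D] constrains the imaginary parts only, so the domain is a tube, stable under the real
    translations over which means are taken. *)
Definition holper D H :=
  (forall q, D (iM q.1) (iM q.2) -> differentiable H q) /\
  (forall q, D (iM q.1) (iM q.2) -> H (q.1 + 1, q.2) = H q /\ H (q.1, q.2 + 1) = H q).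

(** An integral over the cycle of real translates of [p]; its homotopy invariance is [tmean_move1]
    and [tmean_move2]. *)
Definition tmean K p := mean (fun s => mean (fun t => K (p.1 + ofR s, p.2 + ofR t))).

Lemma iM_addR (z : C) s : iM (z + ofR s) = iM z.
Proof. by rewrite iMD iM_ofR addr0. Qed.

Lemma shift_cts p : continuous (fun x : R * R => (p.1 + ofR x.1, p.2 + ofR x.2)).
Proof.
move=> x; apply/cvgC2P => e e0.
exists ([set y | `|y - x.1| < e], [set y | `|y - x.2| < e]).
  by split; apply/nbhsRP; exists e.
have E (z : C) a b : z + ofR a - (z + ofR b) = ofR (a - b) by rewrite ofRB; ring.
by move=> [y1 y2] [/= h1 h2]; rewrite !E !nm_ofR.
Qed.

Lemma torus_cts D K p : holper D K -> D (iM p.1) (iM p.2) ->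
  cts2 (fun s t => K (p.1 + ofR s, p.2 + ofR t)).
Proof.
move=> [dK _] Dp s t; apply: (@continuous_comp _ _ _ (fun x : R * R => (p.1 + ofR x.1, p.2 + ofR x.2)) K).
  exact: shift_cts.
by apply: differentiable_continuous; apply: dK; rewrite /= !iM_addR.
Qed.

Lemma diff_slice1 K (x y : C) : differentiable K (x, y) -> differentiable (fun z => K (z, y)) x.
Proof.
move=> dK; apply: (@differentiable_comp _ _ _ _ (fun z => (z, y)) K) => //.
Qed.
Lemma diff_slice2 K (x y : C) : differentiable K (x, y) -> differentiable (fun z => K (x, z)) y.
Proof.
move=> dK; apply: (@differentiable_comp _ _ _ _ (fun z => (x, z)) K) => //.
Qed.

Lemma tmean_move2 D K p e : holper D K -> (forall u, on01 u -> D (iM p.1) (iM p.2 + u * iM e)) ->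
  tmean K p = tmean K (p.1, p.2 + e).
Proof.
move=> [dK pK] Dp; apply: mean_eq => s _; apply: (@strip_mean _ (fun z => K (p.1 + ofR s, z))) => [t u u1|u u1].
  by apply: diff_slice2; apply: dK; rewrite /= iM_addR !iMD iMM !iM_ofR rE_ofR mul0r !addr0; exact: Dp.
have Dq : D (iM (p.1 + ofR s)) (iM (p.2 + ofR u * e)).
  by rewrite iM_addR !iMD iMM !iM_ofR rE_ofR mul0r !addr0; exact: Dp.
by have [_ /= E] := pK (p.1 + ofR s, p.2 + ofR u * e) Dq.
Qed.

(** The first variable is that of the outer mean; [mean_swap] brings it inside, where [strip_mean]
    applies. *)
Lemma tmean_move1 D K p e : holper D K -> (forall u, on01 u -> D (iM p.1 + u * iM e) (iM p.2)) ->
  tmean K p = tmean K (p.1 + e, p.2).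
Proof.
move=> hK Dp; have [dK pK] := hK; rewrite /tmean mean_swap; last first.
  by apply: torus_cts hK _; rewrite -[iM p.1]addr0 -(mul0r (iM e)); apply: Dp; exact: on010.
rewrite [RHS]mean_swap; last first.
  by apply: (torus_cts (p := (p.1 + e, p.2)) hK); rewrite /= iMD -(mul1r (iM e)); apply: Dp; rewrite /on01 ler01 lexx.
apply: mean_eq => t _; apply: (@strip_mean _ (fun z => K (z, p.2 + ofR t))) => [s u u1|u u1].
  by apply: diff_slice1; apply: dK; rewrite /= iM_addR !iMD iMM !iM_ofR rE_ofR mul0r !addr0; exact: Dp.
have Dq : D (iM (p.1 + ofR u * e)) (iM (p.2 + ofR t)).
  by rewrite iM_addR !iMD iMM !iM_ofR rE_ofR mul0r !addr0; exact: Dp.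
by have [/= E _] := pK (p.1 + ofR u * e, p.2 + ofR t) Dq.
Qed.

Definition mono m n q : C := e2ipi (q.1 * m%:~R + q.2 * n%:~R).

Lemma nm_mono m n q : nm (mono m n q) = expR (- (twopi R * (m%:~R * iM q.1 + n%:~R * iM q.2))).
Proof.
rewrite /mono nm_e2ipi iMD !iMM -!ofR_int !iM_ofR !rE_ofR; congr (expR (- (_ * _))); ring.
Qed.
Lemma monoD m n m' n' q : mono (m + m') (n + n') q = mono m n q * mono m' n' q.
Proof. by rewrite /mono -e2ipiD !intrD; congr e2ipi; ring. Qed.
Lemma mono00 q : mono 0 0 q = 1.
Proof. by rewrite /mono !mulr0z !mulr0 addr0 e2ipi0. Qed.
Lemma mono_neq0 m n q : mono m n q != 0. Proof. exact: e2ipi_neq0. Qed.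
Lemma monoN m n q : mono (- m) (- n) q = (mono m n q)^-1.
Proof. by apply: (mulfI (mono_neq0 m n q)); rewrite -monoD !subrr mono00 mulfV ?mono_neq0. Qed.

Lemma diff_mono m n q : differentiable (mono m n) q.
Proof.
apply: (@differentiable_comp _ _ _ _ (fun q : C * C => q.1 * m%:~R + q.2 * n%:~R)); last exact: diff_e2ipi.
apply: differentiableD; apply: differentiableM; try exact: differentiable_cst; [exact: diff_fst|exact: diff_snd].
Qed.

Lemma mono_per m n q : mono m n (q.1 + 1, q.2) = mono m n q /\ mono m n (q.1, q.2 + 1) = mono m n q.
Proof.
rewrite /mono /=; split.
  by rewrite mulrDl mul1r addrAC e2ipiD e2ipi_int mulr1.
by rewrite mulrDl mul1r addrA e2ipiD e2ipi_int mulr1.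
Qed.

Lemma holper_mono D m n : holper D (mono m n).
Proof. by split=> q _; [exact: diff_mono|exact: mono_per]. Qed.
Lemma holperM D H K : holper D H -> holper D K -> holper D (fun q => H q * K q).
Proof.
move=> [dH pH] [dK pK]; split=> q Dq; first by apply: differentiableM; [exact: dH|exact: dK].
by have [-> ->] := pH q Dq; have [-> ->] := pK q Dq.
Qed.
Lemma holperD D H K : holper D H -> holper D K -> holper D (fun q => H q + K q).
Proof.
move=> [dH pH] [dK pK]; split=> q Dq; first by apply: differentiableD; [exact: dH|exact: dK].
by have [-> ->] := pH q Dq; have [-> ->] := pK q Dq.
Qed.
Lemma holper_cst D (c : C) : holper D (fun=> c).
Proof. by split=> q _; [exact: differentiable_cst|]. Qed.

Definition coef H m n p := tmean (fun q => H q * mono (- m) (- n) q) p.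

Lemma coef_move1 D H m n p p' : holper D H -> p'.2 = p.2 ->
  (forall u, on01 u -> D (iM p.1 + u * (iM p'.1 - iM p.1)) (iM p.2)) -> coef H m n p = coef H m n p'.
Proof.
move=> hH e2 Dp; rewrite /coef (@tmean_move1 D _ p (p'.1 - p.1)).
- by rewrite [p.1 + _]addrC subrK -e2 -surjective_pairing.
- by apply: holperM hH _; exact: holper_mono.
- by move=> u u1; rewrite iMB; exact: Dp.
Qed.
Lemma coef_move2 D H m n p p' : holper D H -> p'.1 = p.1 ->
  (forall u, on01 u -> D (iM p.1) (iM p.2 + u * (iM p'.2 - iM p.2))) -> coef H m n p = coef H m n p'.
Proof.
move=> hH e2 Dp; rewrite /coef (@tmean_move2 D _ p (p'.2 - p.2)).
- by rewrite [p.2 + _]addrC subrK -e2 -surjective_pairing.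
- by apply: holperM hH _; exact: holper_mono.
- by move=> u u1; rewrite iMB; exact: Dp.
Qed.

Lemma tmean_bound D K p B : holper D K -> D (iM p.1) (iM p.2) ->
  (forall s t, nm (K (p.1 + ofR s, p.2 + ofR t)) <= B) -> nm (tmean K p) <= B.
Proof.
move=> hK Dp hB; have c := torus_cts hK Dp.
apply: mean_bound => [|s _]; first exact: mean_cts c.
by apply: mean_bound => [|t _]; [exact: cts2_l c|exact: hB].
Qed.

(** Cauchy's estimate: a character has constant modulus on the torus through [p]. *)
Lemma coef_bound D H m n p B : holper D H -> D (iM p.1) (iM p.2) ->
  (forall s t, nm (H (p.1 + ofR s, p.2 + ofR t)) <= B) ->
  nm (coef H m n p) <= B * expR (twopi R * (m%:~R * iM p.1 + n%:~R * iM p.2)).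
Proof.
move=> hH Dp hB; apply: (@tmean_bound D) => //; first by apply: holperM hH _; exact: holper_mono.
move=> s t; rewrite nmM nm_mono /= !iM_addR !intrN !mulNr -opprD mulrN opprK ler_wpM2r ?expR_ge0//.
Qed.

Lemma tmeanD D H K (c : C) p : holper D H -> holper D K -> D (iM p.1) (iM p.2) ->
  tmean (fun q => H q + c * K q) p = tmean H p + c * tmean K p.
Proof.
move=> hH hK Dp; have cH := torus_cts hH Dp; have cK := torus_cts hK Dp.
have hcK : holper D (fun q => c * K q) by apply: holperM hK; exact: holper_cst.
have ccK := torus_cts hcK Dp.
rewrite /tmean; have -> : (fun s => mean (fun t => H (p.1 + ofR s, p.2 + ofR t) + c * K (p.1 + ofR s, p.2 + ofR t)))
   = fun s => mean (fun t => H (p.1 + ofR s, p.2 + ofR t)) + c * mean (fun t => K (p.1 + ofR s, p.2 + ofR t)).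
  apply/funext => s; rewrite (meanD (@cts2_l _ _ s cH) (@cts2_l _ _ s ccK)); congr (_ + _).
  exact: (meanZ c (@cts2_l _ _ s cK)).
have c1 := mean_cts cH; have c2 := mean_cts cK.
have c3 : ct01 (fun s => c * mean (fun t => K (p.1 + ofR s, p.2 + ofR t))) by apply: ct01M; [exact: ct01_cst|exact: c2].
by rewrite (meanD c1 c3) (meanZ _ c2).
Qed.

Lemma coefD D H K (c : C) m n p : holper D H -> holper D K -> D (iM p.1) (iM p.2) ->
  coef (fun q => H q + c * K q) m n p = coef H m n p + c * coef K m n p.
Proof.
move=> hH hK Dp; have h1 := holperM hH (holper_mono D (- m) (- n)).
have h2 := holperM hK (holper_mono D (- m) (- n)).
rewrite /coef -(tmeanD c h1 h2 Dp).
congr (tmean _ p); apply/funext => q.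
exact: (etrans (mulrDl _ _ _) (congr1 _ (esym (mulrA _ _ _)))).
Qed.

Lemma coef_mono m n m' n' p : coef (mono m n) m' n' p = if (m == m') && (n == n') then 1 else 0.
Proof.
rewrite /coef /tmean.
have E s : mean (fun t => mono m n (p.1 + ofR s, p.2 + ofR t) * mono (- m') (- n') (p.1 + ofR s, p.2 + ofR t))
   = mono (m - m') (n - n') p * (ek (m - m') s * mean (ek (n - n'))).
  rewrite mulrA -meanZ; last by move=> x _; exact: ek_cts.
  apply: mean_eq => t _; rewrite -monoD /mono /ek -!e2ipiD /=; congr e2ipi; ring.
have -> : (fun s => mean (fun t => mono m n (p.1 + ofR s, p.2 + ofR t) * mono (- m') (- n') (p.1 + ofR s, p.2 + ofR t)))
  = fun s => (mono (m - m') (n - n') p * mean (ek (n - n'))) * ek (m - m') s.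
  by apply/funext => s; rewrite E; ring.
rewrite meanZ; last by move=> x _; exact: ek_cts.
rewrite !mean_ek !subr_eq0.
by case: eqP => [->|_]; case: eqP => [->|_]; rewrite ?subrr ?mono00 ?mulr1 ?mulr0 ?mul0r.
Qed.

(** [mean_cts] gives continuity for parameters in [[0, 1]]; translating the parameter gives it on
    the whole line, as [fejer] requires. *)
Lemma mean_cts_all (g : R -> R -> C) : cts2 g -> continuous (fun s => mean (g s)).
Proof.
move=> cg s0; have cg' : cts2 (fun s t => g (s + s0) t).
  move=> s t; apply: (@continuous_comp _ _ _ (fun x : R * R => (x.1 + s0, x.2)) (fun x => g x.1 x.2)); last exact: cg.
  move=> A [[U V] /= [/nbhsRP[e e0 hU] hV] UV]; exists ([set y | `|y - s| < e], V) => /=.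
    by split=> //; apply/nbhsRP; exists e.
  move=> [y1 y2] [/= h1 h2]; apply: (UV (_, _)); split=> //=; apply: hU.
  by have -> : y1 + s0 - (s + s0) = y1 - s by ring.
have /cvgCP h := mean_cts cg' (@on010 R); apply/cvgCP => e /h /nbhsRP[d d0 hd].
apply/nbhsRP; exists d => // w hw; have /= := hd (w - s0); rewrite subr0 add0r => /(_ hw).
by rewrite subrK.
Qed.

(** [fejer] in the second variable, then in the first for each of the finitely many partial
    coefficients that occur. *)
Lemma fejer2 D H p : holper D H -> D (iM p.1) (iM p.2) -> forall e, 0 < e -> exists N M,
  nm (H p) <= \sum_(j < N.*2.+1) \sum_(k < M.*2.+1) nm (coef H (M%:Z - k%:Z) (N%:Z - j%:Z) p)
     * expR (- (twopi R * ((M%:Z - k%:Z)%:~R * iM p.1 + (N%:Z - j%:Z)%:~R * iM p.2))) + e.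
Proof.
move=> hH Dp e e0; have cH := torus_cts hH Dp; have [_ pH] := hH.
have e2 : 0 < e / 2 by rewrite divr_gt0.
pose g t := H (p.1, p.2 + ofR t).
have cg : continuous g.
  have E : g = (fun t => H (p.1 + ofR 0, p.2 + ofR t)) by apply/funext => t; rewrite ofR0 addr0.
  rewrite E => t; apply: (@continuous_comp _ _ _ (fun t : R => (0 : R, t)) (fun x => H (p.1 + ofR x.1, p.2 + ofR x.2))).
    by have [h _] := pair_cts (0 : R) t; exact: h.
  exact: (cH 0 t).
have pg t : g (t + 1) = g t.
  have Dq : D (iM p.1) (iM (p.2 + ofR t)) by rewrite iM_addR.
  by rewrite /g ofRD ofR1 addrA; have [_ /= ->] := pH (p.1, p.2 + ofR t) Dq.
have [N /(_ N (leqnn N)) hN] := fejer cg pg e2.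
pose ph n s := mean (fun t => H (p.1 + ofR s, p.2 + ofR t) * ek (- n) t).
have cF n : cts2 (fun s t => H (p.1 + ofR s, p.2 + ofR t) * ek (- n) t).
  move=> s t; apply: (@continuousM _ _ (fun x : R * R => H (p.1 + ofR x.1, p.2 + ofR x.2)) (fun x => ek (- n) x.2)).
    exact: cH.
  by apply: (@continuous_comp _ _ _ snd (ek (- n))); [exact: cvg_snd|exact: ek_cts].
have cph n : continuous (ph n) by exact: mean_cts_all (cF n).
have pph n s : ph n (s + 1) = ph n s.
  rewrite /ph; apply: mean_eq => t _; congr (_ * _); rewrite ofRD ofR1 addrA.
  have Dq : D (iM (p.1 + ofR s)) (iM (p.2 + ofR t)) by rewrite !iM_addR.
  by have [/= -> _] := pH (p.1 + ofR s, p.2 + ofR t) Dq.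
(* Half of the error is spent on the outer application, the other half is shared among the [2 N + 1]
   inner ones. *)
pose e3 := e / 2 / N.*2.+1%:R.
have e30 : 0 < e3 by rewrite divr_gt0.
have [M0 hM0] := choice (fun n => fejer (cph n) (pph n) e30).
pose M := (\max_(j < N.*2.+1) M0 (N%:Z - j%:Z)%R)%N.
exists N, M; have g0 : g 0 = H p by rewrite /g ofR0 addr0 -surjective_pairing.
rewrite -g0 (le_trans hN)// [X in _ <= _ + X]splitr addrA lerD2r.
have -> : e / 2 = \sum_(j < N.*2.+1) e3 by rewrite sumr_const card_ord -[RHS]mulr_natr divfK// pnatr_eq0.
rewrite -big_split /= ler_sum// => j _.
have -> : fc g (N%:Z - j%:Z) = ph (N%:Z - j%:Z) 0.
  by rewrite /fc /ph; apply: mean_eq => t _; rewrite ofR0 addr0.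
have := hM0 (N%:Z - j%:Z) M (@leq_bigmax _ (fun j : 'I_N.*2.+1 => M0 (N%:Z - j%:Z)) j).
move=> h; apply: (le_trans h); rewrite lerD2r ler_sum// => k _.
set m := M%:Z - k%:Z; set n := N%:Z - j%:Z.
have -> : fc (ph n) m = coef H m n p * mono m n p.
  rewrite /fc /coef /tmean mulrC -meanZ; last first.
    by apply: mean_cts; apply: (torus_cts (K := fun q => H q * mono (- m) (- n) q)) Dp; apply: holperM hH _; exact: holper_mono.
  apply: mean_eq => s _; rewrite /ph mulrC -!meanZ.
  - apply: mean_eq => t _; rewrite mulrCA [in RHS]mulrCA; congr (_ * _).
    by rewrite /mono /ek -!e2ipiD /=; congr e2ipi; rewrite !intrN; ring.
  - exact: (@cts2_l _ _ s (cF n)).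
  - by apply: (@cts2_l _ (fun s t => H (p.1 + ofR s, p.2 + ofR t) * mono (- m) (- n) (p.1 + ofR s, p.2 + ofR t))); apply: (torus_cts (K := fun q => H q * mono (- m) (- n) q)) Dp; apply: holperM hH _; exact: holper_mono.
by rewrite nmM nm_mono.
Qed.

End TubeCoef.

(** * Holomorphic functions on polydiscs *)

Section Aux.
Variable R : realType.
Local Notation C := (Cx R).

Lemma cexp_ii (th : R) : rE (cexp (ofR th * ii R)) = cos th /\ iM (cexp (ofR th * ii R)) = sin th.
Proof.
by rewrite rE_cexp iM_cexp rEM iMM rE_ii iM_ii rE_ofR iM_ofR !(mulr0, mulr1, mul0r) subr0 addr0 expR0 !mul1r.
Qed.

Lemma polar_up (u : C) : nm u = 1 -> 0 <= iM u -> u = cexp (ofR (acos (rE u)) * ii R).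
Proof.
move=> u1 b0; have a1 : -1 <= rE u <= 1 by rewrite -ler_norml -u1; exact: rE_le.
have [_ ca] := acos_def a1; have [c s] := cexp_ii (acos (rE u)).
apply: cx_eq; rewrite ?c ?s ?ca// sin_acos//.
have -> : 1 - rE u ^+ 2 = iM u ^+ 2 by have := nm2 u; rewrite u1 expr1n => ->; ring.
by rewrite sqrtr_sqr ger0_norm.
Qed.

Lemma polar_unit (u : C) : nm u = 1 -> exists th : R, u = cexp (ofR th * ii R).
Proof.
move=> u1; have [b0|/ltW b0] := leP 0 (iM u); first by exists (acos (rE u)); exact: polar_up.
have H : - u = cexp (ofR (acos (rE (- u))) * ii R) by apply: polar_up; rewrite ?nmN// iMN oppr_ge0.
set a := acos _ in H; exists (a + pi); have [c1 s1] := cexp_ii a; have [c2 s2] := cexp_ii (a + pi).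
by apply: oppr_inj; rewrite H; apply: cx_eq; rewrite ?rEN ?iMN ?c1 ?c2 ?s1 ?s2 ?cosDpi ?sinDpi opprK.
Qed.

Lemma cexp_ofR (x : R) : cexp (ofR x) = ofR (expR x) :> C.
Proof. by apply: cx_eq; rewrite ?rE_cexp ?iM_cexp iM_ofR !rE_ofR ?iM_ofR ?cos0 ?sin0 ?mulr1 ?mulr0. Qed.

Lemma cexp_surj (x : C) : x != 0 -> exists p : C, cexp p = x.
Proof.
move=> x0; have n0 : 0 < nm x by rewrite nm_gt0.
have u1 : nm (x / ofR (nm x)) = 1 by rewrite nmM nmV nm_ofR gtr0_norm// mulfV ?lt0r_neq0.
have [th hth] := polar_unit u1; exists (ofR (ln (nm x)) + ofR th * ii R).
rewrite cexpD -hth cexp_ofR lnK ?posrE// mulrC mulfVK//.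
by rewrite ofR_eq0 lt0r_neq0.
Qed.

Lemma twopi_ii_neq0 : ofR (twopi R) * ii R != 0.
Proof. by rewrite mulf_neq0 ?ii_neq0// ofR_eq0 lt0r_neq0// twopi_gt0. Qed.

Lemma e2ipi_surj (x : C) : x != 0 -> exists p : C, e2ipi p = x.
Proof.
move=> /cexp_surj[p <-]; exists (p / (ofR (twopi R) * ii R)).
by rewrite e2ipiE mulrC mulfVK// twopi_ii_neq0.
Qed.

(** Applied with [X] the modulus of a coefficient: a bound that decays along a ray forces the
    coefficient to vanish. The inequality [1 + a u <= exp (a u)] is strong enough. *)
Lemma exp_decay (a X K u0 : R) : 0 < a -> 0 <= K ->
  (forall u, u0 <= u -> X <= K * expR (- (a * u))) -> X <= 0.
Proof.
move=> a0 K0 h; apply/ler_addgt0Pr => e e0; rewrite add0r.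
pose u := Num.max u0 (Num.max 0 (K / (e * a))).
have u1 : u0 <= u by rewrite le_max lexx.
have u2 : K / (e * a) <= u by rewrite !le_max lexx !orbT.
have u3 : 0 <= u by rewrite !le_max lexx !orbT.
rewrite (le_trans (h u u1))// expRN ler_pdivrMr ?expR_gt0//.
have := expR_ge1Dx (a * u) => h1.
rewrite (le_trans (y := e * (a * u)))//; last by rewrite ler_pM2l//; lra.
by rewrite mulrA -ler_pdivrMl ?mulr_gt0// mulrC.
Qed.

(** The subtraction is truncated: the first [d] terms are 1, the others form a geometric series of
    sum at most 2. *)
Lemma geo_sum (t : R) d N : 0 <= t -> t <= 2^-1 -> \sum_(m < N) t ^+ (m - d) <= d%:R + 2.
Proof.
move=> t0 t1; have g n : \sum_(m < n) t ^+ m <= 2 - 2 * t ^+ n.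
  elim: n => [|n IH]; first by rewrite big_ord0 expr0; lra.
  rewrite big_ord_recr /= exprS; have := exprn_ge0 n t0; set s := t ^+ n in IH *; nra.
have [Nd|dN] := leqP N d.
  rewrite (le_trans (y := \sum_(m < N) 1))//.
    by apply: ler_sum => m _; rewrite exprn_ile1//; lra.
  rewrite sumr_const card_ord (le_trans (y := d%:R))// ?lerDl//.
  by rewrite ler_nat.
rewrite -(big_mkord xpredT (fun m => t ^+ (m - d))) (@big_cat_nat _ _ _ d)//=; last exact: ltnW.
rewrite lerD//.
  rewrite big_mkord (le_trans (y := \sum_(m < d) 1))//.
    by apply: ler_sum => m _; rewrite exprn_ile1//; lra.
  by rewrite sumr_const card_ord.
rewrite -{1}[d]add0n big_addn big_mkord.
have -> : \sum_(i < N - d) t ^+ (i + d - d) = \sum_(i < N - d) t ^+ i.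
  by apply: eq_bigr => i _; rewrite addnK.
rewrite (le_trans (g _))// gerDl oppr_le0 mulr_ge0// exprn_ge0//.
Qed.

(** With truncated subtractions, [d <= m + n] gives [d + (m - d) + (n - d) <= m + n], so the double
    sum is dominated by [t ^ d] times a square. *)
Lemma geo_sum2 (t : R) d N : 0 <= t -> t <= 2^-1 ->
  \sum_(m < N) \sum_(n < N | (d <= m + n)%N) t ^+ (m + n) <= (d%:R + 2) ^+ 2 * t ^+ d.
Proof.
move=> t0 t1; have S := geo_sum d N t0 t1.
have S0 : 0 <= \sum_(m < N) t ^+ (m - d) by apply: sumr_ge0 => m _; exact: exprn_ge0.
apply: (@le_trans _ _ (t ^+ d * (\sum_(m < N) t ^+ (m - d)) ^+ 2)); last first.
  by rewrite mulrC ler_wpM2r ?exprn_ge0// lerXn2r// nnegrE addr_ge0.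
rewrite expr2 mulr_suml mulr_sumr; apply: ler_sum => m _; rewrite mulr_sumr mulr_sumr big_mkcond.
apply: ler_sum => n _; case: leqP => h; last by rewrite !mulr_ge0 ?exprn_ge0.
rewrite -!exprD ler_wiXn2l ?t0//; first lra.
by lia.
Qed.

End Aux.

Section Polydisc.
Variable R : realType.
Local Notation C := (Cx R).
Implicit Types (f : C * C -> C) (x y : C) (r B : R).

(** The axes are removed: this is the domain covered by the exponential lift [elift], and what
    happens on the axes is deduced from boundedness. *)
Definition pdb f r B := forall x y, 0 < nm x < r -> 0 < nm y < r -> differentiable f (x, y) /\ nm (f (x, y)) <= B.

Definition elift f (q : C * C) := f (e2ipi q.1, e2ipi q.2).
Definition edom r (u v : R) := expR (- (twopi R * u)) < r /\ expR (- (twopi R * v)) < r.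

Lemma edomP r q : edom r (iM q.1) (iM q.2) -> 0 < nm (e2ipi q.1) < r /\ 0 < nm (e2ipi q.2) < r.
Proof. by rewrite !nm_e2ipi !expR_gt0. Qed.

Lemma diff_elift f q : differentiable f (e2ipi q.1, e2ipi q.2) -> differentiable (elift f) q.
Proof.
move=> df; apply: (@differentiable_comp _ _ _ _ (fun q : C * C => (e2ipi q.1, e2ipi q.2)) f); last exact: df.
apply: differentiable_pair.
  by apply: (@differentiable_comp _ _ _ _ fst (@e2ipi R)); [exact: diff_fst|exact: diff_e2ipi].
by apply: (@differentiable_comp _ _ _ _ snd (@e2ipi R)); [exact: diff_snd|exact: diff_e2ipi].
Qed.

Lemma holper_elift f r B : pdb f r B -> holper (edom r) (elift f).
Proof.
move=> hf; split=> q /edomP[q1 q2]; first by apply: diff_elift; have [] := hf _ _ q1 q2.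
by rewrite /elift /= !e2ipiD -[1]/(1%:R) !e2ipi_nat !mulr1.
Qed.

(** A point whose exponential has modulus [r / 2], so that [pcoef] is the Laurent coefficient
    computed on the torus [|x| = |y| = r / 2]. *)
Definition lnh r : C := ofR (- ln (r / 2) / twopi R) * ii R.
Definition pcoef f r (m n : int) := coef (elift f) m n (lnh r, lnh r).

Lemma iM_lnh r : iM (lnh r) = - ln (r / 2) / twopi R.
Proof. by rewrite /lnh iMM iM_ofR rE_ofR iM_ii mulr1 mul0r addr0. Qed.
Lemma exp_lnh r : 0 < r -> expR (- (twopi R * iM (lnh r))) = r / 2.
Proof.
move=> r0; rewrite iM_lnh mulrCA mulfV ?lt0r_neq0 ?twopi_gt0// mulr1 opprK lnK// posrE divr_gt0//.
Qed.
Lemma edom_lnh r : 0 < r -> edom r (iM (lnh r)) (iM (lnh r)).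
Proof. by move=> r0; rewrite /edom !exp_lnh// ltr_pdivrMr// ltr_pMr// ltr1n. Qed.

Lemma edom_seg r a b u : on01 u -> expR (- (twopi R * a)) < r -> expR (- (twopi R * b)) < r ->
  expR (- (twopi R * (a + u * (b - a)))) < r.
Proof.
move=> /andP[u0 u1] ha hb; have tp := twopi_gt0 R.
have [ab|/ltW ba] := leP a b.
  by rewrite (le_lt_trans _ ha)// ler_expR lerN2 ler_pM2l// lerDl mulr_ge0// subr_ge0.
rewrite (le_lt_trans _ hb)// ler_expR lerN2 ler_pM2l//; nra.
Qed.

Lemma pcoefE f r B m n p : 0 < r -> pdb f r B -> edom r (iM p.1) (iM p.2) -> coef (elift f) m n p = pcoef f r m n.
Proof.
move=> r0 hf [p1 p2]; have hH := holper_elift hf; have [l1 l2] := edom_lnh r0.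
have -> : coef (elift f) m n p = coef (elift f) m n (lnh r, p.2).
  by apply: (coef_move1 _ _ hH) => [//|u u1]; split=> //; exact: edom_seg.
by apply: (coef_move2 _ _ hH) => [//|u u1]; split=> //; exact: edom_seg.
Qed.

Lemma pcoef_bound f r B m n a b : 0 < r -> pdb f r B -> 0 < a < r -> 0 < b < r ->
  nm (pcoef f r m n) <= B * expR (- (m%:~R * ln a + n%:~R * ln b)).
Proof.
move=> r0 hf /andP[a0 ar] /andP[b0 br]; have tp := lt0r_neq0 (twopi_gt0 R).
pose p : C * C := (ofR (- ln a / twopi R) * ii R, ofR (- ln b / twopi R) * ii R).
have E (x : R) : 0 < x -> iM (ofR (- ln x / twopi R) * ii R) = - ln x / twopi R.
  by move=> _; rewrite iMM iM_ofR rE_ofR iM_ii mulr1 mul0r addr0.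
have E2 (x : R) : 0 < x -> expR (- (twopi R * (- ln x / twopi R))) = x.
  by move=> x0; rewrite mulrCA mulfV// mulr1 opprK lnK.
have Dp : edom r (iM p.1) (iM p.2) by rewrite /p /= !E// /edom !E2.
rewrite -(pcoefE m n r0 hf Dp); have := @coef_bound _ (edom r) (elift f) m n p B (holper_elift hf) Dp.
rewrite {3 4}/p /= !E//.
have -> : twopi R * (m%:~R * (- ln a / twopi R) + n%:~R * (- ln b / twopi R)) = - (m%:~R * ln a + n%:~R * ln b) by field.
apply=> s t.
have [] := hf (e2ipi (p.1 + ofR s)) (e2ipi (p.2 + ofR t)) => //;
  by rewrite nm_e2ipi iM_addR /p /= E// E2// ?a0 ?b0.
Qed.

Lemma expR_pow (t : R) n : 0 < t -> expR (- (n%:Z%:~R * ln t)) = t ^- n.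
Proof. by move=> t0; rewrite expRN -pmulrn expRM_natl lnK. Qed.

Lemma pcoef_nat f r B m n : 0 < r -> pdb f r B -> nm (pcoef f r m%:Z n%:Z) <= B / (r / 2) ^+ (m + n).
Proof.
move=> r0 hf; have r2 : 0 < r / 2 by rewrite divr_gt0.
have rr : 0 < r / 2 < r by rewrite r2 ltr_pdivrMr// ltr_pMr// ltr1n.
by rewrite (le_trans (pcoef_bound m%:Z n%:Z r0 hf rr rr))// opprD expRD !expR_pow// -invfM -exprD.
Qed.

(** Cauchy's estimate on tori whose radius in the variable of negative exponent tends to 0, [f]
    being bounded. *)
Lemma pcoef_neg f r B m n : 0 < r -> 0 <= B -> pdb f r B -> (m < 0) || (n < 0) -> pcoef f r m n = 0.
Proof.
move=> r0 B0 hf mn; have r2 : 0 < r / 2 by rewrite divr_gt0.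
have rr : 0 < r / 2 < r by rewrite r2 ltr_pdivrMr// ltr_pMr// ltr1n.
apply/eqP; rewrite -nm_eq0 eq_le nm_ge0 andbT.
have small u : - ln (r / 2) <= u -> 0 < expR (- u) < r.
  move=> hu; rewrite expR_gt0 /= (le_lt_trans (y := r / 2))//; last by case/andP: rr.
  by rewrite -[leRHS]lnK ?posrE// ler_expR lerNl.
case/orP: mn => mn.
  have a0 : 0 < (- m%:~R : R) by rewrite oppr_gt0 ltrz0.
  apply: (@exp_decay _ (- m%:~R) _ (B * expR (- (n%:~R * ln (r / 2)))) (- ln (r / 2))) => //.
    by rewrite mulr_ge0// expR_ge0.
  move=> u /small hu; rewrite (le_trans (pcoef_bound m n r0 hf hu rr))// expRK -mulrA -expRD.
  by rewrite ler_wpM2l// ler_expR; lra.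
have a0 : 0 < (- n%:~R : R) by rewrite oppr_gt0 ltrz0.
apply: (@exp_decay _ (- n%:~R) _ (B * expR (- (m%:~R * ln (r / 2)))) (- ln (r / 2))) => //.
  by rewrite mulr_ge0// expR_ge0.
move=> u /small hu; rewrite (le_trans (pcoef_bound m n r0 hf rr hu))// expRK -mulrA -expRD.
by rewrite ler_wpM2l// ler_expR; lra.
Qed.

Lemma sum_nonneg (g : int -> R) N : (forall m, m < 0 -> g m = 0) ->
  \sum_(j < N.*2.+1) g (N%:Z - j%:Z) = \sum_(m < N.+1) g m.
Proof.
move=> g0; rewrite -(big_mkord xpredT (fun j : nat => g (N%:Z - j%:Z))) (@big_cat_nat _ _ _ N.+1)//=; last by rewrite ltnS -addnn leq_addr.
rewrite [X in _ + X]big_nat_cond [X in _ + X]big1 ?addr0 => [|i /andP[/andP[h _] _]]; last by apply: g0; rewrite subr_lt0 ltz_nat.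
rewrite big_nat_rev /= add0n big_mkord; apply: eq_bigr => i _; congr g.
by have := ltn_ord i; rewrite subSS; lia.
Qed.

Definition psum f r (J : seq (nat * nat)) (w : C * C) :=
  \sum_(k <- J) pcoef f r k.1 k.2 * w.1 ^+ k.1 * w.2 ^+ k.2.

(** [fejer2] for the lift of [f] minus the terms indexed by [J]: subtracting a multiple of a
    character changes exactly one coefficient. Negative exponents drop out by [pcoef_neg]. *)
Lemma expansion f r B (J : seq (nat * nat)) x y e : 0 < r -> 0 <= B -> pdb f r B -> uniq J ->
  0 < nm x < r -> 0 < nm y < r -> 0 < e -> exists N,
  nm (f (x, y) - psum f r J (x, y)) <=
   \sum_(m < N) \sum_(n < N | (m : nat, n : nat) \notin J) nm (pcoef f r m%:Z n%:Z) * nm x ^+ m * nm y ^+ n + e.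
Proof.
move=> r0 B0 hf uJ hx hy e0; have [p1 p1E] : exists p, e2ipi p = x by apply: e2ipi_surj; rewrite -nm_gt0; case/andP: hx.
have [p2 p2E] : exists p, e2ipi p = y by apply: e2ipi_surj; rewrite -nm_gt0; case/andP: hy.
pose p := (p1, p2); have Dp : edom r (iM p.1) (iM p.2).
  by rewrite /edom -!nm_e2ipi /p /= p1E p2E; case/andP: hx => _ ->; case/andP: hy.
pose HJ J q := elift f q + \sum_(k <- J) - pcoef f r k.1%:Z k.2%:Z * mono k.1 k.2 q.
have HJ0 : HJ [::] = elift f by apply/funext => q; rewrite /HJ big_nil addr0.
have HJS k J' : HJ (k :: J') = fun q => HJ J' q + (- pcoef f r k.1%:Z k.2%:Z) * mono k.1 k.2 q.
  by apply/funext => q; rewrite /HJ big_cons addrCA addrC.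
have hol J' : holper (edom r) (HJ J').
  elim: J' => [|k J' IH]; first by rewrite HJ0; exact: holper_elift hf.
  rewrite HJS; apply: holperD IH _; apply: holperM; [exact: holper_cst|exact: holper_mono].
have cJ J' (m n : int) : coef (HJ J') m n p = pcoef f r m n + \sum_(k <- J' | (k.1%:Z == m) && (k.2%:Z == n)) - pcoef f r k.1%:Z k.2%:Z.
  elim: J' => [|k J' IH]; first by rewrite HJ0 big_nil addr0 (pcoefE m n r0 hf Dp).
  rewrite HJS (coefD _ _ _ (hol J') (holper_mono _ _ _) Dp) IH coef_mono big_cons.
  by case: ifP => _; rewrite ?mulr1 ?mulr0 ?addr0// -addrA [X in _ + X]addrC.
have cJnat (m n : nat) : coef (HJ J) m n p = if (m, n) \in J then 0 else pcoef f r m n.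
  have EB : \sum_(k <- J | (k.1%:Z == m) && (k.2%:Z == n)) - pcoef f r k.1%:Z k.2%:Z = \sum_(k <- J | k == (m, n)) - pcoef f r k.1%:Z k.2%:Z.
    by apply: eq_bigl => -[k1 k2] /=; rewrite !eqz_nat xpair_eqE.
  rewrite cJ; case: ifP => mnJ.
    rewrite EB big_mkcond (bigD1_seq (m, n))//= eqxx big1 ?addr0 ?subrr// => k /negPf -> //.
  by rewrite EB big_seq_cond big1 ?addr0// => k /andP[+ /eqP kE]; rewrite kE mnJ.
have cJneg (m n : int) : (m < 0) || (n < 0) -> coef (HJ J) m n p = 0.
  move=> mn; rewrite cJ (pcoef_neg r0 B0 hf mn) add0r big1// => k /andP[/eqP k1 /eqP k2].
  by move: mn; rewrite -k1 -k2.
have [N [M hNM]] := fejer2 (hol J) Dp e0.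
exists (maxn N M).+1; move: hNM.
have -> : HJ J p = f (x, y) - psum f r J (x, y).
  rewrite /HJ /elift /p /= p1E p2E; congr (_ + _); rewrite /psum -sumrN; apply: eq_bigr => k _.
  rewrite mulNr -mulrA; congr (- (_ * _)); rewrite /mono /= e2ipiD -p1E -p2E !e2ipiX.
  by rewrite -!pmulrn !mulr_natr.
move=> h; apply: (le_trans h); rewrite lerD2r.
pose T (m n : int) := nm (coef (HJ J) m n p) * expR (- (twopi R * (m%:~R * iM p.1 + n%:~R * iM p.2))).
have T0 m n : 0 <= T m n by rewrite mulr_ge0 ?nm_ge0 ?expR_ge0.
have -> : \sum_(j < N.*2.+1) \sum_(k < M.*2.+1) T (M%:Z - k%:Z) (N%:Z - j%:Z) = \sum_(n < N.+1) \sum_(m < M.+1) T m n.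
  rewrite (@sum_nonneg (fun n => \sum_(k < M.*2.+1) T (M%:Z - k%:Z) n)).
    apply: eq_bigr => n _; rewrite (@sum_nonneg (fun m => T m n))// => m m0.
    by rewrite /T cJneg ?m0// nm0 mul0r.
  by move=> n n0; rewrite big1// => k _; rewrite /T cJneg ?n0 ?orbT// nm0 mul0r.
have TE (m n : nat) : T m n = if (m, n) \in J then 0 else nm (pcoef f r m n) * nm x ^+ m * nm y ^+ n.
  rewrite /T cJnat; case: ifP => _; first by rewrite nm0 mul0r.
  rewrite -mulrA; congr (_ * _); rewrite -p1E -p2E !nm_e2ipi -!expRM_natl -expRD; congr expR.
  by rewrite -!pmulrn /p /=; ring.
rewrite exchange_big /= (le_trans (y := \sum_(m < (maxn N M).+1) \sum_(n < N.+1) T m n))//.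
  rewrite -!(big_mkord xpredT (fun m : nat => \sum_(n < N.+1) T m n)).
  rewrite [leRHS](@big_cat_nat _ _ _ M.+1)//= ?ltnS ?leq_maxr// lerDl sumr_ge0// => m _.
  by apply: sumr_ge0.
apply: ler_sum => m _; rewrite [leRHS]big_mkcond /=.
rewrite -(big_mkord xpredT (fun n : nat => T m n)) -(big_mkord xpredT (fun n : nat => if (m : nat, n) \notin J then nm (pcoef f r m%:Z n%:Z) * nm x ^+ m * nm y ^+ n else 0)).
rewrite [leRHS](@big_cat_nat _ _ _ N.+1)//= ?ltnS ?leq_maxl//.
apply: (@le_trans _ _ (\sum_(0 <= n < N.+1) (if (m : nat, n) \notin J then nm (pcoef f r m%:Z n%:Z) * nm x ^+ m * nm y ^+ n else 0))).
  by apply: ler_sum => n _; rewrite TE; case: (_ \in J).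
rewrite lerDl sumr_ge0// => n _; case: ifP => // _; rewrite !mulr_ge0 ?nm_ge0 ?exprn_ge0 ?nm_ge0//.
Qed.

(** [expansion] with [J] the exponents of degree less than [d]; Cauchy's estimates and [geo_sum2]
    bound the tail. *)
Lemma taylor f r B (d : nat) x y t : 0 < r -> 0 <= B -> pdb f r B ->
  0 < nm x -> nm x <= t * (r / 2) -> 0 < nm y -> nm y <= t * (r / 2) -> t <= 2^-1 ->
  nm (f (x, y) - \sum_(m < d) \sum_(n < d | (m + n < d)%N) pcoef f r m n * x ^+ m * y ^+ n)
    <= B * (d%:R + 2) ^+ 2 * t ^+ d.
Proof.
move=> r0 B0 hf x0 xt y0 yt t2; have r2 : 0 < r / 2 by rewrite divr_gt0.
have t0 : 0 <= t by rewrite -(pmulr_lge0 _ r2) (le_trans _ xt)// ltW.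
have tr : t * (r / 2) < r.
  by rewrite (le_lt_trans (ler_wpM2r (ltW r2) t2))//; lra.
pose J := [seq k <- [seq (m, n) | m <- iota 0 d, n <- iota 0 d] | (k.1 + k.2 < d)%N].
have uJ : uniq J by apply: filter_uniq; apply: allpairs_uniq => //; [exact: iota_uniq|exact: iota_uniq|move=> [? ?] [? ?]].
have JE m n : ((m, n) \in J) = (m + n < d)%N.
  rewrite mem_filter /= andb_idr// => mn; apply/allpairsP; exists (m, n); rewrite !mem_iota /= add0n.
  by split=> //; apply: leq_ltn_trans mn; rewrite ?leq_addr ?leq_addl.
apply/ler_addgt0Pr => e e0.
have [|//|//|N hN] := @expansion f r B J x y e r0 B0 hf uJ.
- by rewrite x0 (le_lt_trans xt).
- by rewrite y0 (le_lt_trans yt).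
have -> : \sum_(m < d) \sum_(n < d | (m + n < d)%N) pcoef f r m n * x ^+ m * y ^+ n = psum f r J (x, y).
  have BE (F : nat -> C) : \sum_(i <- iota 0 d) F i = \sum_(i < d) F i by rewrite -(big_mkord xpredT F) /index_iota subn0.
  rewrite /psum big_filter big_flatten big_map BE.
  by apply: eq_bigr => m _; rewrite big_map [RHS]big_mkcond BE [LHS]big_mkcond.
rewrite (le_trans hN)// lerD2r.
apply: (@le_trans _ _ (\sum_(m < N) \sum_(n < N | (d <= m + n)%N) B * t ^+ (m + n))); last first.
  under eq_bigr do rewrite -mulr_sumr.
  by rewrite -mulr_sumr -mulrA ler_wpM2l// geo_sum2.
apply: ler_sum => m _; rewrite big_mkcond [leRHS]big_mkcond; apply: ler_sum => n _; rewrite JE -leqNgt.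
case: ifP => // _; rewrite -mulrA.
apply: (@le_trans _ _ ((B / (r / 2) ^+ (m + n)) * ((t * (r / 2)) ^+ m * (t * (r / 2)) ^+ n))).
  apply: ler_pM; rewrite ?nm_ge0 ?mulr_ge0 ?exprn_ge0 ?nm_ge0//; first exact: pcoef_nat.
  by apply: ler_pM; rewrite ?exprn_ge0 ?nm_ge0// lerXn2r ?nnegrE ?nm_ge0// mulr_ge0// ltW.
have q0 : (r / 2) ^+ (m + n) != 0 by rewrite expf_neq0// lt0r_neq0.
by rewrite -exprD [(t * _) ^+ _]exprMn [t ^+ _ * _]mulrC mulrA divfK.
Qed.

End Polydisc.

(** * Removable singularities and division by a coordinate *)

Section Removable.
Variable R : realType.
Local Notation C := (Cx R).
Implicit Types (f u : C * C -> C) (x y : C) (r B : R).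

Lemma lim_le (g : C -> C) (Y d : R) : 0 < d -> {for (0 : C), continuous g} ->
  (forall x, 0 < nm x < d -> nm (g x) <= Y) -> nm (g 0) <= Y.
Proof.
move=> d0 /cvgCP cg hg; apply/ler_addgt0Pr => e e0.
have /nbhsCP[r r0 hr] := cg _ e0; pose m := Num.min d r / 2.
have m0 : 0 < m by rewrite divr_gt0// lt_min d0.
have mm : m < Num.min d r by rewrite /m ltr_pdivrMr// ltr_pMr ?ltr1n// lt_min d0.
have nx : nm (ofR m : C) = m by rewrite nm_ofR gtr0_norm.
have h1 := hg (ofR m); rewrite nx m0 /= in h1.
have h2 := hr (ofR m); rewrite subr0 nx /= in h2.
have := nm_lb (g 0) (g (ofR m)); rewrite nmC.
move: mm; rewrite lt_min => /andP[/h1 a1 /h2 a2]; lra.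
Qed.

Lemma sum_lt1 (F : nat -> nat -> C) : \sum_(m < 1) \sum_(n < 1 | (m + n < 1)%N) F m n = F 0%N 0%N.
Proof. by rewrite big_ord1 big_mkcond big_ord1. Qed.
Lemma sum_lt2 (F : nat -> nat -> C) : \sum_(m < 2) \sum_(n < 2 | (m + n < 2)%N) F m n = F 0%N 0%N + F 0%N 1%N + F 1%N 0%N.
Proof.
rewrite !big_ord_recl big_ord0 !addr0; congr (_ + _); rewrite big_mkcond !big_ord_recl big_ord0 /= !addr0//.
Qed.

Lemma sum_pow2 (c : nat -> nat -> C) x y :
  \sum_(m < 2) \sum_(n < 2 | (m + n < 2)%N) c m n * x ^+ m * y ^+ n = c 0%N 0%N + c 0%N 1%N * y + c 1%N 0%N * x.
Proof. by rewrite (sum_lt2 (fun m n => c m n * x ^+ m * y ^+ n)) !expr0 !mulr1 !expr1. Qed.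

(** Order 1 of [taylor]: 9 is [(1 + 2)^2], just as 16 in [quad_bound] is [(2 + 2)^2]. *)
Lemma lip_bound f r B x y t : 0 < r -> 0 <= B -> pdb f r B ->
  0 < nm x -> nm x <= t * (r / 2) -> 0 < nm y -> nm y <= t * (r / 2) -> t <= 2^-1 ->
  nm (f (x, y) - pcoef f r 0 0) <= B * 9 * t.
Proof.
move=> r0 B0 hf x0 xt y0 yt t2; have := taylor 1 r0 B0 hf x0 xt y0 yt t2.
by rewrite (sum_lt1 (fun m n => pcoef f r m n * x ^+ m * y ^+ n)) !expr0 !mulr1 expr1; congr (_ <= _ * _ * _); ring.
Qed.

Lemma quad_bound f r B x y t : 0 < r -> 0 <= B -> pdb f r B ->
  0 < nm x -> nm x <= t * (r / 2) -> 0 < nm y -> nm y <= t * (r / 2) -> t <= 2^-1 ->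
  nm (f (x, y) - pcoef f r 0 0 - pcoef f r 1 0 * x - pcoef f r 0 1 * y) <= B * 16 * t ^+ 2.
Proof.
move=> r0 B0 hf x0 xt y0 yt t2; have := taylor 2 r0 B0 hf x0 xt y0 yt t2.
rewrite (sum_pow2 (fun m n => pcoef f r m n)).
have alg (A a b c : C) : A - (a + b + c) = A - a - c - b by ring.
by rewrite alg; congr (_ <= _ * _ * _); ring.
Qed.

Lemma shift2_cts (p : C * C) : continuous (fun w : C * C => (p.1 + w.1, p.2 + w.2)).
Proof.
move=> w; apply/cvgC2P => e e0; apply/nbhsC2P; exists e => // v /=.
have E (a b c : C) : a + b - (a + c) = b - c by ring.
by rewrite !E.
Qed.

Lemma diff_shift2 f (p w : C * C) : differentiable f (p.1 + w.1, p.2 + w.2) ->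
  differentiable (fun w => f (p.1 + w.1, p.2 + w.2)) w.
Proof.
move=> df; apply: (@differentiable_comp _ _ _ _ (fun w : C * C => (p.1 + w.1, p.2 + w.2)) f); last exact: df.
apply: differentiable_pair; apply: differentiableD; try exact: differentiable_cst; [exact: diff_fst|exact: diff_snd].
Qed.

(** Off the axes through [p] the order 2 Taylor bound holds; continuity carries it to the axes and
    to [p] itself, where it says that the linear part of the expansion is the differential. *)
Lemma removable f p r : 0 < r ->
  (forall w, nm (w.1 - p.1) < r -> nm (w.2 - p.2) < r -> {for w, continuous f}) ->
  (forall w, nm (w.1 - p.1) < r -> nm (w.2 - p.2) < r -> w.1 != p.1 -> w.2 != p.2 -> differentiable f w) ->
  differentiable f p.
Proof.
move=> r0 cf df.
have cp : {for p, continuous f} by apply: cf; rewrite subrr nm0.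
have /cvgCP/(_ _ ltr01)/nbhsC2P[r1 r10 hr1] := cp.
pose r2 := Num.min r r1; have r20 : 0 < r2 by rewrite lt_min r0.
pose B := nm (f p) + 1; have B0 : 0 <= B by rewrite addr_ge0// nm_ge0.
pose g w := f (p.1 + w.1, p.2 + w.2).
have sh (a b : C) : a + b - a = b by ring.
have hg : pdb g r2 B.
  move=> x y; rewrite /r2 !lt_min => /andP[x0 /andP[xr xr1]] /andP[y0 /andP[yr yr1]]; split.
    apply: diff_shift2; apply: df; rewrite /= ?sh//.
      by rewrite -subr_eq0 sh -nm_gt0.
    by rewrite -subr_eq0 sh -nm_gt0.
  have := hr1 (p.1 + x, p.2 + y); rewrite /= !sh => /(_ xr1 yr1) h.
  have := nm_lb (g (x, y)) (f p); rewrite /B /g /=; lra.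
have cg w : nm w.1 < r -> nm w.2 < r -> {for w, continuous g}.
  move=> w1 w2; apply: (@continuous_comp _ _ _ (fun w : C * C => (p.1 + w.1, p.2 + w.2)) f); first exact: shift2_cts.
  by apply: cf; rewrite /= sh.
pose c00 := pcoef g r2 0 0; pose c01 := pcoef g r2 0 1; pose c10 := pcoef g r2 1 0.
pose T w := g w - c00 - c10 * w.1 - c01 * w.2.
have cT w : nm w.1 < r -> nm w.2 < r -> {for w, continuous T}.
  move=> w1 w2; have c1 : {for w, continuous (fun w : C * C => c10 * w.1)}.
    by apply: continuousM; [exact: cst_continuous|exact: cvg_fst].
  have c2 : {for w, continuous (fun w : C * C => c01 * w.2)}.
    by apply: continuousM; [exact: cst_continuous|exact: cvg_snd].
  by apply: continuousB c2; apply: continuousB c1; apply: continuousB; [exact: cg|exact: cst_continuous].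
pose K := B * 16 / (r2 / 2) ^+ 2; have r22 : 0 < r2 / 2 by rewrite divr_gt0.
have K0 : 0 <= K by apply: divr_ge0; [exact: mulr_ge0|rewrite exprn_ge0// ltW].
have TT x y M : 0 < nm x -> nm x <= M -> 0 < nm y -> nm y <= M -> M <= r2 / 4 -> nm (T (x, y)) <= K * M ^+ 2.
  move=> x0 xM y0 yM Mr; have Mt : M / (r2 / 2) * (r2 / 2) = M by rewrite divfK// lt0r_neq0.
  have h := @quad_bound g r2 B x y (M / (r2 / 2)) r20 B0 hg x0; rewrite Mt in h.
  have {}h : M / (r2 / 2) <= 2^-1 -> nm (T (x, y)) <= B * 16 * (M / (r2 / 2)) ^+ 2 by exact: h.
  apply: (le_trans (h _)); first by rewrite ler_pdivrMr//; lra.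
  rewrite expr_div_n /K [leLHS](_ : _ = B * 16 / (r2 / 2) ^+ 2 * M ^+ 2)//.
  by have := lt0r_neq0 r20 => ?; field.
have rr : r2 / 4 < r.
  have h : r2 <= r by rewrite ge_min lexx.
  lra.
(* Points on one of the axes are reached as limits of points off both axes. *)
have TB h k M : (h != 0) || (k != 0) -> nm h <= M -> nm k <= M -> 0 < M -> M <= r2 / 4 -> nm (T (h, k)) <= K * M ^+ 2.
  move=> hk hM kM M0 Mr.
  have [h0|h0] := eqVneq h 0.
    rewrite h0 eqxx /= in hk; rewrite h0.
    apply: (@lim_le (fun x => T (x, k)) _ M); first exact: M0.
      apply: (@continuous_comp _ _ _ (fun x : C => (x, k)) T).
        by apply: differentiable_continuous; apply: differentiable_pair; [exact: ex_diff|exact: differentiable_cst].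
      by apply: cT; rewrite /= ?nm0// (le_lt_trans kM)// (le_lt_trans Mr).
    by move=> x /andP[x0 xM]; apply: TT => //; [exact: ltW|rewrite nm_gt0].
  have [k0|k0] := eqVneq k 0; last by apply: TT => //; rewrite nm_gt0.
  rewrite k0; apply: (@lim_le (fun y => T (h, y)) _ M); first exact: M0.
    apply: (@continuous_comp _ _ _ (fun y : C => (h, y)) T).
      by apply: differentiable_continuous; apply: differentiable_pair; [exact: differentiable_cst|exact: ex_diff].
    by apply: cT; rewrite /= ?nm0// (le_lt_trans hM)// (le_lt_trans Mr).
  by move=> x /andP[x0 xM]; apply: TT => //; [rewrite nm_gt0|exact: ltW].
have T0 : T (0, 0) = 0.
  apply/eqP; rewrite -nm_eq0 eq_le nm_ge0 andbT; apply/ler_addgt0Pr => e e0; rewrite add0r.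
  pose M := Num.min (Num.min (r2 / 4) 1) (e / (K + 1)).
  have K1 : 0 < K + 1 by rewrite ltr_wpDl.
  have M0 : 0 < M by rewrite !lt_min ltr01 !divr_gt0.
  apply: (@lim_le (fun x => T (x, x)) _ M); first exact: M0.
    apply: (@continuous_comp _ _ _ (fun x : C => (x, x)) T).
      by apply: differentiable_continuous; apply: differentiable_pair; exact: ex_diff.
    by apply: cT; rewrite /= nm0.
  move=> x /andP[x0 xM]; have M1 : M <= r2 / 4 by rewrite /M !ge_min lexx.
  apply: (le_trans (@TB x x M _ (ltW xM) (ltW xM) M0 M1)); first by rewrite -nm_gt0 x0.
  have M2 : M <= 1 by rewrite /M !ge_min lexx orbT.
  have M3 : M <= e / (K + 1) by rewrite /M !ge_min lexx !orbT.
  rewrite ler_pdivlMr// in M3; nra.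
have g00 : f p = c00.
  have alg (A u v w : C) : A - u - v * 0 - w * 0 = 0 -> A = u.
    by rewrite !mulr0 !subr0 => /eqP; rewrite subr_eq0 => /eqP.
  have : g (0, 0) = c00 := alg _ _ _ _ T0.
  by rewrite /g /= !addr0 -surjective_pairing.
apply/diffC2P; exists c10, c01 => e e0.
have K1 : 0 < K + 1 by rewrite ltr_wpDl.
exists (Num.min (r2 / 4) (e / (K + 1))); first by rewrite lt_min !divr_gt0.
move=> h k; rewrite !lt_min => /andP[h1 h2] /andP[k1 k2].
have -> : f (p.1 + h, p.2 + k) - f p - c10 * h - c01 * k = T (h, k) by rewrite /T /g /= g00.
have [hk|] := boolP ((h != 0) || (k != 0)); last first.
  rewrite negb_or !negbK => /andP[/eqP-> /eqP->]; by rewrite T0 nm0 mulr_ge0 ?(ltW e0).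
set M := Num.max _ _.
have hM : nm h <= M by rewrite le_max lexx.
have kM : nm k <= M by rewrite le_max lexx orbT.
have M0 : 0 < M by case/orP: hk => z0; [apply: lt_le_trans hM|apply: lt_le_trans kM]; rewrite nm_gt0.
have Mr : M <= r2 / 4 by rewrite ge_max !ltW.
have Me : M <= e / (K + 1) by rewrite ge_max !ltW.
rewrite (le_trans (TB _ _ _ hk hM kM M0 Mr))// expr2 mulrA ler_pM2r//.
by rewrite ler_pdivlMr// in Me; nra.
Qed.

(** Seen as a function of two variables constant in the second, [g] falls under [lip_bound]; 18 is 9
    times the 2 coming from [r / 2]. *)
Lemma schwarz (g : C -> C) r B x : 0 < r -> 0 <= B -> (forall x, nm x < r -> differentiable g x) ->
  (forall x, nm x < r -> nm (g x) <= B) -> g 0 = 0 -> nm x <= r / 4 -> nm (g x) <= B * 18 / r * nm x.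
Proof.
move=> r0 B0 dg gB g0 xr; have [->|x0] := eqVneq x 0; first by rewrite g0 nm0 mulr0.
pose F (w : C * C) := g w.1.
have hF : pdb F r B.
  move=> a b /andP[_ ar] _; split; last exact: gB.
  by apply: (@differentiable_comp _ _ _ _ fst g); [exact: diff_fst|exact: dg].
have L y : 0 < nm y -> nm y <= r / 4 -> nm (g y - pcoef F r 0 0) <= B * 18 / r * nm y.
  move=> y0 yr; have r2 : 0 < r / 2 by rewrite divr_gt0.
  have E : nm y / (r / 2) * (r / 2) = nm y by rewrite divfK// lt0r_neq0.
  have := @lip_bound F r B y y (nm y / (r / 2)) r0 B0 hF y0; rewrite E => /(_ (lexx _) y0 (lexx _)) h.
  apply: (le_trans (h _)); first by rewrite ler_pdivrMr//; lra.
  rewrite [leLHS](_ : _ = B * 18 / r * nm y)//; by have := lt0r_neq0 r0 => ?; field.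
have c0 : pcoef F r 0 0 = 0.
  apply/eqP; rewrite -nm_eq0 eq_le nm_ge0 andbT; apply/ler_addgt0Pr => e e0; rewrite add0r.
  pose Q := B * 18 / r + 1; have Q0 : 0 < Q by rewrite ltr_wpDl// divr_ge0 ?mulr_ge0// ltW.
  have -> : nm (pcoef F r 0 0) = nm (g 0 - pcoef F r 0 0) by rewrite g0 sub0r nmN.
  apply: (@lim_le (fun y => g y - pcoef F r 0 0) _ (Num.min (r / 4) (e / Q))).
  - by rewrite lt_min !divr_gt0.
  - apply: continuousB; last exact: cst_continuous.
    by apply: differentiable_continuous; apply: dg; rewrite nm0.
  move=> y; rewrite lt_min => /andP[y0 /andP[y1 y2]]; rewrite (le_trans (L y y0 (ltW y1)))//.
  rewrite ltr_pdivlMr// /Q in y2; nra.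
have := L x; rewrite c0 subr0; apply=> //; by rewrite nm_gt0.
Qed.

(** The value at [(0, b)] is the constant coefficient [L b] of [u] centred there. By [star] and [LL]
    this extension is continuous, and [removable] makes it holomorphic. *)
Lemma riemann u r B : 0 < r -> 0 <= B ->
  (forall x y, 0 < nm x < r -> nm y < r -> differentiable u (x, y) /\ nm (u (x, y)) <= B) ->
  exists v : C * C -> C, (forall x y, x != 0 -> v (x, y) = u (x, y)) /\
    (forall x y, nm x < r / 4 -> nm y < r / 4 -> differentiable v (x, y)).
Proof.
move=> r0 B0 hu; have r2 : 0 < r / 2 by rewrite divr_gt0.
pose uu (b : C) (w : C * C) := u (0 + w.1, b + w.2).
have huu b : nm b < r / 2 -> pdb (uu b) (r / 2) B.
  move=> br x y /andP[x0 xr] /andP[y0 yr]; rewrite /uu.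
  have h1 : 0 < nm (0 + x) < r by rewrite add0r x0; lra.
  have h2 : nm (b + y) < r by rewrite (le_lt_trans (nmD _ _))//; lra.
  have [d1 d2] := hu _ _ h1 h2.
  by split; [exact: (@diff_shift2 u (0, b) (x, y) d1)|exact: d2].
pose L b := pcoef (uu b) (r / 2) 0 0.
pose K := B * 36 / r; have K0 : 0 <= K by rewrite divr_ge0 ?mulr_ge0// ltW.
have star0 b x y M : nm b < r / 2 -> 0 < nm x -> nm x <= M -> 0 < nm y -> nm y <= M -> M <= r / 8 -> nm (u (x, b + y) - L b) <= K * M.
  move=> br x0 xM y0 yM Mr; have r4 : 0 < r / 2 / 2 by rewrite divr_gt0.
  have E : M / (r / 2 / 2) * (r / 2 / 2) = M by rewrite divfK// lt0r_neq0.
  have := @lip_bound (uu b) (r / 2) B x y (M / (r / 2 / 2)) r2 B0 (huu _ br) x0; rewrite E => /(_ xM y0 yM) h.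
  rewrite /uu /= add0r in h; apply: (le_trans (h _)); first by rewrite ler_pdivrMr//; lra.
  rewrite [leLHS](_ : _ = K * M)// /K; by have := lt0r_neq0 r0 => ?; field.
have cu x y : 0 < nm x < r -> nm y < r -> {for (x, y), continuous u}.
  by move=> hx hy; apply: differentiable_continuous; have [] := hu x y hx hy.
have star b x y M : nm b < r / 2 -> 0 < nm x -> nm x <= M -> nm y <= M -> M <= r / 8 -> nm (u (x, b + y) - L b) <= K * M.
  move=> br x0 xM yM Mr; have [->|y0] := eqVneq y 0; last by apply: star0 => //; rewrite nm_gt0.
  apply: (@lim_le (fun y => u (x, b + y) - L b) _ M); first exact: lt_le_trans xM.
    apply: continuousB; last exact: cst_continuous.
    apply: (@continuous_comp _ _ _ (fun y : C => (x, b + y)) u).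
      apply: differentiable_continuous; apply: differentiable_pair; first exact: differentiable_cst.
      by apply: differentiableD; [exact: differentiable_cst|exact: ex_diff].
    by apply: cu; rewrite ?addr0 ?x0 /=; lra.
  by move=> z /andP[z0 zM]; apply: star0 => //; exact: ltW.
(* [L b] and [L b'] are compared through [u (m, b')] with [m] small; if [|b' - b| + m] exceeds
   [r / 8], [star] is used at the radius [r / 8]. *)
have LL b b' : nm b < r / 2 -> nm b' < r / 2 -> nm (b' - b) <= r / 8 -> nm (L b' - L b) <= K * nm (b' - b).
  move=> br br' bb; apply/ler_addgt0Pr => e e0.
  pose m := Num.min (r / 8) (e / (2 * K + 1)).
  have Q : 0 < 2 * K + 1 by rewrite ltr_wpDl// mulr_ge0.
  have m0 : 0 < m by rewrite lt_min !divr_gt0.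
  have m1 : m <= r / 8 by rewrite ge_min lexx.
  have m2 : m <= e / (2 * K + 1) by rewrite ge_min lexx orbT.
  have nx : nm (ofR m : C) = m by rewrite nm_ofR gtr0_norm.
  have ar1 (p q s M : R) : s <= p + q -> p <= K * m -> q <= K * (M + m) -> m * (2 * K + 1) <= e -> s <= K * M + e.
    rewrite !(mulrDr K) mulrDr mulr1 (mulrCA m) (mulrC m); lra.
  have ar2 (p q s M : R) : s <= p + q -> p <= K * m -> q <= K * (r / 8) -> r / 8 <= M + m -> m * (2 * K + 1) <= e -> s <= K * M + e.
    by move=> h1 h2 h3 /(ler_wpM2l K0) h4; apply: ar1 h1 h2 (le_trans h3 h4).
  have S1 := @star b' (ofR m) 0 m br'; rewrite nx nm0 addr0 in S1.
  have S2 := @star b (ofR m) (b' - b) (nm (b' - b) + m) br; rewrite nx [b + _]addrC subrK in S2.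
  have {}S1 := S1 m0 (lexx _) (ltW m0) m1.
  have [mb|mb] := leP (nm (b' - b) + m) (r / 8).
    have {}S2 := S2 m0 (ler_wpDl (nm_ge0 _) (lexx _)) (ler_wpDr (ltW m0) (lexx _)) mb.
    have := nm_subr (L b') (u (ofR m, b')) (L b); rewrite [nm (L b' - u _)]nmC.
    rewrite ler_pdivlMr// in m2 => h; exact: ar1 h S1 S2 m2.
  have S3 := @star b (ofR m) (b' - b) (r / 8) br; rewrite nx [b + _]addrC subrK in S3.
  have {}S3 := S3 m0 m1 bb (lexx _).
  have := nm_subr (L b') (u (ofR m, b')) (L b); rewrite [nm (L b' - u _)]nmC.
  rewrite ler_pdivlMr// in m2 => h; exact: ar2 h S1 S3 (ltW mb) m2.
pose v w := if w.1 == 0 then L w.2 else u w.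
have vE x y : x != 0 -> v (x, y) = u (x, y) by rewrite /v /= => /negPf ->.
have dv x y : 0 < nm x < r -> nm y < r -> differentiable v (x, y).
  move=> /[dup] hx /andP[x0 _] hy; have [d _] := hu x y hx hy; apply: near_diffC2 d.
  apply/nbhsC2P; exists (nm x) => // w w1 _; rewrite /v; case: eqP => // w0.
  by move: w1; rewrite w0 sub0r nmN ltxx.
have cv0 b : nm b < r / 2 -> {for (0, b), continuous v}.
  move=> br; apply/cvgCP => e e0; apply/nbhsC2P.
  have Q : 0 < K + 1 by rewrite ltr_wpDl.
  exists (Num.min (Num.min (r / 8) (r / 2 - nm b)) (e / (K + 1))); first by rewrite !lt_min !divr_gt0// subr_gt0 br.
  move=> [x y] /=; rewrite subr0 !lt_min => /andP[/andP[x1 x2] x3] /andP[/andP[y1 y2] y3].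
  rewrite {2}/v /= eqxx; rewrite !ltr_pdivlMr// in x3 y3.
  have yr : nm y < r / 2 by have := nm_lb y b; lra.
  rewrite /v /=; case: eqP => [x0|/eqP x0].
    rewrite (le_lt_trans (LL b y br yr (ltW y1)))//; have := nm_ge0 (y - b); nra.
  have := @star b x (y - b) (Num.max (nm x) (nm (y - b))) br; rewrite [b + _]addrC subrK => h.
  apply: (le_lt_trans (h _ _ _ _)); rewrite ?nm_gt0// ?le_max ?lexx ?orbT//.
    by rewrite ge_max !ltW.
  have [xy|xy] := leP (nm x) (nm (y - b)); [have := nm_ge0 (y - b)|have := nm_ge0 x]; nra.
exists v; split=> // x y xr yr.
have [->|x0] := eqVneq x 0; last by apply: dv; rewrite ?nm_gt0 ?x0 /=; lra.
apply: (@removable v (0, y) (r / 4)); first by rewrite divr_gt0.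
  move=> [a b] /=; rewrite subr0 => ar br; have br' : nm b < r / 2 by have := nm_lb b y; lra.
  have [->|a0] := eqVneq a 0; first exact: cv0.
  by apply: differentiable_continuous; apply: dv; rewrite ?nm_gt0 ?a0 /=; lra.
move=> [a b] /=; rewrite subr0 => ar br a0 _; have br' : nm b < r / 2 by have := nm_lb b y; lra.
by apply: dv; rewrite ?nm_gt0 ?a0 /=; lra.
Qed.

(** [schwarz] on the slices bounds [f (x, y) / x], and [riemann] extends this quotient across
    [x = 0]. *)
Lemma division f r : 0 < r -> (forall x y, nm x < r -> nm y < r -> differentiable f (x, y)) ->
  (forall y, nm y < r -> f (0, y) = 0) -> exists v r', [/\ 0 < r', r' <= r,
   forall x y, nm x < r' -> nm y < r' -> differentiable v (x, y) &
   forall x y, nm x < r' -> nm y < r' -> f (x, y) = x * v (x, y)].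
Proof.
move=> r0 df f0.
have cp : {for (0, 0), continuous f} by apply: differentiable_continuous; apply: df; rewrite nm0.
have /cvgCP/(_ _ ltr01)/nbhsC2P[r1 r10 hr1] := cp.
rewrite f0 ?nm0//= in hr1.
pose s := Num.min r r1; have s0 : 0 < s by rewrite lt_min r0.
have sr : s <= r by rewrite ge_min lexx.
have fB x y : nm x < s -> nm y < s -> nm (f (x, y)) <= 1.
  rewrite !lt_min => /andP[_ xr] /andP[_ yr]; have := hr1 (x, y); rewrite /= !subr0 => /(_ xr yr) /ltW.
  done.
pose u (w : C * C) := f w / w.1.
have s4 : 0 < s / 4 by rewrite divr_gt0.
have [|x y /andP[x0 xs] ys|v [vE dv]] := @riemann u (s / 4) (18 / s) s4.
- by rewrite divr_ge0// ltW.
- have x1 : x != 0 by rewrite -nm_gt0.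
  split.
    apply: differentiableM; first by apply: df; lra.
    by apply: (@differentiableV _ _ fst (x, y)); [exact: diff_fst|exact: x1].
  rewrite /u /= nmM nmV ler_pdivrMr//.
  have := @schwarz (fun x => f (x, y)) s 1 x s0 ler01; rewrite !mul1r; apply.
  + by move=> z zs; apply: diff_slice1; apply: df; lra.
  + by move=> z zs; apply: fB => //; lra.
  + by apply: f0; lra.
  + lra.
exists v, (s / 4 / 4); split=> //; [by rewrite divr_gt0|lra|].
move=> x y xs ys; have [->|x0] := eqVneq x 0; first by rewrite mul0r f0//; lra.
by rewrite vE// /u mulrC divfK.
Qed.

End Removable.

(** * Periodic functions on tubes over growing sectors of a half plane *)

Section Tube.
Variable R : realType.
Local Notation C := (Cx R).
Local Notation T := (twopi R).
Variables (K : C * C -> C) (rr : R -> R).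

(** The slopes [M] exhaust the half plane [b > 0], but the radius [rr M] may grow with [M]: the
    function is controlled only on shrunk sectors. *)
Definition tdom (M a b : R) := `|a| < M * b /\ rr M < b.

Hypothesis rr0 : forall M, 1 <= M -> 0 <= rr M /\ rr 1 <= rr M.
Hypothesis hol : forall M, 1 <= M -> holper (tdom M) K.
Hypothesis lim0 : forall M e, 1 <= M -> 0 < e ->
  exists r, forall p, tdom M (iM p.1) (iM p.2) -> r < iM p.2 -> nm (K p) <= e.

Definition vert (a b : R) : C * C := (ofR a * ii R, ofR b * ii R).

Lemma iM_vert a : iM (ofR a * ii R) = a.
Proof. by rewrite iMM iM_ofR rE_ofR iM_ii mulr1 mul0r addr0. Qed.

Definition tcoef m n := coef K m n (vert 0 (rr 1 + 1)).

(** Move the first imaginary part to 0 inside the tube of slope [M], then the second one inside the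
    tube of slope 1, where [rr 1 <= rr M] puts the starting point. *)
Lemma tcoefE M m n p : 1 <= M -> tdom M (iM p.1) (iM p.2) -> coef K m n p = tcoef m n.
Proof.
move=> M1 [p1 p2]; have [r0 r1] := rr0 M1.
have -> : coef K m n p = coef K m n (ofR 0 * ii R, p.2).
  apply: (coef_move1 _ _ (hol M1)) => // u /andP[u0 u1]; split=> //.
  rewrite /= iM_vert sub0r mulrN -{1}[iM p.1]mul1r -mulrBl normrM ger0_norm ?subr_ge0//.
  by rewrite (le_lt_trans _ p1)// ler_piMl// lerBlDr lerDl.
apply: (coef_move2 _ _ (hol (lexx 1))) => // u /andP[u0 u1] /=.
have r10 := (rr0 (lexx 1)).1.
have h : rr 1 < iM p.2 + u * (iM (ofR (rr 1 + 1) * ii R) - iM p.2).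
  rewrite iM_vert; have [->|u1'] := eqVneq u 1; first by lra.
  have {u1'} u1' : 0 < 1 - u by rewrite subr_gt0 lt_neqAle u1' u1.
  nra.
by split=> //; rewrite iM_vert normr0 mul1r (le_lt_trans r10 h).
Qed.

Lemma tcoef_vert M a b B m n : 1 <= M -> tdom M a b ->
  (forall p, iM p.1 = a -> iM p.2 = b -> nm (K p) <= B) ->
  nm (tcoef m n) <= B * expR (T * (m%:~R * a + n%:~R * b)).
Proof.
move=> M1 hab hB; rewrite -(@tcoefE M m n (vert a b)) ?iM_vert//.
have := @coef_bound R (tdom M) K m n (vert a b) B (hol M1); rewrite !iM_vert; apply=> // s t.
by apply: hB; rewrite /= iM_addR iM_vert.
Qed.

(** On the ray [a = a0 b] the inverse character grows at the rate [m a0 + n]; the assumed bound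
    beats it by [k], so Cauchy's estimate tends to 0. *)
Lemma tcoef_ray a0 m n k Q : 0 < k -> 0 <= Q ->
  (exists u0, forall u p, u0 <= u -> iM p.1 = u * a0 -> iM p.2 = u -> nm (K p) <= Q * expR (T * ((- k - m%:~R * a0 - n%:~R) * u))) ->
  tcoef m n = 0.
Proof.
move=> k0 Q0 [u0 hu]; apply/eqP; rewrite -nm_eq0 eq_le nm_ge0 andbT.
have M1 : 1 <= `|a0| + 1 by rewrite lerDr.
have [r0 _] := rr0 M1.
have tp := twopi_gt0 R.
apply: (@exp_decay _ (T * k) _ Q (Num.max u0 (rr (`|a0| + 1) + 1))) => //; first by rewrite mulr_gt0.
move=> u; rewrite ge_max => /andP[u1 u2]; have u3 : rr (`|a0| + 1) < u by lra.
have ug0 : 0 < u by exact: le_lt_trans u3.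
have := @tcoef_vert (`|a0| + 1) (u * a0) u _ m n M1 _ (fun p => hu u p u1).
move=> h; apply: (le_trans (h _)).
  by split=> //; rewrite normrM (gtr0_norm ug0) mulrC mulrDl mul1r ltrDl.
by rewrite -mulrA -expRD ler_wpM2l// ler_expR; lra.
Qed.

(** The surviving characters are small on every sector. The constant one is excluded by the limit 0,
    [m = 0 > n] by the central ray, and [m] nonzero by a ray leaning far enough to one side. *)
Lemma tcoef0 m n : (m != 0) || (n <= 0) -> tcoef m n = 0.
Proof.
move=> mn; have tp := twopi_gt0 R.
have [m0|m0] := eqVneq m 0.
  rewrite m0 eqxx /= in mn; rewrite m0; have [->|n0] := eqVneq n 0.
    apply/eqP; rewrite -nm_eq0 eq_le nm_ge0 andbT; apply/ler_addgt0Pr => e e0; rewrite add0r.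
    have [r hr] := lim0 (lexx 1) e0; have [r10 _] := rr0 (lexx 1).
    pose b := Num.max (rr 1) r + 1.
    have b1 : rr 1 < b by rewrite /b ltr_pwDr// le_max lexx.
    have b2 : r < b by rewrite /b ltr_pwDr// le_max lexx orbT.
    have D1 : tdom 1 0 b by split=> //; rewrite normr0 mul1r (le_lt_trans r10).
    have := @tcoef_vert 1 0 b e 0 0 (lexx 1) D1; rewrite !mul0r addr0 mulr0 expR0 mulr1; apply.
    by move=> p p1 p2; apply: hr; rewrite ?p1 ?p2.
  have {mn}n0 : n < 0 by rewrite lt_neqAle n0.
  have n0' : 0 < - n%:~R :> R by rewrite oppr_gt0 ltrz0.
  apply: (@tcoef_ray 0 0 n (- n%:~R) 1) => //.
  have [r hr] := lim0 (lexx 1) (@ltr01 R); have [r10 _] := rr0 (lexx 1).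
  exists (Num.max (rr 1) r + 1) => u p; rewrite mulr0 => hu p1 p2.
  have b1 : rr 1 < u by rewrite (lt_le_trans _ hu)// ltr_pwDr// le_max lexx.
  have b2 : r < u by rewrite (lt_le_trans _ hu)// ltr_pwDr// le_max lexx orbT.
  rewrite mulr0 subr0 opprK subrr mul0r mulr0 expR0 mulr1; apply: hr; rewrite ?p1 p2//.
  by split=> //; rewrite normr0 mul1r (le_lt_trans r10).
(* This slope gives [m a0 + n <= -1] because [m ^ 2 >= 1], hence the rate [k = 1]. *)
pose a0 : R := - m%:~R * (`|n%:~R| + 1).
have h1 : 1 <= (m%:~R : R) ^+ 2.
  by rewrite -rmorphXn /= -[leLHS]/((1 : int)%:~R) ler_int; move: m0; lia.
have M1 : 1 <= `|a0| + 1 by rewrite lerDr.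
have [r hr] := lim0 M1 (@ltr01 R); have [r10 _] := rr0 M1.
apply: (@tcoef_ray a0 m n 1 1) => //.
exists (Num.max (rr (`|a0| + 1)) r + 1) => u p hu p1 p2.
have b1 : rr (`|a0| + 1) < u by rewrite (lt_le_trans _ hu)// ltr_pwDr// le_max lexx.
have b2 : r < u by rewrite (lt_le_trans _ hu)// ltr_pwDr// le_max lexx orbT.
have ug0 : 0 < u by exact: le_lt_trans b1.
have {}hr : nm (K p) <= 1.
  apply: hr; rewrite ?p1 p2//; split=> //.
  by rewrite normrM (gtr0_norm ug0) mulrC mulrDl mul1r ltrDl.
rewrite (le_trans hr)// mul1r -[leLHS]expR0 ler_expR; apply: mulr_ge0; first exact: ltW.
apply: mulr_ge0; last exact: ltW.
have := ler_norm (n%:~R : R); have n0 := normr_ge0 (n%:~R : R).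
have -> : m%:~R * a0 = - (m%:~R ^+ 2 * (`|n%:~R| + 1)) by rewrite /a0; ring.
move: h1 n0; set q := _ ^+ 2; set l := `|_|; move=> h1 h2 h3; nra.
Qed.

Lemma tcoef_sum M p e : 1 <= M -> tdom M (iM p.1) (iM p.2) -> 0 < e -> exists N : nat,
  nm (K p) <= \sum_(n < N) nm (tcoef 0 n.+1) * expR (- (T * (n.+1%:R * iM p.2))) + e.
Proof.
move=> M1 Dp e0; have [N [L h]] := fejer2 (hol M1) Dp e0; exists N; apply: (le_trans h); rewrite lerD2r.
pose F (m n : int) := nm (coef K m n p) * expR (- (T * (m%:~R * iM p.1 + n%:~R * iM p.2))).
have F0 m n : (m != 0) || (n <= 0) -> F m n = 0.
  by move=> mn; rewrite /F (tcoefE m n M1 Dp) tcoef0// nm0 mul0r.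
rewrite (eq_bigr (fun j : 'I_N.*2.+1 => F 0 (N%:Z - j%:Z))) => [|j _].
  rewrite (@sum_nonneg R (fun n => F 0 n)) => [|n n0]; last by rewrite F0// (ltW n0) orbT.
  rewrite big_ord_recl F0 ?lexx ?orbT// add0r ler_sum// => i _.
  by rewrite /F (tcoefE 0 _ M1 Dp) mul0r add0r.
rewrite (@sum_nonneg R (fun m => F m (N%:Z - j%:Z))) => [|n n0]; last by rewrite F0// lt_eqF.
by rewrite big_ord_recl big1 ?addr0// => i _; rewrite F0.
Qed.

Lemma expRN_half (x : R) : 1 <= x -> expR (- x) <= 2^-1.
Proof. by move=> x1; rewrite expRN lef_pV2 ?posrE ?expR_gt0//; have := expR_ge1Dx x; lra. Qed.

Lemma twopi_ge1 : 1 <= T.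
Proof. by have := pi_ge2 R; rewrite /twopi; lra. Qed.

Lemma tube_decay : exists Q r, 0 <= Q /\ forall M p, 1 <= M -> tdom M (iM p.1) (iM p.2) ->
  r < iM p.2 -> nm (K p) <= Q * expR (- (T * iM p.2)).
Proof.
have [r hr] := lim0 (lexx 1) (@ltr01 R); have [r10 _] := rr0 (lexx 1).
pose b := Num.max (rr 1) r + 1.
have b1 : rr 1 < b by rewrite /b ltr_pwDr// le_max lexx.
have b2 : r < b by rewrite /b ltr_pwDr// le_max lexx orbT.
have D1 : tdom 1 0 b by split=> //; rewrite normr0 mul1r (le_lt_trans r10).
have cb n : nm (tcoef 0 n%:Z) <= expR (T * (n%:R * b)).
  have := @tcoef_vert 1 0 b 1 0 n%:Z (lexx 1) D1; rewrite mul1r mulr0 add0r -pmulrn; apply.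
  by move=> p p1 p2; apply: hr; rewrite ?p1 ?p2.
(* Cauchy's estimate at height [b] makes the series geometric with ratio [exp (- T (Im p.2 - b))];
   one unit above [b] the ratio is at most 1/2, since [T >= 1], and the sum at most twice the first
   term. *)
exists (2 * expR (T * b)), (b + 1); split; first by rewrite mulr_ge0// expR_ge0.
move=> M p M1 Dp pb; apply/ler_addgt0Pr => e e0; have [N hN] := tcoef_sum M1 Dp e0.
rewrite (le_trans hN)// lerD2r; pose t := expR (- (T * (iM p.2 - b))).
have t0 : 0 <= t by rewrite expR_ge0.
have t2 : t <= 2^-1.
  apply: expRN_half; have := twopi_ge1; set x := T => x1.
  have y1 : 1 <= iM p.2 - b by lra.
  nra.
apply: (@le_trans _ _ (\sum_(n < N) t * t ^+ (n - 0))); last first.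
  rewrite -mulr_sumr -mulrA -expRD [X in expR X](_ : _ = - (T * (iM p.2 - b))) -/t; last by ring.
  by rewrite mulrC ler_wpM2r//; have := geo_sum 0 N t0 t2; rewrite add0r.
apply: ler_sum => n _; rewrite subn0 -exprS (le_trans (ler_wpM2r (expR_ge0 _) (cb _)))//.
rewrite -expRD /t -expRM_natl le_eqVlt; apply/orP; left; apply/eqP; congr expR; ring.
Qed.

Hypothesis decay1 : forall M, 1 <= M -> exists Q r, 0 <= Q /\ forall p, tdom M (iM p.1) (iM p.2) ->
  r < iM p.2 -> iM p.2 < M * iM p.1 -> nm (K p) <= Q * expR (- (T * iM p.1)).

(** Only powers of the exponential of the second variable remain, and near the edge of the half
    plane the decay in the first variable beats each of them. *)
Lemma tube_zero M p : 1 <= M -> tdom M (iM p.1) (iM p.2) -> K p = 0.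
Proof.
move=> M1 Dp; apply/eqP; rewrite -nm_eq0 eq_le nm_ge0 andbT; apply/ler_addgt0Pr => e e0.
have [N hN] := tcoef_sum M1 Dp e0; rewrite (le_trans hN)// lerD2r big1// => n _.
suff -> : tcoef 0 n.+1 = 0 by rewrite nm0 mul0r.
(* One more than the rate [n + 1] of the character, hence [k = 1] in [tcoef_ray]; the slope [L] is
   large enough for its tube to contain the ray. *)
pose a0 : R := n.+1%:R + 1; pose L : R := a0 + 1; have n0 : 1 <= (n.+1%:R : R) by rewrite ler1n.
have L1 : 1 <= L by rewrite /L /a0; lra.
have [Q [r [Q0 hQ]]] := decay1 L1; have [r10 _] := rr0 L1.
apply: (@tcoef_ray a0 0 n.+1 1 Q) => //.
exists (Num.max (rr L) r + 1) => u q hu q1 q2.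
have b1 : rr L < u by rewrite (lt_le_trans _ hu)// ltr_pwDr// le_max lexx.
have b2 : r < u by rewrite (lt_le_trans _ hu)// ltr_pwDr// le_max lexx orbT.
have ug0 : 0 < u by exact: le_lt_trans b1.
have a00 : 1 <= a0 by rewrite /a0; lra.
apply: (le_trans (hQ q _ _ _)); rewrite ?q1 ?q2//.
- by split=> //; rewrite ger0_norm ?mulr_ge0 ?(ltW ug0)//; [rewrite mulrC ltr_pM2r// /L ltrDl|lra].
- have h : 1 < L * a0 by rewrite /L; nra.
  by rewrite mulrCA ltr_pMr.
by rewrite ler_wpM2l// ler_expR -pmulrn mul0r subr0 /a0 -mulrN ler_pM2l ?twopi_gt0//; nra.
Qed.

End Tube.

(** * Laurent coefficients under scalings, and unconditional sums *)

Section Rotation.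
Variable R : realType.
Local Notation C := (Cx R).
Implicit Types (f : C * C -> C) (a b : C).

Definition scl a b (w : C * C) : C * C := (a * w.1, b * w.2).

Lemma mono_e2ipi m n (al be : C) : mono m n (al, be) = e2ipi al ^ m * e2ipi be ^ n.
Proof. by rewrite !e2ipiXz -e2ipiD. Qed.

Lemma pdb_le f r r' B : r' <= r -> pdb f r B -> pdb f r' B.
Proof.
move=> rr hf x y /andP[x0 x1] /andP[y0 y1].
by apply: hf; rewrite ?x0 ?y0 /=; [exact: lt_le_trans rr|exact: lt_le_trans rr].
Qed.

Lemma pcoef_le f r r' B m n : 0 < r' -> r' <= r -> pdb f r B -> pcoef f r' m n = pcoef f r m n.
Proof.
move=> r'0 rr hf; have r0 := lt_le_trans r'0 rr; rewrite -[LHS]/(coef _ _ _ (lnh r', lnh r')).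
apply: (pcoefE m n r0 hf); have [h1 h2] := edom_lnh r'0.
by split; apply: lt_le_trans rr.
Qed.

Lemma pdb_scl f r B a b r' : a != 0 -> b != 0 -> nm a * r' <= r -> nm b * r' <= r -> pdb f r B ->
  pdb (f \o scl a b) r' B.
Proof.
move=> a0 b0 ar br hf x y /andP[x0 x1] /andP[y0 y1].
have na : 0 < nm a by rewrite nm_gt0.
have nb : 0 < nm b by rewrite nm_gt0.
have [|| d1 d2] := hf (a * x) (b * y).
- by rewrite nmM mulr_gt0//= (lt_le_trans _ ar)// ltr_pM2l.
- by rewrite nmM mulr_gt0//= (lt_le_trans _ br)// ltr_pM2l.
split; last exact: d2.
apply: (@differentiable_comp _ _ _ _ (scl a b) f); last exact: d1.
apply: differentiable_pair; apply: differentiableM; try exact: differentiable_cst; [exact: diff_fst|exact: diff_snd].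
Qed.

Lemma tmeanZ D K (c : C) p : holper D K -> D (iM p.1) (iM p.2) ->
  tmean (fun q => c * K q) p = c * tmean K p.
Proof.
move=> hK Dp; have h0 := holper_cst D (0 : C).
have := tmeanD c h0 hK Dp.
have -> : tmean (fun=> (0 : C)) p = 0.
  by rewrite /tmean; under eq_fun do rewrite mean_cst; rewrite mean_cst.
by rewrite add0r => <-; congr (tmean _ p); apply/funext => q; rewrite add0r.
Qed.

(** Scaling the variables translates the base point of the torus in the lift; the coefficient does
    not depend on this point, only the character picks up a factor. *)
Lemma pcoef_scl f r B a b r' m n : 0 < r' -> a != 0 -> b != 0 -> nm a * r' <= r -> nm b * r' <= r -> 0 < r ->
  pdb f r B -> pcoef (f \o scl a b) r' m n = a ^ m * b ^ n * pcoef f r m n.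
Proof.
move=> r'0 a0 b0 ar br r0 hf.
have [al alE] := e2ipi_surj a0; have [be beE] := e2ipi_surj b0.
pose p := (lnh r', lnh r'); pose p' := (lnh r' + al, lnh r' + be).
have [l1 l2] := edom_lnh r'0; have na : 0 < nm a by rewrite nm_gt0.
have nb : 0 < nm b by rewrite nm_gt0.
have Dp' : edom r (iM p'.1) (iM p'.2).
  have E c g : e2ipi g = c -> expR (- (twopi R * iM (lnh r' + g))) = nm c * expR (- (twopi R * iM (lnh r'))).
    by move=> <-; rewrite -!nm_e2ipi -nmM -e2ipiD addrC.
  rewrite /edom /p' /= (E _ _ alE) (E _ _ beE); split.
    by rewrite (lt_le_trans _ ar)// ltr_pM2l.
  by rewrite (lt_le_trans _ br)// ltr_pM2l.
have hg := pdb_scl a0 b0 ar br hf; have hG := holper_elift hg.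
rewrite -(pcoefE m n r0 hf Dp') /pcoef /coef -/p.
have -> : tmean (fun q => elift f q * mono (- m) (- n) q) p' =
   tmean (fun q => mono (- m) (- n) (al, be) * (elift (f \o scl a b) q * mono (- m) (- n) q)) p.
  rewrite /tmean; congr mean; apply/funext => s; congr mean; apply/funext => t.
  have -> : elift f (p'.1 + ofR s, p'.2 + ofR t) = elift (f \o scl a b) (p.1 + ofR s, p.2 + ofR t).
    rewrite /elift /scl /= -alE -beE -!e2ipiD /p' /p /=.
    by congr (f (e2ipi _, e2ipi _)); ring.
  have -> : mono (- m) (- n) (p'.1 + ofR s, p'.2 + ofR t) =
     mono (- m) (- n) (al, be) * mono (- m) (- n) (p.1 + ofR s, p.2 + ofR t).
    by rewrite /mono -e2ipiD /p' /p /=; congr e2ipi; ring.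
  by rewrite mulrCA.
have hK := holperM hG (holper_mono (edom r') (- m) (- n)).
have Dr : edom r' (iM p.1) (iM p.2) := edom_lnh r'0.
rewrite (@tmeanZ (edom r') _ (mono (- m) (- n) (al, be)) p hK Dr) mulrA.
suff -> : a ^ m * b ^ n * mono (- m) (- n) (al, be) = 1 by rewrite mul1r.
rewrite monoN mono_e2ipi alE beE divff// mulf_neq0// expfz_neq0//.
Qed.

Lemma small_scl (a b : C) (r : R) : 0 < r -> exists r', [/\ 0 < r', r' <= r, nm a * r' <= r & nm b * r' <= r].
Proof.
move=> r0; have q : 0 < 1 + nm a + nm b by rewrite ltr_wpDr ?nm_ge0// ltr_wpDr ?nm_ge0.
have a0 := nm_ge0 a; have b0 := nm_ge0 b; exists (r / (1 + nm a + nm b)).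
split; first by rewrite divr_gt0.
- by rewrite ler_pdivrMr// ler_pMr//; lra.
- by rewrite mulrA ler_pdivrMr// mulrC ler_pM2l//; lra.
- by rewrite mulrA ler_pdivrMr// mulrC ler_pM2l//; lra.
Qed.

(** Both sides have the same coefficients on a small torus. Such a torus has [|x| = |y|], so
    invariance there is all that is used. *)
Lemma stab_pcoef f r B a b e m n : 0 < r -> pdb f r B -> a != 0 -> b != 0 -> 0 < e ->
  (forall x y, 0 < nm x < e -> nm y = nm x -> f (a * x, b * y) = f (x, y)) ->
  pcoef f r m n != 0 -> a ^ m * b ^ n = 1.
Proof.
move=> r0 hf a0 b0 e0 hab c0.
have [r' [r'0 r'r ar br]] := small_scl a b (ltac:(by rewrite lt_min r0) : 0 < Num.min r e).
have mr : Num.min r e <= r by rewrite ge_min lexx.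
have me : Num.min r e <= e by rewrite ge_min lexx orbT.
have := pcoef_scl m n r'0 a0 b0 (le_trans ar mr) (le_trans br mr) r0 hf.
have -> : pcoef (f \o scl a b) r' m n = pcoef f r' m n.
  have [l1 l2] := edom_lnh r'0; have D : edom r' (iM (lnh r')) (iM (lnh r')) by [].
  rewrite /pcoef /coef /tmean; congr mean; apply/funext => s; congr mean; apply/funext => t.
  congr (_ * _); rewrite /elift /scl /=; apply: hab.
    by rewrite nm_e2ipi expR_gt0 iM_addR /= (lt_le_trans l1)// (le_trans r'r).
  by rewrite !nm_e2ipi !iM_addR.
rewrite (pcoef_le m n r'0 (le_trans r'r mr) hf) => /eqP.
by rewrite -subr_eq0 -{1}[pcoef f r m n]mul1r -mulrBl mulf_eq0 (negPf c0) orbF subr_eq0 => /eqP.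
Qed.

Lemma pcoef_eq0 f r B x y : 0 < r -> 0 <= B -> pdb f r B -> (forall m n, pcoef f r m n = 0) ->
  0 < nm x < r -> 0 < nm y < r -> f (x, y) = 0.
Proof.
move=> r0 B0 hf cf hx hy; apply/eqP; rewrite -nm_eq0 eq_le nm_ge0 andbT; apply/ler_addgt0Pr => e e0; rewrite add0r.
have [N] := @expansion _ f r B [::] x y e r0 B0 hf isT hx hy e0.
rewrite /psum big_nil subr0 => h; rewrite (le_trans h)// big1 ?add0r// => m _.
by rewrite big1// => n _; rewrite cf nm0 !mul0r.
Qed.

(** All coefficients of [f (a x, b y) - f (x, y)] vanish, so [pcoef_eq0] applies to it. *)
Lemma pcoef_stab f r B a b : 0 < r -> 0 <= B -> pdb f r B -> a != 0 -> b != 0 ->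
  (forall m n, pcoef f r m n != 0 -> a ^ m * b ^ n = 1) ->
  exists2 e, 0 < e & forall x y, 0 < nm x < e -> 0 < nm y < e -> f (a * x, b * y) = f (x, y).
Proof.
move=> r0 B0 hf a0 b0 hab; have [r' [r'0 r'r ar br]] := small_scl a b r0.
exists r' => // x y hx hy; have hg := pdb_scl a0 b0 ar br hf; have hf' := pdb_le r'r hf.
pose g w := f (scl a b w) + - 1 * f w.
have eg : elift g = fun q => elift (f \o scl a b) q + - 1 * elift f q by [].
have hG : pdb g r' (B + B).
  move=> u v hu hv; have [d1 b1] := hg u v hu hv; have [d2 b2] := hf' u v hu hv; split.
    apply: differentiableD; first exact: d1.
    by apply: differentiableM; [exact: differentiable_cst|exact: d2].
  by rewrite (le_trans (nmD _ _))// lerD// mulN1r nmN.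
have cG m n : pcoef g r' m n = 0.
  have D := edom_lnh r'0; rewrite /pcoef eg.
  rewrite (@coefD _ (edom r') _ _ _ _ _ (lnh r', lnh r') (holper_elift hg) (holper_elift hf') D).
  rewrite -/(pcoef (f \o scl a b) r' m n) -/(pcoef f r' m n) (pcoef_scl m n r'0 a0 b0 ar br r0 hf).
  rewrite (pcoef_le m n r'0 r'r hf).
  by have [->|c0] := eqVneq (pcoef f r m n) 0; rewrite ?mulr0 ?addr0// hab// mul1r mulN1r subrr.
suff /eqP : g (x, y) = 0 by rewrite /g /scl /= mulN1r subr_eq0 => /eqP.
exact: (pcoef_eq0 r'0 (addr_ge0 B0 B0) hG cG).
Qed.

(** Comes from [(n + 1)^3 <= 64 * 2^n]: a cubic bound leaves one power to beat the square. *)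
Lemma geo_small (Q e : R) : 0 <= Q -> 0 < e -> exists d : nat, Q * (d%:R + 2) ^+ 2 * 2^-1 ^+ d < e.
Proof.
move=> Q0 e0.
have geo (n : nat) : n.+1%:R ^+ 3 <= 64 * 2 ^+ n :> R.
  suff : (n.+1 ^ 3 <= 64 * 2 ^ n)%N by rewrite -(ler_nat R) natrM !natrX.
  elim: n => // n IH; have [n3|n3] := leqP n 3; first by case: n IH n3 => [|[|[|[|]]]].
  rewrite [(2 ^ n.+1)%N]expnS mulnCA; apply: (leq_trans (n := (2 * n.+1 ^ 3)%N)); last by rewrite leq_mul2l IH orbT.
  rewrite !expnS !expn0; move: n3; clear; nia.
have [n hn] : exists n : nat, Q * 4 * 64 / e < n%:R.
  by exists (Num.bound (Q * 4 * 64 / e)); apply: le_lt_trans (archi_boundP _); rewrite ?divr_ge0 ?mulr_ge0// ltW.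
exists n; have n1 : 0 < (n.+1%:R : R) by rewrite ltr0n.
have g3 : 2^-1 ^+ n <= 64 / n.+1%:R ^+ 3 :> R.
  by rewrite exprVn -div1r ler_pdivrMr ?exprn_gt0// mulrAC ler_pdivlMr ?exprn_gt0// mul1r; exact: geo.
have nn : (n%:R + 2 : R) ^+ 2 <= 4 * n.+1%:R ^+ 2.
  have := ler0n R n; rewrite -natr1; set z : R := n%:R; clear; nra.
apply: (@le_lt_trans _ _ (Q * (4 * n.+1%:R ^+ 2) * (64 / n.+1%:R ^+ 3))).
  apply: ler_pM; [by rewrite mulr_ge0// exprn_ge0// addr_ge0|by rewrite exprn_ge0// invr_ge0|exact: ler_wpM2l|exact: g3].
have -> : Q * (4 * n.+1%:R ^+ 2) * (64 / n.+1%:R ^+ 3) = (Q * 4 * 64) / n.+1%:R :> R by field; rewrite lt0r_neq0.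
rewrite ltr_pdivrMr//; rewrite ltr_pdivrMr// in hn; rewrite (lt_le_trans hn)// mulrC ler_pM2l//.
by rewrite ler_nat.
Qed.

Lemma partial_sumE (I : choiceType) (V : zmodType) (F : I -> V) (A : {fset I}) : partial_sum F A = \sum_(i <- A) F i.
Proof. by rewrite (big_seq_fsetE _ A xpredT F). Qed.

(** Any finite set of indices containing all nonzero terms of degree less than [d] leaves a
    remainder bounded by the tail of [expansion], whatever else it contains: this is convergence
    along [totally]. *)
Lemma laurent_sum f r B (I : choiceType) (io : I -> int * int) x y : 0 < r -> 0 <= B -> pdb f r B ->
  injective io -> (forall m n, pcoef f r m n != 0 -> exists k, io k = (m, n)) ->
  0 < nm x <= r / 4 -> 0 < nm y <= r / 4 ->
  (partial_sum (fun k => pcoef f r (io k).1 (io k).2 * (x ^ (io k).1 * y ^ (io k).2)) : {fset I} -> C)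
    @ totally --> f (x, y).
Proof.
move=> r0 B0 hf ioI supp /andP[x0 xr] /andP[y0 yr].
have FF : Filter (@totally I) by apply: @filter_filter; exact: totally_filter.
apply/cvgCP => e e0.
have h2 : 0 <= (2^-1 : R) < 1 by rewrite invr_ge0 ler0n /= invf_lt1// ltr1n.
have [d hd] := geo_small B0 (ltac:(by rewrite divr_gt0) : 0 < e / 2).
(* An index for the exponent [k], or [None] if its coefficient vanishes and no index is promised. *)
have supp' (k : nat * nat) : {i : option I | if i is Some i' then io i' = (k.1%:Z, k.2%:Z) else pcoef f r k.1 k.2 = 0}.
  apply: cid; have [c0|c0] := eqVneq (pcoef f r k.1 k.2) 0; first by exists None.
  by have [i hi] := supp _ _ c0; exists (Some i).
pose sq := [seq (m, n) | m <- iota 0 d, n <- iota 0 d].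
pose A0 : {fset I} := seq_fset tt (pmap (fun k => sval (supp' k)) sq).
exists A0 => // A /= A0A.
(* [A] may contain indices with a negative exponent; their terms vanish by [pcoef_neg] and are
   discarded. *)
pose J := [seq (`|(io k).1|%N, `|(io k).2|%N) | k <- enum_fset A & (0 <= (io k).1) && (0 <= (io k).2)].
have uJ : uniq J.
  rewrite map_inj_in_uniq; first by rewrite filter_uniq// fset_uniq.
  move=> k k'; rewrite !mem_filter => /andP[/andP[a1 a2] _] /andP[/andP[b1 b2] _] [e1 e2].
  have absI (u v : int) : 0 <= u -> 0 <= v -> `|u|%N = `|v|%N -> u = v by clear; lia.
  by apply: ioI; rewrite (surjective_pairing (io k)) (surjective_pairing (io k')) (absI _ _ a1 b1 e1) (absI _ _ a2 b2 e2).
have pE : partial_sum (fun k => pcoef f r (io k).1 (io k).2 * (x ^ (io k).1 * y ^ (io k).2)) A = psum f r J (x, y).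
  rewrite /psum big_map big_filter.
  rewrite partial_sumE.
  rewrite [RHS]big_mkcond; apply: eq_bigr => k _; case: ifP => [/andP[a1 a2]|/negbT].
    by rewrite /= -mulrA -[in X in x ^ X](gez0_abs a1) -[in X in y ^ X](gez0_abs a2) -[in X in pcoef _ _ X](gez0_abs a1) -[in X in pcoef _ _ _ X](gez0_abs a2).
  by rewrite negb_and -!ltNge => h; rewrite (pcoef_neg r0 B0 hf h) mul0r.
have xr' : 0 < nm x < r by rewrite x0 (le_lt_trans xr)//; lra.
have yr' : 0 < nm y < r by rewrite y0 (le_lt_trans yr)//; lra.
have e2 : 0 < e / 2 by rewrite divr_gt0.
have [N hN] := expansion r0 B0 hf uJ xr' yr' e2.
rewrite [X in nm (X - _)]pE nmC (le_lt_trans hN)// [ltRHS](splitr e) ltrD2r (le_lt_trans _ hd)//.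
apply: (@le_trans _ _ (\sum_(m < N) \sum_(n < N | (d <= m + n)%N) B * 2^-1 ^+ (m + n))); last first.
  under eq_bigr do rewrite -mulr_sumr.
  by rewrite -mulr_sumr -mulrA ler_wpM2l// geo_sum2//; case/andP: h2.
apply: ler_sum => m _; rewrite big_mkcond [leRHS]big_mkcond; apply: ler_sum => n _.
have bd : nm (pcoef f r m%:Z n%:Z) * nm x ^+ m * nm y ^+ n <= B * 2^-1 ^+ (m + n).
  rewrite -mulrA; have r20 : 0 < r / 2 by rewrite divr_gt0.
  apply: (@le_trans _ _ ((B / (r / 2) ^+ (m + n)) * ((r / 4) ^+ m * (r / 4) ^+ n))).
    apply: ler_pM; rewrite ?nm_ge0 ?mulr_ge0 ?exprn_ge0 ?nm_ge0//; first exact: pcoef_nat.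
    by apply: ler_pM; rewrite ?exprn_ge0 ?nm_ge0// lerXn2r ?nnegrE ?nm_ge0// divr_ge0// ltW.
  rewrite -exprD -mulrA -exprVn -exprMn ler_wpM2l// lerXn2r ?nnegrE ?mulr_ge0 ?invr_ge0 ?(ltW r0) ?(ltW r20)//.
  by rewrite le_eqVlt (_ : (_ == _) = true)//; apply/eqP; have := lt0r_neq0 r0 => ?; field.
have [dmn|dmn] := leqP d (m + n); first by case: ifP => // _; rewrite mulr_ge0// exprn_ge0//; case/andP: h2.
case: ifP => // mnJ; suff -> : pcoef f r m n = 0 by rewrite nm0 !mul0r.
have mnsq : (m : nat, n : nat) \in sq.
  by apply/allpairsP; exists (m : nat, n : nat); rewrite !mem_iota /= !add0n; split=> //; apply: leq_ltn_trans dmn; rewrite ?leq_addr ?leq_addl.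
case Es : (supp' (m : nat, n : nat)) => [[k|] /= hk]; last by [].
have kA0 : k \in A0.
  by rewrite seq_fsetE mem_pmap; apply/mapP; exists (m : nat, n : nat) => //; rewrite Es.
case/negP: mnJ; apply/mapP; exists k; last by rewrite hk.
by rewrite mem_filter hk /= (fsubsetP A0A).
Qed.

End Rotation.

Section Compact.
Variable R : realType.
Local Notation C := (Cx R).

Lemma nm_cts : continuous (@nm R).
Proof.
move=> z P /nbhsRP[e e0 h]; apply/nbhsCP; exists e => // w wz; apply: h.
have := nm_lb w z; have := nm_lb z w; rewrite (nmC z) => h1 h2.
by rewrite ltr_norml; apply/andP; split; lra.
Qed.

Lemma compact_nm (U : set C) : compact U -> exists2 K : R, 0 < K & forall z, U z -> nm z <= K.
Proof.
move=> cU; have /compact_bounded/ex_strict_bound_gt0 : compact (@nm R @` U).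
  by apply: continuous_compact cU; apply: continuous_subspaceT => z; exact: nm_cts.
case=> K K0 h; exists K => // z Uz; have := h (nm z) (ex_intro2 _ _ z Uz erefl).
by move=> /ltW/(le_trans (ler_norm _)).
Qed.

Lemma rect_cts : continuous (fun x : R * R => ofR x.1 + ofR x.2 * ii R).
Proof.
have -> : (fun x : R * R => ofR x.1 + ofR x.2 * ii R) =
   (fun w : C * C => w.1 + w.2 * ii R) \o (fun x : R * R => ((0 : C * C).1 + ofR x.1, (0 : C * C).2 + ofR x.2)).
  by apply/funext => x /=; rewrite !add0r.
move=> x; apply: (@continuous_comp _ _ _ (fun x : R * R => ((0 : C * C).1 + ofR x.1, (0 : C * C).2 + ofR x.2)) (fun w : C * C => w.1 + w.2 * ii R)).
  exact: shift_cts.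
apply: differentiable_continuous; apply: differentiableD; first exact: diff_fst.
by apply: differentiableM; [exact: diff_snd|exact: differentiable_cst].
Qed.

Lemma closed_disc (K : R) : closed [set z : C | nm z <= K].
Proof.
rewrite -[X in closed X]setCK; apply: open_closedC; rewrite openE => z /= /negP; rewrite -ltNge => zK.
apply/nbhsCP; exists (nm z - K); first by rewrite subr_gt0.
move=> w wz /=; apply/negP; rewrite -ltNge; have := nm_lb z w; rewrite nmC; lra.
Qed.

Lemma compact_disc (K : R) : compact [set z : C | nm z <= K].
Proof.
have cB : compact ((fun x : R * R => ofR x.1 + ofR x.2 * ii R) @` (`[- K, K] `*` `[- K, K])).
  apply: continuous_compact; first by apply: continuous_subspaceT => z; exact: rect_cts.
  by apply: compact_setX; exact: segment_compact.
apply: (subclosed_compact _ cB); first exact: closed_disc.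
move=> z /= zK; exists (rE z, iM z); last by rewrite /= -rEiM.
have h1 := rE_le z; have h2 := iM_le z.
by split; rewrite /= in_itv /= -ler_norml (le_trans _ zK).
Qed.

End Compact.

(** * Coordinates and cocycles on [P^1 x P^1] *)

Section P1.
Variable R : realType.
Local Notation C := (Cx R).
Local Notation P := (P1xP1 R).
Implicit Types (s t : bool) (u a : C) (x : P1 R).

(** The factor by which the coordinate of chart [s] of the projective line is multiplied when the
    affine coordinate is multiplied by [a]. *)
Definition pw s a : C := if s then a^-1 else a.

Lemma pw_neq0 s a : (pw s a != 0) = (a != 0).
Proof. by case: s; rewrite /pw ?invr_eq0. Qed.
Lemma pwM s a u : pw s (a * u) = pw s a * pw s u.
Proof. by case: s; rewrite /pw ?invfM. Qed.
Lemma pw1 s : pw s 1 = 1.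
Proof. by case: s; rewrite /pw ?invr1. Qed.
Lemma diff_pw (V : normedModType C) (f : V -> C) s v : differentiable f v -> f v != 0 ->
  differentiable (fun q => pw s (f q)) v.
Proof. by case: s => //= df f0; exact: differentiableV. Qed.

Lemma p1paramK s u : p1coord s (p1param s u) = u.
Proof.
by case: s => //=; rewrite /p1param /p1coord; case: eqVneq => [->|]//; rewrite invrK.
Qed.

Lemma p1coordK s x : chart_dom s x -> p1param s (p1coord s x) = x.
Proof.
case: s x => [] [u|] //=; rewrite /p1param /p1coord ?eqxx// invr_eq0 => u0.
by case: eqVneq => [u00|]; [case: u0; rewrite u00|rewrite invrK].
Qed.

Lemma chart_param s u : chart_dom s (p1param s u).
Proof. by case: s => //=; rewrite /p1param /chart_dom /=; case: eqVneq => // u0 []; apply/eqP; rewrite invr_eq0. Qed.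

(** At infinity: compact sets are bounded and closed discs are compact, so complements of compact
    sets correspond to neighbourhoods of 0 in the coordinate [1 / x]. *)
Lemma nbhs_P1 s u (A : set (P1 R)) : nbhs (p1param s u) A <-> nbhs u (A \o p1param s).
Proof.
case: s => //; rewrite {1}/p1param; case: eqVneq => [->|u0]; last first.
  have nz (v : C) : v != 0 -> nbhs v [set w : C | w != 0].
    move=> v0; apply/nbhsCP; exists (nm v); first by rewrite nm_gt0.
    by move=> w; apply: contraTneq => ->; rewrite sub0r nmN ltxx.
  have iu : u^-1 != 0 by rewrite invr_eq0.
  split=> h.
    have h1 := inv_continuous u0 h; apply: filterS2 (nz _ u0) h1 => v /= v0 Av.
    by rewrite /p1param (negPf v0).
  have h1 : nbhs u^-1 ((@GRing.inv C) @^-1` (A \o p1param true)).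
    by apply: (inv_continuous iu); rewrite /= invrK.
  change (nbhs u^-1 [set w | A (Some w)]); apply: filterS2 (nz _ iu) h1 => v /= v0.
  by rewrite /p1param invr_eq0 (negPf v0) invrK.
split.
  case=> U [cU _] UA; have [K K0 hK] := compact_nm cU; apply/nbhsCP; exists K^-1; first by rewrite invr_gt0.
  move=> v; rewrite subr0 /= => vK; apply: UA; rewrite /p1param; case: eqVneq => [_|v0]; first by right.
  left; exists v^-1 => // /hK; rewrite nmV; apply/negP; rewrite -ltNge.
  by rewrite -[ltLHS]invrK ltf_pV2 ?posrE ?invr_gt0// nm_gt0.
move=> /nbhsCP[e e0 h]; exists [set z : C | nm z <= e^-1].
  by split; [exact: compact_disc|exact: closed_disc].
move=> z [[w /= we <-]|/= ->]; last first.
  by have := h 0; rewrite /= /p1param eqxx subrr nm0; apply.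
have w0 : w != 0 by apply: contra_notN we => /eqP ->; rewrite nm0 invr_ge0 ltW.
have := h w^-1; rewrite /= /p1param invr_eq0 (negPf w0) invrK subr0; apply.
rewrite nmV -[ltRHS]invrK ltf_pV2 ?posrE ?invr_gt0 ?nm_gt0//.
by rewrite ltNge; apply/negP.
Qed.

Lemma p1coord2K (s : bool * bool) (p : P) : chart_dom2 s p -> p1param2 s (p1coord2 s p) = p.
Proof. by case: p => p1 p2 [/= h1 h2]; rewrite /p1param2 /p1coord2 /= !p1coordK. Qed.

Lemma p1param2K (s : bool * bool) (w : C * C) : p1coord2 s (p1param2 s w) = w.
Proof. by rewrite /p1param2 /p1coord2 /= !p1paramK -surjective_pairing. Qed.

Lemma chart_param2 (s : bool * bool) (w : C * C) : chart_dom2 s (p1param2 s w).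
Proof. by split; exact: chart_param. Qed.

Lemma nbhs_P2 (s : bool * bool) (w : C * C) (A : set P) : nbhs (p1param2 s w) A <-> nbhs w (A \o p1param2 s).
Proof.
split.
  move=> [[A1 A2] /= [h1 h2] hA]; exists (A1 \o p1param s.1, A2 \o p1param s.2).
    by split; apply/nbhs_P1.
  by move=> v [v1 v2]; apply: hA.
move=> [[A1 A2] /= [h1 h2] hA]; exists (p1param s.1 @` A1, p1param s.2 @` A2).
  by split; apply/nbhs_P1; [apply: filterS h1|apply: filterS h2] => v Av; exists v.
by move=> [p1 p2] [/= [v1 a1 <-] [v2 a2 <-]]; exact: (hA (v1, v2)).
Qed.

Lemma chart2_nbhs (s : bool * bool) (p : P) : chart_dom2 s p -> nbhs p (chart_dom2 s).
Proof.
move=> h; rewrite -(p1coord2K h); apply/nbhs_P2.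
by apply: filterS filterT => v _; exact: chart_param2.
Qed.

Lemma trans_diff s t u : chart_dom t (p1param s u) -> differentiable (fun v => p1coord t (p1param s v)) u.
Proof.
have di : differentiable (fun v : C => v) u by exact: ex_diff.
have nz (v : C) : v != 0 -> nbhs v [set w : C | w != 0].
  move=> v0; apply/nbhsCP; exists (nm v); first by rewrite nm_gt0.
  by move=> w; apply: contraTneq => ->; rewrite sub0r nmN ltxx.
case: s t => [] [] h; rewrite /=; last exact: di.
- by apply: near_diffC di; apply: filterS filterT => v _; rewrite (p1paramK true).
- have u0 : u != 0 by apply/eqP => u0; apply: h; rewrite /p1param u0 eqxx.
  have dV : differentiable (fun v : C => v^-1) u by exact: (@differentiableV _ _ (fun v : C => v)).
  by apply: near_diffC dV; apply: filterS (nz _ u0) => v v0; rewrite /p1param (negPf v0).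
- have u0 : u != 0 by apply/eqP => u0; apply: h; rewrite /p1param u0.
  exact: (@differentiableV _ _ (fun v : C => v)).
Qed.

Lemma trans_diff2 (s t : bool * bool) (w : C * C) : chart_dom2 t (p1param2 s w) ->
  differentiable (fun v => p1coord2 t (p1param2 s v)) w.
Proof.
move=> [/= h1 h2]; apply: differentiable_pair.
  apply: (@differentiable_comp _ _ _ _ fst (fun v => p1coord t.1 (p1param s.1 v))); first exact: diff_fst.
  exact: trans_diff.
apply: (@differentiable_comp _ _ _ _ snd (fun v => p1coord t.2 (p1param s.2 v))); first exact: diff_snd.
exact: trans_diff.
Qed.

(* One pair of charts is enough, the transition maps being holomorphic. *)
Lemma holoP_chart (f : P -> P) (s s' : bool * bool) (p : P) : chart_dom2 s p ->
  nbhs p [set q | chart_dom2 s' (f q)] -> differentiable (in_charts s s' f) (p1coord2 s p) -> holoP f p.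
Proof.
move=> sp s'f df; have s'p := nbhs_singleton s'f; split.
  move=> A; rewrite -[in nbhs _ A](p1coord2K s'p) => /nbhs_P2 hA.
  have hA' : nbhs (in_charts s s' f (p1coord2 s p)) (A \o p1param2 s') by rewrite /in_charts (p1coord2K sp).
  have h := differentiable_continuous df hA'.
  have {h}h : nbhs p [set q | A (p1param2 s' (p1coord2 s' (f q)))].
    have e := @nbhs_P2 s (p1coord2 s p) [set q | A (p1param2 s' (p1coord2 s' (f q)))].
    by rewrite (p1coord2K sp) in e; apply/e; exact: h.
  by apply: filterS2 s'f h => q /= /p1coord2K ->.
move=> t t' tp t'p.
have h1 : differentiable (fun v => p1coord2 s (p1param2 t v)) (p1coord2 t p).
  by apply: trans_diff2; rewrite p1coord2K.
have h2 : differentiable (fun v => p1coord2 t' (p1param2 s' v)) (p1coord2 s' (f p)).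
  by apply: trans_diff2; rewrite p1coord2K.
have h3 : differentiable (fun v => p1coord2 t' (p1param2 s' (in_charts s s' f (p1coord2 s (p1param2 t v))))) (p1coord2 t p).
  apply: (@differentiable_comp _ _ _ _ (fun v => p1coord2 s (p1param2 t v)) (fun v => p1coord2 t' (p1param2 s' (in_charts s s' f v)))); first exact: h1.
  rewrite (p1coord2K tp).
  apply: (@differentiable_comp _ _ _ _ (in_charts s s' f) (fun v => p1coord2 t' (p1param2 s' v))); first exact: df.
  by rewrite /in_charts (p1coord2K sp); exact: h2.
apply: near_diff2 h3.
have n1 : nbhs (p1coord2 t p) [set v | chart_dom2 s (p1param2 t v)].
  by apply/(nbhs_P2 t _ (chart_dom2 s)); rewrite p1coord2K//; exact: chart2_nbhs.
have n2 : nbhs (p1coord2 t p) [set v | chart_dom2 s' (f (p1param2 t v))].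
  by apply/(nbhs_P2 t _ [set q | chart_dom2 s' (f q)]); rewrite p1coord2K.
by apply: filterS2 n1 n2 => v /= v1 v2; rewrite /in_charts (p1coord2K v1) p1coord2K.
Qed.

Lemma p1coord_lin s a u : a != 0 -> p1coord s (omap ( *%R a) (p1param s u)) = pw s a * u.
Proof.
move=> a0; case: s => //=; rewrite /p1param /p1coord /pw; case: eqVneq => [->|u0] /=; first by rewrite mulr0.
by rewrite invfM invrK.
Qed.

Lemma chart_lin s a x : a != 0 -> chart_dom s (omap ( *%R a) x) <-> chart_dom s x.
Proof.
move=> a0; case: s x => [] [u|]//=; split=> // h; apply: contra_not h => -[].
  by move=> ->; rewrite mulr0.
by move/eqP; rewrite mulf_eq0 (negPf a0) => /eqP ->.
Qed.

Lemma chart_lin2 (s : bool * bool) a b (p : P) : a != 0 -> b != 0 -> chart_dom2 s (lin a b p) <-> chart_dom2 s p.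
Proof.
move=> a0 b0; have e1 := @chart_lin s.1 a p.1 a0; have e2 := @chart_lin s.2 b p.2 b0.
by split=> -[/= h1 h2]; split; [apply/e1|apply/e2|apply/e1|apply/e2].
Qed.

Lemma lin_in_charts (s : bool * bool) a b (w : C * C) : a != 0 -> b != 0 ->
  p1coord2 s (lin a b (p1param2 s w)) = (pw s.1 a * w.1, pw s.2 b * w.2).
Proof. by move=> a0 b0; rewrite /p1coord2 /= !p1coord_lin. Qed.

Lemma lin11 (p : P) : lin 1 1 p = p.
Proof.
by case: p => [[x|] [y|]]; rewrite /lin /= ?mul1r.
Qed.

Lemma linM a b a' b' (p : P) : lin a b (lin a' b' p) = lin (a * a') (b * b') p.
Proof. by case: p => [[x|] [y|]]; rewrite /lin /= ?mulrA. Qed.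

End P1.

Section Slice.
Variable R : realType.
Local Notation C := (Cx R).

Lemma diffC_eps (f : C -> C) z (e : R) : differentiable f z -> 0 < e ->
  exists2 r, 0 < r & forall h, nm h < r -> nm (f (z + h) - f z - 'd f z 1 * h) <= e * nm h.
Proof.
move=> df e0; have e0' : 0 < (ofR e : C) by rewrite ltcR.
have /nbhsCP[r r0 hr] := diff1_eps df e0'; exists r => // h hh.
have := hr h; rewrite subr0 => /(_ hh); rewrite addrC [h * _]mulrC !nmE -ofRM.
by rewrite ofR_le [h + z]addrC [- _ + _]addrC.
Qed.

Lemma diffC_unique (f : C -> C) z (l : C) : differentiable f z ->
  (forall e, 0 < e -> exists2 r, 0 < r & forall h, nm h < r -> nm (f (z + h) - f z - l * h) <= e * nm h) ->
  'd f z 1 = l.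
Proof.
move=> df hl; apply/eqP; rewrite -subr_eq0 -nm_eq0 eq_le nm_ge0 andbT; apply/ler_addgt0Pr => e e0; rewrite add0r.
have e2 : 0 < e / 2 by rewrite divr_gt0.
have [r1 r10 h1] := diffC_eps df e2; have [r2 r20 h2] := hl _ e2.
pose m := Num.min r1 r2 / 2; have m0 : 0 < m by rewrite divr_gt0// lt_min r10.
have mm : m < Num.min r1 r2 by rewrite /m ltr_pdivrMr// ltr_pMr ?ltr1n// lt_min r10.
move: mm; rewrite lt_min => /andP[m1 m2].
have nx : nm (ofR m : C) = m by rewrite nm_ofR gtr0_norm.
have {}h1 := h1 (ofR m); have {}h2 := h2 (ofR m); rewrite nx in h1 h2.
have {}h1 := h1 m1; have {}h2 := h2 m2; rewrite -(ler_pM2r m0) -{1}nx -nmM.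
set D := f (z + _) - f z in h1 h2.
have -> : ('d f z 1 - l) * ofR m = (D - l * ofR m) - (D - 'd f z 1 * ofR m) by ring.
rewrite (le_trans (nmB _ _))//; lra.
Qed.

Lemma diff_normal i (f : C * C -> C * C) w v : differentiable f w ->
  'd (@normal_part R i \o f) w v = normal_part i ('d f w v).
Proof.
move=> df; have [d1 d2] := (diff_pairP f w).1 df.
have E : 'd f w v = ('d (fun p => (f p).1) w v, 'd (fun p => (f p).2) w v).
  have e : (fun y => ((f y).1, (f y).2)) = f by apply/funext => y; case: (f y).
  by have := diff_pair d1 d2; rewrite e => ->.
by rewrite E /normal_part /comp; case: odd.
Qed.

Definition aline (w v : C * C) (h : C) : C * C := (w.1 + h * v.1, w.2 + h * v.2).

Lemma diff_aline w v : differentiable (aline w v) 0 /\ 'd (aline w v) 0 1 = v.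
Proof.
have d (a b : C) : differentiable (fun h : C => a + h * b) 0 /\ 'd (fun h : C => a + h * b) 0 1 = b.
  have da : differentiable (fun h : C => a + h * b) 0.
    apply: differentiableD; first exact: differentiable_cst.
    by apply: differentiableM; [exact: ex_diff|exact: differentiable_cst].
  split=> //; apply: (diffC_unique da) => e e0; exists 1 => // h _.
  by rewrite add0r mul0r addr0 [b * h]mulrC [a + _]addrC addrK subrr nm0 mulr_ge0// ?nm_ge0// ltW.
have [a1 a2] := d w.1 v.1; have [b1 b2] := d w.2 v.2; split; first exact: differentiable_pair.
have e : 'd (aline w v) 0 1 = ('d (fun h : C => w.1 + h * v.1) 0 1, 'd (fun h : C => w.2 + h * v.2) 0 1) :=
  f_equal (fun g : C -> C * C => g 1) (diff_pair a1 b1).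
exact: (etrans e (etrans (congr2 pair a2 b2) (esym (surjective_pairing v)))).
Qed.

Lemma slice_eps i (f : C * C -> C * C) w v (e : R) : differentiable f w -> 0 < e ->
  exists2 r, 0 < r & forall h, nm h < r ->
    nm (normal_part i (f (aline w v h)) - normal_part i (f w) - normal_part i ('d f w v) * h) <= e * nm h.
Proof.
move=> df e0; have [da db] := diff_aline w v.
have a0 : aline w v 0 = w by rewrite /aline !mul0r !addr0 -surjective_pairing.
have dn : differentiable (@normal_part R i \o f) w.
  apply: (@differentiable_comp _ _ _ _ f (@normal_part R i)); first exact: df.
  by rewrite /normal_part; case: odd; [exact: diff_snd|exact: diff_fst].
have dN : differentiable (@normal_part R i \o f) (aline w v 0) by rewrite a0.
have dg : differentiable (@normal_part R i \o f \o aline w v) 0.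
  exact: (@differentiable_comp _ _ _ _ (aline w v) (@normal_part R i \o f)).
have [r r0 hr] := diffC_eps dg e0; exists r => // h hh; have := hr h hh.
by rewrite (diff_comp da dN) /= db a0 -(diff_normal i v df) add0r.
Qed.

(** Turns the condition on the differential in [Diff1_line] and [Diff1_corner] into a difference
    quotient in one variable along a line. *)
Lemma slice_unique i (f : C * C -> C * C) w v (l : C) : differentiable f w ->
  (forall e, 0 < e -> exists2 r, 0 < r & forall h, nm h < r ->
    nm (normal_part i (f (aline w v h)) - normal_part i (f w) - l * h) <= e * nm h) ->
  normal_part i ('d f w v) = l.
Proof.
move=> df hl; have [da db] := diff_aline w v.
have a0 : aline w v 0 = w by rewrite /aline !mul0r !addr0 -surjective_pairing.
have dn : differentiable (@normal_part R i \o f) w.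
  apply: (@differentiable_comp _ _ _ _ f (@normal_part R i)); first exact: df.
  by rewrite /normal_part; case: odd; [exact: diff_snd|exact: diff_fst].
have dN : differentiable (@normal_part R i \o f) (aline w v 0) by rewrite a0.
have dg : differentiable (@normal_part R i \o f \o aline w v) 0.
  exact: (@differentiable_comp _ _ _ _ (aline w v) (@normal_part R i \o f)).
have : 'd (@normal_part R i \o f \o aline w v) 0 1 = l.
  apply: (diffC_unique dg) => e e0; have [r r0 hr] := hl e e0; exists r => // h hh.
  by rewrite /= a0 add0r; exact: hr.
by rewrite (diff_comp da dN) /= db a0 (diff_normal i v df).
Qed.

End Slice.

(** * Coordinates at the corners and corrections along the lines *)

Section Corner.
Variable R : realType.
Local Notation C := (Cx R).
Local Notation P := (P1xP1 R).
Implicit Types (i : 'Z_4) (w : C * C) (p : P).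

Definition ncomp i p : P1 R := if odd i then p.2 else p.1.
Definition nside i : bool := (2 <= val i)%N.
Definition wdom i p := chart_dom (nside i) (ncomp i p).
(* [wc i] is the coordinate [w_i] vanishing along [L_i]: [X, Y, 1/X, 1/Y] for [i = 0, 1, 2, 3]. *)
Definition wc i p : C := p1coord (nside i) (ncomp i p).
(** For odd [i] the coordinate [w_i] belongs to the second factor; [swp] restores the order
    [(w_i, w_{i+1})], in which all four corners are treated alike. *)
Definition swp i w : C * C := if odd i then (w.2, w.1) else w.
Definition kap i w : P := p1param2 (corner_chart R i) (swp i w).
Definition kco i p : C * C := (wc i p, wc (i + 1) p).

Lemma Z4P (Q : 'Z_4 -> Prop) : Q 0 -> Q 1 -> Q (1 + 1) -> Q (1 + 1 + 1) -> forall i, Q i.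
Proof.
move=> q0 q1 q2 q3 [[|[|[|[|n]]]] h] //.
- by rewrite (_ : Ordinal h = 0)//; apply/val_inj.
- by rewrite (_ : Ordinal h = 1)//; apply/val_inj.
- by rewrite (_ : Ordinal h = 1 + 1)//; apply/val_inj.
- by rewrite (_ : Ordinal h = 1 + 1 + 1)//; apply/val_inj.
Qed.

Lemma swpK i : involutive (swp i).
Proof. by move=> [x y]; rewrite /swp; case: odd. Qed.

Lemma lineE i p : line i p <-> wdom i p /\ wc i p = 0.
Proof.
move: i; apply: Z4P; rewrite /line /wdom /wc /ncomp /nside /=.
- by case: p.1 => [u|]; split; [by move=> [->]|by case=> _ /= ->|by []|by case].
- by case: p.2 => [u|]; split; [by move=> [->]|by case=> _ /= ->|by []|by case].
- case: p.1 => [u|]; split=> //= -[] h /eqP; rewrite invr_eq0 => /eqP u0.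
  by case: h; rewrite u0.
- case: p.2 => [u|]; split=> //= -[] h /eqP; rewrite invr_eq0 => /eqP u0.
  by case: h; rewrite u0.
Qed.

Lemma cchart i p : chart_dom2 (corner_chart R i) p <-> wdom i p /\ wdom (i + 1) p.
Proof. by move: i; apply: Z4P; rewrite /chart_dom2 /wdom /ncomp /nside /=; split=> -[]. Qed.

Lemma ccoord i p : p1coord2 (corner_chart R i) p = swp i (kco i p).
Proof. by move: i; apply: Z4P. Qed.

Lemma kap_dom i w : wdom i (kap i w) /\ wdom (i + 1) (kap i w).
Proof. by apply/cchart; exact: chart_param2. Qed.

Lemma kco_kap i w : kco i (kap i w) = w.
Proof. by apply: (can_inj (swpK i)); rewrite -ccoord p1param2K. Qed.

Lemma wc_kap i w : wc i (kap i w) = w.1 /\ wc (i + 1) (kap i w) = w.2.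
Proof. by have := kco_kap i w; case: (w) => x y []. Qed.

Lemma kap_kco i p : wdom i p -> wdom (i + 1) p -> kap i (kco i p) = p.
Proof. by move=> h1 h2; rewrite /kap -ccoord p1coord2K//; apply/cchart. Qed.

Lemma kap0 i : kap i (0, 0) = corner R i.
Proof. by move: i; apply: Z4P; rewrite /kap /p1param2 /p1param /= ?eqxx. Qed.

Lemma swp_diff i w : differentiable (swp i) w.
Proof.
rewrite /swp; case: odd; last exact: ex_diff.
by apply: differentiable_pair; [exact: diff_snd|exact: diff_fst].
Qed.

Lemma swp_cts i : continuous (swp i).
Proof. by move=> w; apply: differentiable_continuous; exact: swp_diff. Qed.

Lemma nbhs_kap i w (A : set P) : nbhs (kap i w) A <-> nbhs w (A \o kap i).
Proof.
rewrite /kap; split.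
  by move=> /nbhs_P2 h; exact: (@swp_cts i w _ h).
move=> h; apply/nbhs_P2.
have {h}h : nbhs (swp i (swp i w)) (A \o kap i) by rewrite swpK.
have h' : nbhs (swp i w) ((A \o kap i) \o swp i) := @swp_cts i (swp i w) _ h.
by apply: filterS h' => v /=; rewrite /kap swpK.
Qed.

Definition kch i (f : P -> P) w := kco i (f (kap i w)).

Lemma kchE i f : in_charts (corner_chart R i) (corner_chart R i) f = swp i \o kch i f \o swp i.
Proof. by apply/funext => w; rewrite /in_charts ccoord /= /kch /kap swpK. Qed.

Lemma diff_swp i (f : C * C -> C * C) w : differentiable f (swp i w) -> differentiable (swp i \o f \o swp i) w.
Proof.
move=> h; apply: (@differentiable_comp _ _ _ _ (swp i) (swp i \o f)); first exact: swp_diff.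
by apply: (@differentiable_comp _ _ _ _ f (swp i)); [exact: h|exact: swp_diff].
Qed.

Lemma holo_kch i f w : holoP f (kap i w) -> wdom i (f (kap i w)) -> wdom (i + 1) (f (kap i w)) ->
  differentiable (kch i f) w.
Proof.
move=> [_ h] h1 h2; have {}h := h _ _ (chart_param2 (corner_chart R i) (swp i w)) ((cchart i _).2 (conj h1 h2)).
rewrite p1param2K kchE in h; have := @diff_swp i _ w h.
by rewrite (_ : swp i \o _ \o _ = kch i f)//; apply/funext => v /=; rewrite !swpK.
Qed.

Lemma kch_holo i f w : differentiable (kch i f) w ->
  (\forall v \near w, wdom i (f (kap i v)) /\ wdom (i + 1) (f (kap i v))) -> holoP f (kap i w).
Proof.
move=> df hd; apply: (@holoP_chart R f (corner_chart R i) (corner_chart R i)).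
- by apply/cchart; exact: kap_dom.
- by apply/nbhs_kap; apply: filterS hd => v hv; apply/cchart.
by rewrite ccoord kco_kap kchE; apply: diff_swp; rewrite swpK.
Qed.

(** The multiplier of [w_i] under [(X, Y) |-> (g.1 X, g.2 Y)]; also the value of [w_i] at the torus
    point [g]. *)
Definition tw i (g : C * C) : C := pw (nside i) (if odd i then g.2 else g.1).

Lemma wc_torus i (X Y : C) : wc i (Some X, Some Y) = tw i (X, Y).
Proof. by rewrite /wc /tw /ncomp /=; case: odd; case: nside. Qed.

Lemma wdom_torus i (X Y : C) : X != 0 -> Y != 0 -> wdom i (Some X, Some Y).
Proof. by move=> /eqP X0 /eqP Y0; rewrite /wdom /ncomp /=; case: odd; case: nside => //= -[]. Qed.

Lemma tw_neq0 i g : g.1 != 0 -> g.2 != 0 -> tw i g != 0.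
Proof. by move=> g1 g2; rewrite /tw pw_neq0; case: odd. Qed.

Lemma wdom_lin i a b p : a != 0 -> b != 0 -> wdom i (lin a b p) <-> wdom i p.
Proof. by move=> a0 b0; rewrite /wdom /ncomp /=; case: odd; exact: chart_lin. Qed.

Lemma wc_lin i a b p : a != 0 -> b != 0 -> wdom i p -> wc i (lin a b p) = tw i (a, b) * wc i p.
Proof.
move=> a0 b0; rewrite /wdom /wc /ncomp /tw /=; case: odd => h.
  by rewrite -{1}(p1coordK h) p1coord_lin.
by rewrite -{1}(p1coordK h) p1coord_lin.
Qed.

Lemma lin_kap i a b w : a != 0 -> b != 0 -> lin a b (kap i w) = kap i (tw i (a, b) * w.1, tw (i + 1) (a, b) * w.2).
Proof.
move=> a0 b0; have [d1 d2] := kap_dom i w; have [e1 e2] := wc_kap i w.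
rewrite -[LHS](@kap_kco i); try by apply/wdom_lin.
by congr kap; rewrite /kco !wc_lin// e1 e2.
Qed.

(* [unt i (A, B)] are the factors of [X] and [Y] when [w_i] is multiplied by [A] and [w_{i+1}] by [B]. *)
Definition unt i (g : C * C) : C * C := (pw (corner_chart R i).1 (swp i g).1, pw (corner_chart R i).2 (swp i g).2).

Lemma tw_unt i g : tw i (unt i g) = g.1 /\ tw (i + 1) (unt i g) = g.2.
Proof. by move: i; apply: Z4P; rewrite /tw /unt /pw /= ?invrK. Qed.

(** The inverse appears because [w_{i+2}] is [1 / w_i]. *)
Lemma tw_unt_succ i g : tw i (unt (i + 1) g) = g.2^-1 /\ tw (i + 1) (unt (i + 1) g) = g.1.
Proof. by move: i; apply: Z4P; rewrite /tw /unt /pw /= ?invrK. Qed.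

Lemma unt_neq0 i g : g.1 != 0 -> g.2 != 0 -> (unt i g).1 != 0 /\ (unt i g).2 != 0.
Proof. by move=> g1 g2; rewrite /unt /= !pw_neq0 /swp; case: odd. Qed.

Lemma untM i g h : unt i (g.1 * h.1, g.2 * h.2) = ((unt i g).1 * (unt i h).1, (unt i g).2 * (unt i h).2).
Proof. by rewrite /unt -!pwM /swp; case: odd. Qed.

Lemma unt1 i : unt i (1, 1) = (1, 1).
Proof. by rewrite /unt /swp; case: odd; rewrite /= !pw1. Qed.

(** Written as [lin] with factors depending on the point, so that it makes sense along all of [L_i],
    which no single corner chart covers. *)
Definition Nmap i (A B : C -> C) p : P :=
  lin (unt i (A (wc i p), B (wc i p))).1 (unt i (A (wc i p), B (wc i p))).2 p.

Lemma Nmap_wdom i j A B p : A (wc i p) != 0 -> B (wc i p) != 0 -> wdom j (Nmap i A B p) <-> wdom j p.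
Proof. by move=> A0 B0; have [h1 h2] := @unt_neq0 i (A (wc i p), B (wc i p)) A0 B0; exact: wdom_lin. Qed.

Lemma Nmap_kap i A B w : A w.1 != 0 -> B w.1 != 0 ->
  Nmap i A B (kap i w) = kap i (w.1 * A w.1, w.2 * B w.1).
Proof.
have [e1 e2] := wc_kap i w.
move=> A0 B0; rewrite /Nmap e1; have [h1 h2] := @unt_neq0 i (A w.1, B w.1) A0 B0.
by rewrite lin_kap// -surjective_pairing; have [-> ->] := tw_unt i (A w.1, B w.1); rewrite /= mulrC [B _ * _]mulrC.
Qed.

Lemma Nmap_kap_succ i A B w : A w.2 != 0 -> B w.2 != 0 ->
  Nmap (i + 1) A B (kap i w) = kap i (w.1 / B w.2, w.2 * A w.2).
Proof.
have [e1 e2] := wc_kap i w.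
move=> A0 B0; rewrite /Nmap e2; have [h1 h2] := @unt_neq0 (i + 1) (A w.2, B w.2) A0 B0.
by rewrite lin_kap// -surjective_pairing; have [-> ->] := tw_unt_succ i (A w.2, B w.2); rewrite /= mulrC [A _ * _]mulrC.
Qed.

Lemma wc_Nmap i A B p : A (wc i p) != 0 -> B (wc i p) != 0 -> wdom i p ->
  wc i (Nmap i A B p) = wc i p * A (wc i p).
Proof.
move=> A0 B0 h; have [h1 h2] := @unt_neq0 i (A (wc i p), B (wc i p)) A0 B0.
by rewrite wc_lin// -surjective_pairing (tw_unt i _).1 mulrC.
Qed.

Lemma Nmap_comp i A B A' B' p : wdom i p -> A (wc i p) != 0 -> B (wc i p) != 0 ->
  A (wc i p) * A' (wc i p * A (wc i p)) = 1 -> B (wc i p) * B' (wc i p * A (wc i p)) = 1 ->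
  Nmap i A' B' (Nmap i A B p) = p.
Proof.
move=> h A0 B0 hA hB; rewrite {1}/Nmap wc_Nmap// /Nmap linM.
have e := untM i (A' (wc i p * A (wc i p)), B' (wc i p * A (wc i p))) (A (wc i p), B (wc i p)).
rewrite /= [A' _ * _]mulrC [B' _ * _]mulrC hA hB unt1 in e; case: e => <- <-.
exact: lin11.
Qed.

Definition invgerm (A B A' B' : C -> C) :=
  \forall x \near (0 : C), A x * A' (x * A x) = 1 /\ B x * B' (x * A x) = 1.
Definition germ1 (A : C -> C) := A 0 = 1 /\ \forall x \near (0 : C), differentiable A x.

Lemma nbhs_neq0 (z : C) : z != 0 -> nbhs z [set w : C | w != 0].
Proof.
move=> z0; apply/nbhsCP; exists (nm z); first by rewrite nm_gt0.
by move=> w; apply: contraTneq => ->; rewrite sub0r nmN ltxx.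
Qed.

Lemma germ1_near A : germ1 A -> \forall x \near (0 : C), A x != 0.
Proof.
move=> [A0 dA]; have cA := differentiable_continuous (nbhs_singleton dA).
have : nbhs (A 0) [set z : C | z != 0] by apply: nbhs_neq0; rewrite A0 oner_neq0.
exact: cA.
Qed.

Lemma pole_side i (s : bool * bool) p : line i p -> chart_dom2 s p -> (if odd i then s.2 else s.1) = nside i.
Proof.
move: i; apply: Z4P; case: s p => [s1 s2] [p1 p2]; rewrite /line /chart_dom2 /nside /= => ->; case=> h1 h2.
- by case: s1 h1.
- by case: s2 h2.
- by case: s1 h1.
- by case: s2 h2.
Qed.

Lemma ncomp_nbhs i p (A : set (P1 R)) : nbhs (ncomp i p) A -> nbhs p [set q | A (ncomp i q)].
Proof.
rewrite /ncomp; case: odd => h.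
  by have : nbhs p (snd @^-1` A) by apply: cvg_snd.
by have : nbhs p (fst @^-1` A) by apply: cvg_fst.
Qed.

Lemma wdom_near (i : 'Z_4) (Q : set C) p : wdom i p -> nbhs (wc i p) Q -> nbhs p [set q | wdom i q /\ Q (wc i q)].
Proof.
move=> h hQ; apply: (@ncomp_nbhs i p [set x | chart_dom (nside i) x /\ Q (p1coord (nside i) x)]).
rewrite -(p1coordK h); apply/(@nbhs_P1 R (nside i) _ [set x | chart_dom (nside i) x /\ Q (p1coord (nside i) x)]).
by apply: filterS hQ => v Qv; split; [exact: chart_param|rewrite p1paramK].
Qed.

Lemma wc_param i (s : bool * bool) w : (if odd i then s.2 else s.1) = nside i ->
  wc i (p1param2 s w) = normal_part i w.
Proof. by rewrite /wc /ncomp /normal_part /=; case: odd => <-; rewrite p1paramK. Qed.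

Lemma normal_diff i w : differentiable (@normal_part R i) w.
Proof. rewrite /normal_part; case: odd; [exact: diff_snd|exact: diff_fst]. Qed.

Lemma Nmap_charts i A B (s : bool * bool) w : (if odd i then s.2 else s.1) = nside i ->
  A (normal_part i w) != 0 -> B (normal_part i w) != 0 ->
  in_charts s s (Nmap i A B) w =
   (pw s.1 (unt i (A (normal_part i w), B (normal_part i w))).1 * w.1,
    pw s.2 (unt i (A (normal_part i w), B (normal_part i w))).2 * w.2).
Proof.
move=> hs A0 B0; rewrite /in_charts /Nmap wc_param//.
have [h1 h2] := @unt_neq0 i (A (normal_part i w), B (normal_part i w)) A0 B0.
by rewrite lin_in_charts.
Qed.

Lemma Nmap_diff i A B (s : bool * bool) w : (if odd i then s.2 else s.1) = nside i ->
  (\forall x \near normal_part i w, A x != 0 /\ B x != 0) ->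
  differentiable A (normal_part i w) -> differentiable B (normal_part i w) ->
  differentiable (in_charts s s (Nmap i A B)) w.
Proof.
move=> hs AB dA dB; have [A0 B0] := nbhs_singleton AB.
have nc := differentiable_continuous (normal_diff i w).
have dA' : differentiable (fun v => A (normal_part i v)) w.
  by apply: (@differentiable_comp _ _ _ _ (@normal_part R i) A); [exact: normal_diff|exact: dA].
have dB' : differentiable (fun v => B (normal_part i v)) w.
  by apply: (@differentiable_comp _ _ _ _ (@normal_part R i) B); [exact: normal_diff|exact: dB].
have [h1 h2] := @unt_neq0 i (A (normal_part i w), B (normal_part i w)) A0 B0.
have h : differentiable (fun w => (pw s.1 (unt i (A (normal_part i w), B (normal_part i w))).1 * w.1,
    pw s.2 (unt i (A (normal_part i w), B (normal_part i w))).2 * w.2)) w.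
  apply: differentiable_pair; apply: differentiableM.
  - apply: diff_pw; last exact: h1.
    by rewrite /unt /swp; case: odd; rewrite /=; apply: diff_pw; [exact: dB'|exact: B0|exact: dA'|exact: A0].
  - exact: diff_fst.
  - apply: diff_pw; last exact: h2.
    by rewrite /unt /swp; case: odd; rewrite /=; apply: diff_pw; [exact: dA'|exact: A0|exact: dB'|exact: B0].
  - exact: diff_snd.
apply: near_diff2 h; have h' : nbhs w (@normal_part R i @^-1` [set x | A x != 0 /\ B x != 0]) := nc _ AB.
by apply: filterS h' => v /= [a0 b0]; rewrite Nmap_charts.
Qed.

Lemma Nmap_holo i A B p : line i p -> germ1 A -> germ1 B -> nbhs p [set q | holoP (Nmap i A B) q].
Proof.
move=> /lineE[hp wp0] gA gB; pose Q := [set x : C | [/\ \forall y \near x, A y != 0 /\ B y != 0, differentiable A x & differentiable B x]].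
have hQ : nbhs (wc i p) Q.
  rewrite wp0; have h1 : \forall x \near (0 : C), A x != 0 /\ B x != 0 by apply: filterI; exact: germ1_near.
  have h2 := nbhs_interior h1; move: gA gB => [_ dA] [_ dB].
  by apply: filterS3 h2 dA dB => x x1 x2 x3; split.
apply: filterS (wdom_near hp hQ) => q [hq [q1 q2 q3]].
pose s : bool * bool := if odd i then (q.1 == None, nside i) else (nside i, q.2 == None).
have hs : (if odd i then s.2 else s.1) = nside i by rewrite /s; case: odd.
have qs : chart_dom2 s q.
  by rewrite /s; move: hq; rewrite /wdom /ncomp; case: (q) => [a b]; case: odd => /= hq; split => //=; [case: a|case: b].
have e : normal_part i (p1coord2 s q) = wc i q by rewrite -(@wc_param i s)// p1coord2K.
apply: (@holoP_chart R _ s s) => //; last by apply: Nmap_diff; rewrite ?e.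
have n2 := wdom_near hq q1.
apply: filterS2 (chart2_nbhs qs) n2 => q' d' [_ [a0 b0]].
have [h1 h2] := @unt_neq0 i (A (wc i q'), B (wc i q')) a0 b0.
by apply/chart_lin2.
Qed.

Lemma Nmap_line i A B p : A 0 = 1 -> B 0 = 1 -> line i p -> Nmap i A B p = p.
Proof. by move=> A0 B0 /lineE[_ e]; rewrite /Nmap e A0 B0 unt1 lin11. Qed.

(** The transverse coordinate [n] becomes [n * A n], whose derivative at 0 is [A 0 = 1]. *)
Lemma Diff1_Nmap i A B A' B' : germ1 A -> germ1 B -> germ1 A' -> germ1 B' ->
  invgerm A B A' B' -> invgerm A' B' A B -> Diff1_line i (Nmap i A B).
Proof.
move=> gA gB gA' gB' h1 h2; split.
- exists (Nmap i A' B'); split.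
  + by split=> p hp; apply: Nmap_holo.
  + by move=> _ [p hp <-]; rewrite Nmap_line//; [case: gA|case: gB].
  + by move=> _ [p hp <-]; rewrite Nmap_line//; [case: gA'|case: gB'].
  move=> p /lineE[hp wp0].
  have hQ : nbhs (wc i p) [set x | ((A x != 0 /\ B x != 0) /\ (A' x != 0 /\ B' x != 0)) /\ ((A x * A' (x * A x) = 1 /\ B x * B' (x * A x) = 1) /\ (A' x * A (x * A' x) = 1 /\ B' x * B (x * A' x) = 1))].
    rewrite wp0; apply: filterI; last by apply: filterI.
    by apply: filterI; apply: filterI; apply: germ1_near.
  apply: filterS (wdom_near hp hQ) => q [hq [[[q1 q2] [q3 q4]] [[q5 q6] [q7 q8]]]].
  by split; apply: Nmap_comp.
- move=> p /lineE[hp wp0]; have hQ : nbhs (wc i p) [set x | A x != 0 /\ B x != 0].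
    by rewrite wp0; apply: filterI; exact: germ1_near.
  apply: filterS (wdom_near hp hQ) => q [hq [q1 q2]] [j _ /lineE[e1 e2]]; exists j => //; apply/lineE.
  have [n1 n2] := @unt_neq0 i (A (wc i q), B (wc i q)) q1 q2.
  by split; [apply/Nmap_wdom|rewrite wc_lin// e2 mulr0].
- by move=> p hp; rewrite Nmap_line//; [case: gA|case: gB].
move=> p s hp hs v; have e := pole_side hp hs.
have w0 : normal_part i (p1coord2 s p) = 0 by rewrite -(wc_param _ e) p1coord2K//; case/lineE: hp.
have hQ : \forall x \near (0 : C), A x != 0 /\ B x != 0 by apply: filterI; exact: germ1_near.
have dA0 := nbhs_singleton gA.2.
have dN : differentiable (in_charts s s (Nmap i A B)) (p1coord2 s p).
  apply: Nmap_diff; [exact: e|by rewrite w0|by rewrite w0|rewrite w0; exact: nbhs_singleton gB.2].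
set w := p1coord2 s p in w0 dN *.
have E h : A (normal_part i h) != 0 -> B (normal_part i h) != 0 ->
   normal_part i (in_charts s s (Nmap i A B) h) = normal_part i h * A (normal_part i h).
  move=> a0 b0; rewrite Nmap_charts//; set n := normal_part i h; move: e; rewrite /unt /swp /normal_part.
  by rewrite /n /normal_part; move: (i); apply: Z4P => /= ->; rewrite /pw ?invrK /= mulrC.
apply: (slice_unique dN) => eps e0.
set n := normal_part i v; pose M := nm n + 1; have M0 : 0 < M by rewrite ltr_wpDl// nm_ge0.
have /cvgCP cA := differentiable_continuous dA0.
have /nbhsCP[r1 r10 hr1] := cA _ (divr_gt0 e0 M0).
have /nbhsCP[r2 r20 hr2] := hQ.
exists (Num.min r1 r2 / M); first by rewrite divr_gt0// lt_min r10.
move=> h; rewrite ltr_pdivlMr// lt_min => /andP[h1' h2'].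
have nE : normal_part i (aline w v h) = h * n.
  by move: w0; rewrite /aline /n /normal_part; case: odd => /= ->; rewrite add0r.
have nh : nm (h * n) <= nm h * M by rewrite nmM ler_wpM2l ?nm_ge0// /M lerDl.
have [a0 b0] : A (h * n) != 0 /\ B (h * n) != 0 by apply: hr2; rewrite subr0 (le_lt_trans nh).
rewrite E nE// E ?w0; [|by rewrite gA.1 oner_neq0|by rewrite gB.1 oner_neq0].
have -> : h * n * A (h * n) - 0 * A 0 - n * h = h * n * (A (h * n) - A 0) by rewrite gA.1; ring.
have := hr1 (h * n); rewrite subr0 => /(_ (le_lt_trans nh h1')) /= hh.
rewrite nmM; apply: (le_trans (ler_pM (nm_ge0 _) (nm_ge0 _) nh (ltW hh))).
by rewrite -mulrA [M * _]mulrC divfK ?lt0r_neq0// mulrC.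
Qed.

End Corner.

(** * Germs at the corners and normal form of the cocycle *)

Section CornerGerms.
Variable R : realType.
Local Notation C := (Cx R).
Local Notation P := (P1xP1 R).
Implicit Types (i : 'Z_4) (w : C * C) (U V : C * C -> C).
Local Notation O2 := ((0, 0) : C * C).

Definition hol0 U := \forall w \near O2, differentiable U w.
Definition cg U V := [/\ U O2 = 1, V O2 = 1, hol0 U & hol0 V].
Definition mUV U V w : C * C := (w.1 * U w, w.2 * V w).

Lemma near0P (Q : set (C * C)) : nbhs O2 Q <-> exists2 e : R, 0 < e & forall x y, nm x < e -> nm y < e -> Q (x, y).
Proof.
split=> [/nbhsC2P[e e0 h]|[e e0 h]]; first by exists e => // x y xe ye; apply: h; rewrite /= subr0.
by apply/nbhsC2P; exists e => // -[x y] /=; rewrite !subr0; exact: h.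
Qed.

Lemma fst_near (Q : set C) : nbhs (0 : C) Q -> nbhs O2 [set w | Q w.1].
Proof.
move=> /nbhsCP[e e0 h]; apply/near0P; exists e; first exact: e0.
by move=> x y xe _; apply: h; rewrite subr0.
Qed.

Lemma snd_near (Q : set C) : nbhs (0 : C) Q -> nbhs O2 [set w | Q w.2].
Proof.
move=> /nbhsCP[e e0 h]; apply/near0P; exists e; first exact: e0.
by move=> x y _ ye; apply: h; rewrite subr0.
Qed.

Lemma mUV_diff U V w : differentiable U w -> differentiable V w -> differentiable (mUV U V) w.
Proof.
move=> dU dV; apply: differentiable_pair; apply: differentiableM;
  [exact: diff_fst|exact: dU|exact: diff_snd|exact: dV].
Qed.

Lemma mUV0 U V : mUV U V O2 = O2.
Proof. by rewrite /mUV !mul0r. Qed.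

Lemma mUV_near U V (Q : set (C * C)) : hol0 U -> hol0 V -> nbhs O2 Q -> nbhs O2 [set w | Q (mUV U V w)].
Proof.
move=> hU hV hQ; have dm := mUV_diff (nbhs_singleton hU) (nbhs_singleton hV).
have hQ' : nbhs (mUV U V O2) Q by rewrite mUV0.
exact: (differentiable_continuous dm hQ').
Qed.

Lemma hol0_neq0 U : U O2 != 0 -> hol0 U -> \forall w \near O2, U w != 0.
Proof.
move=> U0 hU; have h := nbhs_neq0 U0.
exact: (differentiable_continuous (nbhs_singleton hU) h).
Qed.

Lemma hol0_mul U V : hol0 U -> hol0 V -> hol0 (fun w => U w * V w).
Proof. by apply: filterS2 => w dU dV; apply: differentiableM; [exact: dU|exact: dV]. Qed.

Lemma hol0_inv U : U O2 != 0 -> hol0 U -> hol0 (fun w => (U w)^-1).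
Proof.
move=> U0 hU; apply: filterS2 (hol0_neq0 U0 hU) hU => w w0 dU.
by apply: differentiableV; [exact: dU|exact: w0].
Qed.

Lemma hol0_comp U V W : hol0 U -> hol0 V -> hol0 W -> hol0 (fun w => W (mUV U V w)).
Proof.
move=> hU hV hW; apply: filterS3 hU hV (mUV_near hU hV hW) => w dU dV dW.
exact: (@differentiable_comp _ _ _ _ (mUV U V) W _ (mUV_diff dU dV) dW).
Qed.

Lemma hol0_fst (A : C -> C) : (\forall x \near (0 : C), differentiable A x) -> hol0 (fun w => A w.1).
Proof.
move=> hA; apply: filterS (fst_near hA) => w dA.
exact: (@differentiable_comp _ _ _ _ fst A _ (diff_fst w) dA).
Qed.

Lemma hol0_snd (A : C -> C) : (\forall x \near (0 : C), differentiable A x) -> hol0 (fun w => A w.2).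
Proof.
move=> hA; apply: filterS (snd_near hA) => w dA.
exact: (@differentiable_comp _ _ _ _ snd A _ (diff_snd w) dA).
Qed.

Lemma near0_axis (Q : set (C * C)) : nbhs O2 Q -> nbhs (0 : C) [set x | Q (x, 0)].
Proof.
move=> /near0P[e e0 h]; apply/nbhsCP; exists e => // x; rewrite subr0 => xe.
by apply: h => //; rewrite nm0.
Qed.

Lemma cancel1 h : hol0 h -> (\forall w \near O2, w.1 * h w = 0) -> \forall w \near O2, h w = 0.
Proof.
move=> hh hw; have h12 : \forall w \near O2, differentiable h w /\ w.1 * h w = 0 by exact: (filterI hh hw).
move: h12 => /near0P[e e0 he]; apply/near0P; exists e => // x y xe ye.
have H z : nm z < e -> z != 0 -> h (z, y) = 0.
  by move=> ze z0; have [_ /= /eqP] := he z y ze ye; rewrite mulf_eq0 (negPf z0) => /eqP.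
have [x0|] := eqVneq x 0; last exact: H.
rewrite x0; apply/eqP; rewrite -nm_eq0 eq_le nm_ge0 andbT.
apply: (@lim_le R (fun z => h (z, y)) 0 e e0).
  have [d _] := he 0 y (ltac:(by rewrite nm0)) ye.
  by apply: differentiable_continuous; apply: diff_slice1.
by move=> z /andP[z0 ze]; rewrite H ?nm0// -nm_gt0.
Qed.

Lemma swap_near (Q : set (C * C)) : nbhs O2 Q -> nbhs O2 [set w | Q (w.2, w.1)].
Proof. by move=> /near0P[e e0 h]; apply/near0P; exists e => // x y xe ye; apply: h. Qed.

Lemma diff_swap U w : differentiable U (w.2, w.1) -> differentiable (fun w => U (w.2, w.1)) w.
Proof.
move=> d; apply: (@differentiable_comp _ _ _ _ (fun w : C * C => (w.2, w.1)) U); last exact: d.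
by apply: differentiable_pair; [exact: diff_snd|exact: diff_fst].
Qed.

Lemma hol0_swap U : hol0 U -> hol0 (fun w => U (w.2, w.1)).
Proof. by move=> /swap_near; apply: filterS => w; exact: diff_swap. Qed.

Lemma cancel2 h : hol0 h -> (\forall w \near O2, w.2 * h w = 0) -> \forall w \near O2, h w = 0.
Proof.
move=> hh hw; have := swap_near (cancel1 (hol0_swap hh) (swap_near hw)).
by apply: filterS => -[x y].
Qed.

Lemma div_germ1 U : hol0 U -> (\forall w \near O2, U (0, w.2) = 0) ->
  exists2 V, hol0 V & \forall w \near O2, U w = w.1 * V w.
Proof.
move=> hU h0; have h12 : \forall w \near O2, differentiable U w /\ U (0, w.2) = 0 by exact: (filterI hU h0).
move: h12 => /near0P[e e0 he].
have [|| v [r [r0 re dv hv]]] := @division R U e e0.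
- by move=> x y xe ye; have [] := he x y xe ye.
- by move=> y ye; have [_] := he 0 y (ltac:(by rewrite nm0)) ye.
by exists v; apply/near0P; exists r.
Qed.

Lemma div_germ2 U : hol0 U -> (\forall w \near O2, U (w.1, 0) = 0) ->
  exists2 V, hol0 V & \forall w \near O2, U w = w.2 * V w.
Proof.
move=> hU h0; have [||V hV hE] := @div_germ1 (fun w => U (w.2, w.1)).
- exact: hol0_swap.
- by have := swap_near h0; apply: filterS.
exists (fun w => V (w.2, w.1)); first exact: hol0_swap.
by have := swap_near hE; apply: filterS => -[x y].
Qed.

Lemma vanish_bound U : hol0 U -> (\forall w \near O2, U (w.1, 0) = 1) ->
  exists2 K, 0 <= K & \forall w \near O2, nm (U w - 1) <= K * nm w.2.
Proof.
move=> hU h1; have [||V hV hE] := @div_germ2 (fun w => U w - 1).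
- by apply: filterS hU => w d; apply: differentiableB; [exact: d|exact: differentiable_cst].
- by apply: filterS h1 => w /= ->; rewrite subrr.
exists (nm (V O2) + 1); first by rewrite addr_ge0 ?nm_ge0.
have /cvgCP cV := differentiable_continuous (nbhs_singleton hV).
have := cV _ ltr01; apply: filterS2 hE => w -> /= Vw.
rewrite nmM mulrC ler_wpM2r ?nm_ge0//; have := nm_lb (V w) (V O2); lra.
Qed.

Lemma limit1 U : hol0 U -> (forall e, 0 < e -> exists2 r, 0 < r & forall h, 0 < nm h < r -> nm (U (h, 0) - 1) <= e) -> U O2 = 1.
Proof.
move=> hU hl; apply/eqP; rewrite -subr_eq0 -nm_eq0 eq_le nm_ge0 andbT; apply/ler_addgt0Pr => e e0; rewrite add0r.
have [r r0 hr] := hl e e0; apply: (@lim_le R (fun z => U (z, 0) - 1) e r r0); last exact: hr.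
apply: differentiable_continuous; apply: differentiableB; last exact: differentiable_cst.
by apply: diff_slice1; exact: nbhs_singleton hU.
Qed.

Definition invUV U V U' V' := \forall w \near O2, mUV U' V' (mUV U V w) = w.

Lemma inv_units U V U' V' : hol0 U -> hol0 V -> hol0 U' -> hol0 V' -> invUV U V U' V' ->
  \forall w \near O2, U w * U' (mUV U V w) = 1 /\ V w * V' (mUV U V w) = 1.
Proof.
move=> hU hV hU' hV' hi.
have h1 : \forall w \near O2, U w * U' (mUV U V w) - 1 = 0.
  apply: cancel1.
    apply: filterS (hol0_mul hU (hol0_comp hU hV hU')) => w d.
    by apply: differentiableB; [exact: d|exact: differentiable_cst].
  by apply: filterS hi => -[x y] [e _]; rewrite /= mulrBr mulr1 mulrA; apply/eqP; rewrite subr_eq0; apply/eqP.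
have h2 : \forall w \near O2, V w * V' (mUV U V w) - 1 = 0.
  apply: cancel2.
    apply: filterS (hol0_mul hV (hol0_comp hU hV hV')) => w d.
    by apply: differentiableB; [exact: d|exact: differentiable_cst].
  by apply: filterS hi => -[x y] [_ e]; rewrite /= mulrBr mulr1 mulrA; apply/eqP; rewrite subr_eq0; apply/eqP.
apply: filterS2 h1 h2 => w /eqP e1 /eqP e2; move: e1 e2; rewrite !subr_eq0 => /eqP -> /eqP ->.
by [].
Qed.

Lemma normal_swp i w : normal_part i (swp i w) = w.1 /\ normal_part (i + 1) (swp i w) = w.2.
Proof. by move: i; apply: Z4P. Qed.

Lemma normal_kap_nbhs i (Q : set P) : nbhs (corner R i) Q <-> nbhs O2 (Q \o kap i).
Proof. by rewrite -kap0; exact: nbhs_kap. Qed.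

Lemma corner_dom i : wdom i (corner R i) /\ wdom (i + 1) (corner R i).
Proof. by rewrite -kap0; exact: kap_dom. Qed.

Lemma near_dom i (f : P -> P) : {for corner R i, continuous f} -> f (corner R i) = corner R i ->
  \forall w \near O2, wdom i (f (kap i w)) /\ wdom (i + 1) (f (kap i w)).
Proof.
move=> cf fc; have [h1 h2] := corner_dom i.
have n1 : nbhs (corner R i) [set q | wdom i q /\ setT (wc i q)] by apply: wdom_near; [exact: h1|exact: filterT].
have n2 : nbhs (corner R i) [set q | wdom (i + 1) q /\ setT (wc (i + 1) q)] by apply: wdom_near; [exact: h2|exact: filterT].
have n : nbhs (f (corner R i)) [set p | wdom i p /\ wdom (i + 1) p].
  by rewrite fc; apply: filterS2 n1 n2 => p [p1 _] [p2 _].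
by have /normal_kap_nbhs := cf _ n.
Qed.

Lemma corner_chart_germ i (f : P -> P) : nbhs (corner R i) [set p | holoP f p] -> f (corner R i) = corner R i ->
  [/\ hol0 (fun w => (kch i f w).1), hol0 (fun w => (kch i f w).2),
    \forall w \near O2, f (kap i w) = kap i (kch i f w) & kch i f O2 = O2].
Proof.
move=> hf fc; have [cf _] := nbhs_singleton hf; have nd := near_dom cf fc.
move: hf => /normal_kap_nbhs hf.
have dk : \forall w \near O2, differentiable (kch i f) w.
  by apply: filterS2 hf nd => w h [h1 h2]; apply: holo_kch.
split.
- by apply: filterS dk => w /diff_pairP[].
- by apply: filterS dk => w /diff_pairP[].
- by apply: filterS nd => w [h1 h2]; rewrite /kch kap_kco.
- by rewrite /kch kap0 fc -kap0 kco_kap.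
Qed.

(** Along the direction [v] the relevant component of [f] is [h * U (h, 0)], with derivative
    [U (0, 0)] at [h = 0]. *)
Lemma corner_unit1 i (f : P -> P) U j v :
  'd (in_charts (corner_chart R i) (corner_chart R i) f) O2 = id :> (C * C -> C * C) ->
  differentiable (in_charts (corner_chart R i) (corner_chart R i) f) O2 -> hol0 U ->
  in_charts (corner_chart R i) (corner_chart R i) f O2 = O2 -> normal_part j v = 1 ->
  (\forall h \near (0 : C), normal_part j (in_charts (corner_chart R i) (corner_chart R i) f (aline O2 v h)) = h * U (h, 0)) ->
  U O2 = 1.
Proof.
move=> did df hU f0 v1 hE; apply: (limit1 hU) => e e0.
have [r r0 hr] := slice_eps j v df e0; have /nbhsCP[r' r'0 hr'] := hE.
exists (Num.min r r'); first by rewrite lt_min r0.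
move=> h /andP[h0]; rewrite lt_min => /andP[h1 h2].
have := hr h h1; rewrite hr' ?subr0// f0 did v1 mul1r.
have -> : normal_part j O2 = 0 by rewrite /normal_part; case: odd.
have alg (a b : C) : a * b - a = a * (b - 1) by ring.
by rewrite subr0 alg nmM mulrC ler_pM2r.
Qed.

(** Preservation of the two branches lets [div_germ1] and [div_germ2] factor the components. The
    inverse germ preserves the branches because the units of [f] do not vanish. *)
Lemma corner_germs i (f : P -> P) : Diff1_corner i f -> exists U V U' V',
  [/\ cg U V, cg U' V', \forall w \near O2, f (kap i w) = kap i (mUV U V w),
    invUV U V U' V' & invUV U' V' U V].
Proof.
move=> [[g [[hf hg] fc gc gf]] hl did].
have {}hf : nbhs (corner R i) [set p | holoP f p] by exact: hf.
have {}hg : nbhs (corner R i) [set p | holoP g p] by exact: hg.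
have {}fc : f (corner R i) = corner R i by apply: fc; exists (corner R i).
have {}gc : g (corner R i) = corner R i by apply: gc; exists (corner R i).
have {}gf : nbhs O2 [set w | g (f (kap i w)) = kap i w /\ f (g (kap i w)) = kap i w].
  by apply/(normal_kap_nbhs i [set p | g (f p) = p /\ f (g p) = p]); exact: gf.
have {}hl : nbhs O2 [set w | (line i (kap i w) -> line i (f (kap i w))) /\ (line (i + 1) (kap i w) -> line (i + 1) (f (kap i w)))].
  by apply/(normal_kap_nbhs i [set p | (line i p -> line i (f p)) /\ (line (i + 1) p -> line (i + 1) (f p))]); exact: hl.
have [f1 f2 fE f0] := corner_chart_germ hf fc.
have [g1 g2 gE g0] := corner_chart_germ hg gc.
have ax1 (Q : set (C * C)) : nbhs O2 Q -> nbhs O2 [set w | Q (0, w.2)].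
  by move=> /near0P[e e0 h]; apply/near0P; exists e => // x y _ ye; apply: h; rewrite ?nm0.
have ax2 (Q : set (C * C)) : nbhs O2 Q -> nbhs O2 [set w | Q (w.1, 0)].
  by move=> /near0P[e e0 h]; apply/near0P; exists e => // x y xe _; apply: h; rewrite ?nm0.
have fl1 : \forall w \near O2, (kch i f (0, w.2)).1 = 0.
  apply: filterS (ax1 _ hl) => w [h _]; have /lineE[_ //] : line i (f (kap i (0, w.2))).
  by apply: h; apply/lineE; split; [exact: (kap_dom i _).1|exact: (wc_kap i _).1].
have fl2 : \forall w \near O2, (kch i f (w.1, 0)).2 = 0.
  apply: filterS (ax2 _ hl) => w [_ h]; have /lineE[_ //] : line (i + 1) (f (kap i (w.1, 0))).
  by apply: h; apply/lineE; split; [exact: (kap_dom i _).2|exact: (wc_kap i _).2].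
have [U hU UE] := div_germ1 f1 fl1; have [V hV VE] := div_germ2 f2 fl2.
have fm : \forall w \near O2, kch i f w = mUV U V w.
  by apply: filterS2 UE VE => w e1 e2; rewrite /mUV -e1 -e2 -surjective_pairing.
have df : differentiable (in_charts (corner_chart R i) (corner_chart R i) f) O2.
  rewrite kchE; apply: diff_swp; rewrite (_ : swp i O2 = O2); last by rewrite /swp; case: odd.
  by apply/diff_pairP; split; [exact: nbhs_singleton f1|exact: nbhs_singleton f2].
have s0 : swp i O2 = O2 by rewrite /swp; case: odd.
have fi0 : in_charts (corner_chart R i) (corner_chart R i) f O2 = O2 by rewrite kchE /= s0 f0 s0.
have al (v : C * C) h : aline O2 (swp i v) h = swp i (h * v.1, h * v.2).
  by rewrite /aline /swp; case: odd; rewrite /= !add0r.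
have U1 : U O2 = 1.
  apply: (@corner_unit1 i f U i (swp i (1, 0)) did df hU fi0); first by have [] := normal_swp i (1, 0).
  apply: filterS (near0_axis fm) => h e; rewrite al kchE /= !swpK mulr1 mulr0 e.
  by have [-> _] := normal_swp i (mUV U V (h, 0)).
have V1 : V O2 = 1.
  apply: (@corner_unit1 i f (fun w => V (w.2, w.1)) (i + 1) (swp i (0, 1)) did df (hol0_swap hV) fi0); first by have [] := normal_swp i (0, 1).
  apply: filterS (near0_axis (swap_near fm)) => h e; rewrite al kchE /= !swpK mulr1 mulr0 e.
  by have [_ ->] := normal_swp i (mUV U V (0, h)).
have U0 := hol0_neq0 (ltac:(by rewrite U1 oner_neq0) : U O2 != 0) hU.
have V0 := hol0_neq0 (ltac:(by rewrite V1 oner_neq0) : V O2 != 0) hV.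
have gn (Q : set (C * C)) : nbhs O2 Q -> nbhs O2 [set w | Q (kch i g w)].
  move=> hQ; have d : differentiable (kch i g) O2.
    by apply/diff_pairP; split; [exact: nbhs_singleton g1|exact: nbhs_singleton g2].
  have hQ' : nbhs (kch i g O2) Q by rewrite g0.
  exact: (differentiable_continuous d hQ').
have fg : \forall w \near O2, mUV U V (kch i g w) = w.
  apply: filterS3 gf gE (filterI (gn _ fE) (gn _ fm)) => w [_ e1] e2 [e3 e4].
  by rewrite -e4 -(kco_kap i (kch i f _)) -e3 -e2 e1 kco_kap.
have gl1 : \forall w \near O2, (kch i g (0, w.2)).1 = 0.
  apply: filterS2 (ax1 _ fg) (ax1 _ (gn _ U0)) => w [/eqP + _] h0.
  by rewrite mulf_eq0 (negPf h0) orbF => /eqP.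
have gl2 : \forall w \near O2, (kch i g (w.1, 0)).2 = 0.
  apply: filterS2 (ax2 _ fg) (ax2 _ (gn _ V0)) => w [_ /eqP +] h0.
  by rewrite mulf_eq0 (negPf h0) orbF => /eqP.
have [U' hU' UE'] := div_germ1 g1 gl1; have [V' hV' VE'] := div_germ2 g2 gl2.
have gm : \forall w \near O2, kch i g w = mUV U' V' w.
  by apply: filterS2 UE' VE' => w e1 e2; rewrite /mUV -e1 -e2 -surjective_pairing.
have i1 : invUV U' V' U V by apply: filterS2 fg gm => w + <-.
have i2 : invUV U V U' V'.
  apply: filterS3 gf fE (filterI (filterI fm (mUV_near hU hV gE)) (mUV_near hU hV gm)) => w [e1 _] e2 [[e3 e4] e5].
  by rewrite -e5 -(kco_kap i (kch i g _)) -e4 -e3 -e2 e1 kco_kap.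
have [u1 v1] := nbhs_singleton (inv_units hU' hV' hU hV i1).
rewrite mUV0 U1 mulr1 in u1; rewrite mUV0 V1 mulr1 in v1.
exists U, V, U', V'; split=> //.
by apply: filterS2 fE fm => w -> ->.
Qed.

Lemma normal_inj i w w' : normal_part i w = normal_part i w' -> normal_part (i + 1) w = normal_part (i + 1) w' -> w = w'.
Proof. by move: i; apply: Z4P; case: w w' => [x y] [x' y']; rewrite /normal_part /= => -> ->. Qed.

Lemma corner_build i U V U' V' : cg U V -> cg U' V' -> invUV U V U' V' -> invUV U' V' U V ->
  Diff1_corner i (fun p => kap i (mUV U V (kco i p))).
Proof.
move=> [U0 V0 hU hV] [U'0 V'0 hU' hV'] i1 i2; set f := fun p => _.
have holo X Y : hol0 X -> hol0 Y -> nbhs (corner R i) [set p | holoP (fun p => kap i (mUV X Y (kco i p))) p].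
  move=> hX hY; apply/normal_kap_nbhs; apply: filterS2 hX hY => w dX dY.
  apply: kch_holo; last by apply: filterS filterT => v _; exact: kap_dom.
  rewrite (_ : kch i _ = mUV X Y); first exact: mUV_diff.
  by apply/funext => v; rewrite /kch !kco_kap.
have fixc X Y : (fun p => kap i (mUV X Y (kco i p))) @` [set corner R i] `<=` [set corner R i].
  by move=> _ [p /= -> <-]; rewrite -kap0 kco_kap mUV0.
split.
- exists (fun p => kap i (mUV U' V' (kco i p))); split.
  + by split=> p /= ->; apply: holo.
  + exact: fixc.
  + exact: fixc.
  move=> p /= ->; apply/normal_kap_nbhs; apply: filterS2 i1 i2 => w e1 e2 /=.
  by rewrite /f !kco_kap e1 e2.
- move=> p /= ->; apply: filterS filterT => q _; split=> /lineE[_ e]; apply/lineE.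
    by split; [exact: (kap_dom i _).1|rewrite (wc_kap i _).1 /= e mul0r].
  by split; [exact: (kap_dom i _).2|rewrite (wc_kap i _).2 /= e mul0r].
have s0 : swp i O2 = O2 by rewrite /swp; case: odd.
have kE : kch i f = mUV U V by apply/funext => v; rewrite /kch /f !kco_kap.
have dG : differentiable (in_charts (corner_chart R i) (corner_chart R i) f) O2.
  by rewrite kchE; apply: diff_swp; rewrite s0 kE; apply: mUV_diff; [exact: nbhs_singleton hU|exact: nbhs_singleton hV].
have key j X v : hol0 X -> X O2 = 1 ->
   (forall w, normal_part j (swp i (mUV U V w)) = normal_part j (swp i w) * X w) ->
   normal_part j ('d (in_charts (corner_chart R i) (corner_chart R i) f) O2 v) = normal_part j v.
  move=> hX X1 hE; apply: (slice_unique dG) => e e0.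
  pose M := nm (normal_part j v) + 1; have M0 : 0 < M by rewrite ltr_wpDl// nm_ge0.
  have /cvgCP cX := differentiable_continuous (nbhs_singleton hX).
  have /near0P[r r0 hr] := cX _ (divr_gt0 e0 M0).
  pose Q := nm v.1 + nm v.2 + 1; have Q0 : 0 < Q by rewrite ltr_wpDl// addr_ge0 ?nm_ge0.
  exists (r / Q); first by rewrite divr_gt0.
  move=> h; rewrite ltr_pdivlMr// => hh.
  have -> : aline O2 v h = (h * v.1, h * v.2) by rewrite /aline !add0r.
  have n0 : normal_part j O2 = 0 by rewrite /normal_part; case: odd.
  have nh : normal_part j (h * v.1, h * v.2) = h * normal_part j v by rewrite /normal_part; case: odd.
  rewrite kchE /= kE !hE !swpK s0 n0 mul0r subr0 nh mulrAC.
  have -> (a b c : C) : a * b * c - c * a = c * a * (b - 1) by ring.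
  have := hr (swp i (h * v.1, h * v.2)).1 (swp i (h * v.1, h * v.2)).2.
  rewrite -surjective_pairing /= X1 => Xh.
  have b1 : nm (h * v.1) < r by rewrite nmM (le_lt_trans _ hh)// ler_wpM2l ?nm_ge0// /Q; have := nm_ge0 v.2; lra.
  have b2 : nm (h * v.2) < r by rewrite nmM (le_lt_trans _ hh)// ler_wpM2l ?nm_ge0// /Q; have := nm_ge0 v.1; lra.
  have {}Xh : nm (X (swp i (h * v.1, h * v.2)) - 1) < e / M.
    by apply: Xh; rewrite /swp; case: odd.
  rewrite nmM nmM mulrAC ler_wpM2r ?nm_ge0//.
  apply: (le_trans (ler_pM (nm_ge0 _) (nm_ge0 _) (_ : _ <= M) (ltW Xh))); first by rewrite /M lerDl.
  by rewrite mulrC divfK// lt0r_neq0.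
apply/funext => v.
have k1 := @key i U v hU U0 (fun w => ltac:(by rewrite !(normal_swp i _).1)).
have k2 := @key (i + 1) V v hV V0 (fun w => ltac:(by rewrite !(normal_swp i _).2)).
exact: (normal_inj k1 k2).
Qed.

(** The transition at corner [i] is modified by the corrections of index [i] and [i + 1]. The latter
    is the identity on [w_{i+1} = 0], so the former can be chosen for each [i] independently to
    normalize the transition there. *)
Lemma normal_form (phi : 'Z_4 -> P -> P) : is_cocycle phi ->
  exists (A B A' B' : 'Z_4 -> C -> C) (u v : 'Z_4 -> C * C -> C),
  [/\ forall i, [/\ germ1 (A i), germ1 (B i), germ1 (A' i) & germ1 (B' i)],
      forall i, invgerm (A i) (B i) (A' i) (B' i) /\ invgerm (A' i) (B' i) (A i) (B i),
      is_cocycle (fun i p => kap i (mUV (u i) (v i) (kco i p))),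
      forall i, [/\ cg (u i) (v i), \forall w \near O2, u i (w.1, 0) = 1 & \forall w \near O2, v i (w.1, 0) = 1]
    & forall i, \forall p \near corner R i,
        kap i (mUV (u i) (v i) (kco i (Nmap (i + 1) (A' (i + 1)) (B' (i + 1)) p))) = Nmap i (A' i) (B' i) (phi i p)].
Proof.
move=> hphi; have /choice[D hD] : forall i, exists D : (C * C -> C) * (C * C -> C) * (C * C -> C) * (C * C -> C),
    [/\ cg D.1.1.1 D.1.1.2, cg D.1.2 D.2, \forall w \near O2, phi i (kap i w) = kap i (mUV D.1.1.1 D.1.1.2 w),
    invUV D.1.1.1 D.1.1.2 D.1.2 D.2 & invUV D.1.2 D.2 D.1.1.1 D.1.1.2].
  by move=> i; have [U [V [U' [V' h]]]] := corner_germs (hphi i); exists (U, V, U', V').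
pose U i := (D i).1.1.1; pose V i := (D i).1.1.2; pose U' i := (D i).1.2; pose V' i := (D i).2.
have {}hD i : [/\ cg (U i) (V i), cg (U' i) (V' i), \forall w \near O2, phi i (kap i w) = kap i (mUV (U i) (V i) w),
    invUV (U i) (V i) (U' i) (V' i) & invUV (U' i) (V' i) (U i) (V i)] := hD i.
pose A i x := U i (x, 0); pose B i x := V i (x, 0); pose A' i x := U' i (x, 0); pose B' i x := V' i (x, 0).
have ga X : X O2 = 1 -> hol0 X -> germ1 (fun x => X (x, 0)).
  by move=> X1 hX; split=> //; apply: filterS (near0_axis hX) => x; exact: diff_slice1.
have gs i : [/\ germ1 (A i), germ1 (B i), germ1 (A' i) & germ1 (B' i)].
  by have [[? ? ? ?] [? ? ? ?] _ _ _] := hD i; split; apply: ga.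
have iv i : invgerm (A i) (B i) (A' i) (B' i) /\ invgerm (A' i) (B' i) (A i) (B i).
  have [[U0 V0 hU hV] [U'0 V'0 hU' hV'] _ i1 i2] := hD i.
  have j1 := near0_axis (inv_units hU hV hU' hV' i1).
  have j2 := near0_axis (inv_units hU' hV' hU hV i2).
  by split; [apply: filterS j1|apply: filterS j2] => x; rewrite /mUV /= mul0r.
(* Composition at the level of units, [X] being applied first. *)
pose cmp (X Y : (C * C -> C) * (C * C -> C)) : (C * C -> C) * (C * C -> C) :=
  (fun w => X.1 w * Y.1 (mUV X.1 X.2 w), fun w => X.2 w * Y.2 (mUV X.1 X.2 w)).
have cmpE X Y w : mUV (cmp X Y).1 (cmp X Y).2 w = mUV Y.1 Y.2 (mUV X.1 X.2 w).
  by rewrite /mUV /= !mulrA.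
have cgc X Y : cg X.1 X.2 -> cg Y.1 Y.2 -> cg (cmp X Y).1 (cmp X Y).2.
  move=> [a1 a2 a3 a4] [b1 b2 b3 b4]; split=> /=; rewrite ?mUV0 ?a1 ?a2 ?b1 ?b2 ?mulr1//.
    by apply: hol0_mul => //; apply: hol0_comp.
  by apply: hol0_mul => //; apply: hol0_comp.
have invc X Y X' Y' : cg X.1 X.2 -> invUV X.1 X.2 X'.1 X'.2 -> invUV Y.1 Y.2 Y'.1 Y'.2 ->
   invUV (cmp X Y).1 (cmp X Y).2 (cmp Y' X').1 (cmp Y' X').2.
  move=> [_ _ a1 a2] h1 h2; apply: filterS2 h1 (mUV_near a1 a2 h2) => w e1 e2.
  by rewrite !cmpE e2.
(* [N i] and [N' i] act near corner [i], [M i] and [M' i] are the maps of index [i + 1] near the same corner. *)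
pose N i : (C * C -> C) * (C * C -> C) := (fun w => A i w.1, fun w => B i w.1).
pose N' i : (C * C -> C) * (C * C -> C) := (fun w => A' i w.1, fun w => B' i w.1).
pose M i : (C * C -> C) * (C * C -> C) := (fun w => (B (i + 1) w.2)^-1, fun w => A (i + 1) w.2).
pose M' i : (C * C -> C) * (C * C -> C) := (fun w => (B' (i + 1) w.2)^-1, fun w => A' (i + 1) w.2).
pose Fi i : (C * C -> C) * (C * C -> C) := (U i, V i).
pose Fi' i : (C * C -> C) * (C * C -> C) := (U' i, V' i).
have cgF i : cg (Fi i).1 (Fi i).2 by have [] := hD i.
have cgF' i : cg (Fi' i).1 (Fi' i).2 by have [] := hD i.
have cgN i : cg (N i).1 (N i).2.
  by have [[? ?] [? ?] _ _] := gs i; split=> //; exact: hol0_fst.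
have cgN' i : cg (N' i).1 (N' i).2.
  by have [_ _ [? ?] [? ?]] := gs i; split=> //; exact: hol0_fst.
have cgM i : cg (M i).1 (M i).2.
  have [[? ?] [b1 b2] _ _] := gs (i + 1); split=> //=; first by rewrite b1 invr1.
    by apply: hol0_inv; rewrite /= ?b1 ?oner_neq0//; exact: hol0_snd.
  exact: hol0_snd.
have cgM' i : cg (M' i).1 (M' i).2.
  have [_ _ [? ?] [b1 b2]] := gs (i + 1); split=> //=; first by rewrite b1 invr1.
    by apply: hol0_inv; rewrite /= ?b1 ?oner_neq0//; exact: hol0_snd.
  exact: hol0_snd.
have iN i : invUV (N i).1 (N i).2 (N' i).1 (N' i).2.
  by apply: filterS (fst_near (iv i).1) => -[x y] [/= e1 e2]; rewrite /mUV /= -!mulrA e1 e2 !mulr1.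
have iN' i : invUV (N' i).1 (N' i).2 (N i).1 (N i).2.
  by apply: filterS (fst_near (iv i).2) => -[x y] [/= e1 e2]; rewrite /mUV /= -!mulrA e1 e2 !mulr1.
have iM1 i : invUV (M i).1 (M i).2 (M' i).1 (M' i).2.
  by apply: filterS (snd_near (iv (i + 1)).1) => -[x y] [/= e1 e2]; rewrite /mUV /= -!mulrA -invfM e1 e2 invr1 !mulr1.
have iM2 i : invUV (M' i).1 (M' i).2 (M i).1 (M i).2.
  by apply: filterS (snd_near (iv (i + 1)).2) => -[x y] [/= e1 e2]; rewrite /mUV /= -!mulrA -invfM e1 e2 invr1 !mulr1.
have iF i : invUV (Fi i).1 (Fi i).2 (Fi' i).1 (Fi' i).2 by have [] := hD i.
have iF' i : invUV (Fi' i).1 (Fi' i).2 (Fi i).1 (Fi i).2 by have [] := hD i.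
(* Apply [M], the transition, then [N']: on [w_{i+1} = 0], [M] is the identity and [N'] undoes the
   multipliers [A], [B]. *)
pose uv i := cmp (cmp (M i) (Fi i)) (N' i); pose uv' i := cmp (N i) (cmp (Fi' i) (M' i)).
have cguv i : cg (uv i).1 (uv i).2 := (cgc (cmp (M i) (Fi i)) (N' i) (cgc (M i) (Fi i) (cgM i) (cgF i)) (cgN' i)).
have cguv' i : cg (uv' i).1 (uv' i).2 := cgc (N i) (cmp (Fi' i) (M' i)) (cgN i) (cgc (Fi' i) (M' i) (cgF' i) (cgM' i)).
exists A, B, A', B', (fun i => (uv i).1), (fun i => (uv i).2); split; [exact: gs|exact: iv| | |].
- move=> i; apply: (@corner_build i _ _ (uv' i).1 (uv' i).2); [exact: cguv|exact: cguv'| |].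
    exact: (invc (cmp (M i) (Fi i)) (N' i) (cmp (Fi' i) (M' i)) (N i) (cgc (M i) (Fi i) (cgM i) (cgF i)) (invc (M i) (Fi i) (M' i) (Fi' i) (cgM i) (iM1 i) (iF i)) (iN' i)).
  exact: (invc (N i) (cmp (Fi' i) (M' i)) (N' i) (cmp (M i) (Fi i)) (cgN i) (iN i) (invc (Fi' i) (M' i) (Fi i) (M i) (cgF' i) (iF' i) (iM2 i))).
- move=> i; have e1 (x : C) : mUV (M i).1 (M i).2 (x, 0) = (x, 0).
    by have [_ [b1 _] _ _] := gs (i + 1); rewrite /mUV /= b1 invr1 mulr1 mul0r.
  have [_ [b1 _] _ _] := gs (i + 1); have [[a1 _] _ _ _] := gs (i + 1).
  split; [exact: cguv| |]; apply: filterS (fst_near (iv i).1) => w [e2 e3].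
    by rewrite /uv /cmp /= e1 b1 invr1 mul1r; exact: e2.
  by rewrite /uv /cmp /= e1 a1 b1 invr1 !mul1r; exact: e3.
move=> i; apply/normal_kap_nbhs.
have [[U0 V0 hU hV] _ hphiE _ _] := hD i.
have [_ _ gA' gB'] := gs i; have [_ _ gA1 gB1] := gs (i + 1).
have m1 : \forall x \near (0 : C), A' (i + 1) x != 0 /\ B' (i + 1) x != 0 by exact: (filterI (germ1_near gA1) (germ1_near gB1)).
have m2 : \forall x \near (0 : C), A' i x != 0 /\ B' i x != 0 by exact: (filterI (germ1_near gA') (germ1_near gB')).
have n1 := snd_near m1; have n2 := mUV_near hU hV (fst_near m2).
apply: filterS3 (filterI n1 n2) (iM2 i) hphiE => w [[a1 b1] [a2 b2]] e1 e2.
rewrite /comp Nmap_kap_succ// kco_kap e2 Nmap_kap//; congr kap; rewrite /uv !cmpE.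
have -> : (w.1 / B' (i + 1) w.2, w.2 * A' (i + 1) w.2) = mUV (M' i).1 (M' i).2 w by [].
by rewrite e1.
Qed.

End CornerGerms.

(** * Sectors *)

Section Sectors.
Variables (R : realType) (varpi : R).
Local Notation C := (Cx R).
Implicit Types (i j : 'Z_4) (J : seq 'Z_4) (c d r K : R) (p q : C * C) (P Q : set (C * C)).

(** Equals [|xi|] times the sine of the angle from the lower end of [I_i]. Membership in a shrunk
    sector becomes the inequality [lam i xi > d |xi|] with [d = sin eps], stable under bounded moves
    of [xi]. *)
Definition lam i (xi : C) : R := iM (xi * cexp (ofR (- arc_start varpi i) * ii R)).

Definition Sec J c d r p : Prop :=
  [/\ p.2 != 0, r < nm p.2^-1, expR (- c) < nm p.1 < expR c
    & forall j, j \in J -> d * nm p.2^-1 < lam j p.2^-1].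

Definition SF J c d : set_system (C * C) := [set P | exists r, forall p, Sec J c d r p -> P p].

Global Instance SF_filter J c d : Filter (SF J c d).
Proof.
split; first by exists 0.
- move=> P Q [r1 h1] [r2 h2]; exists (Num.max r1 r2) => p [p0 pr pc pJ].
  by move: pr; rewrite gt_max => /andP[pr1 pr2]; split; [apply: h1|apply: h2].
- by move=> P Q PQ [r h]; exists r => p /h; exact: PQ.
Qed.

Definition Sect J P := forall c d, 0 < c -> 0 < d -> SF J c d P.

Lemma SF_mono J J' c c' d d' P : c <= c' -> d' <= d -> {subset J' <= J} -> SF J' c' d' P -> SF J c d P.
Proof.
move=> cc dd JJ [r h]; exists r => p [p0 pr /andP[pc1 pc2] pJ]; apply: h; split=> //.
  by rewrite (le_lt_trans _ pc1) ?(lt_le_trans pc2)// ler_expR ?lerN2.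
by move=> j /JJ /pJ; apply: le_lt_trans; rewrite ler_wpM2r ?nm_ge0.
Qed.

Lemma Sect_sub J J' P : {subset J' <= J} -> Sect J' P -> Sect J P.
Proof. by move=> JJ h c d c0 d0; apply: SF_mono (h c d c0 d0). Qed.

Lemma SectS J P Q : (forall p, P p -> Q p) -> Sect J P -> Sect J Q.
Proof. by move=> PQ h c d c0 d0; apply: filterS (h c d c0 d0). Qed.

Lemma SectI J P Q : Sect J P -> Sect J Q -> Sect J (fun p => P p /\ Q p).
Proof. by move=> h1 h2 c d c0 d0; apply: filterI; [exact: h1|exact: h2]. Qed.

Lemma SF_far J c d K : SF J c d [set p | [/\ p.2 != 0, K < nm p.2^-1 & expR (- c) < nm p.1 < expR c]].
Proof. by exists K => p []. Qed.

Lemma Sect_torus J : Sect J (@torus R).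
Proof.
move=> c d _ _; apply: filterS (SF_far J c d 0) => p [p0 _ /andP[h _]]; split=> //.
by rewrite -nm_gt0 (lt_trans _ h)// expR_gt0.
Qed.

Lemma SF_small J c d e : 0 < e -> SF J c d [set p | nm p.2 < e].
Proof.
move=> e0; apply: filterS (SF_far J c d e^-1) => p [p0 h _].
by rewrite nmV ltf_pV2 ?posrE ?nm_gt0 in h.
Qed.

Lemma lamD i x y : lam i (x + y) = lam i x + lam i y.
Proof. by rewrite /lam mulrDl iMD. Qed.

Lemma lam_le i x : `|lam i x| <= nm x.
Proof.
rewrite /lam (le_trans (iM_le _))// nmM nm_cexp.
by rewrite (_ : rE _ = 0) ?expR0 ?mulr1// rEM rE_ofR iM_ofR rE_ii mulr0 mul0r subr0.
Qed.

(** Such a map moves [xi] by a bounded amount and changes [|z|] by a bounded factor, so it sends the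
    far part of a shrunk sector into a slightly larger one: statements valid on sectors can be
    pulled back ([tame_Sect]). *)
Definition tame J (f : C * C -> C * C) := forall c d, 0 < c -> 0 < d -> exists2 K, 0 <= K &
  SF J c d [set p | [/\ (f p).2 != 0, nm ((f p).2^-1 - p.2^-1) <= K & expR (- K) * nm p.1 <= nm (f p).1 <= expR K * nm p.1]].

Lemma box_sec J c d K L r : 0 < d -> 0 <= K -> exists r', forall p q, Sec J c d r' p -> q.2 != 0 ->
  nm (q.2^-1 - p.2^-1) <= K -> expR (- L) * nm p.1 <= nm q.1 <= expR L * nm p.1 -> Sec J (c + L) (d / 2) r q.
Proof.
move=> d0 K0; exists (Num.max (r + K) (K * (2 / d + 1))) => p q [p0 pr /andP[pc1 pc2] pJ] q0 qp /andP[q1 q2].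
move: pr; rewrite gt_max => /andP[r1 r2]; have pq : nm (p.2^-1 - q.2^-1) <= K by rewrite nmC.
have h1 := nm_lb p.2^-1 q.2^-1; have h2 := nm_lb q.2^-1 p.2^-1.
split=> //; first by lra.
  by rewrite opprD !expRD mulrC (lt_le_trans _ q1) ?ltr_pM2l ?expR_gt0// (le_lt_trans q2)// mulrC ltr_pM2r ?expR_gt0.
move=> j /pJ hj; have : lam j q.2^-1 = lam j p.2^-1 + lam j (q.2^-1 - p.2^-1) by rewrite -lamD addrC subrK.
have := lam_le j (q.2^-1 - p.2^-1); rewrite ler_norml => /andP[l1 _] ->.
have r3 : K * 2 + K * d < d * nm p.2^-1.
  by rewrite [d * _]mulrC -ltr_pdivrMr// (le_lt_trans _ r2)// le_eqVlt; apply/orP; left; apply/eqP; have := lt0r_neq0 d0 => ?; field.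
have h3 : d * nm q.2^-1 <= d * nm p.2^-1 + K * d by rewrite mulrC -[K * d]mulrC [d * nm p.2^-1]mulrC -[d * K]mulrC -mulrDl ler_wpM2r ?(ltW d0)//; lra.
rewrite mulrAC; move: hj l1 r3 h3; set a := d * nm q.2^-1; set b := d * nm p.2^-1; set e := K * d; lra.
Qed.

Lemma tame_SF J f c d : tame J f -> 0 < c -> 0 < d -> exists2 c', c < c' & exists2 d', 0 < d' <= d &
  forall P, SF J c' d' P -> SF J c d (fun p => P (f p)).
Proof.
move=> tf c0 d0; have [K K0 hK] := tf c d c0 d0.
exists (c + (K + 1)); first by rewrite ltrDl ltr_wpDl.
exists (d / 2); first by rewrite divr_gt0//= ler_pdivrMr// ler_peMr ?(ltW d0)// ler1n.
move=> P [r hP]; have K1 : 0 <= K + 1 by rewrite addr_ge0.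
have [r' hr'] := @box_sec J c d (K + 1) (K + 1) r d0 K1.
have KK : K <= K + 1 by rewrite lerDl.
have hs : SF J c d (Sec J c d r') by exists r'.
apply: filterS2 hs hK => p hp [f0 f1 /andP[f2 f3]]; apply: hP; apply: hr' hp f0 (le_trans f1 KK) _.
by rewrite (le_trans _ f2) ?(le_trans f3)// ler_wpM2r ?nm_ge0// ler_expR ?lerN2.
Qed.

Lemma tame_Sect J f P : tame J f -> Sect J P -> Sect J (fun p => P (f p)).
Proof.
move=> tf hP c d c0 d0; have [c' cc [d' /andP[d'0 _] h]] := tame_SF tf c0 d0.
by apply: h; apply: hP => //; exact: lt_trans cc.
Qed.

Lemma tame_comp J f g : tame J f -> tame J g -> tame J (g \o f).
Proof.
move=> tf tg c d c0 d0; have [K K0 hK] := tf c d c0 d0.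
have [c' cc [d' /andP[d'0 _] h]] := tame_SF tf c0 d0.
have [L L0 hL] := tg c' d' (lt_trans c0 cc) d'0.
exists (K + L); first by rewrite addr_ge0.
apply: filterS2 hK (h _ hL) => p [f0 f1 /andP[f2 f3]] [g0 g1 /andP[g2 g3]]; split=> //=.
  by rewrite (le_trans (nm_subr _ (f p).2^-1 _))// addrC lerD.
rewrite opprD !expRD; apply/andP; split.
  by rewrite mulrAC (le_trans _ g2)// [leRHS]mulrC ler_pM2r ?expR_gt0.
by rewrite (le_trans g3)// mulrAC [leRHS]mulrC ler_pM2l ?expR_gt0.
Qed.

Lemma tame_sub J J' f : {subset J' <= J} -> tame J' f -> tame J f.
Proof.
move=> JJ tf c d c0 d0; have [K K0 h] := tf c d c0 d0; exists K => //.
by apply: SF_mono h.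
Qed.

(** The first-order shape shared by sectorial charts, lifts of automorphisms and [F]; it implies
    [tame]. *)
Definition close J (c0 : C) (f : C * C -> C * C) := forall c d, 0 < c -> 0 < d -> exists2 K, 0 <= K &
  SF J c d [set p | nm ((f p).1 - c0 * p.1) <= K * nm p.2 /\ nm ((f p).2 - p.2) <= K * nm p.2 ^+ 2].

Lemma close_bounds J (c0 : C) f c d : c0 != 0 -> close J c0 f -> 0 < c -> 0 < d -> exists2 K, 0 <= K &
  SF J c d [set p | [/\ (f p).2 != 0, nm ((f p).2^-1 - p.2^-1) <= K & nm ((f p).1 / (c0 * p.1) - 1) <= 4^-1]].
Proof.
move=> cn cf cp dp; have [K K0 hK] := cf c d cp dp.
have nc : 0 < nm c0 by rewrite nm_gt0.
pose e := Num.min (1 / (2 * (K + 1))) (nm c0 * expR (- c) / (4 * (K + 1))).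
have K1 : 0 < K + 1 by rewrite ltr_wpDl.
have e0 : 0 < e by rewrite lt_min !divr_gt0 ?mulr_gt0 ?expR_gt0.
exists (2 * K); first by rewrite mulr_ge0.
apply: filterS3 hK (SF_small J c d e0) (SF_far J c d 0) => p [h1 h2]; rewrite /= lt_min => /andP[e1 e2] [p0 _ /andP[p1 _]].
have np : 0 < nm p.2 by rewrite nm_gt0.
have z0 : 0 < nm p.1 by rewrite (lt_trans _ p1)// expR_gt0.
have z1 : p.1 != 0 by rewrite -nm_gt0.
have Ky : K * nm p.2 <= 2^-1.
  move: e1; rewrite ltr_pdivlMr ?mulr_gt0// => e1; nra.
have f2 : 2^-1 * nm p.2 <= nm (f p).2.
  have := nm_lb p.2 (f p).2; rewrite nmC; rewrite expr2 mulrA in h2; nra.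
have fn : 0 < nm (f p).2 by apply: lt_le_trans f2; rewrite mulr_gt0// invr_gt0.
have f0 : (f p).2 != 0 by rewrite -nm_gt0.
split=> //.
  have -> : (f p).2^-1 - p.2^-1 = (p.2 - (f p).2) / ((f p).2 * p.2) by field; rewrite p0 f0.
  rewrite nmM nmV nmM ler_pdivrMr ?mulr_gt0// nmC (le_trans h2)// expr2.
  move: K0 f2 np; set x := nm p.2; set y := nm (f p).2 => k0 hy hx.
  have : K * x * (2^-1 * x) <= K * x * y by apply: ler_wpM2l => //; rewrite mulr_ge0// ltW.
  lra.
have -> : (f p).1 / (c0 * p.1) - 1 = ((f p).1 - c0 * p.1) / (c0 * p.1) by field; rewrite cn z1.
rewrite nmM nmV nmM ler_pdivrMr ?mulr_gt0// (le_trans h1)//.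
move: e2; rewrite ltr_pdivlMr ?mulr_gt0// => e2.
have : nm c0 * expR (- c) <= nm c0 * nm p.1 by rewrite ler_pM2l// ltW.
nra.
Qed.

Lemma close_tame J (c0 : C) f : c0 != 0 -> close J c0 f -> tame J f.
Proof.
move=> cn cf c d cp dp; have [K K0 hK] := close_bounds cn cf cp dp.
have nc : 0 < nm c0 by rewrite nm_gt0.
(* The ratio of [(f p).1] to [c0 * p.1] has modulus in [[1/2, 2]], hence in [[e^-1, e]]; the
   logarithm accounts for [c0]. *)
pose L := K + 1 + `|ln (nm c0)|.
have L1 : K <= L by rewrite /L -addrA lerDl addr_ge0.
exists L; first exact: le_trans L1.
apply: filterS2 hK (SF_far J c d 0) => p [f0 f1 f2] [p0 _ /andP[p1 _]].
have z0 : 0 < nm p.1 by rewrite (lt_trans _ p1)// expR_gt0.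
have z1 : p.1 != 0 by rewrite -nm_gt0.
split=> //; first exact: le_trans L1.
pose q := (f p).1 / (c0 * p.1).
have fq : nm (f p).1 = nm q * nm c0 * nm p.1.
  by rewrite -!nmM /q; congr nm; field; rewrite cn z1.
have q1 : 2^-1 <= nm q by have := nm_lb 1 q; rewrite nm1 nmC -/q in f2 *; lra.
have q2 : nm q <= 2 by have := nm_lb q 1; rewrite nm1 -/q in f2 *; lra.
have e2 : 2 <= expR 1 :> R by have := expR_ge1Dx (1 : R); lra.
have el : expR (ln (nm c0)) = nm c0 by rewrite lnK.
have eL : expR 1 * nm c0 <= expR L.
  by rewrite -{1}el -expRD ler_expR /L; have := ler_norm (ln (nm c0)); lra.
have eL' : expR (- L) <= expR (- 1) * nm c0.
  by rewrite -{1}el -expRD ler_expR /L; have := ler_norm (- ln (nm c0)); rewrite normrN; lra.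
have e2' : expR (- 1) <= 2^-1 :> R by rewrite expRN lef_pV2 ?posrE ?expR_gt0.
rewrite fq !ler_pM2r//; apply/andP; split.
  by rewrite (le_trans eL')// ler_pM2r// (le_trans e2').
by rewrite (le_trans _ eL)// ler_pM2r// (le_trans q2).
Qed.

End Sectors.

Section Arcs.
Variables (R : realType) (varpi : R).
Local Notation C := (Cx R).
Local Notation lam := (lam varpi).
Local Notation Sect := (Sect varpi).

Lemma sin_homo (x y : R) : - (pi / 2) <= x -> x <= y -> y <= pi / 2 -> sin x <= sin y.
Proof.
move=> h1 h2 h3; have [->//|xy] := eqVneq x y.
have lxy : x < y by rewrite lt_neqAle xy.
by apply: ltW; rewrite ltr_sin// in_itv /=; apply/andP; split; lra.
Qed.

Lemma sin_near0 (eps th : R) : 0 < eps < pi / 2 -> eps < th < pi - eps -> sin eps < sin th.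
Proof.
move=> /andP[e0 e1] /andP[h1 h2]; have [th2|th2] := leP th (pi / 2).
  by rewrite ltr_sin// in_itv /=; apply/andP; split; lra.
have -> : sin th = sin (pi - th) by rewrite sinB sinpi cospi; ring.
by rewrite ltr_sin// ?in_itv /=; try (apply/andP; split); lra.
Qed.

Lemma sin_near0_conv (eps th : R) : 0 < eps < pi / 2 -> 0 <= th <= pi -> sin eps < sin th -> eps < th < pi - eps.
Proof.
move=> /andP[e0 e1] /andP[h1 h2] hs.
have mono (x y : R) : 0 <= x -> x <= y -> y <= pi / 2 -> sin x <= sin y.
  by move=> x0 xy y2; apply: sin_homo => //; lra.
apply/andP; split; rewrite ltNge; apply/negP => h.
  by have := mono th eps h1 h (ltW e1); lra.
have := mono (pi - th) eps; have -> : sin (pi - th) = sin th by rewrite sinB sinpi cospi; ring.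
have a1 : 0 <= pi - th by lra.
have a2 : pi - th <= eps by lra.
by move=> /(_ a1 a2 (ltW e1)); lra.
Qed.

Lemma lam_polar i (th t : R) : lam i (ofR t * cexp (ofR th * ii R)) = t * sin (th - arc_start varpi i).
Proof.
rewrite /lam -mulrA -cexpD -mulrDl -ofRD.
by have [h1 h2] := cexp_ii (th - arc_start varpi i); rewrite iMM rE_ofR iM_ofR mul0r addr0 h2.
Qed.

Lemma arc_lam i eps xi : 0 < eps < pi / 2 -> xi != 0 -> Defs.arc varpi i eps xi <-> sin eps * nm xi < lam i xi.
Proof.
move=> e01 x0; have n0 : 0 < nm xi by rewrite nm_gt0.
split.
  move=> [th [h1 h2 ->]]; rewrite nmE lam_polar nmM nm_ofR (gtr0_norm n0) nm_cexp.
  have -> : rE (ofR th * (0 +i* 1)%C) = 0 by rewrite rEM rE_ofR iM_ofR mul0r subr0 (rE_ii R) mulr0.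
  by rewrite expR0 mulr1 mulrC ltr_pM2l// sin_near0//; apply/andP; split; lra.
move=> h; set s := arc_start varpi i in h *.
pose u := xi / ofR (nm xi) * cexp (ofR (- s) * ii R).
have nn : ofR (nm xi) != 0 :> C by rewrite ofR_eq0 lt0r_neq0.
have iu : iM u = lam i xi / nm xi.
  have -> : u = ofR (nm xi)^-1 * (xi * cexp (ofR (- s) * ii R)) by rewrite /u ofRV; ring.
  by rewrite iMM rE_ofR iM_ofR mul0r addr0 mulrC.
have u1 : nm u = 1.
  rewrite /u nmM nmM nmV nm_ofR (gtr0_norm n0) mulfV ?lt0r_neq0// mul1r nm_cexp.
  by rewrite rEM rE_ofR iM_ofR rE_ii mulr0 mul0r subr0 expR0.
have iu' : sin eps < iM u by rewrite iu ltr_pdivlMr.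
have s0 : 0 < sin eps by case/andP: e01 => e0 e1; apply: sin_gt0_pi; rewrite e0 /=; have := pi_gt0 R; lra.
have uE := polar_up u1 (ltW (lt_trans s0 iu')).
have c1 : -1 <= rE u <= 1 by rewrite -ler_norml -u1 rE_le.
pose th := acos (rE u); have t0 : 0 <= th := acos_ge0 c1.
have tp : th <= pi := acos_lepi c1.
have st : sin th = iM u by rewrite uE; have [_ ->] := cexp_ii th.
have /andP[t1 t2] : eps < th < pi - eps by apply: sin_near0_conv => //; rewrite ?t0 ?st.
have h1 : s + eps < s + th by rewrite ltrD2l.
have h2 : s + th < s + pi - eps by rewrite -addrA ltrD2l.
exists (s + th); split; [exact: h1|exact: h2|].
rewrite nmE ofRD mulrDl cexpD.
have : xi = ofR (nm xi) * (u * cexp (ofR s * ii R)).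
  rewrite /u -mulrA -cexpD -mulrDl -ofRD addNr mul0r cexp0 mulr1.
  by rewrite mulrC divfK.
by move=> e; apply: (etrans e); congr (_ * _); rewrite {1}uE; exact: mulrC.
Qed.

Lemma arc_le i (e e' : R) xi : e' <= e -> Defs.arc varpi i e xi -> Defs.arc varpi i e' xi.
Proof. by move=> ee [th [h1 h2 h3]]; exists th; split => //; lra. Qed.

(** Passage between the angle [eps] and the slope [d], by sine and arcsine; both are first cut at
    1/2 to stay where the sine is monotone. *)
Lemma sectP (J : seq 'Z_4) (P : set (C * C)) :
  sectorially (fun eps => [set xi : C | forall j, j \in J -> Defs.arc varpi j eps xi]) P <-> Sect J P.
Proof.
have conv c r (p : C * C) : ofR r < `|p.2^-1| -> ofR (expR (- c)) < `|p.1| < ofR (expR c) ->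
   r < nm p.2^-1 /\ expR (- c) < nm p.1 < expR c.
  by rewrite !nmE !ofR_lt.
split=> h c d c0 d0.
  pose y := Num.min d 2^-1; have y0 : 0 < y by rewrite lt_min d0 invr_gt0 ltr0n.
  have y1 : y <= 2^-1 by rewrite ge_min lexx orbT.
  have yy : -1 <= y <= 1 by apply/andP; split; lra.
  have sy : sin (asin y) = y by rewrite asinK// in_itv.
  have a2 : asin y < pi / 2 by rewrite asin_ltpi2//; apply/andP; split; lra.
  have a0 : 0 < asin y.
    rewrite ltNge; apply/negP => a0; have : sin (asin y) <= sin 0.
      by have := asin_geNpi2 yy; have := pi_gt0 R => pp h1; apply: sin_homo => //; lra.
    by rewrite sin0 sy leNgt y0.
  have [r hr] := h c (asin y) c0 a0; exists r => p [p0 pr pc pJ]; apply: hr; split=> //.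
  - move=> j /pJ hj; apply/arc_lam; rewrite ?a0 ?invr_eq0// sy (le_lt_trans _ hj)// ler_wpM2r ?nm_ge0//.
    by rewrite ge_min lexx.
  - by rewrite nmE ofR_lt.
  - by rewrite nmE !ofR_lt.
pose e := Num.min d 2^-1; have e0 : 0 < e by rewrite lt_min d0 invr_gt0 ltr0n.
have e1 : e < pi / 2.
  have h1 : e <= 2^-1 by rewrite ge_min lexx orbT.
  by have := pihalf_ge1 R; lra.
have e01 : 0 < e < pi / 2 by rewrite e0.
have s0 : 0 < sin e by apply: sin_gt0_pi; rewrite e0 /=; have := pi_gt0 R; lra.
have [r hr] := h c (sin e) c0 s0; exists r => p [p0 pJ pr pc]; have [r1 r2] := conv _ _ _ pr pc.
apply: hr; split=> // j /pJ hj; apply/arc_lam; rewrite ?invr_eq0//.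
by apply: arc_le hj; rewrite ge_min lexx.
Qed.

Lemma sect1P i (P : set (C * C)) : sectorially (Defs.arc varpi i) P <-> Sect [:: i] P.
Proof.
rewrite -sectP (_ : Defs.arc varpi i = fun eps => [set xi : C | forall j, j \in [:: i] -> Defs.arc varpi j eps xi])//.
apply/funext => eps; apply/seteqP; split=> xi /= h; last by apply: h; rewrite inE.
by move=> j; rewrite inE => /eqP ->.
Qed.

Lemma sect2P i i' (P : set (C * C)) : sectorially (fun eps => Defs.arc varpi i eps `&` Defs.arc varpi i' eps) P <-> Sect [:: i; i'] P.
Proof.
rewrite -sectP (_ : (fun eps => Defs.arc varpi i eps `&` Defs.arc varpi i' eps) = fun eps => [set xi : C | forall j, j \in [:: i; i'] -> Defs.arc varpi j eps xi])//.
apply/funext => eps; apply/seteqP; split=> xi /= h.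
  by move=> j; rewrite !inE => /orP[] /eqP ->; case: h.
by split; apply: h; rewrite !inE eqxx ?orbT.
Qed.

End Arcs.

(** * Uniform estimates and asymptotic expansions on sectors *)

Section Uniform.
Variable R : realType.
Local Notation C := (Cx R).

Lemma compact_annulus (u v : R) : compact [set z : C | u <= nm z <= v].
Proof.
have cl : closed [set z : C | u <= nm z].
  rewrite -[X in closed X]setCK; apply: open_closedC; rewrite openE => z /= /negP; rewrite -ltNge => zu.
  apply/nbhsCP; exists (u - nm z); first by rewrite subr_gt0.
  move=> w wz /=; apply/negP; rewrite -ltNge; have := nm_lb w z; lra.
apply: (subclosed_compact _ (compact_disc (K := v))); last by move=> z /= /andP[].
have -> : [set z : C | u <= nm z <= v] = [set z : C | u <= nm z] `&` [set z : C | nm z <= v].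
  by apply/seteqP; split=> z /= => [/andP[]|[-> ->]].
by apply: closedI cl _; exact: closed_disc.
Qed.

Lemma compact_ball (w : C) (K : R) : compact [set z : C | nm (z - w) <= K].
Proof.
have cl : closed [set z : C | nm (z - w) <= K].
  rewrite -[X in closed X]setCK; apply: open_closedC; rewrite openE => z /= /negP; rewrite -ltNge => zu.
  apply/nbhsCP; exists (nm (z - w) - K); first by rewrite subr_gt0.
  move=> x xz /=; apply/negP; rewrite -ltNge; have := nm_subr z x w; rewrite (nmC z x); lra.
apply: (subclosed_compact cl (compact_disc (K := K + nm w))) => z /= zw.
have := nm_lb z w; lra.
Qed.

Lemma bigOy_loc k (h : C * C -> C) (z : C) : bigOy k h -> z != 0 -> exists K e : R, [/\ 0 <= K, 0 < e &
  forall p, nm (p.1 - z) < e -> nm p.2 < e -> nm (h p) <= K * nm p.2 ^+ k].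
Proof.
move=> hh z0; have [K /nbhsC2P[e e0 hK]] := hh z z0; exists `|rE K|, e; split=> // p p1 p2.
have := hK p p1; rewrite /= subr0 => /(_ p2); rewrite !nmE -ofRX.
rewrite lecE => /andP[_]; rewrite -!/(rE _) rE_ofR rEM rE_ofR iM_ofR mulr0 subr0 => hk.
by rewrite (le_trans hk)// ler_wpM2r ?ler_norm// exprn_ge0 ?nm_ge0.
Qed.

(** The constants of [bigOy] depend on [z]; compactness of the annulus makes them uniform. *)
Lemma bigOy_unif k (h : C * C -> C) (u v : R) : bigOy k h -> 0 < u -> exists K e : R, [/\ 0 <= K, 0 < e &
  forall p, u <= nm p.1 <= v -> nm p.2 < e -> nm (h p) <= K * nm p.2 ^+ k].
Proof.
move=> hh u0; have := @compact_annulus u v; rewrite compact_near_coveringP => cov.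
(* A single parameter, both constant and inverse radius, so that compactness can be applied to the
   filter [M -> +oo]. *)
pose Q (M : R) (z : C) := forall y, nm y < M^-1 -> nm (h (z, y)) <= M * nm y ^+ k.
have [M0 [_ hM]] : \forall M \near +oo, [set z : C | u <= nm z <= v] `<=` Q M.
  apply: cov => z /= /andP[uz _]; have z0 : z != 0 by rewrite -nm_gt0 (lt_le_trans u0).
  have [K [e [K0 e0 hK]]] := bigOy_loc hh z0.
  exists ([set w : C | nm (w - z) < e], [set M : R | Num.max K e^-1 < M]).
    split=> /=; first by apply/nbhsCP; exists e.
    by exists (Num.max K e^-1); rewrite num_real.
  move=> [w M] [/= wz]; rewrite gt_max => /andP[KM eM] y yM.
  have M0 : 0 < M by apply: le_lt_trans KM.
  apply: (le_trans (hK (w, y) wz _)) => /=; last by rewrite ler_wpM2r ?exprn_ge0 ?nm_ge0// ltW.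
  by rewrite (lt_trans yM)// -[ltRHS]invrK ltf_pV2 ?posrE ?invr_gt0.
pose M := Num.max M0 0 + 1; have M1 : 0 < M by rewrite ltr_pwDr// le_max lexx orbT.
have M2 : M0 < M by rewrite ltr_pwDr// le_max lexx.
exists M, M^-1; split; [exact: ltW|by rewrite invr_gt0|].
by move=> [z y] /= hz hy; exact: (hM M M2 z hz y hy).
Qed.

End Uniform.

Section Asymptotics.
Variables (R : realType) (varpi : R).
Local Notation C := (Cx R).
Local Notation SF := (SF varpi).
Local Notation Sect := (Sect varpi).
Local Notation Sec := (Sec varpi).
Variables (a b : nat -> C -> C).
Hypothesis ab : holomorphic_coefs a b.

Lemma bigOy_SF J c d k (h : C * C -> C) : bigOy k h -> exists2 K, 0 <= K &
  SF J c d [set p | nm (h p) <= K * nm p.2 ^+ k].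
Proof.
move=> hh; have [K [e [K0 e0 hK]]] := @bigOy_unif R k h (expR (- c)) (expR c) hh (expR_gt0 _).
exists K => //; apply: filterS2 (SF_far varpi J c d 0) (SF_small varpi J c d e0) => p [_ _ /andP[p1 p2]] pe.
by apply: hK => //; rewrite !ltW.
Qed.

Lemma bigOy0 (f : C -> C) : (forall z, z != 0 -> differentiable f z) -> bigOy 0 (fun p => f p.1).
Proof.
move=> df z z0; exists (ofR (nm (f z) + 1)).
have /cvgCP cf := differentiable_continuous (df z z0); have /nbhsCP[e e0 he] := cf _ ltr01.
apply/nbhsC2P; exists e => // p /he /= h _; rewrite expr0 mulr1 nmE ofR_le.
have := nm_lb (f p.1) (f z); lra.
Qed.

Lemma coef_SF J c d (f : C -> C) : (forall z, z != 0 -> differentiable f z) -> exists2 K, 0 <= K &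
  SF J c d [set p | nm (f p.1) <= K].
Proof.
move=> df; have [K K0 h] := @bigOy_SF J c d 0 _ (bigOy0 df); exists K => //.
by apply: filterS h => p /=; rewrite expr0 mulr1.
Qed.

(** Explicit [O(y^(N+1))] bounds on both components, which are easier to compose than the small
    constants of [asymptotic]. *)
Definition asy J (f : C * C -> C * C) := forall N c d, 0 < c -> 0 < d -> exists2 K, 0 <= K &
  SF J c d [set p | nm ((f p).1 - (trunc a b N p).1) <= K * nm p.2 ^+ N.+1
                 /\ nm ((f p).2 - (trunc a b N p).2) <= K * nm p.2 ^+ N.+1].

(** The second sum of [trunc] starts at [n = 2], whence the special case [N = 0]. *)
Lemma truncS N (p : C * C) : trunc a b N.+1 p =
  ((trunc a b N p).1 + a N.+1 p.1 * p.2 ^+ N.+1, (trunc a b N p).2 + (if N == 0%N then 0 else b N.+1 p.1 * p.2 ^+ N.+1)).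
Proof.
rewrite /trunc /= big_nat_recr//= addrA; congr (_, _).
by case: N => [|N]; [rewrite !big_geq// !addr0|rewrite big_nat_recr//= addrA].
Qed.

Lemma trunc1 (p : C * C) : trunc a b 1 p = (p.1 + a 1%N p.1 * p.2, p.2).
Proof. by rewrite truncS /trunc /= !big_geq// !addr0 expr1. Qed.

Lemma trunc_axis N (z : C) : trunc a b N (z, 0) = (z, 0).
Proof.
by elim: N => [|N IH]; [rewrite /trunc !big_geq// !addr0|rewrite truncS IH /= expr0n /= !mulr0 if_same !addr0].
Qed.

Lemma prod_norm_le (x : C * C) (t : C) : `|x| <= t -> `|x.1| <= t /\ `|x.2| <= t.
Proof.
move=> h; suff [h1 h2] : `|x.1| <= `|x| /\ `|x.2| <= `|x| by split; exact: le_trans h.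
rewrite prod_normE maxElt !nmE ofR_lt; case: ifP => [/ltW h1|/negbT]; first by rewrite !ofR_le h1.
by rewrite -leNgt !ofR_le => ->.
Qed.

(** The expansion at order [N + 1] with [delta = 1]; the extra term is absorbed because its
    coefficient is bounded on annuli. *)
Lemma asymptotic_asy i (f : C * C -> C * C) : asymptotic varpi i a b f -> asy [:: i] f.
Proof.
move=> hf N c d c0 d0; have /sect1P h := hf N.+1 1 ltr01.
have dfa n z : z != 0 -> differentiable (a n) z by move=> /(ab n)[].
have dfb n z : z != 0 -> differentiable (b n) z by move=> /(ab n)[].
have [A A0 hA] := @coef_SF [:: i] c d (a N.+1) (dfa N.+1).
have [B B0 hB] := @coef_SF [:: i] c d (b N.+1) (dfb N.+1).
exists (1 + A + B); first by rewrite !addr_ge0.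
apply: filterS3 (h c d c0 d0) hA hB => p /prod_norm_le[]; rewrite truncS.
set t1 := (trunc a b N p).1; set t2 := (trunc a b N p).2.
rewrite /= !nmE -ofRX -ofRM !ofR_le mul1r => h1 h2 hA hB.
have y0 : 0 <= nm p.2 ^+ N.+1 by rewrite exprn_ge0// nm_ge0.
split.
  have := nm_subr (f p).1 (t1 + a N.+1 p.1 * p.2 ^+ N.+1) t1.
  rewrite [X in _ + nm X]addrAC subrr add0r nmM nmX; nra.
have hE : nm (if N == 0%N then 0 else b N.+1 p.1 * p.2 ^+ N.+1) <= B * nm p.2 ^+ N.+1.
  by case: ifP => _; rewrite ?nm0 ?nmM ?nmX ?mulr_ge0// ler_wpM2r.
have := nm_subr (f p).2 (t2 + (if N == 0%N then 0 else b N.+1 p.1 * p.2 ^+ N.+1)) t2.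
rewrite [X in _ + nm X]addrAC subrr add0r -/t2; have := mulr_ge0 A0 y0; lra.
Qed.

Lemma asy_close J f : asy J f -> close varpi J 1 f.
Proof.
move=> hf c d c0 d0; have [K K0 hK] := hf 1%N c d c0 d0.
have dfa n z : z != 0 -> differentiable (a n) z by move=> /(ab n)[].
have [A A0 hA] := @coef_SF J c d (a 1%N) (dfa 1%N).
exists (K + A); first by rewrite addr_ge0.
apply: filterS3 hK hA (SF_small varpi J c d ltr01) => p []; rewrite trunc1 /= => h1 h2 hA y1.
have y0 := nm_ge0 p.2; split.
  have := nm_subr (f p).1 (p.1 + a 1%N p.1 * p.2) p.1.
  rewrite [X in _ + nm X]addrAC subrr add0r nmM [1 * _]mul1r; rewrite expr2 in h1.
  have k1 : K * (nm p.2 * nm p.2) <= K * nm p.2 by rewrite ler_wpM2l// ler_piMl// ltW.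
  have k2 : nm (a 1%N p.1) * nm p.2 <= A * nm p.2 by rewrite ler_wpM2r.
  lra.
by rewrite (le_trans h2)// ler_wpM2r ?exprn_ge0// lerDl.
Qed.

End Asymptotics.

(** * Images of sectorial charts *)

Section Image.
Variable R : realType.
Local Notation C := (Cx R).
Local Notation xi := (fun p : C * C => p.2^-1).

Lemma ratio_window (u p q : C) : p != 0 -> q != 0 -> nm (u / p - 1) <= 4^-1 -> nm (u / q - 1) <= 4^-1 ->
  expR (- 1) * nm q < nm p < expR 1 * nm q.
Proof.
move=> p0 q0 hp hq; have n0 : 0 < nm q by rewrite nm_gt0.
have bnd (v : C) : v != 0 -> nm (u / v - 1) <= 4^-1 -> 3 / 4 * nm v <= nm u <= 5 / 4 * nm v.
  move=> v0 h; have nv : 0 < nm v by rewrite nm_gt0.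
  have := nm_lb 1 (u / v); have := nm_lb (u / v) 1; rewrite nm1 (nmC 1) nmM nmV => h1 h2.
  by apply/andP; split; [rewrite -ler_pdivlMr//|rewrite -ler_pdivrMr//]; lra.
have /andP[a1 a2] := bnd p p0 hp; have /andP[a3 a4] := bnd q q0 hq.
have e2 : 2 <= expR 1 :> R by have := expR_ge1Dx (1 : R); lra.
have a5 : 2 * nm q <= expR 1 * nm q by rewrite ler_pM2r.
have a6 : expR (- 1) * nm q <= 2^-1 * nm q by rewrite ler_pM2r// expRN lef_pV2 ?posrE ?expR_gt0.
by clear -a1 a2 a3 a4 a5 a6 n0; apply/andP; split; lra.
Qed.

(** A segment joins [f q] to [q]. The parameters at which it meets the image of the box form a
    closed set by compactness, and an open one because [f] is open and the preimages stay off the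
    boundary of the box; connectedness leads to [q]. *)
Lemma image_point (S : set (C * C)) (f : C * C -> C * C) (q : C * C) (K : R) :
  (forall O, open O -> open (f @` (S `&` O))) -> (forall p, S p -> differentiable f p) ->
  (forall p, S p -> (f p).2 != 0) ->
  q.1 != 0 -> q.2 != 0 -> 0 <= K -> 3 * K + 1 < nm q.2^-1 ->
  (forall p, p.1 != 0 -> p.2 != 0 -> nm (p.2^-1 - q.2^-1) <= 3 * K + 1 ->
     expR (- 1) * nm q.1 <= nm p.1 <= expR 1 * nm q.1 ->
     [/\ S p, nm ((f p).2^-1 - p.2^-1) <= K & nm ((f p).1 / p.1 - 1) <= 4^-1]) ->
  exists p, [/\ S p, f p = q, p.2 != 0, nm (p.2^-1 - q.2^-1) <= 3 * K + 1 & expR (- 1) * nm q.1 <= nm p.1 <= expR 1 * nm q.1].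
Proof.
move=> oim df fn q1 q2 K0 Kq hbox; have n1 : 0 < nm q.1 by rewrite nm_gt0.
have e2 : 2 <= expR 1 :> R by have := expR_ge1Dx (1 : R); lra.
have e2' : expR (- 1) <= 2^-1 :> R by rewrite expRN lef_pV2 ?posrE ?expR_gt0.
pose Box := [set p : C * C | [/\ p.2 != 0, nm (p.2^-1 - q.2^-1) <= 3 * K + 1 & expR (- 1) * nm q.1 <= nm p.1 <= expR 1 * nm q.1]].
pose O := [set p : C * C | [/\ p.2 != 0, nm (p.2^-1 - q.2^-1) < 3 * K + 1 & expR (- 1) * nm q.1 < nm p.1 < expR 1 * nm q.1]].
have Bn p : Box p -> p.1 != 0.
  by case=> _ _ /andP[h _]; rewrite -nm_gt0 (lt_le_trans _ h)// mulr_gt0// expR_gt0.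
have BS p : Box p -> [/\ S p, nm ((f p).2^-1 - p.2^-1) <= K & nm ((f p).1 / p.1 - 1) <= 4^-1].
  by move=> Bp; case: (Bp) => p2 h1 h2; apply: hbox => //; exact: Bn.
have OB p : O p -> Box p by case=> p2 h1 /andP[h2 h3]; split; [exact: p2|exact: ltW|rewrite (ltW h2) (ltW h3)].
have cBox : compact Box.
  pose psi (w : C * C) : C * C := (w.1, w.2^-1).
  have -> : Box = psi @` ([set z : C | expR (- 1) * nm q.1 <= nm z <= expR 1 * nm q.1] `*` [set x : C | nm (x - q.2^-1) <= 3 * K + 1]).
    apply/seteqP; split=> [p [p2 h1 h2]|_ [[z x] [/= h1 h2] <-]].
      by exists (p.1, p.2^-1) => //; rewrite /psi /= invrK -surjective_pairing.
    split=> //=; last by rewrite invrK.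
    rewrite invr_eq0 -nm_gt0; have := nm_lb q.2^-1 x; rewrite nmC; lra.
  apply: continuous_compact; last by apply: compact_setX; [exact: compact_annulus|exact: compact_ball].
  apply: continuous_in_subspaceT => w /set_mem; case: w => z x [/= h1 h2].
  have x0 : x != 0 by rewrite -nm_gt0; have := nm_lb q.2^-1 x; rewrite nmC; lra.
  apply: differentiable_continuous; apply: differentiable_pair; first exact: diff_fst.
  by apply: (@differentiableV _ _ snd (z, x)); [exact: diff_snd|exact: x0].
have oO : open O.
  rewrite openE => p [p2 h1 /andP[h2 h3]].
  have m1 : nbhs p [set v : C * C | v.2 != 0].
    have h : nbhs p (snd @^-1` [set x : C | x != 0]) by apply: cvg_snd; exact: nbhs_neq0.
    exact: h.
  have cxi : {for p, continuous (fun v : C * C => v.2^-1)}.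
    by apply: differentiable_continuous; apply: (@differentiableV _ _ snd p); [exact: diff_snd|exact: p2].
  have /cvgCP/(_ (3 * K + 1 - nm (p.2^-1 - q.2^-1)) ltac:(by rewrite subr_gt0)) m2 := cxi.
  have /nbhsC2P m3 : exists2 e : R, 0 < e & forall v : C * C, nm (v.1 - p.1) < e -> nm (v.2 - p.2) < e ->
      expR (- 1) * nm q.1 < nm v.1 < expR 1 * nm q.1.
    exists (Num.min (nm p.1 - expR (- 1) * nm q.1) (expR 1 * nm q.1 - nm p.1)).
      by rewrite lt_min !subr_gt0 h2.
    move=> v; rewrite lt_min => /andP[v1 v2] _.
    by have := nm_lb p.1 v.1; have := nm_lb v.1 p.1; rewrite (nmC p.1); move=> w1 w2; apply/andP; split; lra.
  apply: filterS3 m1 m2 m3 => v v2 /= hv v1; split=> //.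
  by have := nm_subr v.2^-1 p.2^-1 q.2^-1; lra.
pose zf := (f q).1; pose xf := (f q).2^-1.
have Bq : Box q.
  split=> //; first by rewrite subrr nm0; lra.
  by rewrite -[X in _ <= X <= _]mul1r !ler_pM2r//; apply/andP; split; lra.
have [Sq kq zq] := BS q Bq.
pose gx (s : R) : C := xf + ofR s * (q.2^-1 - xf); pose gz (s : R) : C := zf + ofR s * (q.1 - zf).
(* The segment is taken in the coordinates [(z, xi)], in which closeness is measured. *)
pose gam (s : R) : C * C := (gz s, (gx s)^-1).
have gxq s : on01 s -> nm (gx s - q.2^-1) <= K.
  move=> /andP[s0 s1]; have -> : gx s - q.2^-1 = ofR (1 - s) * (xf - q.2^-1) by rewrite /gx ofRB ofR1; ring.
  rewrite nmM nm_ofR ger0_norm ?subr_ge0// (le_trans _ kq)// ler_piMl ?nm_ge0//; lra.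
have gx0 s : on01 s -> gx s != 0.
  by move=> /gxq h; rewrite -nm_gt0; have := nm_lb q.2^-1 (gx s); rewrite nmC; lra.
have gzq s : on01 s -> nm (gz s / q.1 - 1) <= 4^-1.
  move=> /andP[s0 s1]; have -> : gz s / q.1 - 1 = ofR (1 - s) * (zf / q.1 - 1).
    by rewrite /gz ofRB ofR1; field.
  rewrite nmM nm_ofR ger0_norm ?subr_ge0// (le_trans _ zq)// ler_piMl ?nm_ge0//; lra.
(* A preimage has [xi] within [K] of [gx s], itself within [K] of that of [q], and [2 K < 3 K + 1]:
   it lies in the open box. [ratio_window] does the same for [z]. *)
have key s p : on01 s -> Box p -> f p = gam s -> O p.
  move=> s01 Bp fp; have [Sp kp zp] := BS p Bp; have p1 := Bn p Bp.
  case: (Bp) => p2 _ _; rewrite fp /gam /= invrK in kp; rewrite fp /gam /= in zp.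
  split=> //.
    have := nm_subr p.2^-1 (gx s) q.2^-1; rewrite [nm (p.2^-1 - gx s)]nmC; have := gxq s s01; lra.
  exact: (ratio_window p1 q1 zp (gzq s s01)).
have cofR : continuous (fun s : R => ofR s : C).
  move=> s; apply/cvgCP => e e0; apply/nbhsRP; exists e => // t.
  by rewrite /= -ofRB nm_ofR.
have cgam s : on01 s -> {for s, continuous gam}.
  move=> s01; apply: (@continuous_comp _ _ _ (fun s : R => ofR s : C) (fun x : C => (zf + x * (q.1 - zf), (xf + x * (q.2^-1 - xf))^-1))).
    exact: cofR.
  have dl (u v : C) : differentiable (fun x : C => u + x * v) (ofR s).
    apply: differentiableD; first exact: differentiable_cst.
    by apply: differentiableM; [exact: ex_diff|exact: differentiable_cst].
  apply: differentiable_continuous; apply: differentiable_pair; first exact: dl.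
  by apply: (@differentiableV _ _ (fun x : C => xf + x * (q.2^-1 - xf)) (ofR s)); [exact: dl|exact: gx0].
pose T := [set s : R | on01 s /\ (f @` Box) (gam s)].
have itvE : [set` `[0, 1]] = [set s : R | on01 s] by apply/seteqP; split=> s /=; rewrite in_itv.
have clB : closed (f @` Box).
  apply: compact_closed; first exact: norm_hausdorff.
  apply: continuous_compact cBox; apply: continuous_in_subspaceT => p /set_mem Bp.
  by apply: differentiable_continuous; apply: df; have [] := BS p Bp.
have TE : T = [set` `[0, 1]].
  have := @segment_connected R 0 1; apply.
  - exists 0; split; first by rewrite /on01 lexx ler01.
    exists q => //; rewrite /gam /gz /gx ofR0 !mul0r !addr0 /xf invrK /zf -surjective_pairing//.
  - exists ([set s | (f @` (S `&` O)) (gam s)]°); first exact: open_interior.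
    rewrite itvE; apply/seteqP; split=> s.
      move=> [s01 [p Bp fp]]; split=> //; apply: (cgam s s01).
      apply: open_nbhs_nbhs; split; first exact: oim.
      by exists p => //; split; [have [] := BS p Bp|exact: key fp].
    move=> [s01 /interior_subset [p [Sp Op] fp]]; split=> //; exists p => //; exact: OB.
  - exists T; last by rewrite itvE; apply/seteqP; split=> s; [move=> [? ?]; split|case].
    rewrite -[X in closed X]setCK; apply: open_closedC; rewrite openE => s /= nT.
    have [s01|ns] := boolP (on01 s).
      have oc : open (~` (f @` Box)) by exact: closed_openC.
      have : nbhs (gam s) (~` (f @` Box)).
        by apply: open_nbhs_nbhs; split=> // fB; apply: nT.
      move=> hn; have h : nbhs s (gam @^-1` (~` (f @` Box))) := cgam s s01 _ hn.
      by change (nbhs s (~` T)); apply: filterS h => t nB [_ fB]; exact: nB.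
    change (nbhs s (~` T)); have : nbhs s [set t : R | ~~ on01 t].
      apply/nbhsRP; move: ns; rewrite /on01 negb_and -!ltNge => /orP[sn|sn].
        exists (- s); first by rewrite oppr_gt0.
        by move=> t; rewrite ltr_norml => /andP[_ h]; rewrite /= negb_and -!ltNge; apply/orP; left; lra.
      exists (s - 1); first by rewrite subr_gt0.
      by move=> t; rewrite ltr_norml => /andP[h _]; rewrite /= negb_and -!ltNge; apply/orP; right; lra.
    by apply: filterS => t /negP nt [].
have : T 1 by rewrite TE /= in_itv /= ler01 lexx.
case=> _ [p Bp fp]; case: (Bp) => p2 h1 h2; exists p; split=> //; first by have [] := BS p Bp.
rewrite fp /gam /gz /gx ofR1 !mul1r.
have -> : zf + (q.1 - zf) = q.1 by rewrite addrC subrK.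
by rewrite [xf + _]addrC subrK invrK -surjective_pairing.
Qed.

End Image.

(** * Local logarithms *)

Section Log.
Variable R : realType.
Local Notation C := (Cx R).

(** Principal logarithm, used on the right half plane, where the argument is the arcsine of
    [Im x / |x|]. *)
Definition clog (x : C) : C := ofR (ln (nm x)) + ofR (asin (iM x / nm x)) * ii R.

Lemma slit_bound (x : C) : 0 < rE x -> 0 < nm x /\ -1 < iM x / nm x < 1.
Proof.
move=> x0; have n0 : 0 < nm x by rewrite nm_gt0; apply: contraTneq x0 => ->; rewrite /rE /= ltxx.
split=> //; rewrite -ltr_norml normrM normfV (gtr0_norm n0) ltr_pdivrMr// mul1r.
have h : iM x ^+ 2 < nm x ^+ 2 by rewrite nm2 ltrDr exprn_gt0.
by rewrite -(ltr_pXn2r (n := 2)) ?nnegrE ?nm_ge0// real_normK ?num_real.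
Qed.

Lemma clogK (x : C) : 0 < rE x -> cexp (clog x) = x.
Proof.
move=> x0; have [n0 hs] := slit_bound x0; set s := iM x / nm x in hs.
have s1 : -1 <= s <= 1 by case/andP: hs => h1 h2; rewrite !ltW.
rewrite /clog cexpD cexp_ofR lnK// -/s; have [h1 h2] := cexp_ii (asin s).
have rs (t : R) (w : C) : rE (ofR t * w) = t * rE w by rewrite rEM rE_ofR iM_ofR mul0r subr0.
have im (t : R) (w : C) : iM (ofR t * w) = t * iM w by rewrite iMM rE_ofR iM_ofR mul0r addr0.
apply: cx_eq.
  rewrite rs h1 cos_asin//; have -> : 1 - s ^+ 2 = (rE x / nm x) ^+ 2.
    rewrite /s !expr_div_n; have e := nm2 x; have n2 : nm x ^+ 2 != 0 by rewrite expf_neq0// lt0r_neq0.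
    have -> : rE x ^+ 2 = nm x ^+ 2 - iM x ^+ 2 by rewrite e addrK.
    by rewrite mulrBl divff.
  by rewrite sqrtr_sqr ger0_norm ?divr_ge0 ?ltW// mulrC divfK// lt0r_neq0.
by rewrite im h2 asinK ?in_itv// mulrC /s divfK// lt0r_neq0.
Qed.

Lemma clog1 : clog 1 = 0.
Proof.
have i1 : iM (1 : C) = 0 by [].
rewrite /clog nm1 ln1 i1 mul0r; have -> : asin (0 : R) = 0.
  by rewrite -[X in asin X]sin0 sinK// in_itv /=; have := pihalf_ge1 R => h; apply/andP; split; lra.
by rewrite !ofR0 mul0r addr0.
Qed.

Lemma iM_cts : continuous (@iM R).
Proof.
move=> z P /nbhsRP[e e0 h]; apply/nbhsCP; exists e => // w wz; apply: h.
by rewrite -iMB (le_lt_trans (iM_le _)).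
Qed.

Lemma ofR_cts : continuous (fun s : R => ofR s : C).
Proof. by move=> s; apply/cvgCP => e e0; apply/nbhsRP; exists e => // t; rewrite /= -ofRB nm_ofR. Qed.

Lemma clog_cts (x : C) : 0 < rE x -> {for x, continuous clog}.
Proof.
move=> x0; have [n0 hs] := slit_bound x0.
have c1 : {for x, continuous (fun z : C => ofR (ln (nm z)) : C)}.
  apply: (@continuous_comp _ _ _ (fun z : C => ln (nm z)) (fun s : R => ofR s : C)); last exact: ofR_cts.
  by apply: (@continuous_comp _ _ _ (@nm R) (@ln R)); [exact: nm_cts|exact: continuous_ln].
have c2 : {for x, continuous (fun z : C => ofR (asin (iM z / nm z)) : C)}.
  apply: (@continuous_comp _ _ _ (fun z : C => asin (iM z / nm z)) (fun s : R => ofR s : C)); last exact: ofR_cts.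
  apply: (@continuous_comp _ _ _ (fun z : C => iM z / nm z) (@asin R)); last exact: continuous_asin.
  apply: (@continuousM R C (@iM R) (fun z => (nm z)^-1)); first exact: iM_cts.
  by apply: (@continuousV R C (@nm R)); [exact: lt0r_neq0|exact: nm_cts].
apply: continuousD; first exact: c1.
by apply: continuousM; [exact: c2|exact: cst_continuous].
Qed.

(** Inverse function argument: [cexp_small] at the increment of [clog], small by continuity. *)
Lemma clog_diff (x : C) : 0 < rE x -> differentiable clog x.
Proof.
move=> x0; have [n0 _] := slit_bound x0; have xn : x != 0 by rewrite -nm_gt0.
apply/diffCP; exists x^-1 => e e0.
pose e1 := Num.min 2^-1 (e * nm x / 2).
have e10 : 0 < e1 by rewrite lt_min invr_gt0 ltr0n divr_gt0// mulr_gt0.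
have e12 : e1 <= 2^-1 by rewrite ge_min lexx.
have e13 : e1 <= e * nm x / 2 by rewrite ge_min lexx orbT.
have [r r0 hr] := @cexp_small R e1 e10.
have /cvgCP/(_ r r0)/nbhsCP[r1 r10 hr1] := clog_cts x0.
exists (Num.min r1 (rE x)); first by rewrite lt_min r10.
move=> h; rewrite lt_min => /andP[h1 h2].
have xh0 : 0 < rE (x + h) by rewrite rED; have := rE_le h; rewrite ler_norml => /andP[]; lra.
have k1 := hr1 (x + h); rewrite /= [x + h]addrC addrK in k1; have {}k1 := k1 h1; rewrite [h + x]addrC in k1.
set k := clog (x + h) - clog x in k1 *.
have kE : cexp k = 1 + h / x.
  by rewrite /k cexpD cexpN !clogK// mulrDl divff.
have k2 := hr k k1; rewrite kE [1 + _]addrC addrK nmC in k2.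
have hk : k - x^-1 * h = k - h / x by rewrite [x^-1 * h]mulrC.
rewrite hk; apply: (le_trans k2).
have k3 : nm k <= 2 * nm (h / x).
  have := nm_lb k (h / x) => k3; have := nm_ge0 k => k4.
  have : e1 * nm k <= 2^-1 * nm k by rewrite ler_wpM2r.
  lra.
have -> : e * nm h = e * nm x / 2 * (2 * nm (h / x)).
  by rewrite nmM nmV; field; rewrite lt0r_neq0.
by apply: ler_pM => //; [exact: ltW|exact: nm_ge0].
Qed.

Definition germ0 (al : C -> C) := al 0 = 0 /\ \forall x \near (0 : C), differentiable al x.

Lemma log_germ A : germ1 A -> exists2 al, germ0 al & \forall x \near (0 : C), e2ipi (al x) = A x.
Proof.
move=> [A0 dA]; have T0 := twopi_ii_neq0 R.
exists (fun x => (ofR (twopi R) * ii R)^-1 * clog (A x)).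
  have h : \forall x \near (0 : C), 0 < rE (A x).
    have /cvgCP/(_ 1 ltr01) := differentiable_continuous (nbhs_singleton dA).
    apply: filterS => x /=; rewrite A0 => hx; have := rE_le (A x - 1); rewrite rEB ler_norml => /andP[h _].
    have r1 : rE (1 : C) = 1 by []. lra.
  split; first by rewrite A0 clog1 mulr0.
  apply: filterS2 dA h => x dx hx; apply: differentiableM; first exact: differentiable_cst.
  by apply: (@differentiable_comp _ _ _ _ A clog); [exact: dx|exact: clog_diff].
have /cvgCP/(_ 1 ltr01) := differentiable_continuous (nbhs_singleton dA).
apply: filterS => x /=; rewrite A0 => hx; have := rE_le (A x - 1); rewrite rEB ler_norml => /andP[h _].
have r1 : rE (1 : C) = 1 by [].
rewrite e2ipiE mulrA mulfV// mul1r clogK//; lra.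
Qed.

Lemma e2ipi_eq1 (x : C) : e2ipi x = 1 -> nm x < 2^-1 -> x = 0.
Proof.
move=> ex xs; have tp := twopi_gt0 R.
have i0 : iM x = 0.
  have := nm_e2ipi x; rewrite ex nm1 -[LHS]expR0 => /expR_inj/eqP.
  by rewrite eq_sym oppr_eq0 mulf_eq0 (gt_eqF tp) /= => /eqP.
have c1 : cos (twopi R * rE x) = 1.
  have := congr1 (@rE R) ex; rewrite e2ipiE rE_cexp rE_twopi_ii i0 mulr0 oppr0 expR0 mul1r iM_twopi_ii => ->.
  by [].
have c2 : cos `|twopi R * rE x| = cos 0 by rewrite cos0 -c1; case: ger0P => _ //; rewrite cosN.
have r0 : `|twopi R * rE x| = 0.
  apply: (@cos_inj R); last exact: c2; rewrite in_itv /= ?lexx ?pi_ge0// normr_ge0 /=.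
  rewrite normrM (gtr0_norm tp) /twopi mulrAC -[leRHS]mul1r ler_wpM2r ?pi_ge0//.
  have := rE_le x; lra.
apply: cx_eq; last by rewrite i0.
by apply/eqP; move/eqP: r0; rewrite normr_eq0 mulf_eq0 (gt_eqF tp).
Qed.

Lemma germ0_lip al : germ0 al -> exists2 K, 0 <= K & \forall x \near (0 : C), nm (al x) <= K * nm x.
Proof.
move=> [a0 da]; have /diffCP[d hd] := nbhs_singleton da.
have [r r0 hr] := hd 1 ltr01; exists (nm d + 1); first by rewrite addr_ge0 ?nm_ge0.
apply/nbhsCP; exists r => // x; rewrite subr0 => xr; have := hr x xr.
rewrite add0r a0 subr0 mul1r => h; have := nm_lb (al x) (d * x); rewrite nmM; lra.
Qed.

End Log.

Section Inverse.
Variables (R : realType) (varpi : R).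
Local Notation C := (Cx R).
Local Notation SF := (SF varpi).
Local Notation Sect := (Sect varpi).
Local Notation Sec := (Sec varpi).

(** The inverse is given only on the image of [S]; [image_point] shows that this image contains
    sectors of the same opening. *)
Lemma sect_inverse i (S : set (C * C)) (f : C * C -> C * C) : S `<=` @torus R -> Sect [:: i] S ->
  biholo_onto_image S f -> f @` S `<=` @torus R -> open S -> close varpi [:: i] 1 f ->
  exists g, [/\ Sect [:: i] (fun q => [/\ differentiable g q, f (g q) = q & S (g q)]), tame varpi [:: i] g
    & forall p, S p -> g (f p) = p].
Proof.
move=> St hS [df of_ [g [dg gf]]] fSt oS cf; exists g.
have oim O : open O -> open (f @` (S `&` O)).
  move=> oO; rewrite openE => _ [p [Sp Op] <-].
  have n1 : nbhs (f p) (f @` S) by apply: open_nbhs_nbhs; split=> //; exists p.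
  have n2 : nbhs (f p) (g @^-1` O).
    have dgp := dg (f p) (ex_intro2 _ _ p Sp erefl).
    have hO : nbhs (g (f p)) O by apply: open_nbhs_nbhs; split=> //; rewrite gf.
    exact: (differentiable_continuous dgp hO).
  apply: filterS2 n1 n2 => _ [x Sx <-] /=; rewrite gf// => Ox; exists x => //.
have main c d : 0 < c -> 0 < d -> exists2 K, 0 <= K & SF [:: i] c d [set q | exists p,
    [/\ S p, f p = q, p.2 != 0, nm (p.2^-1 - q.2^-1) <= K & expR (- 1) * nm q.1 <= nm p.1 <= expR 1 * nm q.1]].
  move=> c0 d0; have c1 : 0 < c + 1 by rewrite addr_gt0.
  have d2 : 0 < d / 2 by rewrite divr_gt0.
  have [K K0 hK] := close_bounds (oner_neq0 C) cf c1 d2.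
  have K3 : 0 <= 3 * K + 1 by rewrite addr_ge0// mulr_ge0.
  have [r1 hr1] := filterI hK (hS _ _ c1 d2).
  have [r hr] := @box_sec R varpi [:: i] c d (3 * K + 1) 1 r1 d0 K3.
  exists (3 * K + 1) => //.
  have hs : SF [:: i] c d (Sec [:: i] c d r) by exists r.
  apply: filterS2 hs (SF_far varpi [:: i] c d (3 * K + 1)) => q hq [q2 qK /andP[q1 _]].
  have q10 : q.1 != 0 by rewrite -nm_gt0 (lt_trans _ q1)// expR_gt0.
  apply: (@image_point R S f q K) => //.
  - by move=> p Sp; have [] := fSt (f p) (ex_intro2 _ _ p Sp erefl).
  move=> p p1 p2 h1 h2; have [[h3 h4 h5] Sp] := hr1 p (hr q p hq p2 h1 h2).
  by rewrite mul1r in h5; split.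
split=> //.
- move=> c d c0 d0; have [K _ hK] := main c d c0 d0; apply: filterS hK => q [p [Sp fp _ _ _]].
  by rewrite -fp gf//; split=> //; apply: dg; exists p.
move=> c d c0 d0; have [K K0 hK] := main c d c0 d0; exists (K + 1); first by rewrite addr_ge0.
apply: filterS hK => q [p [Sp fp p2 h1 /andP[h2 h3]]]; have gq : g q = p by rewrite -fp gf.
rewrite /= gq; split=> //; first by rewrite (le_trans h1)// lerDl.
by rewrite (le_trans _ h2) ?(le_trans h3)// ler_wpM2r ?nm_ge0// ler_expR ?lerN2 lerDr.
Qed.

End Inverse.

(** * Normalized sectorial charts *)

Section Lift.
Variables (R : realType) (tau : Cx R) (varpi : R).
Local Notation C := (Cx R).
Local Notation T := (twopi R).
Local Notation SF := (SF varpi).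
Local Notation Sect := (Sect varpi).
Local Notation Sec := (Sec varpi).
Local Notation lam := (lam varpi).
Hypothesis tau_im : 0 < iM tau.
Hypothesis tau_arg : tau = ofR (nm tau) * cexp (ofR varpi * ii R).
Implicit Types (i : 'Z_4) (p q : C * C) (A B al be : C -> C).

Definition Xc p : C := e2ipi p.2^-1.
Definition Yc p : C := p.1 * e2ipi (tau / p.2).
Definition Wc i p : C := wc i (Pimap tau p).

Lemma WE i p : Wc i p = tw i (Xc p, Yc p). Proof. exact: wc_torus. Qed.
Lemma Xc_neq0 p : Xc p != 0. Proof. exact: e2ipi_neq0. Qed.
Lemma Yc_neq0 p : p.1 != 0 -> Yc p != 0. Proof. by move=> p1; rewrite mulf_neq0// e2ipi_neq0. Qed.

Lemma kco_Pi i p : kco i (Pimap tau p) = (Wc i p, Wc (i + 1) p). Proof. by []. Qed.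

Lemma Pi_dom i p : p.1 != 0 -> wdom i (Pimap tau p).
Proof. by move=> p1; apply: wdom_torus; [exact: Xc_neq0|exact: Yc_neq0]. Qed.

Lemma kap_Pi i p : p.1 != 0 -> kap i (Wc i p, Wc (i + 1) p) = Pimap tau p.
Proof. by move=> p1; rewrite -kco_Pi kap_kco//; exact: Pi_dom. Qed.

Lemma W_neq0 i p : p.1 != 0 -> Wc i p != 0.
Proof. by move=> p1; rewrite WE; apply: tw_neq0; [exact: Xc_neq0|exact: Yc_neq0]. Qed.

Lemma tau_gt0 : 0 < nm tau.
Proof. by rewrite (lt_le_trans tau_im)// (le_trans (ler_norm _))// iM_le. Qed.

Lemma lamE i x : lam i x = iM x * cos (arc_start varpi i) - rE x * sin (arc_start varpi i).
Proof.
rewrite /lam; have [h1 h2] := cexp_ii (- arc_start varpi i).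
by rewrite iMM h1 h2 cosN sinN; ring.
Qed.

Lemma iM_tau x : iM (tau * x) = nm tau * (iM x * cos varpi + rE x * sin varpi).
Proof.
have [h1 h2] := cexp_ii varpi; rewrite tau_arg -mulrA iMM rE_ofR iM_ofR mul0r addr0 nmM nm_ofR.
have -> : nm (cexp (ofR varpi * ii R)) = 1.
  by rewrite nm_cexp rEM rE_ofR iM_ofR rE_ii mulr0 mul0r subr0 expR0.
by rewrite mulr1 ger0_norm ?nm_ge0// iMM h1 h2; ring.
Qed.

Lemma lam_cases x : [/\ lam 0 x = iM x, nm tau * lam 1 x = iM (tau * x),
  lam (1 + 1) x = - iM x & nm tau * lam (1 + 1 + 1) x = - iM (tau * x)].
Proof.
rewrite !lamE iM_tau /arc_start /= cos0 sin0 !cosN !sinN cospi sinpi cosB sinB cospi sinpi; split; ring.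
Qed.

Definition kapf i : R := if odd i then nm tau else 1.
Lemma kapf_gt0 i : 0 < kapf i. Proof. by rewrite /kapf; case: odd => //; exact: tau_gt0. Qed.

(** On annuli in [z], [|w_i|] is bounded by a constant times an exponential of a negative multiple
    of [lam i]: the sector [I_i] is the half plane where [w_i] is small. *)
Lemma nm_W i p c : expR (- c) < nm p.1 < expR c -> nm (Wc i p) <= expR `|c| * expR (- (T * (kapf i * lam i p.2^-1))).
Proof.
move=> /andP[p1 p2]; have [l0 l1 l2 l3] := lam_cases p.2^-1.
have c1 : 1 <= expR `|c| by rewrite -[leLHS]expR0 ler_expR.
have cc : c <= `|c| := ler_norm c.
have n1 : 0 < nm p.1 by rewrite (lt_trans _ p1)// expR_gt0.
rewrite WE; move: i; apply: Z4P; rewrite /tw /kapf /= ?mul1r.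
- by rewrite l0 /pw /= nm_e2ipi ler_peMl ?expR_ge0.
- by rewrite l1 /pw /= nmM nm_e2ipi ler_wpM2r ?expR_ge0// (le_trans (ltW p2))// ler_expR.
- by rewrite l2 /pw /= nmV nm_e2ipi -expRN mulrN ler_peMl ?expR_ge0.
- rewrite l3 /pw /= nmV nmM nm_e2ipi invfM -expRN mulrN ler_wpM2r ?expR_ge0//.
  by rewrite (le_trans (y := expR c)) ?ler_expR// -[leRHS]invrK -expRN lef_pV2 ?posrE ?expR_gt0// ltW.
Qed.

Lemma W_flat i c d N : 0 < c -> 0 < d -> SF [:: i] c d [set p | nm (Wc i p) <= nm p.2 ^+ N].
Proof.
move=> c0 d0; pose k := T * kapf i * d; have k0 : 0 < k by apply: mulr_gt0 => //; apply: mulr_gt0; [exact: twopi_gt0|exact: kapf_gt0].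
have N1 : 0 < (N.+1%:R : R) by rewrite ltr0n.
(* From [(x / (N + 1)) ^ (N + 1) <= exp x] at [x = k |xi|]: beyond this radius the exponential
   exceeds [exp |c| * |xi| ^ N]. *)
pose r := expR `|c| * (N.+1%:R / k) ^+ N.+1.
have r0 : 0 < r by rewrite mulr_gt0 ?expR_gt0// exprn_gt0// divr_gt0.
exists r => p [p0 pr pc pl]; have := pl i; rewrite inE eqxx => /(_ isT) hl.
apply: (le_trans (nm_W i pc)); set t := nm p.2^-1 in pr hl.
have t0 : 0 < t by exact: lt_trans pr.
have -> : nm p.2 = t^-1 by rewrite /t nmV invrK.
have h1 : expR (- (T * (kapf i * lam i p.2^-1))) <= expR (- (k * t)).
  rewrite ler_expR lerN2 /k; have -> : T * kapf i * d * t = T * (kapf i * (d * t)) by ring.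
  by apply: ler_wpM2l; [exact: ltW (twopi_gt0 R)|apply: ler_wpM2l; [exact: ltW (kapf_gt0 i)|exact: ltW hl]].
apply: (le_trans (ler_wpM2l (expR_ge0 _) h1)).
have h2 : (k * t / N.+1%:R) ^+ N.+1 <= expR (k * t).
  have -> : expR (k * t) = expR (k * t / N.+1%:R) ^+ N.+1.
    by rewrite -expRM_natl [N.+1%:R * _]mulrC divfK// lt0r_neq0.
  rewrite lerXn2r ?nnegrE ?expR_ge0//; first by rewrite divr_ge0// ltW// mulr_gt0.
  by rewrite (le_trans _ (expR_ge1Dx _))// lerDr.
rewrite expRN exprVn ler_pdivrMr ?expR_gt0// -ler_pdivrMl ?invr_gt0 ?exprn_gt0// invrK.
apply: le_trans h2.
have e : (k / N.+1%:R) ^+ N.+1 * r = expR `|c|.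
  by rewrite /r mulrCA -exprMn mulrA divfK ?lt0r_neq0// divff ?lt0r_neq0// expr1n mulr1.
have -> : (k * t / N.+1%:R) ^+ N.+1 = (k / N.+1%:R) ^+ N.+1 * (t ^+ N * t) by rewrite -exprSr -exprMn mulrAC.
rewrite -e mulrCA ler_pM2l ?exprn_gt0 ?divr_gt0// ler_pM2l ?exprn_gt0//; exact: ltW.
Qed.

Lemma W_near i (Q : set C) : nbhs (0 : C) Q -> Sect [:: i] (fun p => Q (Wc i p)).
Proof.
move=> /nbhsCP[e e0 hQ] c d c0 d0; apply: filterS2 (W_flat i 1 c0 d0) (SF_small varpi [:: i] c d e0) => p /=.
by rewrite expr1 => h1 h2; apply: hQ; rewrite subr0 (le_lt_trans h1).
Qed.

Lemma W_near2 i (Q : set (C * C)) : nbhs ((0, 0) : C * C) Q -> Sect [:: i; i + 1] (fun p => Q (Wc i p, Wc (i + 1) p)).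
Proof.
move=> /near0P[e e0 hQ].
have h : nbhs (0 : C) [set x | nm x < e] by apply/nbhsCP; exists e => // x; rewrite subr0.
have s1 : {subset [:: i] <= [:: i; i + 1]} by move=> j; rewrite !inE => ->.
have s2 : {subset [:: i + 1] <= [:: i; i + 1]} by move=> j; rewrite !inE => ->; rewrite orbT.
have h1 := Sect_sub s1 (@W_near i _ h); have h2 := Sect_sub s2 (@W_near (i + 1) _ h).
by move=> c d c0 d0; apply: filterS2 (h1 c d c0 d0) (h2 c d c0 d0) => p; exact: hQ.
Qed.

Lemma model_xi (c t : C) p : p.2 != 0 -> (model c t p).2^-1 = p.2^-1 + t.
Proof. by move=> p0; rewrite /model /= invf_div mulrDl mul1r mulfK. Qed.

Lemma model2 (c t : C) p : p.2 != 0 -> model c t p = (c * p.1, (p.2^-1 + t)^-1).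
Proof. by move=> p0; rewrite -(model_xi c t p0) invrK. Qed.

Lemma Pimap_model (c t : C) p : p.2 != 0 -> Pimap tau (model c t p) = lin (e2ipi t) (c * e2ipi (tau * t)) (Pimap tau p).
Proof.
move=> p0; rewrite /Pimap /lin /=; congr (Some _, Some _).
  by rewrite -[_ / _]/((model c t p).2) (model_xi c t p0) e2ipiD mulrC.
rewrite -[_ / (1 + _)]/((model c t p).2) (model_xi c t p0) mulrDr e2ipiD; ring.
Qed.

Lemma model_comp (c t c' t' : C) p : p.2 != 0 -> p.2^-1 + t' != 0 ->
  model c t (model c' t' p) = model (c * c') (t + t') p.
Proof.
move=> p0 h; have m0 : (model c' t' p).2 != 0 by rewrite model2// invr_eq0.
by rewrite model2// model_xi// [RHS]model2//= mulrA [t + t']addrC addrA.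
Qed.

Lemma model10 p : model 1 0 p = p.
Proof. by rewrite /model mul1r mul0r addr0 divr1 -surjective_pairing. Qed.

(** [Pimap] forgets the action of [F100], which shifts [xi] by 1; a bound below 1/2 selects the
    preimage. *)
Lemma Pi_inj p q : p.2 != 0 -> q.2 != 0 -> nm (p.2^-1 - q.2^-1) < 2^-1 -> Pimap tau p = Pimap tau q -> p = q.
Proof.
move=> p0 q0 h e; have e1 : Xc p = Xc q := congr1 (fun x : P1xP1 R => odflt 0 x.1) e.
have e2 : Yc p = Yc q := congr1 (fun x : P1xP1 R => odflt 0 x.2) e; rewrite /Xc /Yc in e1 e2.
have x0 : p.2^-1 - q.2^-1 = 0.
  by apply: e2ipi_eq1 => //; rewrite e2ipiB e1 divff// e2ipi_neq0.
have y : p.2 = q.2 by apply: invr_inj; apply/eqP; rewrite -subr_eq0 x0.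
rewrite y in e2; rewrite (surjective_pairing p) (surjective_pairing q) y; congr pair.
exact: (mulIf (e2ipi_neq0 _) e2).
Qed.

Lemma diff_W i p : p.1 != 0 -> p.2 != 0 -> differentiable (Wc i) p.
Proof.
move=> p1 p2; have dxi : differentiable (fun p : C * C => p.2^-1) p.
  by apply: (@differentiableV _ _ snd p); [exact: diff_snd|exact: p2].
have dX : differentiable Xc p.
  by apply: (@differentiable_comp _ _ _ _ (fun p : C * C => p.2^-1) (@e2ipi R)); [exact: dxi|exact: diff_e2ipi].
have dY : differentiable Yc p.
  apply: differentiableM; first exact: diff_fst.
  apply: (@differentiable_comp _ _ _ _ (fun p : C * C => tau / p.2) (@e2ipi R)); last exact: diff_e2ipi.
  by apply: differentiableM; [exact: differentiable_cst|exact: dxi].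
have -> : Wc i = fun p => tw i (Xc p, Yc p) by apply/funext => q; rewrite WE.
rewrite /tw; case: odd; apply: diff_pw; [exact: dY|exact: Yc_neq0|exact: dX|exact: Xc_neq0].
Qed.

(** Lift of [Nmap] through [Pimap]: the factor [e2ipi al] on [X] is the translation of [xi] by [al],
    which already multiplies [Y] by [e2ipi (tau * al)]; the factor on [z] supplies the rest. *)
Definition Lmp i al be p := model (e2ipi (be (Wc i p) - tau * al (Wc i p))) (al (Wc i p)) p.

Lemma Lmap_diff i al be p : p.1 != 0 -> p.2 != 0 -> differentiable al (Wc i p) -> differentiable be (Wc i p) ->
  1 + al (Wc i p) * p.2 != 0 -> differentiable (Lmp i al be) p.
Proof.
move=> p1 p2 da db h; have dw := diff_W i p1 p2.
have da' : differentiable (fun p => al (Wc i p)) p by exact: (@differentiable_comp _ _ _ _ (Wc i) al _ dw da).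
have db' : differentiable (fun p => be (Wc i p)) p by exact: (@differentiable_comp _ _ _ _ (Wc i) be _ dw db).
apply: differentiable_pair.
  apply: differentiableM; last exact: diff_fst.
  apply: (@differentiable_comp _ _ _ _ (fun p => be (Wc i p) - tau * al (Wc i p)) (@e2ipi R)); last exact: diff_e2ipi.
  apply: differentiableB; first exact: db'.
  by apply: differentiableM; [exact: differentiable_cst|exact: da'].
apply: differentiableM; first exact: diff_snd.
apply: (@differentiableV _ _ (fun p : C * C => 1 + al (Wc i p) * p.2) p); last exact: h.
apply: differentiableD; first exact: differentiable_cst.
by apply: differentiableM; [exact: da'|exact: diff_snd].
Qed.

Definition lgs i A B al be := [/\ germ0 al, germ0 be &
  \forall w \near (0 : C), e2ipi (al w) = (unt i (A w, B w)).1 /\ e2ipi (be w) = (unt i (A w, B w)).2].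

Lemma lgs_ex i A B : germ1 A -> germ1 B -> exists al be, lgs i A B al be.
Proof.
move=> gA gB; have gp s D : germ1 D -> germ1 (fun w => pw s (D w)).
  move=> gD; split; first by rewrite gD.1 pw1.
  by apply: filterS2 gD.2 (germ1_near gD) => w dD D0; apply: diff_pw; [exact: dD|exact: D0].
have g1 : germ1 (fun w => (unt i (A w, B w)).1) by rewrite /unt /swp; case: odd; exact: gp.
have g2 : germ1 (fun w => (unt i (A w, B w)).2) by rewrite /unt /swp; case: odd; exact: gp.
have [al ga ha] := log_germ g1; have [be gb hb] := log_germ g2.
by exists al, be; split=> //; apply: filterS2 ha hb.
Qed.

Lemma Lmap_Pi i A B al be p : p.2 != 0 ->
  e2ipi (al (Wc i p)) = (unt i (A (Wc i p), B (Wc i p))).1 -> e2ipi (be (Wc i p)) = (unt i (A (Wc i p), B (Wc i p))).2 ->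
  Pimap tau (Lmp i al be p) = Nmap i A B (Pimap tau p).
Proof. by move=> p0 e1 e2; rewrite Pimap_model// -e2ipiD subrK e1 e2. Qed.

Lemma germ0_near al e : germ0 al -> 0 < e -> \forall w \near (0 : C), nm (al w) < e.
Proof.
move=> [a0 da] e0; have /cvgCP/(_ e e0) := differentiable_continuous (nbhs_singleton da).
by apply: filterS => w; rewrite /= a0 subr0.
Qed.

(** [al] and [be] vanish at 0 and [w_i] is flat in [y], so the correction is the identity to
    infinite order and leaves the expansion [hatPsi] unchanged. *)
Lemma Lmap_flat i al be N c d : germ0 al -> germ0 be -> 0 < c -> 0 < d -> SF [:: i] c d [set p |
  nm ((Lmp i al be p).1 - p.1) <= nm p.2 ^+ N /\ nm ((Lmp i al be p).2 - p.2) <= nm p.2 ^+ N].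
Proof.
move=> ga gb c0 d0; have [Ka Ka0 ha] := germ0_lip ga.
have gh : germ0 (fun w => e2ipi (be w - tau * al w) - 1).
  split; first by rewrite ga.1 gb.1 mulr0 subr0 e2ipi0 subrr.
  apply: filterS2 ga.2 gb.2 => w da db; apply: differentiableB; last exact: differentiable_cst.
  apply: (@differentiable_comp _ _ _ _ (fun w => be w - tau * al w) (@e2ipi R)); last exact: diff_e2ipi.
  apply: differentiableB; first exact: db.
  by apply: differentiableM; [exact: differentiable_cst|exact: da].
have [Kh Kh0 hh] := germ0_lip gh.
(* [W_flat] is used at order [N + 1]: the extra power of [y] absorbs the constants as soon as
   [|y| < 1 / Q]. *)
pose Q := expR c * Kh + 2 * Ka + 1; have Q0 : 0 < Q by rewrite ltr_wpDl// addr_ge0 ?mulr_ge0 ?expR_ge0.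
have e0 : 0 < Num.min 1 Q^-1 by rewrite lt_min ltr01 invr_gt0.
have s1 := @W_near i _ (filterI (filterI ha hh) (germ0_near ga (ltac:(by rewrite invr_gt0 ltr0n) : 0 < 2^-1))).
apply: filterS3 (filterI (s1 c d c0 d0) (SF_far varpi [:: i] c d 0)) (W_flat i N.+1 c0 d0) (SF_small varpi [:: i] c d e0).
move=> p [[[h1 h2] h3] [p0 _ /andP[_ pc]]] /= hw; rewrite lt_min => /andP[y1 yQ].
have ny : 0 < nm p.2 by rewrite nm_gt0.
have yN : 0 <= nm p.2 ^+ N by rewrite exprn_ge0// ltW.
have hQ : Q * nm p.2 ^+ N.+1 <= nm p.2 ^+ N.
  rewrite exprS mulrA ler_piMl// -[leRHS](mulfV (lt0r_neq0 Q0)) ler_pM2l// ltW//.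
have hw' : nm (Wc i p) <= nm p.2 ^+ N.+1 by [].
have w0 := nm_ge0 (Wc i p).
split.
  have -> : (Lmp i al be p).1 - p.1 = p.1 * (e2ipi (be (Wc i p) - tau * al (Wc i p)) - 1) by rewrite /Lmp /=; ring.
  rewrite nmM; apply: le_trans hQ.
  apply: (@le_trans _ _ (expR c * (Kh * nm p.2 ^+ N.+1))).
    by apply: ler_pM; [exact: nm_ge0|exact: nm_ge0|exact: ltW|rewrite (le_trans h2)// ler_wpM2l].
  rewrite mulrA ler_wpM2r ?exprn_ge0 ?ltW// /Q.
  by rewrite -addrA ltrDl ltr_wpDl// mulr_ge0.
set t := al (Wc i p) in h1 h3 *.
have h4 : nm (t * p.2) <= 2^-1 by rewrite nmM; have := nm_ge0 t; nra.
have n5 : 2^-1 <= nm (1 + t * p.2) by have := nm_lbD 1 (t * p.2); rewrite nm1; lra.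
have n6 : 1 + t * p.2 != 0 by rewrite -nm_gt0; lra.
have -> : (Lmp i al be p).2 - p.2 = - (t * p.2 ^+ 2) / (1 + t * p.2).
  by rewrite /Lmp /model /= -/t; field.
rewrite nmM nmN nmV nmM nmX ler_pdivrMr; last by lra.
have t1 : nm t * nm p.2 ^+ 2 <= Ka * nm p.2 ^+ N.+1.
  apply: (@le_trans _ _ (nm t * 1)).
    by rewrite ler_wpM2l ?nm_ge0// expr_le1 ?ltW.
  by rewrite mulr1 (le_trans h1)// ler_wpM2l.
have t2 : Ka * nm p.2 ^+ N.+1 <= 2^-1 * nm p.2 ^+ N.
  have yN1 : 0 <= nm p.2 ^+ N.+1 by rewrite exprn_ge0// ltW.
  have := mulr_ge0 (mulr_ge0 (expR_ge0 c) Kh0) yN1; move: hQ; rewrite /Q !mulrDl; lra.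
rewrite (le_trans t1)// (le_trans t2)// mulrC ler_wpM2l//.
Qed.

Lemma Lmap_tame i al be : germ0 al -> germ0 be -> tame varpi [:: i] (Lmp i al be).
Proof.
move=> ga gb; apply: (close_tame (oner_neq0 C)) => c d c0 d0; exists 1 => //.
apply: filterS2 (Lmap_flat i 2 ga gb c0 d0) (SF_small varpi [:: i] c d ltr01) => p [h1 h2] y1.
have y0 := nm_ge0 p.2; rewrite /= !mul1r; split=> //; rewrite (le_trans h1)// expr2 ler_piMl// ltW//.
Qed.

(** The logarithms of mutually inverse germs add up to an integer near 0, hence to 0 by
    [e2ipi_eq1]. *)
Lemma Lmap_inv i A B A' B' al be al' be' : germ1 A' -> lgs i A B al be -> lgs i A' B' al' be' -> invgerm A' B' A B ->
  germ1 B' -> Sect [:: i] (fun p => Lmp i al be (Lmp i al' be' p) = p).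
Proof.
move=> gA' [ga gb hab] [ga' gb' hab'] hi gB'.
have cm : forall Q : set C, nbhs (0 : C) Q -> \forall w \near (0 : C), Q (w * A' w).
  move=> Q hQ; have d : differentiable (fun w : C => w * A' w) 0.
    by apply: differentiableM; [exact: ex_diff|exact: nbhs_singleton gA'.2].
  have hQ' : nbhs (0 * A' 0) Q by rewrite mul0r.
  exact: (differentiable_continuous d hQ').
have q4 : (0 : R) < 4^-1 by rewrite invr_gt0 ltr0n.
have nh : \forall w \near (0 : C), (((nm (al' w) < 4^-1 /\ nm (al (w * A' w)) < 4^-1) /\ (nm (be' w) < 4^-1 /\ nm (be (w * A' w)) < 4^-1)) /\
  (((e2ipi (al' w) = (unt i (A' w, B' w)).1 /\ e2ipi (be' w) = (unt i (A' w, B' w)).2) /\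
  (e2ipi (al (w * A' w)) = (unt i (A (w * A' w), B (w * A' w))).1 /\ e2ipi (be (w * A' w)) = (unt i (A (w * A' w), B (w * A' w))).2)) /\
  ((A' w * A (w * A' w) = 1 /\ B' w * B (w * A' w) = 1) /\ (A' w != 0 /\ B' w != 0)))).
  by apply: filterI; apply: filterI; apply: filterI; [exact: germ0_near|exact: (cm _ (germ0_near ga q4))|exact: germ0_near|exact: (cm _ (germ0_near gb q4))|exact: hab'|exact: (cm _ hab)|exact: hi|apply: filterI; exact: germ1_near].
have ww := @W_near i _ nh.
move=> c d c0 d0; apply: filterS2 (ww c d c0 d0) (SF_far varpi [:: i] c d 1).
move=> p [[[a1 a2] [b1 b2]] [[[e1 e2] [e3 e4]] [[i1 i2] [A'0 B'0]]]] [p0 px /andP[p1 _]].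
have z0 : p.1 != 0 by rewrite -nm_gt0 (lt_trans _ p1)// expR_gt0.
set w := Wc i p in a1 a2 b1 b2 e1 e2 e3 e4 i1 i2 A'0 B'0.
have w' : Wc i (Lmp i al' be' p) = w * A' w.
  by rewrite /Wc (Lmap_Pi p0 e1 e2) wc_Nmap//; exact: Pi_dom.
have u1 := untM i (A' w, B' w) (A (w * A' w), B (w * A' w)); rewrite /= i1 i2 unt1 in u1.
case: u1 => u1 u2.
have sa : al (w * A' w) + al' w = 0.
  apply: e2ipi_eq1; first by rewrite e2ipiD e1 e3 mulrC -u1.
  by rewrite (le_lt_trans (nmD _ _))//; lra.
have sb : be (w * A' w) + be' w = 0.
  apply: e2ipi_eq1; first by rewrite e2ipiD e2 e4 mulrC -u2.
  by rewrite (le_lt_trans (nmD _ _))//; lra.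
rewrite {1}/Lmp w' /Lmp -/w model_comp//; last first.
  by rewrite -nm_gt0; have := nm_lbD p.2^-1 (al' w); lra.
rewrite sa -e2ipiD; have -> : be (w * A' w) - tau * al (w * A' w) + (be' w - tau * al' w) = 0.
  have alg (x y z t : C) : x - tau * y + (z - tau * t) = (x + z) - tau * (y + t) by ring.
  by rewrite alg sa sb mulr0 subr0.
by rewrite e2ipi0 model10.
Qed.

End Lift.

Section Charts.
Variables (R : realType) (tau : Cx R) (varpi : R) (F : Cx R * Cx R -> Cx R * Cx R) (a b : nat -> Cx R -> Cx R).
Local Notation C := (Cx R).
Local Notation SF := (SF varpi).
Local Notation Sect := (Sect varpi).
Local Notation tame := (tame varpi).
Local Notation close := (close varpi).
Local Notation asy := (asy varpi a b).
Local Notation W := (Wc tau).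
Local Notation Lmap := (Lmp tau).
Hypothesis tau_im : 0 < iM tau.
Hypothesis tau_arg : tau = ofR (nm tau) * cexp (ofR varpi * ii R).
Hypothesis F_nbhd : neighbourhood_germ tau F.
Hypothesis ab : holomorphic_coefs a b.
Implicit Types (i : 'Z_4) (p q : C * C) (P Q : C * C -> C * C).

Lemma F_close J : close J (q0 tau) F.
Proof.
move=> c d c0 d0; have [_ h1 h2] := F_nbhd.
have [K1 K10 hK1] := bigOy_SF varpi J c d h1; have [K2 K20 hK2] := bigOy_SF varpi J c d h2.
exists (K1 + (K2 + 2)); first by rewrite !addr_ge0.
apply: filterS3 hK1 hK2 (SF_small varpi J c d ltr01) => p /= e1 e2 y1; have y0 := nm_ge0 p.2.
have y2 : nm p.2 ^+ 2 <= nm p.2 by rewrite expr2 ler_piMl// ltW.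
have y20 : 0 <= nm p.2 ^+ 2 by rewrite exprn_ge0.
split.
  rewrite (le_trans e1)//; apply: (le_trans (ler_wpM2l K10 y2)).
  by rewrite ler_wpM2r// lerDl addr_ge0.
have y3 : nm p.2 ^+ 3 <= nm p.2 ^+ 2 by rewrite exprS ler_piMl// ltW.
have y4 : nm p.2 ^+ 4 <= nm p.2 ^+ 2 by rewrite exprS (le_trans _ y3)// ler_piMl ?exprn_ge0// ltW.
have -> : (F p).2 - p.2 = (F p).2 - (p.2 + p.2 ^+ 2 + p.2 ^+ 3) + (p.2 ^+ 2 + p.2 ^+ 3) by ring.
rewrite (le_trans (nmD _ _))//; have := nmD (p.2 ^+ 2) (p.2 ^+ 3); rewrite !nmX => h3.
have h4 : K2 * nm p.2 ^+ 4 <= K2 * nm p.2 ^+ 2 by rewrite ler_wpM2l.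
have h5 : 0 <= K1 * nm p.2 ^+ 2 by rewrite mulr_ge0.
rewrite !mulrDl; lra.
Qed.

Lemma F_tame J : tame J F.
Proof. by apply: (close_tame (e2ipi_neq0 tau)); exact: F_close. Qed.

(** A sectorial normalization together with its inverse; the domain [S] is replaced by statements
    valid on sectors. *)
Definition SC i P Q := [/\ asy [:: i] P, tame [:: i] Q,
   Sect [:: i] (fun p => differentiable P p /\ Q (P p) = p),
   Sect [:: i] (fun q => differentiable Q q /\ P (Q q) = q) & Sect [:: i] (fun p => P (F p) = F100 tau (P p))].

Lemma asy_tame J P : asy J P -> tame J P.
Proof. by move=> h; apply: (close_tame (oner_neq0 C)); exact: asy_close h. Qed.

Lemma SC_Psi i (S : set (C * C)) (Psi : C * C -> C * C) : sectorial_normalization tau varpi F a b i S Psi ->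
  exists g, SC i Psi g.
Proof.
move=> [[oS St /sect1P hS] bh im /(asymptotic_asy ab) hasy /sect1P hF].
have hc := asy_close ab hasy; have [g [g1 g2 g3]] := sect_inverse St hS bh im oS hc.
exists g; split=> //.
- by apply: SectS hS => p Sp; split; [case: bh => dS _ _; exact: dS|exact: g3].
- by apply: SectS g1 => q [].
have hSF := tame_Sect (F_tame [:: i]) hS.
by apply: SectS (SectI hF hSF) => p [h1 h2]; exact: h1.
Qed.

Lemma Lmap_diffS i al be : germ0 al -> germ0 be -> Sect [:: i] (fun p => differentiable (Lmap i al be) p).
Proof.
move=> ga gb; have h : \forall w \near (0 : C), (differentiable al w /\ differentiable be w) /\ nm (al w) < 2^-1.
  apply: filterI; last by apply: germ0_near => //; rewrite invr_gt0 ltr0n.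
  by apply: filterI; [case: ga|case: gb].
move=> c d c0 d0; have hW := @W_near R tau varpi tau_im tau_arg i _ h c d c0 d0.
apply: filterS3 hW (SF_far varpi [:: i] c d 0) (SF_small varpi [:: i] c d ltr01).
move=> p [[da db] al2] [p2 _ /andP[p1 _]] y1.
have z0 : p.1 != 0 by rewrite -nm_gt0 (lt_trans _ p1)// expR_gt0.
apply: Lmap_diff; [exact: z0|exact: p2|exact: da|exact: db|].
rewrite -nm_gt0; have := nm_lbD 1 (al (W i p) * p.2); rewrite nm1 nmM.
have := nm_ge0 (al (W i p)); have := nm_ge0 p.2; rewrite /= in y1; nra.
Qed.

Lemma F100_Pi p : p.2 != 0 -> Pimap tau (F100 tau p) = Pimap tau p.
Proof.
move=> p0; rewrite /F100 Pimap_model// /q0 -e2ipiD mulrN1 subrr e2ipi0 e2ipiN.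
by have := @e2ipi_nat R 1; rewrite mulr1n => ->; rewrite invr1 lin11.
Qed.

Lemma Lmap_F100 i al be : germ0 al -> Sect [:: i] (fun p => Lmap i al be (F100 tau p) = F100 tau (Lmap i al be p)).
Proof.
move=> ga c d c0 d0; have h2 : (0 : R) < 2^-1 by rewrite invr_gt0 ltr0n.
have hW := @W_near R tau varpi tau_im tau_arg i _ (germ0_near ga h2) c d c0 d0.
apply: filterS2 hW (SF_far varpi [:: i] c d 1) => p /= al2 [p2 px _].
have e : W i (F100 tau p) = W i p by rewrite /Wc F100_Pi.
have n1 : p.2^-1 + - 1 != 0 by rewrite -nm_gt0; have := nm_lb p.2^-1 1; rewrite nm1; lra.
have n2 : p.2^-1 + al (W i p) != 0 by rewrite -nm_gt0; have := nm_lbD p.2^-1 (al (W i p)); lra.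
rewrite {1}/Lmp e /F100 model_comp// /Lmp model_comp//.
by rewrite mulrC [al _ + _]addrC.
Qed.

Lemma nm_close J P c d : close J 1 P -> 0 < c -> 0 < d -> SF J c d [set p | nm (P p).2 <= 2 * nm p.2].
Proof.
move=> hP c0 d0; have [K K0 hK] := hP c d c0 d0.
have e0 : 0 < (K + 1)^-1 by rewrite invr_gt0 ltr_wpDl.
apply: filterS2 hK (SF_small varpi J c d e0) => p [_ h] /= y1.
have y0 := nm_ge0 p.2; have := nm_lb (P p).2 p.2.
have : K * nm p.2 ^+ 2 <= nm p.2.
  rewrite expr2 mulrA ler_piMl//; have K1 : 0 < K + 1 by rewrite ltr_wpDl.
  by move: y1; rewrite -[X in _ < X]mul1r ltr_pdivlMr//; nra.
lra.
Qed.

(** The correction is flat, and it commutes with [F100] because [w_i] is invariant. *)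
Lemma SC_Lmap i A B A' B' al be al' be' P g : germ1 A -> germ1 B -> germ1 A' -> germ1 B' ->
  lgs i A B al be -> lgs i A' B' al' be' -> invgerm A' B' A B -> invgerm A B A' B' ->
  SC i P g -> SC i (Lmap i al' be' \o P) (g \o Lmap i al be).
Proof.
move=> gA gB gA' gB' hl hl' i1 i2 [hasy gt h1 h2 h3].
have [ga gb _] := hl; have [ga' gb' _] := hl'.
have tP := asy_tame hasy; have tL := @Lmap_tame R tau varpi tau_im tau_arg i al be ga gb.
have LL := @Lmap_inv R tau varpi tau_im tau_arg i A B A' B' al be al' be' gA' hl hl' i1 gB'.
have LL' := @Lmap_inv R tau varpi tau_im tau_arg i A' B' A B al' be' al be gA hl' hl i2 gB.
split.
- move=> N c d c0 d0; have [K K0 hK] := hasy N c d c0 d0.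
  exists (2 ^+ N.+1 + K); first by rewrite addr_ge0// exprn_ge0.
  have [c' cc [d' /andP[d'0 _] hp]] := tame_SF tP c0 d0.
  have hf := hp _ (@Lmap_flat R tau varpi tau_im tau_arg i al' be' N.+1 c' d' ga' gb' (lt_trans c0 cc) d'0).
  apply: filterS3 hK hf (nm_close (asy_close ab hasy) c0 d0) => p [e1 e2] [f1 f2] y2.
  have y3 : nm (P p).2 ^+ N.+1 <= 2 ^+ N.+1 * nm p.2 ^+ N.+1.
    by rewrite -exprMn lerXn2r ?nnegrE ?nm_ge0// mulr_ge0 ?nm_ge0.
  change (nm ((Lmap i al' be' (P p)).1 - (trunc a b N p).1) <= (2 ^+ N.+1 + K) * nm p.2 ^+ N.+1 /\
    nm ((Lmap i al' be' (P p)).2 - (trunc a b N p).2) <= (2 ^+ N.+1 + K) * nm p.2 ^+ N.+1).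
  rewrite !mulrDl; split.
    apply: (le_trans (nm_subr _ (P p).1 _)); apply: lerD _ e1; exact: le_trans f1 y3.
  apply: (le_trans (nm_subr _ (P p).2 _)); apply: lerD _ e2; exact: le_trans f2 y3.
- exact: tame_comp.
- have k1 := tame_Sect tP (@Lmap_diffS i al' be' ga' gb'); have k2 := tame_Sect tP LL.
  apply: SectS (SectI h1 (SectI k1 k2)) => p [[dP gP] [dL e]]; split; last by rewrite /= e.
  exact: (@differentiable_comp _ _ _ _ P (Lmap i al' be') _ dP dL).
- have k1 := @Lmap_diffS i al be ga gb; have k2 := tame_Sect tL h2.
  apply: SectS (SectI k1 (SectI k2 LL')) => q [dL [[dg e] e']]; split; last by rewrite /= e e'.
  exact: (@differentiable_comp _ _ _ _ (Lmap i al be) g _ dL dg).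
have k1 := tame_Sect tP (@Lmap_F100 i al' be' ga').
by apply: SectS (SectI h3 k1) => p [e1 e2]; rewrite /= e1 e2.
Qed.

Variables (S : 'Z_4 -> set (C * C)) (Psi : 'Z_4 -> C * C -> C * C) (phi : 'Z_4 -> P1xP1 R -> P1xP1 R).
Hypothesis Psi_norm : forall i, sectorial_normalization tau varpi F a b i (S i) (Psi i).
Hypothesis phi_cocycle : is_cocycle phi.
Hypothesis Psi_cocycle : has_cocycle tau varpi Psi phi.

Lemma normalized_charts : exists (A B : 'Z_4 -> C -> C) (u v : 'Z_4 -> C * C -> C) (P Q : 'Z_4 -> C * C -> C * C),
  [/\ (forall i, Diff1_line i (Nmap i (A i) (B i))) /\ is_cocycle (fun i (p : P1xP1 R) => kap i (mUV (u i) (v i) (kco i p))),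
    forall i, [/\ cg (u i) (v i), \forall w \near ((0, 0) : C * C), u i (w.1, 0) = 1 & \forall w \near ((0, 0) : C * C), v i (w.1, 0) = 1],
    forall i, \forall p \near corner R i,
        kap i (mUV (u i) (v i) (kco i (Nmap (i + 1) (A (i + 1)) (B (i + 1)) p))) = Nmap i (A i) (B i) (phi i p),
    forall i, SC i (P i) (Q i) /\ Sect [:: i] (fun p => Pimap tau (P i p) = Nmap i (A i) (B i) (Pimap tau (Psi i p)))
  & forall i, Sect [:: i; i + 1] (fun p => Pimap tau (P i p) = kap i (mUV (u i) (v i) (W i (P (i + 1) p), W (i + 1) (P (i + 1) p))))].
Proof.
have [A [B [A' [B' [u [v [gs iv ck uv1 comp]]]]]]] := normal_form phi_cocycle.
have /choice[g hg] : forall i, exists g, SC i (Psi i) g by move=> i; exact: SC_Psi.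
have /choice[lg hlg] : forall i, exists lg : (C -> C) * (C -> C), lgs i (A i) (B i) lg.1 lg.2.
  by move=> i; have [gA gB _ _] := gs i; have [al [be h]] := lgs_ex i gA gB; exists (al, be).
have /choice[lg' hlg'] : forall i, exists lg : (C -> C) * (C -> C), lgs i (A' i) (B' i) lg.1 lg.2.
  by move=> i; have [_ _ gA gB] := gs i; have [al [be h]] := lgs_ex i gA gB; exists (al, be).
pose P i := Lmap i (lg' i).1 (lg' i).2 \o Psi i; pose Q i := g i \o Lmap i (lg i).1 (lg i).2.
have tPsi i : tame [:: i] (Psi i) by apply: asy_tame; have [] := hg i.
have PiP i : Sect [:: i] (fun p => Pimap tau (P i p) = Nmap i (A' i) (B' i) (Pimap tau (Psi i p))).
  have [_ _ hl] := hlg' i; have k1 := tame_Sect (tPsi i) (@W_near R tau varpi tau_im tau_arg i _ hl).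
  have k2 := tame_Sect (tPsi i) (@Sect_torus R varpi [:: i]).
  by apply: SectS (SectI k1 k2) => p [[e1 e2] [_ p2]]; apply: Lmap_Pi.
(* The charts are corrected by the inverse germs of [normal_form], which become the [A], [B] of the
   statement. *)
exists A', B', u, v, P, Q; split=> //.
- split=> // i; have [gA gB gA' gB'] := gs i; have [i1 i2] := iv i.
  exact: (@Diff1_Nmap R i (A' i) (B' i) (A i) (B i)).
- move=> i; split=> //; have [gA gB gA' gB'] := gs i; have [i1 i2] := iv i.
  exact: (@SC_Lmap i (A i) (B i) (A' i) (B' i) _ _ _ _ _ _ gA gB gA' gB' (hlg i) (hlg' i) i2 i1 (hg i)).
move=> i; have /sect2P coc := Psi_cocycle i.
have s1 : {subset [:: i] <= [:: i; i + 1]} by move=> j; rewrite !inE => ->.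
have s2 : {subset [:: i + 1] <= [:: i; i + 1]} by move=> j; rewrite !inE => ->; rewrite orbT.
have t2 := tame_sub s2 (tPsi (i + 1)).
have /normal_kap_nbhs nc := comp i.
have k1 := tame_Sect t2 (@W_near2 R tau varpi tau_im tau_arg i _ nc).
have k2 := tame_Sect t2 (@Sect_torus R varpi [:: i; i + 1]).
apply: SectS (SectI (SectI coc (Sect_sub s1 (PiP i))) (SectI (Sect_sub s2 (PiP (i + 1))) (SectI k1 k2))).
move=> p [[e1 e2] [e3 [e4 [p1 p2]]]]; rewrite e2 e1.
have e5 := @kap_Pi R tau i (Psi (i + 1) p) p1.
set w := (W i (Psi (i + 1) p), W (i + 1) (Psi (i + 1) p)) in e4 e5.
have e6 : kap i (mUV (u i) (v i) (kco i (Nmap (i + 1) (A' (i + 1)) (B' (i + 1)) (kap i w)))) = Nmap i (A' i) (B' i) (phi i (kap i w)) := e4.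
by rewrite e5 in e6; rewrite -kco_Pi e3 -e6.
Qed.

End Charts.

(** * Automorphisms act linearly *)

Section TubeCoordinates.
Variables (R : realType) (tau : Cx R) (varpi : R).
Local Notation C := (Cx R).
Local Notation T := (twopi R).
Local Notation SF := (SF varpi).
Local Notation Sect := (Sect varpi).
Local Notation Sec := (Sec varpi).
Local Notation lam := (lam varpi).
Local Notation W := (Wc tau).
Hypothesis tau_im : 0 < iM tau.
Hypothesis tau_arg : tau = ofR (nm tau) * cexp (ofR varpi * ii R).
Implicit Types (j : 'Z_4) (p q : C * C) (k : int).

Lemma close_model J (c t : C) : close varpi J c (model c t).
Proof.
move=> c' d c0 d0; exists (2 * nm t); first by rewrite mulr_ge0 ?nm_ge0.
have e0 : 0 < (2 * (nm t + 1))^-1 by rewrite invr_gt0 mulr_gt0// ltr_wpDl ?nm_ge0.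
apply: filterS (SF_small varpi J c' d e0) => p /= hp; have t0 := nm_ge0 t; have y0 := nm_ge0 p.2.
rewrite subrr nm0; split; first by rewrite !mulr_ge0.
have h : nm (t * p.2) <= 2^-1.
  move: hp; rewrite nmM -[(2 * _)^-1]mul1r ltr_pdivlMr; last by rewrite mulr_gt0// ltr_wpDl.
  nra.
have n5 : 2^-1 <= nm (1 + t * p.2) by have := nm_lbD 1 (t * p.2); rewrite nm1; lra.
have n6 : 1 + t * p.2 != 0 by rewrite -nm_gt0; lra.
have -> : p.2 / (1 + t * p.2) - p.2 = - (t * p.2 ^+ 2) / (1 + t * p.2) by field.
rewrite nmM nmN nmV nmM nmX ler_pdivrMr; last by lra.
have x0 : 0 <= nm t * nm p.2 ^+ 2 by rewrite mulr_ge0// exprn_ge0.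
rewrite -[2 * nm t * _]mulrA; move: x0 n5; set x := nm t * nm p.2 ^+ 2; set y := nm (1 + _); clear; nra.
Qed.

Definition sgn j (x : C) : C := if nside j then - x else x.
(** The linear form in [(xi, eta)] whose exponential is [w_j]. [xe j] recovers [(xi, eta)] from the
    forms of indices [j + 1] and [j], in this order, so that the second tube variable belongs to
    [w_j]. *)
Definition bt j p : C := sgn j (if odd j then p.2 else p.1).
Definition xe j p : C * C := if odd j then (sgn (j + 1) p.1, sgn j p.2) else (sgn j p.2, sgn (j + 1) p.1).

Lemma tw_e2ipi j p : tw j (e2ipi p.1, e2ipi p.2) = e2ipi (bt j p).
Proof. by rewrite /tw /bt /sgn /pw; case: nside; case: odd; rewrite /= ?e2ipiN. Qed.

Lemma bt_xe j p : bt j (xe j p) = p.2 /\ bt (j + 1) (xe j p) = p.1.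
Proof. by move: j; apply: Z4P; rewrite /bt /xe /sgn /nside /= ?opprK. Qed.

Lemma xe_bt j p : xe j (bt (j + 1) p, bt j p) = p.
Proof. by case: p => x y; move: j; apply: Z4P; rewrite /bt /xe /sgn /nside /= ?opprK. Qed.

Lemma norm_xe j p : `|iM (xe j p).1| + `|iM (xe j p).2| = `|iM p.1| + `|iM p.2|.
Proof. by move: j; apply: Z4P; rewrite /xe /sgn /nside /= ?iMN ?normrN// addrC. Qed.

Lemma diff_sgn j (f : C * C -> C) p : differentiable f p -> differentiable (fun q => sgn j (f q)) p.
Proof. by move=> df; rewrite /sgn; case: nside; [exact: (differentiableN df)|exact: df]. Qed.

Lemma diff_xe j p : differentiable (xe j) p.
Proof.
apply/diff_pairP; rewrite /xe; case: odd => /=; split; apply: diff_sgn;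
  by [exact: diff_fst|exact: diff_snd].
Qed.

(* Inverse of [Pimap] in the coordinates [X = e2ipi xi], [Y = e2ipi eta]: the integer [k] selects the preimage, up to
   [F100], and [fl p] the one with [z] in a fundamental annulus. *)
Definition ptk k p : C * C := (e2ipi (p.2 - tau * (p.1 + k%:~R)), (p.1 + k%:~R)^-1).
Definition fl p : int := Num.floor (iM (p.2 - tau * p.1) / iM tau).
Definition pt p := ptk (fl p) p.

Lemma W_ptk j k p : W j (ptk k p) = e2ipi (bt j p).
Proof.
rewrite WE -tw_e2ipi /Xc /Yc /ptk /= invrK e2ipiD e2ipi_int mulr1; congr (tw j (_, _)).
by rewrite -e2ipiD subrK.
Qed.

Lemma model_ptk k k' p : p.1 + k%:~R != 0 -> model (e2ipi (- (tau * k'%:~R))) k'%:~R (ptk k p) = ptk (k + k') p.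
Proof.
move=> h; rewrite model2 /= ?invr_eq0// invrK /ptk intrD addrA -e2ipiD; congr (e2ipi _, _); ring.
Qed.

Lemma F100E p : F100 tau p = model (e2ipi (- (tau * (-1)%:~R))) (-1)%:~R p.
Proof. by rewrite /F100 /q0 mulrN1z mulrN mulr1 opprK. Qed.

Lemma fl_itv p : 0 <= iM (p.2 - tau * (p.1 + (fl p)%:~R)) < iM tau.
Proof.
have /andP[h1 h2] := floor_itv (iM (p.2 - tau * p.1) / iM tau); rewrite -/(fl p) in h1 h2.
have -> : iM (p.2 - tau * (p.1 + (fl p)%:~R)) = iM (p.2 - tau * p.1) - (fl p)%:~R * iM tau.
  by rewrite -ofR_int mulrDr !iMB iMD [iM (tau * ofR _)]iMM rE_ofR iM_ofR mulr0 add0r; ring.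
rewrite intrD ltr_pdivrMr// ler_pdivlMr// in h1 h2 *; apply/andP; split; lra.
Qed.

Lemma fl_uniq p k : 0 <= iM (p.2 - tau * (p.1 + k%:~R)) < iM tau -> fl p = k.
Proof.
have -> : iM (p.2 - tau * (p.1 + k%:~R)) = iM (p.2 - tau * p.1) - k%:~R * iM tau.
  by rewrite -ofR_int mulrDr !iMB iMD [iM (tau * ofR _)]iMM rE_ofR iM_ofR mulr0 add0r; ring.
move=> /andP[h1 h2]; apply: floor_def; rewrite intrD ltr_pdivrMr// ler_pdivlMr//; apply/andP; split; lra.
Qed.

(** A translation of [xi] is absorbed by the integer [fl], one of [eta] disappears in the
    exponential: [pt] is periodic although [ptk k] is not. *)
Lemma pt_per p : pt (p.1 + 1, p.2) = pt p /\ pt (p.1, p.2 + 1) = pt p.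
Proof.
have e (k : int) : p.1 + 1 + (k - 1)%:~R = p.1 + k%:~R by rewrite intrD /=; ring.
have h := fl_itv p; split.
  have f1 : fl (p.1 + 1, p.2) = fl p - 1 by apply: fl_uniq => /=; rewrite e.
  by rewrite /pt f1 /ptk /= e.
have f2 : fl (p.1, p.2 + 1) = fl p by apply: fl_uniq => /=; rewrite addrAC iMD [iM 1]/= addr0.
have E1 : e2ipi (1 : C) = 1 := e2ipi_nat R 1.
rewrite /pt f2 /ptk; congr pair.
change (e2ipi (p.2 + 1 - tau * (p.1 + (fl p)%:~R)) = e2ipi (p.2 - tau * (p.1 + (fl p)%:~R))).
by rewrite [p.2 + 1 - _]addrAC [e2ipi (_ + 1)]e2ipiD E1 mulr1.
Qed.

Lemma pt_perN p : pt (p.1 - 1, p.2) = pt p /\ pt (p.1, p.2 - 1) = pt p.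
Proof.
have [h _] := pt_per (p.1 - 1, p.2); have [_ h'] := pt_per (p.1, p.2 - 1).
by move: h h'; rewrite /= !subrK -surjective_pairing => -> ->.
Qed.

Lemma pt_xe_per j p : pt (xe j (p.1 + 1, p.2)) = pt (xe j p) /\ pt (xe j (p.1, p.2 + 1)) = pt (xe j p).
Proof.
have [h1 h2] := pt_per (xe j p); have [h3 h4] := pt_perN (xe j p); move: h1 h2 h3 h4.
rewrite /xe /sgn; case: odd; case: nside; case: nside; rewrite /= ?opprD => *; by split.
Qed.

Lemma lam_pt j k p :
  `|kapf tau j * lam j (ptk k p).2^-1 - iM (bt j p)| <= `|iM (p.2 - tau * (p.1 + k%:~R))|.
Proof.
have [l0 l1 l2 l3] := lam_cases tau_arg (p.1 + k%:~R).
have e1 : iM (p.1 + k%:~R) = iM p.1 by rewrite -ofR_int iMD iM_ofR addr0.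
have e2 : iM (tau * (p.1 + k%:~R)) = iM p.2 - iM (p.2 - tau * (p.1 + k%:~R)) by rewrite iMB; ring.
rewrite /= invrK; set s := iM (p.2 - _) in e2 *; move: j; apply: Z4P; rewrite /kapf /bt /sgn /nside /= ?mul1r ?iMN.
- by rewrite l0 e1 subrr normr0.
- by rewrite l1 e2 addrAC subrr add0r normrN.
- by rewrite l2 e1 subrr normr0.
- by rewrite l3 e2 -opprD normrN addrAC subrr add0r normrN.
Qed.

(** [Im x] and [Im (tau x)] are independent real linear forms since [Im tau > 0]; this constant
    bounds [|x|] by them ([nm_basis]). *)
Definition C1 : R := 1 + (1 + nm tau) / iM tau.

Lemma C1_gt0 : 0 < C1.
Proof. by rewrite ltr_wpDr// divr_ge0 ?addr_ge0 ?nm_ge0// ltW. Qed.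

Lemma nm_basis (x : C) : nm x <= C1 * (`|iM x| + `|iM (tau * x)|).
Proof.
have h : rE x * iM tau = iM (tau * x) - rE tau * iM x by rewrite iMM; ring.
have h2 : `|rE x| * iM tau <= `|iM (tau * x)| + nm tau * `|iM x|.
  rewrite -[X in _ * X](gtr0_norm tau_im) -normrM h (le_trans (ler_normB _ _))// lerD2l normrM ler_wpM2r//.
  exact: rE_le.
have h3 : `|rE x| <= (`|iM (tau * x)| + nm tau * `|iM x|) / iM tau by rewrite ler_pdivlMr.
have h4 := nm_le x; have t0 := nm_ge0 tau.
apply: (le_trans h4); rewrite /C1 mulrDl mul1r mulrAC.
set a := `|iM x| in h3 *; set b := `|iM (tau * x)| in h3 *.
have a0 : 0 <= a := normr_ge0 _; have b0 : 0 <= b := normr_ge0 _.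
have : (b + nm tau * a) / iM tau <= (1 + nm tau) * (a + b) / iM tau.
  by rewrite ler_pM2r ?invr_gt0//; nra.
lra.
Qed.

Lemma lam_large M : 1 <= M -> exists2 d, 0 < d & forall r, exists2 rho, 0 <= rho & forall j p, rho < iM (bt j p) ->
  `|iM p.1| + `|iM p.2| <= (M + 1) * iM (bt j p) ->
  [/\ (pt p).2 != 0, r < nm (pt p).2^-1 & d * nm (pt p).2^-1 < lam j (pt p).2^-1].
Proof.
move=> M1; have c1 := C1_gt0; pose k1 := 1 + nm tau; have k10 : 0 < k1 by rewrite ltr_wpDr ?nm_ge0.
have M3 : 0 < M + 3 by rewrite ltr_wpDl// (le_trans _ M1).
have D0 : 0 < 4 * k1 * (C1 * (M + 3)) by rewrite mulr_gt0 ?mulr_gt0.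
(* With [b = Im (bt j p)], [lam j] exceeds [b / (2 k1)] while [|xi|] is at most [C1 (M + 2) b]; the
   constant leaves some room. *)
exists (4 * k1 * (C1 * (M + 3)))^-1; first by rewrite invr_gt0.
move=> r; exists (2 * iM tau + 2 * k1 * `|r|); first by rewrite addr_ge0// mulr_ge0// ltW// mulr_gt0.
move=> j p; set b := iM (bt j p) => hb hab; have := lam_pt j (fl p) p; rewrite -/(pt p) -/b.
have /andP[s0 s1] := fl_itv p; rewrite (ger0_norm s0).
set s := iM (p.2 - tau * (p.1 + (fl p)%:~R)) in s0 s1 *.
have := nm_basis (p.1 + (fl p)%:~R).
have -> : iM (tau * (p.1 + (fl p)%:~R)) = iM p.2 - s by rewrite /s iMB; ring.
have -> : iM (p.1 + (fl p)%:~R) = iM p.1 by rewrite -ofR_int iMD iM_ofR addr0.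
have -> : p.1 + (fl p)%:~R = (pt p).2^-1 by rewrite /pt /= invrK.
set x := (pt p).2^-1; set L := lam j x => h1 h2'; have := le_trans h2' (ltW s1).
have kj : 0 < kapf tau j <= k1.
  by rewrite (kapf_gt0 tau_im)/= /kapf /k1; case: odd; rewrite ?lerDl ?lerDr ?nm_ge0.
rewrite ler_norml => /andP[h2 _]; move/andP: kj => [kj0 kj1].
have b0 : 0 < b by rewrite (le_lt_trans _ hb)// addr_ge0// mulr_ge0// ltW// mulr_gt0.
have r0 : 0 <= 2 * k1 * `|r| by rewrite mulr_ge0// ltW// mulr_gt0.
have kL : b / 2 < kapf tau j * L by lra.
have L0 : 0 < L by rewrite -(pmulr_rgt0 _ kj0) (lt_trans _ kL)// divr_gt0.
have kL1 : b / 2 < k1 * L by apply: (lt_le_trans kL); rewrite ler_pM2r.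
have nx : nm x <= C1 * (M + 2) * b.
  apply: (le_trans h1); rewrite -mulrA ler_pM2l//; have := ler_normB (iM p.2) s; rewrite (ger0_norm s0) => h3.
  have : (M + 2) * b = (M + 1) * b + b by ring.
  lra.
have Lx : L <= nm x by rewrite (le_trans (ler_norm _))// lam_le.
have x0 : 0 < nm x by exact: lt_le_trans Lx.
split.
- by rewrite -invr_eq0 -nm_gt0.
- apply: lt_le_trans Lx; apply: (le_lt_trans (ler_norm r)); rewrite -(ltr_pM2l k10); move: kL1; rewrite -/L; lra.
rewrite mulrC ltr_pdivrMr//; apply: (le_lt_trans nx).
have e : L * (4 * k1 * (C1 * (M + 3))) = (C1 * (M + 3)) * (4 * (k1 * L)) by ring.
rewrite e; have cM : 0 < C1 * (M + 3) by apply: mulr_gt0.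
have : C1 * (M + 2) * b <= C1 * (M + 3) * b by rewrite ler_pM2r// ler_pM2l// lerD2l; lra.
have : C1 * (M + 3) * b < C1 * (M + 3) * (4 * (k1 * L)) by rewrite ltr_pM2l//; lra.
lra.
Qed.

(** [fl] selects [z = e2ipi s] with [0 <= Im s < Im tau], so [|z|] stays in a fixed annulus. *)
Definition c0 : R := T * iM tau + 1.
Lemma c0_gt0 : 0 < c0.
Proof. by rewrite ltr_wpDl// ltW// mulr_gt0 ?twopi_gt0. Qed.

Lemma pt_annulus p : expR (- c0) < nm (pt p).1 < expR c0.
Proof.
have /andP[s0 s1] := fl_itv p; rewrite /pt /ptk /= nm_e2ipi !ltr_expR /c0; set s := iM _ in s0 s1 *.
have h1 : T * s < T * iM tau by rewrite ltr_pM2l ?twopi_gt0.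
have h2 : 0 <= T * s by rewrite mulr_ge0// ltW// twopi_gt0.
by apply/andP; split; lra.
Qed.

(** From tubes to sectors. The slope bound gives the sector of [w_j]; if [Im p.1] also dominates
    [Im p.2], the point is in the next sector as well. *)
Lemma pt_sec M : 1 <= M -> exists2 d, 0 < d & forall r, exists2 rho, 0 <= rho & forall j p,
  `|iM p.1| < M * iM p.2 -> rho < iM p.2 -> Sec [:: j] c0 d r (pt (xe j p)) /\
  (iM p.2 < M * iM p.1 -> Sec [:: j; j + 1] c0 d r (pt (xe j p))).
Proof.
move=> M1; have [d d0 hd] := lam_large M1; exists d => // r; have [rho rho0 h] := hd r.
have M0 : 0 < M by exact: lt_le_trans M1.
exists (M * rho); first by rewrite mulr_ge0// ltW.
move=> j p h1 h2; have rM : rho <= M * rho by rewrite ler_peMl.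
have [b1 b2] := bt_xe j p.
have hb : rho < iM (bt j (xe j p)) by rewrite b1 (le_lt_trans rM).
have p20 : 0 < iM p.2 by rewrite -b1 (le_lt_trans rho0 hb).
have [] := h j (xe j p) hb; first by rewrite norm_xe b1 (gtr0_norm p20); lra.
move=> y0 ry ly; have an := pt_annulus (xe j p); split; first by split=> // j'; rewrite inE => /eqP ->.
move=> h3; have ha : rho < iM (bt (j + 1) (xe j p)) by rewrite b2 -(ltr_pM2l M0) (lt_trans h2 h3).
have a0 : 0 < iM p.1 by rewrite -b2 (le_lt_trans rho0 ha).
have [] := h (j + 1) (xe j p) ha; first by rewrite norm_xe b2 (gtr0_norm a0) (gtr0_norm p20); lra.
by move=> _ _ ly'; split=> // j'; rewrite !inE => /orP[] /eqP ->.
Qed.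

Section Invariant.
Variables (j : 'Z_4) (D : C * C -> C).
Hypothesis D_inv : Sect [:: j] (fun q => D (F100 tau q) = D q).

Lemma model_tame J (c t : C) : c != 0 -> tame varpi J (model c t).
Proof. by move=> hc; apply: (close_tame hc); exact: close_model. Qed.

(** These maps are the iterates of [F100], indexed by the integers, and [D] is invariant under each
    of them, far enough in the sector. *)
Lemma shift_inv k : Sect [:: j] (fun q => D (model (e2ipi (- (tau * k%:~R))) k%:~R q) = D q).
Proof.
have step (n m : int) : Sect [:: j] (fun q => model (e2ipi (- (tau * n%:~R))) n%:~R
    (model (e2ipi (- (tau * m%:~R))) m%:~R q) = model (e2ipi (- (tau * (n + m)%:~R))) (n + m)%:~R q).
  move=> c d _ _; apply: filterS (SF_far varpi [:: j] c d (nm (m%:~R : C))) => q [q0 h _].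
  rewrite model_comp//; first by rewrite intrD mulrDr opprD e2ipiD.
  by rewrite addrC -nm_gt0; have := nm_lbD q.2^-1 m%:~R; rewrite addrC; lra.
have tm (n : int) := @model_tame [:: j] _ n%:~R (e2ipi_neq0 (- (tau * n%:~R))).
have base : Sect [:: j] (fun q => D (model (e2ipi (- (tau * (-1)%:~R))) (-1)%:~R q) = D q).
  by apply: SectS D_inv => q; rewrite F100E.
have base' : Sect [:: j] (fun q => D (model (e2ipi (- (tau * 1%:~R))) 1%:~R q) = D q).
  apply: SectS (SectI (step (-1) 1) (tame_Sect (tm 1) base)) => q [e1 e2].
  by rewrite -e2 e1 addNr mulr0z mulr0 oppr0 e2ipi0 model10.
elim/int_ind: k => [|n IH|n IH].
- by apply: SectS (@Sect_torus R varpi [:: j]) => q _; rewrite mulr0z mulr0 oppr0 e2ipi0 model10.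
- apply: SectS (SectI (step 1 n) (SectI (tame_Sect (tm n) base') IH)) => q [e1 [e2 e3]].
  by rewrite (_ : n.+1%:Z = 1 + n%:Z)// -e1 e2.
apply: SectS (SectI (step (-1) (- n%:Z)) (SectI (tame_Sect (tm (- n%:Z)) base) IH)) => q [e1 [e2 e3]].
by rewrite (_ : - n.+1%:Z = -1 + - n%:Z) -?e1 ?e2//; lia.
Qed.

Lemma shift_inv_le (N : nat) : Sect [:: j] (fun q => forall k, (`|k| <= N)%N -> D (model (e2ipi (- (tau * k%:~R))) k%:~R q) = D q).
Proof.
elim: N => [|N IH].
  by apply: SectS (shift_inv 0) => q h k; rewrite leqn0 absz_eq0 => /eqP ->.
apply: SectS (SectI IH (SectI (shift_inv N.+1) (shift_inv (- N.+1%:Z)))) => q [h1 [h2 h3]] k kN.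
have [->//|n1] := eqVneq k N.+1; have [->//|n2] := eqVneq k (- N.+1%:Z).
by apply: h1; lia.
Qed.

(** Conversely, a sector is covered by a tube up to iterates of [F100]; the slope [M] depends only
    on [c] and [d], the radius also on [rho]. *)
Lemma sect_tube c d : 0 < c -> 0 < d -> exists2 M, 1 <= M & forall rho, SF [:: j] c d (fun q =>
  exists p, [/\ `|iM p.1| < M * iM p.2, rho < iM p.2, D q = D (pt (xe j p)) & W j q = e2ipi p.2]).
Proof.
have aux (x y : int) : 0 <= x -> y <= x + 1 -> - x - 2 <= y -> (`|y| <= `|x|.+2)%N.
  by clear; lia.
move=> cp dp; pose k1 := 1 + nm tau; have k10 : 0 < k1 by rewrite ltr_wpDr ?nm_ge0.
have kj (i : 'Z_4) : 0 < kapf tau i <= k1.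
  by rewrite (kapf_gt0 tau_im)/= /kapf /k1; case: odd; rewrite ?lerDl ?lerDr ?nm_ge0.
pose al := kapf tau j * d; have al0 : 0 < al by have /andP[h _] := kj j; exact: mulr_gt0.
pose c' := c / T; have c'0 : 0 < c' by rewrite divr_gt0 ?twopi_gt0.
exists (4 * k1 / al + 1); first by rewrite lerDr divr_ge0 ?(ltW al0)// mulr_ge0// ltW.
(* In the annulus of [c], [log z / (2 i pi)] has imaginary part less than [c'] in modulus, so the
   integer chosen by [fl] is at most [N] in modulus: one radius serves these finitely many
   iterates. *)
move=> rho; pose N : nat := `|Num.floor (c' / iM tau)|.+2.
pose r := Num.max (Num.max ((2 * (c' + `|rho|)) / al) (c' / k1)) N%:R.
have h1 := shift_inv_le N cp dp.
have hs : SF [:: j] c d (Sec [:: j] c d r) by exists r.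
apply: filterS2 h1 hs => q hk [q0 qr qc ql].
have ql' := ql j (mem_head _ _).
have q1 : q.1 != 0 by rewrite -nm_gt0; move/andP: qc => [+ _]; apply: lt_trans; exact: expR_gt0.
have [ze hz] := e2ipi_surj q1; pose P0 := (q.2^-1, ze + tau * q.2^-1) : C * C.
have qE : q = ptk 0 P0 by rewrite /ptk /P0 /= addr0 addrK invrK hz -surjective_pairing.
have ze1 : `|iM ze| < c'.
  move: qc; rewrite -hz nm_e2ipi !ltr_expR ltrN2 => /andP[z1 z2].
  by rewrite /c' ltr_pdivlMr ?twopi_gt0// mulrC -[X in X * _](gtr0_norm (twopi_gt0 R)) -normrM ltr_norml; apply/andP; split; lra.
have lp i : `|kapf tau i * lam i q.2^-1 - iM (bt i P0)| < c'.
  rewrite {1}qE; apply: (le_lt_trans (lam_pt i 0 P0)).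
  by rewrite /= mulr0z addr0 addrK.
exists (bt (j + 1) P0, bt j P0); rewrite /= xe_bt; set y := nm q.2^-1 in qr ql'.
have y0 : 0 < y by rewrite nm_gt0 invr_eq0.
move: (qr); rewrite !gt_max => /andP[/andP[r1 r2] r3].
have b1 : al * y / 2 < iM (bt j P0) /\ `|rho| < iM (bt j P0).
  have := lp j; rewrite ltr_norml => /andP[g1 g2]; have /andP[kj0 _] := kj j.
  have g3 : al * y < kapf tau j * lam j q.2^-1 by rewrite /al -mulrA ltr_pM2l.
  move: r1; rewrite ltr_pdivrMr// [y * _]mulrC => r1; split; have := normr_ge0 rho; lra.
have a1 : `|iM (bt (j + 1) P0)| <= 2 * k1 * y.
  have := ltW (lp (j + 1)); rewrite distrC => g1.
  have /andP[k0 kk] := kj (j + 1).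
  have g2 : `|kapf tau (j + 1) * lam (j + 1) q.2^-1| <= k1 * y.
    by rewrite normrM (gtr0_norm k0) ler_pM// ?(ltW k0)// lam_le.
  have g3 : c' < k1 * y by rewrite mulrC -ltr_pdivrMr.
  have := ler_normD (iM (bt (j + 1) P0) - kapf tau (j + 1) * lam (j + 1) q.2^-1) (kapf tau (j + 1) * lam (j + 1) q.2^-1).
  by rewrite subrK => g4; rewrite (le_trans g4)//; lra.
have [b2 b3] := b1; split.
- apply: (le_lt_trans a1); rewrite mulrDl mul1r.
  have q4 : 0 < 4 * k1 / al by apply: divr_gt0 al0; exact: mulr_gt0.
  have : 4 * k1 / al * (al * y / 2) < 4 * k1 / al * iM (bt j P0) by rewrite (ltr_pM2l q4).
  have -> : 4 * k1 / al * (al * y / 2) = 2 * k1 * y by field; exact: lt0r_neq0.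
  have : 0 <= al * y by rewrite ltW// mulr_gt0.
  lra.
- by rewrite (le_lt_trans (ler_norm _)).
- rewrite /pt; set k := fl P0.
  have kN : (`|k| <= N)%N.
    have := fl_itv P0; rewrite -/k; have -> : iM (P0.2 - tau * (P0.1 + k%:~R)) = iM ze - k%:~R * iM tau.
      by rewrite /P0 /= mulrDr opprD addrA addrK iMB -ofR_int [iM (tau * ofR _)]iMM rE_ofR iM_ofR mulr0 add0r mulrC.
    move: ze1; rewrite ltr_norml => /andP[z1 z2] /andP[g1 g2].
    have g3 : (k%:~R : R) < c' / iM tau by rewrite ltr_pdivlMr//; lra.
    have g4 : - (c' / iM tau) - 1 < (k%:~R : R).
      by rewrite -(ltr_pM2r tau_im) mulrBl mulNr divfK ?lt0r_neq0// mul1r; lra.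
    have /andP[f1 f2] := floor_itv (c' / iM tau); rewrite intrD in f2.
    have f3 : 0 <= c' / iM tau by rewrite divr_ge0 ?ltW.
    have f0 : 0 <= Num.floor (c' / iM tau) by rewrite floor_ge0.
    rewrite /N; set fl0 := Num.floor _ in f0 f1 f2 *.
    have g5 : k <= fl0 + 1 by rewrite -(ler_int R) intrD; lra.
    have g6 : - fl0 - 2 <= k by rewrite -(ler_int R) intrD intrN; lra.
    exact: aux.
  rewrite -(hk k kN) {1}qE model_ptk ?add0r// /P0 /= addr0.
  by rewrite -invr_eq0 invrK.
by rewrite {1}qE W_ptk.
Qed.

Hypothesis D_diff : Sect [:: j] (fun q => differentiable D q).
Hypothesis D_lim : forall e, 0 < e -> Sect [:: j] (fun q => nm (D q) <= e).

Let K p := D (pt (xe j p)).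

Lemma pt_xe_SF M (P : set (C * C)) : 1 <= M -> Sect [:: j] P -> exists2 rho, 0 <= rho & forall p,
  `|iM p.1| < M * iM p.2 -> rho < iM p.2 -> P (pt (xe j p)).
Proof.
move=> M1 hP; have [d dp hd] := pt_sec M1; have [r hr] := hP _ _ c0_gt0 dp.
by have [rho rho0 h] := hd r; exists rho => // p p1 p2; apply: hr; have [] := h j p p1 p2.
Qed.

Lemma tdom_open M r p : `|iM p.1| < M * iM p.2 -> r < iM p.2 ->
  \forall q \near p, `|iM q.1| < M * iM q.2 /\ r < iM q.2.
Proof.
move=> h1 h2; pose e := Num.min ((M * iM p.2 - `|iM p.1|) / (1 + `|M|)) (iM p.2 - r).
have M1 : 0 < 1 + `|M| by rewrite ltr_wpDr.
have e0 : 0 < e by rewrite lt_min subr_gt0 h2 andbT divr_gt0// subr_gt0.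
apply/nbhsC2P; exists e => // q q1 q2.
have k1 : `|iM q.1 - iM p.1| < e by rewrite -iMB (le_lt_trans (iM_le _)).
have k2 : `|iM q.2 - iM p.2| < e by rewrite -iMB (le_lt_trans (iM_le _)).
have e1 : e * (1 + `|M|) <= M * iM p.2 - `|iM p.1| by rewrite -ler_pdivlMr// ge_min lexx.
have e2 : e <= iM p.2 - r by rewrite ge_min lexx orbT.
split; last by move: k2; rewrite ltr_norml => /andP[]; lra.
have h3 : `|iM q.1| <= `|iM p.1| + `|iM q.1 - iM p.1|.
  by rewrite -{1}[iM q.1](subrK (iM p.1)) addrC (le_trans (ler_normD _ _))// lerD2r.
have h4 : M * (iM p.2 - iM q.2) <= `|M| * e.
  rewrite (le_trans (ler_norm _))// normrM distrC; apply: ler_wpM2l => //; exact: ltW.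
rewrite mulrBr in h4; lra.
Qed.

Lemma diff_ptk k p : p.1 + k%:~R != 0 -> differentiable (ptk k) p.
Proof.
move=> h; have d1 : differentiable (fun p : C * C => p.1 + k%:~R) p.
  by apply: differentiableD; [exact: diff_fst|exact: differentiable_cst].
apply/diff_pairP; split; rewrite /ptk /=; last exact: differentiableV.
apply: (@differentiable_comp _ _ _ _ (fun p : C * C => p.2 - tau * (p.1 + k%:~R)) (@e2ipi R)); last exact: diff_e2ipi.
apply: differentiableB; first exact: diff_snd.
by apply: differentiableM; [exact: differentiable_cst|exact: d1].
Qed.

Lemma fl_near p : \forall q \near p, fl q = fl p \/ fl q = fl p - 1.
Proof.
have df : differentiable (fun q : C * C => q.2 - tau * (q.1 + (fl p)%:~R)) p.
  apply: differentiableB; first exact: diff_snd.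
  apply: differentiableM; first exact: differentiable_cst.
  by apply: differentiableD; [exact: diff_fst|exact: differentiable_cst].
have /cvgCP cf := differentiable_continuous df.
have /andP[h1 h2] := fl_itv p; pose e := Num.min (iM tau) (iM tau - iM (p.2 - tau * (p.1 + (fl p)%:~R))).
have e0 : 0 < e by rewrite lt_min tau_im subr_gt0.
apply: filterS (cf e e0) => q /= hq.
have : `|iM (q.2 - tau * (q.1 + (fl p)%:~R)) - iM (p.2 - tau * (p.1 + (fl p)%:~R))| < e.
  by rewrite -iMB (le_lt_trans (iM_le _)).
rewrite lt_min => /andP[]; set s := iM (p.2 - _) in h1 h2 *.
have es (k : int) : iM (q.2 - tau * (q.1 + (fl p - k)%:~R)) = iM (q.2 - tau * (q.1 + (fl p)%:~R)) + k%:~R * iM tau.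
  have -> : q.2 - tau * (q.1 + (fl p - k)%:~R) = q.2 - tau * (q.1 + (fl p)%:~R) + tau * k%:~R by rewrite intrB /=; ring.
  by rewrite iMD -(ofR_int R k) [iM (tau * ofR _)]iMM rE_ofR iM_ofR mulr0 add0r [iM tau * _]mulrC.
set s' := iM _ in es *; rewrite !ltr_norml => /andP[a1 a2] /andP[b1 b2].
have [s0|s0] := leP 0 s'; [left|right]; apply: fl_uniq.
  by rewrite -/s'; apply/andP; split; lra.
by rewrite es mul1r; apply/andP; split; lra.
Qed.

(** [fl] is locally constant up to a jump by one; across a jump the invariance of [D] identifies [K]
    with [D] composed with a fixed branch [ptk k0]. *)
Lemma K_holper M rho : 1 <= M -> (forall p, `|iM p.1| < M * iM p.2 -> rho < iM p.2 ->
     [/\ differentiable D (pt (xe j p)), D (model (e2ipi (- (tau * 1%:~R))) 1%:~R (pt (xe j p))) = D (pt (xe j p))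
       & (pt (xe j p)).2 != 0 /\ (pt (xe j p)).2^-1 + 1 != 0]) ->
  holper (fun a b => `|a| < M * b /\ rho < b) K.
Proof.
move=> M1 hr; split; last first.
  by move=> q _; have [e1 e2] := pt_xe_per j q; rewrite /K e1 e2.
move=> p [p1 p2]; have [dD _ [y0 _]] := hr p p1 p2.
set k0 := fl (xe j p).
have P0 : (xe j p).1 + k0%:~R != 0 by move: y0; rewrite /pt /= invr_eq0.
have dg : differentiable (fun q => ptk k0 (xe j q)) p.
  apply: (@differentiable_comp _ _ _ _ (xe j) (ptk k0)); [exact: diff_xe|exact: diff_ptk].
have dDg : differentiable (fun q => D (ptk k0 (xe j q))) p.
  exact: (@differentiable_comp _ _ _ _ (fun q => ptk k0 (xe j q)) D p dg dD).
suff nq : \forall q \near p, D (ptk k0 (xe j q)) = K q by exact: (near_diffC2 nq dDg).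
have cx : \forall q \near p, fl (xe j q) = k0 \/ fl (xe j q) = k0 - 1.
  have h : nbhs p (xe j @^-1` [set q | fl q = k0 \/ fl q = k0 - 1]).
    exact: (differentiable_continuous (diff_xe j p) (fl_near (xe j p))).
  exact: h.
apply: filterS2 (tdom_open p1 p2) cx => q [q1 q2] [e|e]; first by rewrite /K /pt e.
have [_ eD [z0 z1]] := hr q q1 q2; rewrite /K -eD /pt e model_ptk ?subrK//.
by move: z0; rewrite /pt e /= invr_eq0.
Qed.

Lemma tube_radius : exists rr : R -> R, [/\ forall M, 1 <= M -> 0 <= rr M /\ rr 1 <= rr M,
  forall M, 1 <= M -> holper (tdom rr M) K &
  forall M e, 1 <= M -> 0 < e -> exists r, forall p, tdom rr M (iM p.1) (iM p.2) -> r < iM p.2 -> nm (K p) <= e].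
Proof.
have far : Sect [:: j] (fun q => q.2 != 0 /\ q.2^-1 + 1 != 0).
  move=> c d _ _; apply: filterS (SF_far varpi [:: j] c d 1) => q [q0 h _]; split=> //.
  by rewrite -nm_gt0; have := nm_lbD q.2^-1 1; rewrite nm1; lra.
have good := SectI (SectI D_diff (shift_inv 1)) far.
pose ok M rho := 0 <= rho /\ forall p, `|iM p.1| < M * iM p.2 -> rho < iM p.2 ->
   [/\ differentiable D (pt (xe j p)), D (model (e2ipi (- (tau * 1%:~R))) 1%:~R (pt (xe j p))) = D (pt (xe j p))
     & (pt (xe j p)).2 != 0 /\ (pt (xe j p)).2^-1 + 1 != 0].
have /choice[f hf] : forall M : R, exists rho, 1 <= M -> ok M rho.
  move=> M; have [M1|_] := boolP (1 <= M); last by exists 0.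
  have [rho rho0 h] := pt_xe_SF M1 good; exists rho => _; split=> // p p1 p2.
  by have [[h1 h2] h3] := h p p1 p2.
(* The maximum with [f 1] yields [rr 1 <= rr M], through which the coefficients of all tubes are
   compared with those of slope 1. *)
pose rr M := Num.max (f 1) (f M).
have rM M : f M <= rr M by rewrite le_max lexx orbT.
have r1 M : f 1 <= rr M by rewrite le_max lexx.
exists rr; split.
- move=> M M1; have [h _] := hf 1 (lexx 1); split; first exact: le_trans h (r1 M).
  by rewrite {1}/rr maxxx r1.
- move=> M M1; have [_ h] := hf M M1; apply: (K_holper M1) => p p1 p2; apply: h => //; exact: le_lt_trans p2.
move=> M e M1 e0; have [rho _ h] := pt_xe_SF M1 (D_lim e0).
by exists rho => p [p1 _] p2; apply: h.
Qed.

Lemma sect_decay c d : 0 < c -> 0 < d -> exists2 Q, 0 <= Q & SF [:: j] c d (fun q => nm (D q) <= Q * nm (W j q)).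
Proof.
move=> cp dp; have [rr [rr0 hol lim]] := tube_radius.
have [Q [r [Q0 hQ]]] := tube_decay rr0 hol lim; exists Q => //.
have [M M1 hM] := sect_tube cp dp.
apply: filterS (hM (Num.max (rr M) r)) => q [p [p1 p2 -> ->]].
move: p2; rewrite gt_max => /andP[p2 p3].
by rewrite nm_e2ipi; apply: hQ p3; first exact: M1.
Qed.

Hypothesis D_decay : forall c d, 0 < c -> 0 < d -> exists2 Q, 0 <= Q &
  SF [:: j; j + 1] c d (fun q => nm (D q) <= Q * nm (W (j + 1) q)).

Lemma sect_zero : Sect [:: j] (fun q => D q = 0).
Proof.
have [rr [rr0 hol lim]] := tube_radius.
have dec M : 1 <= M -> exists Q r, 0 <= Q /\ forall p, tdom rr M (iM p.1) (iM p.2) ->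
    r < iM p.2 -> iM p.2 < M * iM p.1 -> nm (K p) <= Q * expR (- (T * iM p.1)).
  move=> M1; have [d dp hd] := pt_sec M1; have [Q Q0 [r hr]] := D_decay c0_gt0 dp.
  have [rho _ h] := hd r; exists Q, rho; split=> // p [p1 _] p2 p3.
  have [_ /(_ p3) hs] := h j p p1 p2; have := hr _ hs.
  by rewrite /pt W_ptk; have [_ ->] := bt_xe j p; rewrite nm_e2ipi.
move=> c d cp dp; have [M M1 hM] := sect_tube cp dp.
apply: filterS (hM (rr M)) => q [p [p1 p2 -> _]].
exact: (tube_zero rr0 hol lim dec M1).
Qed.

End Invariant.

End TubeCoordinates.

(** * Estimates for conjugacies *)

Section Estimates.
Variable R : realType.
Local Notation C := (Cx R).

(** In the coordinate [y = 1 / xi], translation by [t] is a homography, Lipschitz as long as its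
    denominator stays away from 0. *)
Lemma mobius_lip (t x y : C) : nm t * nm x <= 2^-1 -> nm t * nm y <= 2^-1 ->
  nm (x / (1 + t * x) - y / (1 + t * y)) <= 4 * nm (x - y).
Proof.
have small (w : C) : nm t * nm w <= 2^-1 -> 2^-1 <= nm (1 + t * w).
  by move=> nw; have := nm_lbD 1 (t * w); rewrite nm1 nmM; lra.
move=> /small sx /small sy.
have x1 : 1 + t * x != 0 by rewrite -nm_gt0; lra.
have y1 : 1 + t * y != 0 by rewrite -nm_gt0; lra.
have -> : x / (1 + t * x) - y / (1 + t * y) = (x - y) / ((1 + t * x) * (1 + t * y)) by field; rewrite x1 y1.
rewrite nmM nmV nmM ler_pdivrMr ?mulr_gt0 ?nm_gt0//.
have := nm_ge0 (x - y); set n := nm (x - y) => n0.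
have : 4^-1 <= nm (1 + t * x) * nm (1 + t * y) by nra.
set k := nm _ * _ => hk; nra.
Qed.

Lemma mobius_close (t x y : C) (K s : R) n : 0 <= K -> 0 <= s -> s < Num.min 1 (2 * (nm t * (K + 2) + 1))^-1 ->
  nm (y - x) <= K * s ^+ n.+1 -> nm y <= 2 * s ->
  nm (x / (1 + t * x) - y / (1 + t * y)) <= 4 * K * s ^+ n.+1.
Proof.
move=> K0 s0; rewrite lt_min => /andP[s1 sM] xy ys; have t0 := nm_ge0 t.
have hs : nm t * ((K + 2) * s) <= 2^-1.
  move: sM; rewrite -[X in _ < X]mul1r ltr_pdivlMr; last by rewrite mulr_gt0// ltr_wpDl// mulr_ge0// addr_ge0.
  by rewrite mulrA; set m := nm t * _; nra.
have sn : K * s ^+ n.+1 <= K * s by rewrite ler_wpM2l// exprS ler_piMr// exprn_ile1// ltW.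
have sm (w : C) : nm w <= (K + 2) * s -> nm t * nm w <= 2^-1.
  by move=> nw; apply: le_trans hs; rewrite ler_wpM2l.
have hx : nm x <= (K + 2) * s by have := nm_lb x y; rewrite nmC mulrDl; lra.
have hy : nm y <= (K + 2) * s by rewrite (le_trans ys)// ler_wpM2r// lerDr.
by rewrite (le_trans (mobius_lip (sm _ hx) (sm _ hy)))// nmC -mulrA ler_wpM2l.
Qed.

Lemma nm_exp_close (p q : C) (L : R) n : 0 <= L -> nm p < 1 -> nm (q - p) <= L * nm p ^+ 2 ->
  nm q ^+ n <= (L + 1) ^+ n * nm p ^+ n.
Proof.
move=> L0 p1 qp; rewrite -exprMn lerXn2r ?nnegrE ?mulr_ge0 ?nm_ge0 ?addr_ge0//.
have : L * nm p ^+ 2 <= L * nm p by rewrite ler_wpM2l// expr2 ler_piMl ?nm_ge0// ltW.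
by have := nm_lb q p; lra.
Qed.

Lemma nm_near1 (u : C) : nm (u - 1) <= 2^-1 -> 1 <= 2 * nm u.
Proof. by have := nm_lb 1 u; rewrite nm1 nmC; lra. Qed.

Lemma ratio_close (u u' e : C) (l l' k : R) : nm (u - 1) <= l -> l <= 2^-1 -> nm (u' - 1) <= l' -> l' <= 2^-1 -> nm e <= k ->
  nm (((u' - 1) - (u - 1) + e * u') / u) <= 2 * l' + 2 * l + 4 * k.
Proof.
move=> ul l2 ul' l2' ek.
have u2 := nm_near1 (le_trans ul l2).
have u'2 : nm u' <= 2 by have := nm_lb u' 1; rewrite nm1; lra.
rewrite nmM nmV ler_pdivrMr; last by lra.
have b1 := nmD (u' - 1 - (u - 1)) (e * u').
have b2 := nmB (u' - 1) (u - 1).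
have b3 : nm (e * u') <= k * 2 by rewrite nmM ler_pM ?nm_ge0.
have := nm_ge0 (u - 1); have := nm_ge0 (u' - 1); have := nm_ge0 e; nra.
Qed.

End Estimates.

Section ConjugacyBounds.
Variables (R : realType) (varpi : R).
Local Notation C := (Cx R).
Local Notation SF := (SF varpi).
Local Notation Sect := (Sect varpi).
Local Notation tame := (tame varpi).
Local Notation close := (close varpi).
Implicit Types (J : seq 'Z_4) (p q : C * C) (f g : C * C -> C * C).

(** The indicator of the complement vanishes near [Ctilde], so it is [O(y)]; [bigOy_SF] turns this
    into a uniform bound, below 1 far in the sector. *)
Lemma set_nbhs_Sect J (Q : set (C * C)) : set_nbhs (@Ctilde R) Q -> Sect J Q.
Proof.
move=> hQ c d c0 d0; pose h p : C := if `[< Q p >] then 0 else 1.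
have hh : bigOy 1 h.
  move=> z z0; exists 0; have hz : nbhs ((z, 0) : C * C) Q by apply: hQ.
  by apply: filterS hz => p Qp; rewrite /h asboolT// normr0 mul0r.
have [K K0 hK] := bigOy_SF varpi J c d hh.
have e0 : 0 < (K + 1)^-1 by rewrite invr_gt0 ltr_wpDl.
apply: filterS2 hK (SF_small varpi J c d e0) => p /=; rewrite expr1 /h.
case: asboolP => // _; rewrite nm1 => h1; rewrite -[X in _ < X]mul1r ltr_pdivlMr; last by rewrite ltr_wpDl.
have := nm_ge0 p.2; nra.
Qed.

Lemma tame_nm J f c d : tame J f -> 0 < c -> 0 < d ->
  SF J c d [set p | (f p).2 != 0 /\ nm (f p).2^-1 <= 2 * nm p.2^-1].
Proof.
move=> tf c0 d0; have [K K0 hK] := tf c d c0 d0.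
apply: filterS2 hK (SF_far varpi J c d K) => p [f0 f1 _] [_ h _]; split=> //=.
have := nm_lb (f p).2^-1 p.2^-1; lra.
Qed.

Lemma close_comp J (c1 c2 : C) f g : c1 != 0 -> close J c1 f -> close J c2 g -> close J (c2 * c1) (g \o f).
Proof.
move=> n1 cf cg c d c0 d0; have [K K0 hK] := cf c d c0 d0.
have [c' cc [d' /andP[d'0 _] h]] := tame_SF (close_tame n1 cf) c0 d0.
have [L L0 hL] := cg c' d' (lt_trans c0 cc) d'0.
have L4 : 0 <= L * (K + 1) ^+ 2 by rewrite mulr_ge0// exprn_ge0// addr_ge0.
have L5 : 0 <= nm c2 * K by rewrite mulr_ge0 ?nm_ge0.
exists (L * (K + 1) ^+ 2 + nm c2 * K + K); first by rewrite !addr_ge0.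
apply: filterS3 hK (h _ hL) (SF_small varpi J c d ltr01) => p [a1 a2] [b1 b2] /= y1.
have y0 := nm_ge0 p.2; have y2 : nm p.2 ^+ 2 <= nm p.2 by rewrite expr2 ler_piMl// ltW.
have f2 : nm (f p).2 <= (K + 1) * nm p.2.
  have := nm_lb (f p).2 p.2; have : K * nm p.2 ^+ 2 <= K * nm p.2 by rewrite ler_wpM2l.
  lra.
have f0 := nm_ge0 (f p).2.
have K1 : K + 1 <= (K + 1) ^+ 2 by rewrite expr2 ler_peMr ?addr_ge0// lerDr.
split.
  apply: (le_trans (nm_subr _ (c2 * (f p).1) _)).
  rewrite -[c2 * c1 * _]mulrA -mulrBr nmM !mulrDl.
  have h1 : nm c2 * nm ((f p).1 - c1 * p.1) <= nm c2 * K * nm p.2 by rewrite -mulrA ler_wpM2l ?nm_ge0.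
  have h2 : L * nm (f p).2 <= L * (K + 1) ^+ 2 * nm p.2.
    rewrite -mulrA ler_wpM2l// (le_trans f2)// ler_wpM2r//.
  have : 0 <= K * nm p.2 by rewrite mulr_ge0.
  lra.
apply: (le_trans (nm_subr _ (f p).2 _)); rewrite !mulrDl.
have h2 : L * nm (f p).2 ^+ 2 <= L * (K + 1) ^+ 2 * nm p.2 ^+ 2.
  by rewrite -mulrA -exprMn ler_wpM2l// lerXn2r ?nnegrE// mulr_ge0// addr_ge0.
have : 0 <= nm c2 * K * nm p.2 ^+ 2 by rewrite mulr_ge0// exprn_ge0.
lra.
Qed.

(** In [1 / f - 1 / g = (g - f) / (f g)] the denominator has order [y^2], so contact of order 3 in
    [y] makes the difference of the [xi] coordinates tend to 0. *)
Lemma xi_diff J f g e : tame J f -> tame J g -> 0 < e ->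
  (forall c d, 0 < c -> 0 < d -> exists2 K, 0 <= K & SF J c d [set p | nm ((f p).2 - (g p).2) <= K * nm p.2 ^+ 3]) ->
  Sect J (fun p => nm ((f p).2^-1 - (g p).2^-1) <= e).
Proof.
move=> tf tg e0 h c d c0 d0; have [K K0 hK] := h c d c0 d0.
have r0 : 0 < e / (4 * (K + 1)) by rewrite divr_gt0// mulr_gt0// ltr_wpDl.
apply: filterS3 hK (filterI (SF_small varpi J c d r0) (SF_far varpi J c d 0)) (filterI (tame_nm tf c0 d0) (tame_nm tg c0 d0)).
move=> p /= hp [ps [p0 _ _]] [[f0 f1] [g0 g1]].
have -> : (f p).2^-1 - (g p).2^-1 = ((g p).2 - (f p).2) * ((f p).2^-1 * (g p).2^-1) by field; rewrite f0 g0.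
rewrite nmM nmC nmM; have y0 : 0 < nm p.2 by rewrite nm_gt0.
have hfg : nm (f p).2^-1 * nm (g p).2^-1 <= 4 * nm p.2^-1 ^+ 2.
  have -> : 4 * nm p.2^-1 ^+ 2 = (2 * nm p.2^-1) * (2 * nm p.2^-1) by ring.
  by apply: ler_pM; rewrite ?nm_ge0.
apply: (le_trans (ler_pM _ _ hp hfg)); rewrite ?mulr_ge0 ?nm_ge0//.
have -> : K * nm p.2 ^+ 3 * (4 * nm p.2^-1 ^+ 2) = 4 * K * nm p.2.
  by rewrite nmV; field; exact: lt0r_neq0.
move: ps; rewrite ltr_pdivlMr; last by rewrite mulr_gt0// ltr_wpDl.
nra.
Qed.

Lemma z_ratio J (c1 : C) f g e : c1 != 0 -> close J c1 f -> close J c1 g -> 0 < e ->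
  Sect J (fun p => (g p).1 != 0 /\ nm ((f p).1 / (g p).1 - 1) <= e).
Proof.
move=> n1 cf cg e0 c d c0 d0; have [K K0 hK] := cf c d c0 d0; have [L L0 hL] := cg c d c0 d0.
have [N N0 hN] := close_tame n1 cg c0 d0.
have r0 : 0 < e * (expR (- N) * expR (- c)) / (K + L + 1) by rewrite divr_gt0 ?mulr_gt0 ?expR_gt0// ltr_wpDl// addr_ge0.
apply: filterS3 (filterI hK hL) (filterI (SF_small varpi J c d r0) (SF_far varpi J c d 0)) hN.
move=> p [[a1 _] [b1 _]] [/= ps [p0 _ /andP[p1 _]]] [_ _ /andP[q1 _]].
have zb : expR (- N) * expR (- c) < nm (g p).1 by rewrite (lt_le_trans _ q1)// ltr_pM2l ?expR_gt0.
have z0 : 0 < nm (g p).1 by rewrite (lt_trans _ zb)// mulr_gt0 ?expR_gt0.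
have z1 : (g p).1 != 0 by rewrite -nm_gt0.
split=> //; have -> : (f p).1 / (g p).1 - 1 = ((f p).1 - (g p).1) / (g p).1 by field.
rewrite nmM nmV ler_pdivrMr//; have := nm_subr (f p).1 (c1 * p.1) (g p).1.
rewrite [nm (c1 * _ - _)]nmC => h1.
move: ps; rewrite ltr_pdivlMr; last by rewrite ltr_wpDl// addr_ge0.
have := nm_ge0 p.2; set x := expR (- N) * _ in zb *; move=> y0 h2.
have : e * x < e * nm (g p).1 by rewrite ltr_pM2l.
nra.
Qed.

End ConjugacyBounds.

(** * Convergent automorphisms read in the charts *)

Section Forward.
Variables (R : realType) (tau : Cx R) (varpi : R) (F : Cx R * Cx R -> Cx R * Cx R) (a b : nat -> Cx R -> Cx R).
Local Notation C := (Cx R).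
Local Notation T := (twopi R).
Local Notation SF := (SF varpi).
Local Notation Sect := (Sect varpi).
Local Notation tame := (tame varpi).
Local Notation close := (close varpi).
Local Notation asy := (asy varpi a b).
Local Notation W := (Wc tau).
Local Notation SC := (SC tau varpi F a b).
Hypothesis tau_im : 0 < iM tau.
Hypothesis tau_arg : tau = ofR (nm tau) * cexp (ofR varpi * ii R).
Hypothesis F_nbhd : neighbourhood_germ tau F.
Hypothesis ab : holomorphic_coefs a b.
Variables (u v : 'Z_4 -> C * C -> C) (P Q : 'Z_4 -> C * C -> C * C).
Hypothesis huv : forall i, [/\ cg (u i) (v i), \forall w \near ((0, 0) : C * C), u i (w.1, 0) = 1
  & \forall w \near ((0, 0) : C * C), v i (w.1, 0) = 1].
Hypothesis hSC : forall i, SC i (P i) (Q i).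
Hypothesis hov : forall i, Sect [:: i; i + 1] (fun p => Pimap tau (P i p) =
  kap i (mUV (u i) (v i) (W i (P (i + 1) p), W (i + 1) (P (i + 1) p)))).
Implicit Types (i j g : 'Z_4) (p q : C * C).

Lemma sub_l i : {subset [:: i] <= [:: i; i + 1]}. Proof. by move=> j; rewrite !inE => ->. Qed.
Lemma sub_r i : {subset [:: i + 1] <= [:: i; i + 1]}. Proof. by move=> j; rewrite !inE => ->; rewrite orbT. Qed.

Lemma P_close i : close [:: i] 1 (P i).
Proof. by have [h _ _ _ _] := hSC i; exact: asy_close h. Qed.

Lemma P_tame i : tame [:: i] (P i).
Proof. by have [h _ _ _ _] := hSC i; exact: asy_tame h. Qed.

Lemma Q_tame i : tame [:: i] (Q i). Proof. by have [] := hSC i. Qed.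

(* [u] multiplies the coordinate [W i] and [v] the coordinate [W (i + 1)]. *)
Definition fac i g U := (g = i /\ U = u i) \/ (g = i + 1 /\ U = v i).

Lemma overlap i g U : fac i g U -> Sect [:: i; i + 1] (fun p =>
  W g (P i p) = W g (P (i + 1) p) * U (W i (P (i + 1) p), W (i + 1) (P (i + 1) p))).
Proof.
move=> hU; apply: SectS (hov i) => p e; have [e1 e2] := wc_kap i (mUV (u i) (v i) (W i (P (i + 1) p), W (i + 1) (P (i + 1) p))).
by case: hU => -[-> ->]; [move: e1|move: e2]; rewrite -e.
Qed.

Lemma fac_germ i g U : fac i g U -> hol0 U /\ \forall w \near ((0, 0) : C * C), U (w.1, 0) = 1.
Proof. by have [[_ _ h1 h2] h3 h4] := huv i; case=> -[_ ->]. Qed.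

Lemma Q_F100 i : Sect [:: i] (fun q => Q i (F100 tau q) = F (Q i q)).
Proof.
have [_ tQ h1 h2 h3] := hSC i.
have k1 := tame_Sect tQ h3; have k2 := tame_Sect tQ (tame_Sect (@F_tame R tau varpi F F_nbhd [:: i]) h1).
by apply: SectS (SectI h2 (SectI k1 k2)) => q [[_ e1] [e2 [_ e3]]]; rewrite -{1}e1 -e2.
Qed.

Variables (c t : C) (Th : C * C -> C * C).
Hypothesis hTh : convergent_aut F a b c t Th.
Let Am := e2ipi t.
Let Bm := c * e2ipi (tau * t).

Lemma c_neq0 : c != 0. Proof. by have [[]] := hTh. Qed.

Lemma Th_close J : close J c Th.
Proof.
move=> c' d c'0 d0; have [_ hf] := hTh; have [h0 _] := hf 0%N; have [_ h1] := hf 1%N.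
have [K K0 hK] := bigOy_SF varpi J c' d h0; have [L L0 hL] := bigOy_SF varpi J c' d h1.
have [N N0 hN] := @close_model R varpi J c t c' d c'0 d0.
exists (K + L + N); first by rewrite !addr_ge0.
apply: filterS3 hK hL hN => p /=; rewrite !big_geq// !addr0 expr1 => k1 k2 [_ k3].
have y0 := nm_ge0 p.2; have y2 : 0 <= nm p.2 ^+ 2 by rewrite exprn_ge0.
have lN : 0 <= (L + N) * nm p.2 by rewrite mulr_ge0// addr_ge0.
have kN : 0 <= K * nm p.2 ^+ 2 by rewrite mulr_ge0.
split; first by rewrite -addrA mulrDl; lra.
apply: (le_trans (nm_subr _ (p.2 / (1 + t * p.2)) _)); rewrite !mulrDl; lra.
Qed.

Lemma Th_tame J : tame J Th. Proof. by apply: (close_tame c_neq0); exact: Th_close. Qed.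

(** The formal identity at order 2 gives exactly the contact of order 3 that [xi_diff] requires. *)
Lemma conj_cubic i c' d : 0 < c' -> 0 < d -> exists2 K, 0 <= K & SF [:: i] c' d
  [set p | nm ((P i (Th p)).2 - (model c t (P i p)).2) <= K * nm p.2 ^+ 3].
Proof.
move=> c'0 d0; have [_ /(_ 2%N)[_ h2]] := hTh; have [K1 K10 hK1] := bigOy_SF varpi [:: i] c' d h2.
have [hasy _ _ _ _] := hSC i.
have [K2 K20 hK2] := hasy 2%N c' d c'0 d0.
have [c1 cc [d1 /andP[d10 _] hp]] := tame_SF (@Th_tame [:: i]) c'0 d0.
have [K3 K30 hK3] := hasy 2%N c1 d1 (lt_trans c'0 cc) d10.
have [L L0 hL] := @Th_close [:: i] c' d c'0 d0.
have e0 : 0 < Num.min 1 (2 * (nm t * (K2 + 2) + 1))^-1.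
  by rewrite lt_min ltr01 invr_gt0 mulr_gt0// ltr_wpDl// mulr_ge0 ?nm_ge0// addr_ge0.
exists (K3 * (L + 1) ^+ 3 + K1 + 4 * K2); first by rewrite !addr_ge0 ?mulr_ge0 ?exprn_ge0 ?addr_ge0.
apply: filterS3 (filterI hK1 hK2) (filterI (hp _ hK3) hL) (filterI (nm_close (@P_close i) c'0 d0) (SF_small varpi [:: i] c' d e0)).
move=> p [k1 [_ k2]] [[_ k3] [_ k4]] [/= k5 pe].
have lip := mobius_close K20 (nm_ge0 p.2) pe k2 k5.
have y1 : nm p.2 < 1 by move: pe; rewrite lt_min => /andP[].
have f3 : K3 * nm (Th p).2 ^+ 3 <= K3 * (L + 1) ^+ 3 * nm p.2 ^+ 3 by rewrite -mulrA ler_wpM2l// nm_exp_close.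
set x := (trunc a b 2 p).2 in k1 lip.
have k1' : nm ((trunc a b 2 (Th p)).2 - x / (1 + t * x)) <= K1 * nm p.2 ^+ 3 := k1.
set A := K3 * _ in f3 *; rewrite 2!mulrDl; apply: (le_trans (nm_subr _ (x / (1 + t * x)) _) (lerD _ lip)).
exact: (le_trans (nm_subr _ (trunc a b 2 (Th p)).2 _) (lerD (le_trans k3 f3) k1')).
Qed.

Definition Tr i q := P i (Th (Q i q)).

Lemma Tr_tame i : tame [:: i] (Tr i).
Proof. exact: (tame_comp (Q_tame i) (tame_comp (@Th_tame [:: i]) (P_tame i))). Qed.

Lemma Tr_lim i e : 0 < e -> Sect [:: i] (fun q => [/\ q.1 != 0, q.2 != 0,
  nm ((Tr i q).2^-1 - (q.2^-1 + t)) <= e & nm ((Tr i q).1 / (c * q.1) - 1) <= e]).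
Proof.
move=> e0; have c0 := c_neq0; have [_ tQ _ h2 _] := hSC i.
have tm := @model_tame R varpi [:: i] c t c0.
have h3 := xi_diff (tame_comp (@Th_tame [:: i]) (P_tame i)) (tame_comp (P_tame i) tm) e0 (@conj_cubic i).
have cm := close_comp (oner_neq0 C) (@P_close i) (@close_model R varpi [:: i] c t).
have cT := close_comp c0 (@Th_close [:: i]) (@P_close i).
rewrite mul1r in cT; rewrite mulr1 in cm.
have h4 := z_ratio c0 cT cm e0.
apply: SectS (SectI (tame_Sect tQ h3) (SectI (tame_Sect tQ h4) (SectI h2 (@Sect_torus R varpi [:: i])))).
move=> q [k1 [[_ k2] [[_ e1] [q1 q2]]]]; split=> //.
  by rewrite -(model_xi c t q2) -{2}e1.
by rewrite -{2}e1.
Qed.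

Lemma Tr_diff i : Sect [:: i] (fun q => differentiable (Tr i) q).
Proof.
have [[_ [gi [[dT _] _ _ _]] _ _] _] := hTh.
have [_ tQ h1 h2 _] := hSC i.
have k1 := tame_Sect tQ (set_nbhs_Sect varpi [:: i] dT).
have k2 := tame_Sect tQ (tame_Sect (@Th_tame [:: i]) h1).
apply: SectS (SectI h2 (SectI k1 k2)) => q [[dQ _] [dTh [dP _]]].
have d1 : differentiable (Th \o Q i) q by exact: (@differentiable_comp _ _ _ _ (Q i) Th _ dQ dTh).
exact: (@differentiable_comp _ _ _ _ (Th \o Q i) (P i) _ d1 dP).
Qed.

Lemma Tr_F100 i : Sect [:: i] (fun q => Tr i (F100 tau q) = F100 tau (Tr i q)).
Proof.
have [[_ _ com _] _] := hTh; have [_ tQ _ _ h3] := hSC i.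
have k1 := tame_Sect tQ (set_nbhs_Sect varpi [:: i] com).
have k2 := tame_Sect tQ (tame_Sect (@Th_tame [:: i]) h3).
by apply: SectS (SectI (@Q_F100 i) (SectI k1 k2)) => q [e1 [e2 e3]]; rewrite /Tr e1 e2.
Qed.

(* [Er] vanishes when the automorphism multiplies the coordinate [W g] by its linear multiplier. *)
Definition Er i g q := W g (Tr i q) / (tw g (Am, Bm) * W g q) - 1.

Lemma AB_neq0 : Am != 0 /\ Bm != 0.
Proof. by split; [exact: e2ipi_neq0|apply: mulf_neq0; [exact: c_neq0|exact: e2ipi_neq0]]. Qed.

Lemma tw_mul g (x y x' y' : C) : tw g (x * x', y * y') = tw g (x, y) * tw g (x', y').
Proof. by rewrite /tw; case: odd; rewrite pwM. Qed.

(** The exponentials of [xi], which may be huge or tiny, cancel: [Er] depends only on the deviations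
    controlled by [Tr_lim], hence tends to 0. *)
Lemma Er_E i g q : q.1 != 0 -> q.2 != 0 ->
  Er i g q = tw g (e2ipi ((Tr i q).2^-1 - (q.2^-1 + t)), (Tr i q).1 / (c * q.1) * e2ipi (tau * ((Tr i q).2^-1 - (q.2^-1 + t)))) - 1.
Proof.
move=> q1 q2; rewrite /Er !WE /Xc /Yc; set d := _ - (_ + t).
have e : (Tr i q).2^-1 = q.2^-1 + t + d by rewrite /d; ring.
have -> : e2ipi (Tr i q).2^-1 = Am * e2ipi q.2^-1 * e2ipi d by rewrite e !e2ipiD /Am; ring.
have -> : (Tr i q).1 * e2ipi (tau / (Tr i q).2) = Bm * (q.1 * e2ipi (tau / q.2)) * ((Tr i q).1 / (c * q.1) * e2ipi (tau * d)).
  rewrite e !mulrDr !e2ipiD /Bm; field; by rewrite q1 c_neq0.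
rewrite (tw_mul g (Am * e2ipi q.2^-1) (Bm * (q.1 * e2ipi (tau / q.2)))) (tw_mul g Am Bm); congr (_ - 1); have [A0 B0] := AB_neq0.
have h : tw g (Am, Bm) * tw g (e2ipi q.2^-1, q.1 * e2ipi (tau / q.2)) != 0.
  apply: mulf_neq0; first exact: tw_neq0.
  by apply: tw_neq0; [exact: e2ipi_neq0|apply: mulf_neq0; [exact: q1|exact: e2ipi_neq0]].
by rewrite mulrAC mulfV// mul1r.
Qed.

Lemma tw_cts g e : 0 < e -> exists2 r, 0 < r & forall d z : C, nm d < r -> nm (z - 1) < r ->
  nm (tw g (e2ipi d, z * e2ipi (tau * d)) - 1) <= e.
Proof.
move=> e0; pose f (w : C * C) := tw g (e2ipi w.1, w.2 * e2ipi (tau * w.1)).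
have de : differentiable (fun w : C * C => e2ipi w.1) ((0 : C), (1 : C)).
  exact: (@differentiable_comp _ _ _ _ (@fst C C) (@e2ipi R) _ (diff_fst _) (diff_e2ipi _)).
have dte : differentiable (fun w : C * C => w.2 * e2ipi (tau * w.1)) ((0 : C), (1 : C)).
  apply: differentiableM; first exact: diff_snd.
  apply: (@differentiable_comp _ _ _ _ (fun w : C * C => tau * w.1) (@e2ipi R)); last exact: diff_e2ipi.
  by apply: differentiableM; [exact: differentiable_cst|exact: diff_fst].
have f1 : f (0, 1) = 1 by rewrite /f /= mulr0 mul1r e2ipi0 /tw /= if_same pw1.
have df : differentiable f ((0 : C), (1 : C)).
  rewrite /f /tw; case: odd.
    by apply: diff_pw; [exact: dte|rewrite /= mul1r e2ipi_neq0].
  by apply: diff_pw; [exact: de|exact: e2ipi_neq0].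
have /cvgCP/(_ e e0) := differentiable_continuous df.
move=> /nbhsC2P[r r0 h]; exists r => // d z dr zr; have := h (d, z); rewrite /= f1 subr0 => /(_ dr zr).
exact: ltW.
Qed.

Lemma Er_lim i g e : 0 < e -> Sect [:: i] (fun q => nm (Er i g q) <= e).
Proof.
move=> e0; have [r r0 h] := tw_cts g e0; have r2 : 0 < r / 2 by rewrite divr_gt0.
have r3 : r / 2 < r by rewrite ltr_pdivrMr// ltr_pMr// ltr1n.
apply: SectS (Tr_lim i r2) => q [q1 q2 h1 h2]; rewrite Er_E//; apply: h; exact: le_lt_trans r3.
Qed.

Lemma Er_diff i g : Sect [:: i] (fun q => differentiable (Er i g) q).
Proof.
have k1 := tame_Sect (Tr_tame i) (@Sect_torus R varpi [:: i]).
apply: SectS (SectI (@Tr_diff i) (SectI k1 (@Sect_torus R varpi [:: i]))) => q [dT [[z1 z2] [q1 q2]]].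
apply: differentiableB; last exact: differentiable_cst.
apply: differentiableM.
  exact: (@differentiable_comp _ _ _ _ (Tr i) (W g) _ dT (@diff_W R tau g _ z1 z2)).
apply: differentiableV.
  by apply: differentiableM; [exact: differentiable_cst|exact: (@diff_W R tau g _ q1 q2)].
have [A0 B0] := AB_neq0; apply: mulf_neq0; [exact: tw_neq0|exact: W_neq0].
Qed.

Lemma Er_inv i g : Sect [:: i] (fun q => Er i g (F100 tau q) = Er i g q).
Proof.
have k1 := tame_Sect (Tr_tame i) (@Sect_torus R varpi [:: i]).
apply: SectS (SectI (@Tr_F100 i) (SectI k1 (@Sect_torus R varpi [:: i]))) => q [e [[_ z2] [_ q2]]].
by rewrite /Er e /Wc !F100_Pi.
Qed.

(** On the overlap, [1 + Er i] is [1 + Er (i + 1)] times the quotient of the values of [U] after and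
    before the automorphism. [Er (i + 1)] is [O(w_{i+1})] by [sect_decay] in the next chart, and so
    is [U - 1] by the normalization. *)
Lemma Er_decay i g U c' d : fac i g U -> 0 < c' -> 0 < d -> exists2 K, 0 <= K &
  SF [:: i; i + 1] c' d (fun q => nm (Er i g q) <= K * nm (W (i + 1) q)).
Proof.
move=> hU c'0 d0; have [hU0 hU1] := fac_germ hU; have [L L0 hL] := vanish_bound hU0 hU1.
have [[_ _ _ hv0] _ hv1] := huv i; have [L' L'0 hL'] := vanish_bound hv0 hv1.
have tq : tame [:: i; i + 1] (P (i + 1) \o Q i).
  by apply: tame_comp (tame_sub (@sub_l i) (Q_tame i)) (tame_sub (@sub_r i) (P_tame (i + 1))).
have tq' : tame [:: i; i + 1] (P (i + 1) \o (Th \o Q i)).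
  by apply: tame_comp (tame_sub (@sub_r i) (P_tame (i + 1))); apply: tame_comp (tame_sub (@sub_l i) (Q_tame i)) (@Th_tame _).
have tTh : tame [:: i; i + 1] (Th \o Q i) by apply: tame_comp (tame_sub (@sub_l i) (Q_tame i)) (@Th_tame _).
have [c1 cc [d1 /andP[d10 _] hp]] := tame_SF tq c'0 d0.
have decay g' : exists2 K, 0 <= K & SF [:: i; i + 1] c' d (fun q => nm (Er (i + 1) g' ((P (i + 1) \o Q i) q)) <= K * nm (W (i + 1) ((P (i + 1) \o Q i) q))).
  have [K K0 hK] := sect_decay tau_im tau_arg (@Er_inv (i + 1) g') (@Er_diff (i + 1) g') (fun e => @Er_lim (i + 1) g' e) (lt_trans c'0 cc) d10.
  exists K => //; exact: (hp (fun q => nm (Er (i + 1) g' q) <= K * nm (W (i + 1) q)) (SF_mono (lexx _) (lexx _) (@sub_r i) hK)).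
have [K K0 hK] := decay g; have [K' K'0 hK'] := decay (i + 1).
have [A0 B0] := AB_neq0; pose s2 := nm (tw (i + 1) (Am, Bm)); have s20 : 0 <= s2 := nm_ge0 _.
pose Z := 2 * (L * (2 * s2)) + 2 * L + 4 * K.
have Z0 : 0 <= Z by rewrite /Z !addr_ge0 ?mulr_ge0.
exists (Z * 2); first by rewrite mulr_ge0.
(* Small enough that [L], [L'] and [2 * s2 * L] times [|w.2|] are at most 1/2, which keeps the units
   away from 0 in [ratio_close]. *)
pose e1 : R := Num.min 1 (2 * (L + L' + 1) * (2 * s2 + 1))^-1.
have D0 : 0 < 2 * (L + L' + 1) * (2 * s2 + 1) by rewrite !mulr_gt0// ltr_wpDl// ?addr_ge0 ?mulr_ge0.
have e10 : 0 < e1 by rewrite lt_min ltr01 invr_gt0.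
have nsm : \forall w \near ((0, 0) : C * C), nm w.2 < e1.
  by apply: (@snd_near R [set x | nm x < e1]); apply/nbhsCP; exists e1 => // x; rewrite subr0.
have near1 : \forall w \near ((0, 0) : C * C), [/\ nm (U w - 1) <= L * nm w.2, nm (v i w - 1) <= L' * nm w.2 & nm w.2 < e1].
  by apply: filterS3 hL hL' nsm => w h1 h2 h3; split.
have s1 := tame_Sect tq (@W_near2 R tau varpi tau_im tau_arg i _ near1) c'0 d0.
have s2' := tame_Sect tq' (@W_near2 R tau varpi tau_im tau_arg i _ near1) c'0 d0.
have hv : fac i (i + 1) (v i) by right.
have ov1 := tame_Sect (tame_sub (@sub_l i) (Q_tame i)) (overlap hU) c'0 d0.
have ov2 := tame_Sect tTh (overlap hU) c'0 d0.
have ov3 := tame_Sect (tame_sub (@sub_l i) (Q_tame i)) (overlap hv) c'0 d0.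
have [_ _ _ h2 _] := hSC i; have QP := Sect_sub (@sub_l i) h2 c'0 d0.
have [_ _ h2' _ _] := hSC (i + 1).
have PQ := tame_Sect (tame_sub (@sub_l i) (Q_tame i)) (Sect_sub (@sub_r i) h2') c'0 d0.
have El := Sect_sub (@sub_r i) (@Er_lim (i + 1) (i + 1) 1 ltr01).
have El' := tame_Sect tq El c'0 d0.
have tor := tame_Sect tq (@Sect_torus R varpi [:: i; i + 1]) c'0 d0.
have torq := @Sect_torus R varpi [:: i; i + 1] c' d c'0 d0.
apply: filterS3 (filterI (filterI hK El') (filterI s1 s2')) (filterI (filterI ov1 ov2) (filterI ov3 tor)) (filterI (filterI QP PQ) torq).
clear s1 s2' ov1 ov2 ov3 QP PQ El El' tor torq hK hK' decay near1 nsm hL hL' hU0 hU1 hv0 hv1 tq tq' tTh hp h2 h2' hv.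
rewrite /comp /=.
move=> q [[k1 k2] [[m1 m2 m3] [n1 _ n3]]] [[ha1 ha2] [ha3 [z1 z2]]] [[[_ r1] [_ r2]] [q1 q2]].
set p := Q i q in k1 k2 m1 m2 m3 n1 n3 ha1 ha2 ha3 z1 z2 r1 r2.
rewrite r1 in ha1 ha3.
set x := P (i + 1) p in k1 k2 m1 m2 m3 n1 n3 ha1 ha2 ha3 z1 z2 r2.
have TrE : Tr (i + 1) x = P (i + 1) (Th p) by rewrite /Tr r2.
set y := P (i + 1) (Th p) in n1 n3 ha2 TrE.
set w := (W i x, W (i + 1) x) in ha1 ha3 m1 m2 m3; set w' := (W i y, W (i + 1) y) in n1 n3 ha2.
have tg : tw g (Am, Bm) != 0 by apply: tw_neq0.
have tg1 : tw (i + 1) (Am, Bm) != 0 by apply: tw_neq0.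
have Wx g' : W g' x != 0 by apply: W_neq0.
have yE g' : W g' y = tw g' (Am, Bm) * W g' x * (1 + Er (i + 1) g' x).
  have tg' : tw g' (Am, Bm) != 0 by apply: tw_neq0.
  by rewrite /Er TrE [1 + _]addrC subrK mulrC divfK// mulf_neq0.
have y1E := yE g; have y2E := yE (i + 1).
have ww : nm w'.2 <= 2 * s2 * nm w.2.
  rewrite /= y2E 2!nmM -/s2 mulrC mulrA ler_wpM2r ?nm_ge0// mulrC [leRHS]mulrC ler_wpM2l// .
  by have := nmD 1 (Er (i + 1) (i + 1) x); rewrite nm1; lra.
have wn := nm_ge0 w.2.
have m3' : (L + L' + 1) * (2 * s2 + 1) * nm w.2 <= 2^-1.
  move: m3; rewrite lt_min => /andP[_]; rewrite -[X in _ < X]mul1r ltr_pdivlMr//; lra.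
have s2w : 0 <= 2 * s2 * nm w.2 by rewrite mulr_ge0// mulr_ge0.
have lw : L * nm w.2 <= 2^-1 /\ L' * nm w.2 <= 2^-1 /\ L * (2 * s2 * nm w.2) <= 2^-1.
  have h1 : 0 <= L * nm w.2 by rewrite mulr_ge0.
  have h3 : 0 <= L' * nm w.2 by rewrite mulr_ge0.
  have h4 : 0 <= L * (2 * s2 * nm w.2) by rewrite mulr_ge0.
  have h5 : 0 <= L' * (2 * s2 * nm w.2) by rewrite mulr_ge0.
  have : (L + L' + 1) * (2 * s2 + 1) * nm w.2 = L * nm w.2 + L' * nm w.2 + L * (2 * s2 * nm w.2) + L' * (2 * s2 * nm w.2) + 2 * s2 * nm w.2 + nm w.2 by ring.
  by lra.
have [lw1 [lw2 lw3]] := lw.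
have n1' : nm (U w' - 1) <= L * (2 * s2 * nm w.2) by rewrite (le_trans n1)// ler_wpM2l.
have U0 : U w != 0 by rewrite -nm_gt0 -(pmulr_rgt0 _ (ltr0n _ 2)) (lt_le_trans ltr01 (nm_near1 (le_trans m1 lw1))).
have w2q : nm w.2 <= 2 * nm (W (i + 1) q).
  by rewrite ha3 nmM mulrCA ler_peMr// (nm_near1 (le_trans m2 lw2)).
have EE : Er i g q = ((U w' - 1) - (U w - 1) + Er (i + 1) g x * U w') / U w.
  by rewrite {1}/Er /Tr -/p ha2 y1E ha1; field; rewrite U0 tg Wx.
have ZW := ler_wpM2l Z0 w2q; rewrite mulrA in ZW.
rewrite EE (le_trans (ratio_close m1 lw1 n1' lw3 k1))//; apply: le_trans ZW.
by rewrite le_eqVlt; apply/orP; left; apply/eqP; rewrite /Z /=; ring.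
Qed.

Lemma Er_zero i g U : fac i g U -> Sect [:: i] (fun q => Er i g q = 0).
Proof.
move=> hU; apply: (sect_zero tau_im tau_arg (@Er_inv i g) (@Er_diff i g) (fun e => @Er_lim i g e)).
by move=> c' d; exact: (Er_decay hU).
Qed.

Lemma Tr_W i g U : fac i g U -> Sect [:: i] (fun p => W g (P i (Th p)) = tw g (Am, Bm) * W g (P i p)).
Proof.
move=> hU; have [_ _ h1 _ _] := hSC i.
have k1 := tame_Sect (P_tame i) (Er_zero hU).
have k2 := tame_Sect (P_tame i) (@Sect_torus R varpi [:: i]).
apply: SectS (SectI h1 (SectI k1 k2)) => p [[_ e1] [/eqP e2 [z1 z2]]].
move: e2; rewrite /Er /Tr e1 subr_eq0 => /eqP e2.
have [A0 B0] := AB_neq0.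
have n0 : tw g (Am, Bm) * W g (P i p) != 0 by rewrite mulf_neq0 ?tw_neq0 ?W_neq0.
by rewrite -[LHS](divfK n0) e2 mul1r.
Qed.

Lemma forward i : Sect [:: i] (fun p => Pimap tau (P i (Th p)) = lin Am Bm (Pimap tau (P i p))).
Proof.
have h1 := Tr_W (or_introl (conj erefl erefl) : fac i i (u i)).
have h2 := Tr_W (or_intror (conj erefl erefl) : fac i (i + 1) (v i)).
have k2 := tame_Sect (P_tame i) (@Sect_torus R varpi [:: i]).
have k3 := tame_Sect (@Th_tame [:: i]) k2.
apply: SectS (SectI (SectI h1 h2) (SectI k2 k3)) => p [[e1 e2] [[z1 _] [z2 _]]].
have [A0 B0] := AB_neq0.
by rewrite -(@kap_Pi R tau i _ z2) -(@kap_Pi R tau i _ z1) lin_kap//= e1 e2.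
Qed.

Lemma forward_W i g : Sect [:: i] (fun p => W g (P i (Th p)) = tw g (Am, Bm) * W g (P i p)).
Proof.
have k2 := tame_Sect (P_tame i) (@Sect_torus R varpi [:: i]); have [A0 B0] := AB_neq0.
apply: SectS (SectI (@forward i) k2) => p [e [z1 _]]; rewrite /Wc e wc_lin//.
exact: Pi_dom.
Qed.

(** The overlap relation at a point and at its image under [Th]: both charts being linearized, the
    multipliers cancel and leave the invariance of [U]. *)
Lemma overlap_stab i g U : fac i g U -> exists2 e, 0 < e & forall x y : C, 0 < nm x < e -> nm y = nm x ->
  U (tw i (Am, Bm) * x, tw (i + 1) (Am, Bm) * y) = U (x, y).
Proof.
move=> hU; have tQ := tame_sub (@sub_r i) (Q_tame (i + 1)).
have ov1 := tame_Sect tQ (overlap hU); have ov2 := tame_Sect (tame_comp tQ (@Th_tame [:: i; i + 1])) (overlap hU).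
have f1 := tame_Sect tQ (Sect_sub (@sub_l i) (@forward_W i g)).
have f2 g' := tame_Sect tQ (Sect_sub (@sub_r i) (@forward_W (i + 1) g')).
have [_ _ _ h2 _] := hSC (i + 1); have PQ := Sect_sub (@sub_r i) h2.
have main : Sect [:: i; i + 1] (fun q => U (tw i (Am, Bm) * W i q, tw (i + 1) (Am, Bm) * W (i + 1) q) = U (W i q, W (i + 1) q)).
  have h := SectI (SectI (SectI ov1 ov2) (SectI f1 (f2 g))) (SectI (SectI (f2 i) (f2 (i + 1))) (SectI PQ (@Sect_torus R varpi [:: i; i + 1]))).
  apply: SectS h => q; rewrite /comp; move=> [[[ha1 ha2] [e1 e2]] [[e3 e4] [[_ e5] [q1 q2]]]].
  rewrite e5 in ha1 e2 e3 e4; rewrite e1 ha1 e2 e3 e4 in ha2.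
  have [A0 B0] := AB_neq0; apply/esym; apply: (@mulfI _ (tw g (Am, Bm) * W g q)); last by rewrite -mulrA.
  by apply: mulf_neq0; [exact: tw_neq0|exact: W_neq0].
(* The tube of slope 2 contains the diagonal [Im al = Im be], where every pair with [|x| = |y|]
   small is attained. *)
have [d d0 hd] := pt_sec tau_im tau_arg (ler1n R 2 : 1 <= 2).
have [r hr] := main _ _ (c0_gt0 tau_im) d0; have [rho rho0 h] := hd r.
exists (expR (- (T * rho))); first exact: expR_gt0.
move=> x y /andP[x0 xe] yx.
have [al hal] := e2ipi_surj (ltac:(by rewrite -nm_gt0) : x != 0).
have [be hbe] := e2ipi_surj (ltac:(by rewrite -nm_gt0 yx) : y != 0).
have s1 : rho < iM al.
  by move: xe; rewrite -hal nm_e2ipi ltr_expR ltrN2 ltr_pM2l ?twopi_gt0.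
have s2 : iM be = iM al.
  move: yx; rewrite -hal -hbe !nm_e2ipi => /expR_inj/oppr_inj; apply: mulfI.
  by rewrite lt0r_neq0// twopi_gt0.
have al0 : 0 < iM al by exact: le_lt_trans s1.
have al2 : iM al < 2 * iM al by rewrite ltr_pMl// ltr1n.
have [_] := h i (be, al) (ltac:(by rewrite /= s2 gtr0_norm) : `|iM (be, al).1| < 2 * iM (be, al).2) s1.
rewrite /= s2 => /(_ al2) hs; have := hr _ hs; rewrite /pt !W_ptk.
by have [-> ->] := bt_xe i (be, al); rewrite /= hal hbe.
Qed.

End Forward.

(** * Gluing of sectorial automorphisms *)

Section Gluing.
Variables (R : realType) (tau : Cx R) (varpi : R).
Local Notation C := (Cx R).
Local Notation SF := (SF varpi).
Local Notation Sect := (Sect varpi).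
Local Notation Sec := (Sec varpi).
Local Notation lam := (lam varpi).
Local Notation close := (close varpi).
Hypothesis tau_im : 0 < iM tau.
Hypothesis tau_arg : tau = ofR (nm tau) * cexp (ofR varpi * ii R).
Implicit Types (i j : 'Z_4) (p q : C * C).

(** [Im xi] and [Im (tau xi)] are not both small against [|xi|], and up to positive factors the four
    [lam] are these two forms with both signs. *)
Lemma sectors_cover : exists2 d, 0 < d & forall x : C, x != 0 -> exists j, d * nm x < lam j x.
Proof.
have c1 := C1_gt0 tau_im; have t0 := tau_gt0 tau_im.
pose k1 := 1 + nm tau; have k10 : 0 < k1 by rewrite ltr_wpDr// ltW.
have D0 : 0 < 4 * (C1 tau * k1) by rewrite mulr_gt0// mulr_gt0.
exists (4 * (C1 tau * k1))^-1; first by rewrite invr_gt0.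
move=> x x0; have nx : 0 < nm x by rewrite nm_gt0.
have [l0 l1 l2 l3] := lam_cases tau_arg x.
have l4 : lam (1 + 1 + 1) x = - lam 1 x by apply: (mulfI (lt0r_neq0 t0)); rewrite l3 mulrN l1.
have hb := nm_basis tau_im x; set d := _^-1.
have key (y : R) : nm x <= C1 tau * (2 * (k1 * y)) -> d * nm x < y.
  move=> h; rewrite /d mulrC ltr_pdivrMr//.
  have e : y * (4 * (C1 tau * k1)) = 2 * (C1 tau * (2 * (k1 * y))) by ring.
  rewrite e; lra.
have [h|h] := leP `|iM x| `|iM (tau * x)|.
  have hx : nm x <= C1 tau * (2 * `|iM (tau * x)|).
    by rewrite (le_trans hb)// ler_pM2l// mulrDl mul1r lerD2r.
  have [s|s] := leP 0 (iM (tau * x)).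
    exists 1; apply: key; rewrite (ger0_norm s) -l1 in hx; rewrite (le_trans hx)// ler_pM2l// ler_pM2l//.
    have : 0 <= lam 1 x by rewrite -(pmulr_rge0 _ t0) l1.
    rewrite /k1 mulrDl mul1r; lra.
  exists (1 + 1 + 1); apply: key; rewrite (ltr0_norm s) -l1 -mulrN in hx; rewrite (le_trans hx)// ler_pM2l// ler_pM2l// l4.
  have : 0 <= - lam 1 x by rewrite -(pmulr_rge0 _ t0) mulrN l1 oppr_ge0 ltW.
  rewrite /k1 mulrDl mul1r; lra.
have hx : nm x <= C1 tau * (2 * `|iM x|).
  by rewrite (le_trans hb)// ler_pM2l// mulrDl mul1r lerD2l ltW.
have h2 (y : R) : 0 <= y -> y <= k1 * y by move=> y0; rewrite ler_peMl// /k1 lerDl ltW.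
have [s|s] := leP 0 (iM x).
  exists 0; apply: key; rewrite l0; rewrite (ger0_norm s) in hx; rewrite (le_trans hx)// ler_pM2l// ler_pM2l//; exact: h2.
exists (1 + 1); apply: key; rewrite l2; rewrite (ltr0_norm s) in hx; rewrite (le_trans hx)// ler_pM2l// ler_pM2l//; by apply: h2; rewrite oppr_ge0 ltW.
Qed.

(** Close to [(z0, 0)] and off the axis, [1 / y] is large and in one of the four covering sectors,
    and [z] is in the annulus of [c]. *)
Lemma near_axis (z0 : C) : z0 != 0 -> exists c d : R, [/\ 0 < c, 0 < d & forall P : set (C * C),
  (forall i, SF [:: i] c d P) -> \forall p \near (z0, 0 : C), p.2 != 0 -> P p].
Proof.
move=> z00; have n0 : 0 < nm z0 by rewrite nm_gt0.
have [d d0 cov] := sectors_cover.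
pose c := `|ln (nm z0)| + 1; have c0 : 0 < c by rewrite ltr_wpDl.
exists c, d; split=> // P h.
have /choice[r hr] : forall i, exists r, forall p, Sec [:: i] c d r p -> P p by move=> i; exact: h.
pose rm := \sum_(i : 'Z_4) `|r i|.
have rmi i : r i <= rm.
  by rewrite /rm (bigD1 i)//= (le_trans (ler_norm _))// lerDl sumr_ge0.
have rm0 : 0 < rm + 1 by rewrite ltr_wpDl// /rm sumr_ge0.
have e1 : 0 < nm z0 * (1 - expR (- 1)) by rewrite mulr_gt0// subr_gt0 expR_lt1 oppr_lt0.
pose e := Num.min (nm z0 * (1 - expR (- 1))) (rm + 1)^-1.
have e0 : 0 < e by rewrite lt_min e1 invr_gt0.
apply/nbhsC2P; exists e; first exact: e0.
move=> p; rewrite /= subr0 /e !lt_min => /andP[p1 _] /andP[_ p2] y0.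
have [j hj] := cov p.2^-1 (ltac:(by rewrite invr_eq0) : p.2^-1 != 0).
have ny : 0 < nm p.2 by rewrite nm_gt0.
have big : rm + 1 < nm p.2^-1 by rewrite nmV -[ltLHS]invrK ltf_pV2 ?posrE ?invr_gt0.
apply: (hr j); split=> //; last by move=> i; rewrite inE => /eqP ->.
  by have := rmi j; lra.
have eln : expR (ln (nm z0)) = nm z0 by rewrite lnK.
have ee : expR (- 1) * expR 1 = 1 :> R by rewrite -expRD addNr expR0.
have e2 : 2 <= expR 1 :> R by have := expR_ge1Dx (1 : R); lra.
have lo : nm z0 * expR (- 1) < nm p.1 by have := nm_lb z0 p.1; rewrite nmC; lra.
have hi : nm p.1 < nm z0 * expR 1.
  have := nm_lb p.1 z0; have : 0 < expR (- 1) :> R := expR_gt0 _; nra.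
have l1 := ler_norm (ln (nm z0)); have l2 := ler_norm (- ln (nm z0)); rewrite normrN in l2.
apply/andP; split.
  by rewrite (le_lt_trans _ lo)// -{1}eln -expRD ler_expR /c; lra.
by rewrite (lt_le_trans hi)// -{1}eln -expRD ler_expR /c; lra.
Qed.

Lemma Sec_open i c d r p : Sec [:: i] c d r p -> \forall q \near p, Sec [:: i] c d r q.
Proof.
move=> [p0 pr /andP[p1 p2] pl]; have {pl} pl := pl i (mem_head _ _).
have dxi : differentiable (fun q : C * C => q.2^-1) p by apply: differentiableV; [exact: diff_snd|exact: p0].
have /cvgCP cxi := differentiable_continuous dxi; have /cvgCP cz := differentiable_continuous (diff_fst p).
pose e1 := Num.min (nm p.2^-1 - r) ((lam i p.2^-1 - d * nm p.2^-1) / (2 + `|d|)).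
pose e2 := Num.min (nm p.1 - expR (- c)) (expR c - nm p.1).
have d2 : 0 < 2 + `|d| by rewrite ltr_wpDr.
have e10 : 0 < e1 by rewrite lt_min subr_gt0 pr divr_gt0// subr_gt0.
have e20 : 0 < e2 by rewrite lt_min !subr_gt0 p1.
have nz : \forall q \near p, q.2 != 0.
  have h := nbhs_neq0 p0.
  exact: (differentiable_continuous (diff_snd p) h).
apply: filterS3 (cxi e1 e10) (cz e2 e20) nz => q /=; rewrite !lt_min => /andP[q1 q2] /andP[q3 q4] q0.
have h1 := nm_lb p.2^-1 q.2^-1; have h2 := nm_lb q.2^-1 p.2^-1; rewrite nmC in h1.
have h3 := nm_lb p.1 q.1; have h4 := nm_lb q.1 p.1; rewrite nmC in h3.
split=> //; [by lra|by apply/andP; split; lra|].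
move=> j; rewrite inE => /eqP ->; move: q2; rewrite ltr_pdivlMr// mulrDr => q2.
have : lam i q.2^-1 = lam i p.2^-1 + lam i (q.2^-1 - p.2^-1) by rewrite -lamD addrC subrK.
have := lam_le varpi i (q.2^-1 - p.2^-1); rewrite ler_norml => /andP[l1 _] ->.
have k1 : d * (nm q.2^-1 - nm p.2^-1) <= nm (q.2^-1 - p.2^-1) * `|d|.
  rewrite (le_trans (ler_norm _))// normrM mulrC ler_wpM2r// ler_norml; apply/andP; split; lra.
have := nm_ge0 (q.2^-1 - p.2^-1); rewrite mulrBr in k1; lra.
Qed.

Lemma Sect_open i (P : set (C * C)) : Sect [:: i] P -> Sect [:: i] (fun p => \forall q \near p, P q).
Proof.
move=> h c d c0 d0; have [r hr] := h c d c0 d0; exists r => p hp.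
by apply: filterS (Sec_open hp) => q; exact: hr.
Qed.

Lemma set_nbhs_of_Sect (P : set (C * C)) : (forall i, Sect [:: i] P) -> (forall z, z != 0 -> P (z, 0)) ->
  set_nbhs (@Ctilde R) P.
Proof.
move=> h h0 [z0 y0] [/= z00 ->]; have z1 := nbhs_neq0 z00.
have [c [d [cp dp hcd]]] := near_axis z00.
have h1 : \forall p \near (z0, 0 : C), p.2 != 0 -> P p by apply: hcd => i; exact: h.
have h2 : \forall p \near (z0, 0 : C), p.1 != 0.
  exact: (differentiable_continuous (diff_fst (z0, 0 : C)) z1).
apply: filterS2 h1 h2 => p hp p1; have [p2|p2] := eqVneq p.2 0; last exact: hp.
by rewrite (surjective_pairing p) p2; exact: h0.
Qed.

Lemma near_bound k (f : C * C -> C) (z0 : C) : z0 != 0 -> (forall i c d, 0 < c -> 0 < d -> exists2 K, 0 <= K &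
    SF [:: i] c d [set p | nm (f p) <= K * nm p.2 ^+ k]) ->
  exists2 K, 0 <= K & \forall p \near (z0, 0 : C), p.2 != 0 -> nm (f p) <= K * nm p.2 ^+ k.
Proof.
move=> z00 h; have [c [d [cp dp hcd]]] := near_axis z00.
have /choice[K hK] : forall i, exists K, 0 <= K /\ SF [:: i] c d [set p | nm (f p) <= K * nm p.2 ^+ k].
  by move=> i; have [K K0 hK] := h i c d cp dp; exists K.
exists (\sum_(i : 'Z_4) K i); first by apply: sumr_ge0 => i _; have [] := hK i.
apply: (hcd [set p | nm (f p) <= (\sum_(i : 'Z_4) K i) * nm p.2 ^+ k]) => i.
have [_ hi] := hK i; apply: filterS hi => p hp; rewrite /= (le_trans hp)// ler_wpM2r ?exprn_ge0 ?nm_ge0//.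
by rewrite (bigD1 i)//= lerDl sumr_ge0// => j _; have [] := hK j.
Qed.

Lemma bigOy_of_SF k (f : C * C -> C) : (forall i c d, 0 < c -> 0 < d -> exists2 K, 0 <= K &
    SF [:: i] c d [set p | nm (f p) <= K * nm p.2 ^+ k]) ->
  (forall z, z != 0 -> f (z, 0) = 0) -> bigOy k f.
Proof.
move=> h h0 z0 z00; have [K K0 hK] := near_bound z00 h; exists (ofR K).
have z1 := nbhs_neq0 z00.
have h2 : \forall p \near (z0, 0 : C), p.1 != 0.
  exact: (differentiable_continuous (diff_fst (z0, 0 : C)) z1).
apply: filterS2 hK h2 => p hp p1; rewrite !nmE -ofRX -ofRM ofR_le.
have [p2|p2] := eqVneq p.2 0; last exact: hp.
by rewrite {1}(surjective_pairing p) p2 h0// nm0 mulr_ge0// exprn_ge0.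
Qed.

Lemma lam_opp i x : lam (i + 1 + 1) x = - lam i x.
Proof.
have [l0 l1 l2 l3] := lam_cases tau_arg x.
have l4 : lam (1 + 1 + 1) x = - lam 1 x by apply: (mulfI (lt0r_neq0 (tau_gt0 tau_im))); rewrite l3 mulrN l1.
move: i; apply: Z4P.
- by rewrite add0r l2 l0.
- exact: l4.
- by rewrite (_ : 1 + 1 + 1 + 1 = 0); [rewrite l2 opprK l0|apply/val_inj].
by rewrite (_ : 1 + 1 + 1 + 1 + 1 = 1); [rewrite l4 opprK|apply/val_inj].
Qed.

Lemma Z4_cases i j : [\/ j = i, j = i + 1, j = i + 1 + 1 | i = j + 1].
Proof.
case: i j => [[|[|[|[|m]]]] hi] [[|[|[|[|n]]]] hj] //;
  first [by apply: Or41; apply/val_inj | by apply: Or42; apply/val_inj | by apply: Or43; apply/val_inj | by apply: Or44; apply/val_inj].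
Qed.

Variables (c0 : C) (Tm : 'Z_4 -> C * C -> C * C).
Hypothesis c00 : c0 != 0.
Hypothesis Tm_close : forall i, close [:: i] c0 (Tm i).
Hypothesis Tm_diff : forall i, Sect [:: i] (fun p => differentiable (Tm i) p).
Hypothesis Tm_agree : forall i, Sect [:: i; i + 1] (fun p => Tm i p = Tm (i + 1) p).

(** Each point uses the map of some sector that contains it. That sector is the given one or a
    neighbour, where the maps agree; opposite half planes are disjoint. *)
Lemma glue_sect : exists Th : C * C -> C * C, (forall z, Th (z, 0) = (c0 * z, 0)) /\ forall i, Sect [:: i] (fun p => Th p = Tm i p).
Proof.
have [d0 d00 cov] := sectors_cover.
have /choice[jf hjf] : forall p, exists j, p.2 != 0 -> d0 * nm p.2^-1 < lam j p.2^-1.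
  move=> p; have [y0|y0] := eqVneq p.2 0; first by exists 0.
  by have [j hj] := cov p.2^-1 (ltac:(by rewrite invr_eq0) : p.2^-1 != 0); exists j.
exists (fun p => if p.2 == 0 then (c0 * p.1, 0) else Tm (jf p) p); split; first by move=> z; rewrite /= eqxx.
move=> i c d cp dp; pose d' := Num.min d d0; have d'0 : 0 < d' by rewrite lt_min dp.
have /choice[r hr] : forall i, exists r, forall p, Sec [:: i; i + 1] c d' r p -> Tm i p = Tm (i + 1) p.
  by move=> j; exact: Tm_agree.
pose rm := \sum_(i : 'Z_4) `|r i|.
have rmi j : r j <= rm by rewrite /rm (bigD1 j)//= (le_trans (ler_norm _))// lerDl sumr_ge0.
exists rm => p [y0 pr pc pl]; rewrite (negPf y0); have hj := hjf p y0.
have hi := pl i (mem_head _ _); have ny : 0 < nm p.2^-1 by rewrite nm_gt0 invr_eq0.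
have di : d' * nm p.2^-1 < lam i p.2^-1 by rewrite (le_lt_trans _ hi)// ler_pM2r// ge_min lexx.
have dj : d' * nm p.2^-1 < lam (jf p) p.2^-1 by rewrite (le_lt_trans _ hj)// ler_pM2r// ge_min lexx orbT.
have [e|e|e|e] := Z4_cases i (jf p).
- by rewrite e.
- rewrite e; apply/esym; apply: hr; split=> //; first exact: le_lt_trans (rmi i) pr.
  by move=> k; rewrite !inE => /orP[] /eqP ->; rewrite ?di// -e.
- by move: dj; rewrite e lam_opp => dj; have dn := mulr_gt0 d'0 ny; exfalso; lra.
rewrite [in RHS]e; apply: hr; split=> //; first exact: le_lt_trans (rmi _) pr.
by move=> k; rewrite !inE => /orP[] /eqP ->; rewrite ?dj// -e.
Qed.

(** Holomorphic off [y = 0], and continuous there because every [Tm i] is close to the same linear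
    map; [removable] does the rest. *)
Lemma glue_diff (Th : C * C -> C * C) : (forall z, Th (z, 0) = (c0 * z, 0)) -> (forall i, Sect [:: i] (fun p => Th p = Tm i p)) ->
  set_nbhs (@Ctilde R) [set p | differentiable Th p].
Proof.
move=> h0 hT; have off i : Sect [:: i] (fun p => differentiable Th p).
  apply: SectS (SectI (@Tm_diff i) (Sect_open (hT i))) => p [dT hp].
  have hp' : \forall q \near p, Tm i q = Th q by apply: filterS hp => q ->.
  exact: (near_diff2 hp' dT).
have cl i c d : 0 < c -> 0 < d -> exists2 K, 0 <= K &
    SF [:: i] c d [set p | nm ((Th p).1 - c0 * p.1) <= K * nm p.2 /\ nm ((Th p).2 - p.2) <= K * nm p.2].
  move=> cp dp; have [K K0 hK] := @Tm_close i c d cp dp; exists K => //.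
  apply: filterS3 hK (hT i c d cp dp) (SF_small varpi [:: i] c d ltr01) => p [h1 h2] /= e y1; rewrite e; split=> //.
  by rewrite (le_trans h2)// ler_wpM2l// expr2 ler_piMl ?nm_ge0// ltW.
have cl1 i c d : 0 < c -> 0 < d -> exists2 K, 0 <= K & SF [:: i] c d [set p | nm ((Th p).1 - c0 * p.1) <= K * nm p.2 ^+ 1].
  by move=> cp dp; have [K K0 h] := cl i c d cp dp; exists K => //; apply: filterS h => p [h _]; rewrite /= expr1.
have cl2 i c d : 0 < c -> 0 < d -> exists2 K, 0 <= K & SF [:: i] c d [set p | nm ((Th p).2 - p.2) <= K * nm p.2 ^+ 1].
  by move=> cp dp; have [K K0 h] := cl i c d cp dp; exists K => //; apply: filterS h => p [_ h]; rewrite /= expr1.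
have cts (z0 : C) : z0 != 0 -> {for (z0, 0 : C), continuous Th}.
  move=> z00; have [K1 K10 hK1] := near_bound z00 cl1; have [K2 K20 hK2] := near_bound z00 cl2.
  apply/cvgC2P => e e0; rewrite h0 /=.
  pose M := nm c0 + K1 + K2 + 2; have M0 : 0 < M by rewrite ltr_wpDl// !addr_ge0 ?nm_ge0.
  have eM : 0 < e / M by rewrite divr_gt0.
  have nb : \forall p \near (z0, 0 : C), nm (p.1 - z0) < e / M /\ nm p.2 < e / M.
    by apply/nbhsC2P; exists (e / M) => // w; rewrite /= subr0.
  apply: filterS3 hK1 hK2 nb => p k1 k2 [n1 n2]; rewrite expr1 in k1 k2.
  have y0 := nm_ge0 p.2; have x0 := nm_ge0 (p.1 - z0); have c1 := nm_ge0 c0.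
  have e1 : M * (e / M) = e by rewrite mulrC divfK// lt0r_neq0.
  have k1' : nm ((Th p).1 - c0 * p.1) <= K1 * nm p.2.
    have [p2|/k1//] := eqVneq p.2 0; by rewrite (surjective_pairing p) p2 h0 /= subrr nm0 mulr0.
  have k2' : nm ((Th p).2 - p.2) <= K2 * nm p.2.
    have [p2|/k2//] := eqVneq p.2 0; by rewrite (surjective_pairing p) p2 h0 /= subrr nm0 mulr0.
  have b1 : nm c0 * nm (p.1 - z0) <= nm c0 * (e / M) by rewrite ler_wpM2l// ltW.
  have b2 : K1 * nm p.2 <= K1 * (e / M) by rewrite ler_wpM2l// ltW.
  have b3 : K2 * nm p.2 <= K2 * (e / M) by rewrite ler_wpM2l// ltW.
  have nn (x : R) : 0 <= x -> 0 <= x * (e / M) by move=> xx; rewrite mulr_ge0// ltW.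
  have q1 := nn _ c1; have q2 := nn _ K10; have q3 := nn _ K20.
  rewrite /M !mulrDl in e1; split.
    have := nm_subr (Th p).1 (c0 * p.1) (c0 * z0); rewrite -mulrBr nmM; lra.
  rewrite subr0; have := nm_lb (Th p).2 p.2; lra.
move=> [z0 y0] [/= z00 ->]; have z1 := nbhs_neq0 z00.
have [c [d [cp dp hcd]]] := near_axis z00.
have h1 : \forall p \near (z0, 0 : C), p.2 != 0 -> differentiable Th p by apply: hcd => i; exact: off.
have h2 : \forall p \near (z0, 0 : C), p.1 != 0.
  exact: (differentiable_continuous (diff_fst (z0, 0 : C)) z1).
have /nbhsC2P[e e0 he] : \forall p \near (z0, 0 : C), p.1 != 0 /\ (p.2 != 0 -> differentiable Th p) by exact: (filterI h2 h1).
have ctsp p : nm (p.1 - z0) < e -> nm p.2 < e -> {for p, continuous Th}.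
  move=> p1 p2; have [q1 q2] := he p p1 (ltac:(by rewrite /= subr0) : nm (p.2 - 0) < e).
  have [y0'|/q2 dp'] := eqVneq p.2 0; last exact: (differentiable_continuous dp').
  by rewrite (surjective_pairing p) y0'; exact: cts.
apply/nbhsC2P; exists (e / 2); first by rewrite divr_gt0.
move=> p p1 p2; rewrite /= subr0 in p1 p2.
have tri w : nm (w.1 - p.1) < e / 2 -> nm (w.2 - p.2) < e / 2 -> nm (w.1 - z0) < e /\ nm w.2 < e.
  by move=> w1 w2; have := nm_subr w.1 p.1 z0; have := nm_lb w.2 p.2; lra.
have [q1 q2] := he p (ltac:(lra) : nm (p.1 - z0) < e) (ltac:(by rewrite /= subr0; lra) : nm (p.2 - 0) < e).
have [p20|/q2//] := eqVneq p.2 0.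
have main (f : C * C -> C) : (forall w, differentiable Th w -> differentiable (fun p => f (Th p)) w) ->
    continuous f -> differentiable (fun p => f (Th p)) p.
  move=> df cf; have e2 : 0 < e / 2 by rewrite divr_gt0.
  apply: (removable e2).
    move=> w w1 w2; have [w3 w4] := tri w w1 w2.
    by apply: (@continuous_comp _ _ _ Th f); [exact: ctsp|exact: cf].
  move=> w w1 w2 _ w5; have [w3 w4] := tri w w1 w2.
  apply: df; have [_ q4] := he w w3 (ltac:(by rewrite /= subr0) : nm (w.2 - 0) < e).
  by apply: q4; rewrite -p20.
apply/diff_pairP; split; apply: main.
- by move=> w /diff_pairP[].
- by move=> w; exact: cvg_fst.
- by move=> w /diff_pairP[].
- by move=> w; exact: cvg_snd.
Qed.

End Gluing.

(** * Automorphisms and equivalences obtained by gluing *)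

Section Backward.
Variables (R : realType) (tau : Cx R) (varpi : R) (F : Cx R * Cx R -> Cx R * Cx R) (a b : nat -> Cx R -> Cx R).
Local Notation C := (Cx R).
Local Notation SF := (SF varpi).
Local Notation Sect := (Sect varpi).
Local Notation tame := (tame varpi).
Local Notation close := (close varpi).
Local Notation W := (Wc tau).
Local Notation SC := (SC tau varpi F a b).
Hypothesis tau_im : 0 < iM tau.
Hypothesis tau_arg : tau = ofR (nm tau) * cexp (ofR varpi * ii R).
Hypothesis F_nbhd : neighbourhood_germ tau F.
Hypothesis ab : holomorphic_coefs a b.
Variables (u v : 'Z_4 -> C * C -> C) (P Q : 'Z_4 -> C * C -> C * C).
Hypothesis hSC : forall i, SC i (P i) (Q i).
Hypothesis hov : forall i, Sect [:: i; i + 1] (fun p => Pimap tau (P i p) =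
  kap i (mUV (u i) (v i) (W i (P (i + 1) p), W (i + 1) (P (i + 1) p)))).
Implicit Types (i j g : 'Z_4) (p q : C * C) (c t : C).
Local Notation Pt i := (P_tame ab hSC i).
Local Notation Pc i := (P_close ab hSC i).
Local Notation Qt i := (Q_tame hSC i).

Lemma Q_close i : close [:: i] 1 (Q i).
Proof.
move=> c d c0 d0; have [c' cc [d' /andP[d'0 _] hp]] := tame_SF (Qt i) c0 d0.
have [K K0 hK] := Pc i (lt_trans c0 cc) d'0; have [_ _ _ h2 _] := hSC i.
have h3 := nm_close (Pc i) (lt_trans c0 cc) d'0.
have [L L0 hL] := Qt i c0 d0.
(* The coordinate [y] of [Q i q] is at most twice that of [q], and the error is quadratic in it. *)
exists (4 * K); first by rewrite mulr_ge0.
have hs : SF [:: i] c d [set q | nm (Q i q).2 <= 2 * nm q.2].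
  have hP := tame_nm (Pt i) (lt_trans c0 cc) d'0.
  apply: filterS3 (hp _ hP) (h2 c d c0 d0) (filterI (SF_far varpi [:: i] c d 0) hL) => q [_ h] [_ e] [[q0 _ _] [z0 _ _]].
  move: h; rewrite e !nmV => h; have y0 : 0 < nm q.2 by rewrite nm_gt0.
  have x0 : 0 < nm (Q i q).2 by rewrite nm_gt0.
  by move: h; rewrite ler_pdivlMr// mulrC ler_pdivrMr.
apply: filterS3 (hp _ hK) hs (h2 c d c0 d0) => q; rewrite /= => [[h5 h6]] h7 [_ e].
rewrite e in h5 h6; rewrite nmC !mul1r in h5 *; rewrite [nm (_.2 - _)]nmC.
have y0 := nm_ge0 q.2; have x0 := nm_ge0 (Q i q).2; split.
  rewrite (le_trans h5)// [4 * K]mulrC -mulrA ler_wpM2l//; lra.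
rewrite (le_trans h6)// [4 * K]mulrC -mulrA ler_wpM2l//.
by have -> : 4 * nm q.2 ^+ 2 = (2 * nm q.2) ^+ 2; [ring|rewrite lerXn2r ?nnegrE// mulr_ge0].
Qed.

(** The charts share the expansion [hatPsi], so their [xi] coordinates are close; this selects the
    preimage when [Pi_inj] is applied. *)
Lemma PP_xi i e : 0 < e -> Sect [:: i; i + 1] (fun p => nm ((P i p).2^-1 - (P (i + 1) p).2^-1) <= e).
Proof.
move=> e0; apply: (xi_diff (tame_sub (@sub_l i) (Pt i)) (tame_sub (@sub_r i) (Pt (i + 1))) e0).
move=> c d c0 d0; have [h1 _ _ _ _] := hSC i; have [h2 _ _ _ _] := hSC (i + 1).
have [K K0 hK] := h1 2%N c d c0 d0; have [L L0 hL] := h2 2%N c d c0 d0.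
exists (K + L); first by rewrite addr_ge0.
apply: filterS2 (SF_mono (lexx _) (lexx _) (@sub_l i) hK) (SF_mono (lexx _) (lexx _) (@sub_r i) hL) => p [_ k1] [_ k2].
rewrite /= mulrDl (le_trans (nm_subr _ (trunc a b 2 p).2 _))// lerD// nmC.
exact: k2.
Qed.

Lemma P_agree i (p p' : C * C) : p.2 != 0 -> p'.2 != 0 -> nm (p.2^-1 - p'.2^-1) <= 4^-1 ->
  Pimap tau p = Pimap tau p' -> p = p'.
Proof. by move=> h1 h2 h3; apply: Pi_inj => //; apply: (le_lt_trans h3); rewrite ltf_pV2 ?posrE// ltr_nat. Qed.

Definition stab c t := forall i g U, fac u v i g U -> exists2 e, 0 < e & forall x y : C, 0 < nm x < e -> 0 < nm y < e ->
  U (tw i (multipliers tau c t) * x, tw (i + 1) (multipliers tau c t) * y) = U (x, y).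

Definition Lf c t i p := Q i (model c t (P i p)).

Lemma Lf_close c t i : c != 0 -> close [:: i] c (Lf c t i).
Proof.
move=> c0; have h1 := close_comp (oner_neq0 C) (Pc i) (@close_model R varpi [:: i] c t).
rewrite mulr1 in h1; have := close_comp c0 h1 (@Q_close i); by rewrite mul1r.
Qed.

Lemma Lf_conj c t i : c != 0 -> Sect [:: i] (fun p => P i (Lf c t i p) = model c t (P i p)).
Proof.
move=> c0; have [_ _ _ h2 _] := hSC i.
have h := tame_Sect (tame_comp (Pt i) (@model_tame R varpi [:: i] c t c0)) h2.
by apply: SectS h => p [_ e].
Qed.

(** The units being stabilized, the linear map commutes with the transition, so both lifts have the
    same image under [Pimap] after [P i]; [PP_xi] makes them equal. *)
Lemma Lf_agree c t i : c != 0 -> stab c t -> Sect [:: i; i + 1] (fun p => Lf c t i p = Lf c t (i + 1) p).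
Proof.
move=> c0 hs; have A0 : (multipliers tau c t).1 != 0 by exact: e2ipi_neq0.
have B0 : (multipliers tau c t).2 != 0 by apply: mulf_neq0; [exact: c0|exact: e2ipi_neq0].
have tL i' : tame [:: i'] (Lf c t i') by apply: (close_tame c0); exact: Lf_close.
have tL1 := tame_sub (@sub_r i) (tL (i + 1)).
have k1 := Sect_sub (@sub_l i) (@Lf_conj c t i c0); have k2 := Sect_sub (@sub_r i) (@Lf_conj c t (i + 1) c0).
have ov1 := @hov i; have ov2 := tame_Sect tL1 (@hov i).
have e8 : (0 : R) < 8^-1 by rewrite invr_gt0 ltr0n.
have x1 := PP_xi i e8; have x2 := tame_Sect tL1 (PP_xi i e8).
have t1 := tame_Sect (tame_sub (@sub_l i) (Pt i)) (@Sect_torus R varpi [:: i; i + 1]).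
have t2 := tame_Sect (tame_sub (@sub_r i) (Pt (i + 1))) (@Sect_torus R varpi [:: i; i + 1]).
have t3 := tame_Sect (tame_comp tL1 (tame_sub (@sub_l i) (Pt i))) (@Sect_torus R varpi [:: i; i + 1]).
have t4 := tame_Sect (tame_comp (tame_sub (@sub_l i) (Pt i)) (@model_tame R varpi [:: i; i + 1] c t c0)) (@Sect_torus R varpi [:: i; i + 1]).
have [_ _ h1 _ _] := hSC i; have q1 := tame_Sect tL1 (Sect_sub (@sub_l i) h1).
have [e e0 hu] := hs i i (u i) (or_introl (conj erefl erefl)).
have [e' e'0 hv] := hs i (i + 1) (v i) (or_intror (conj erefl erefl)).
pose m := Num.min e e'; have m0 : 0 < m by rewrite lt_min e0.
have nb : \forall w \near ((0, 0) : C * C), nm w.1 < m /\ nm w.2 < m by apply/near0P; exists m.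
have wn := tame_Sect (tame_sub (@sub_r i) (Pt (i + 1))) (@W_near2 R tau varpi tau_im tau_arg i _ nb).
apply: SectS (SectI (SectI (SectI k1 k2) (SectI ov1 ov2)) (SectI (SectI (SectI x1 x2) (SectI t1 t2)) (SectI (SectI t3 t4) (SectI q1 wn)))).
clear k1 k2 ov1 ov2 x1 x2 t1 t2 t3 t4 h1 q1 nb wn.
move=> p; rewrite /comp => -[[[k1 k2] [v1 v2]] [[[x1 x2] [[z1 y1] [z2 y2]]] [[[z3 y3] [z4 y4]] [[_ q1] [w1 w2]]]]].
set p' := Lf c t (i + 1) p in k2 v2 x2 z3 y3 q1 *.
rewrite k2 in v2 x2.
set x := P (i + 1) p in k2 v1 v2 x1 x2 z2 y2 w1 w2.
have wE g : W g (model c t x) = tw g (multipliers tau c t) * W g x.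
  rewrite /Wc Pimap_model// wc_lin//; exact: Pi_dom.
rewrite !wE in v2.
have W0 g : 0 < nm (W g x) by rewrite nm_gt0; exact: W_neq0.
have b1 : 0 < nm (W i x) < m by rewrite W0.
have b2 : 0 < nm (W (i + 1) x) < m by rewrite W0.
have me : m <= e by rewrite ge_min lexx.
have me' : m <= e' by rewrite ge_min lexx orbT.
have sm (z : C) e1 : 0 < nm z < m -> m <= e1 -> 0 < nm z < e1 by move=> /andP[-> h] /(lt_le_trans h) ->.
rewrite /mUV /= (hu _ _ (sm _ _ b1 me) (sm _ _ b2 me)) (hv _ _ (sm _ _ b1 me') (sm _ _ b2 me')) in v2.
have E : Pimap tau (P i p') = Pimap tau (model c t (P i p)).
  rewrite Pimap_model// v1 v2 lin_kap// /mUV.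
  by congr (kap i (_, _)); exact: (esym (mulrA _ _ _)).
have pe : P i p' = model c t (P i p).
  apply: (@P_agree i) => //; rewrite (model_xi c t y1).
  rewrite (model_xi c t y2) in x2.
  have := nm_subr (P i p').2^-1 (x.2^-1 + t) ((P i p).2^-1 + t).
  have -> : x.2^-1 + t - ((P i p).2^-1 + t) = - ((P i p).2^-1 - x.2^-1) by ring.
  rewrite nmN; lra.
by rewrite /Lf -pe q1.
Qed.

Lemma Lf_diff c t i : c != 0 -> Sect [:: i] (fun p => differentiable (Lf c t i) p).
Proof.
move=> c0; have [_ _ h1 h2 _] := hSC i.
have t1 := tame_Sect (Pt i) (@Sect_torus R varpi [:: i]).
have tm := @model_tame R varpi [:: i] c t c0.
have t2 := tame_Sect (tame_comp (Pt i) tm) h2.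
have t3 := tame_Sect (tame_comp (Pt i) tm) (@Sect_torus R varpi [:: i]).
apply: SectS (SectI (SectI h1 t1) (SectI t2 t3)) => p; rewrite /comp => -[[[dP _] [_ y0]] [[dQ _] [_ y1]]].
have dm : differentiable (model c t) (P i p).
  apply/diff_pairP; split; rewrite /model /=.
    by apply: differentiableM; [exact: differentiable_cst|exact: diff_fst].
  apply: differentiableM; first exact: diff_snd.
  apply: (@differentiableV _ _ (fun q : C * C => 1 + t * q.2) (P i p)); last first.
    by apply: contra_neq y1 => e; rewrite /model /= e invr0 mulr0.
  apply: differentiableD; first exact: differentiable_cst.
  by apply: differentiableM; [exact: differentiable_cst|exact: diff_snd].
have d1 : differentiable (model c t \o P i) p by exact: (@differentiable_comp _ _ _ _ (P i) (model c t) _ dP dm).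
exact: (@differentiable_comp _ _ _ _ (model c t \o P i) (Q i) p d1 dQ).
Qed.

Lemma lift_exists c t : c != 0 -> stab c t -> exists Th : C * C -> C * C,
  [/\ forall z, Th (z, 0) = (c * z, 0), forall i, Sect [:: i] (fun p => Th p = Lf c t i p)
    & set_nbhs (@Ctilde R) [set p | differentiable Th p]].
Proof.
move=> c0 hs; have [Th [h0 hT]] := glue_sect tau_im tau_arg c (fun i => @Lf_agree c t i c0 hs).
exists Th; split=> //.
exact: (glue_diff tau_im tau_arg (fun i => @Lf_close c t i c0) (fun i => @Lf_diff c t i c0) h0 hT).
Qed.

Lemma F_axis z : z != 0 -> F (z, 0) = (q0 tau * z, 0).
Proof.
move=> z0; have [_ h1 h2] := F_nbhd.
have [K1 [e1 [_ e10 hK1]]] := bigOy_loc h1 z0; have [K2 [e2 [_ e20 hK2]]] := bigOy_loc h2 z0.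
have zz : nm ((z, 0 : C).1 - z) = 0 by rewrite subrr nm0.
have n0 : nm (z, 0 : C).2 = 0 by exact: nm0.
have k1 := hK1 (z, 0) (ltac:(by rewrite zz) : nm ((z, 0 : C).1 - z) < e1) (ltac:(by rewrite n0) : nm (z, 0 : C).2 < e1).
have k2 := hK2 (z, 0) (ltac:(by rewrite zz) : nm ((z, 0 : C).1 - z) < e2) (ltac:(by rewrite n0) : nm (z, 0 : C).2 < e2).
rewrite n0 !expr0n !mulr0 /= in k1 k2.
have f1 : (F (z, 0)).1 = q0 tau * z by apply/eqP; rewrite -subr_eq0 -nm_eq0 eq_le k1 nm_ge0.
have f2 : (F (z, 0)).2 = 0.
  rewrite !addr0 subr0 in k2.
  by apply/eqP; rewrite -nm_eq0 eq_le k2 nm_ge0.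
by rewrite (surjective_pairing (F (z, 0))) f1 f2.
Qed.

(** Checked in each sector, where [P i] has the expansion [hatPsi] and conjugates [Lf] to the model;
    [bigOy_of_SF] assembles the four bounds. *)
Lemma lift_formal c t (Th : C * C -> C * C) : c != 0 -> (forall z, Th (z, 0) = (c * z, 0)) ->
  (forall i, Sect [:: i] (fun p => Th p = Lf c t i p)) -> formal_conj a b Th c t.
Proof.
move=> c0 h0 hT N.
have main i (c' d : R) : 0 < c' -> 0 < d -> exists2 K, 0 <= K & SF [:: i] c' d [set p |
    nm ((trunc a b N (Th p)).1 - (model c t (trunc a b N p)).1) <= K * nm p.2 ^+ N.+1 /\
    nm ((trunc a b N (Th p)).2 - (model c t (trunc a b N p)).2) <= K * nm p.2 ^+ N.+1].
  move=> c'0 d0; have [hasy _ _ _ _] := hSC i; have [K K0 hK] := hasy N c' d c'0 d0.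
  have tL : tame [:: i] (Lf c t i) by apply: (close_tame c0); exact: Lf_close.
  have [c1 cc [d1 /andP[d10 _] hp]] := tame_SF tL c'0 d0.
  have [K3 K30 hK3] := hasy N c1 d1 (lt_trans c'0 cc) d10.
  have [L L0 hL] := @Lf_close c t i c0 c' d c'0 d0.
  have e0 : 0 < Num.min 1 (2 * (nm t * (K + 2) + 1))^-1.
    by rewrite lt_min ltr01 invr_gt0 mulr_gt0// ltr_wpDl// mulr_ge0 ?nm_ge0// addr_ge0.
  exists (K3 * (L + 1) ^+ N.+1 + nm c * K + 4 * K).
    by rewrite !addr_ge0 ?mulr_ge0 ?nm_ge0// exprn_ge0// addr_ge0.
  apply: filterS3 (filterI hK (@Lf_conj c t i c0 c' d c'0 d0)) (filterI (hp _ hK3) (filterI hL (hT i c' d c'0 d0)))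
     (filterI (nm_close (Pc i) c'0 d0) (SF_small varpi [:: i] c' d e0)).
  move=> p [[a1 a2] e1] [[b1 b2] [[_ f] e2]] [/= k5 ye].
  have y1 : nm p.2 < 1 by move: ye; rewrite lt_min => /andP[].
  have lip := mobius_close K0 (nm_ge0 p.2) ye a2 k5; rewrite nmC in lip.
  have f3 : K3 * nm (Lf c t i p).2 ^+ N.+1 <= K3 * (L + 1) ^+ N.+1 * nm p.2 ^+ N.+1 by rewrite -mulrA ler_wpM2l// nm_exp_close.
  rewrite e2; rewrite e1 in b1 b2.
  have b1' := le_trans b1 f3; have b2' := le_trans b2 f3; rewrite nmC in b1'; rewrite nmC in b2'.
  have m1 : nm (c * (P i p).1 - c * (trunc a b N p).1) <= nm c * K * nm p.2 ^+ N.+1.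
    by rewrite -mulrBr nmM -mulrA ler_wpM2l ?nm_ge0.
  have z1 : 0 <= nm c * K * nm p.2 ^+ N.+1 by rewrite !mulr_ge0 ?exprn_ge0 ?nm_ge0.
  have z2 : 0 <= 4 * K * nm p.2 ^+ N.+1 by rewrite !mulr_ge0 ?exprn_ge0 ?nm_ge0.
  set A := K3 * _ in b1' b2' *; rewrite 2!mulrDl; split.
    by rewrite (le_trans (nm_subr _ _ _) (le_trans (lerD b1' m1) _))// lerDl.
  rewrite (le_trans (nm_subr _ _ _) (le_trans (lerD b2' lip) _))// lerD2r lerDl //.
split; apply: (bigOy_of_SF tau_im tau_arg).
- by move=> i c' d c'0 d0; have [K K0 hK] := main i c' d c'0 d0; exists K => //; apply: filterS hK => p [].
- by move=> z z0; rewrite h0 !trunc_axis /= subrr.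
- by move=> i c' d c'0 d0; have [K K0 hK] := main i c' d c'0 d0; exists K => //; apply: filterS hK => p [].
by move=> z z0; rewrite h0 !trunc_axis /= mul0r subrr.
Qed.

(** The inverse germ is the lift attached to [(c^-1, - t)], hence the second condition. *)
Lemma backward c t : c != 0 -> stab c t -> stab c^-1 (- t) -> exists Th, convergent_aut F a b c t Th.
Proof.
move=> c0 s1 s2; have c0' : c^-1 != 0 by rewrite invr_eq0.
have [Th [h0 hT dT]] := lift_exists c0 s1; have [Th' [h0' hT' dT']] := lift_exists c0' s2.
have tT i : tame [:: i] Th.
  by apply: (close_tame c0) => c' d c'0 d0; have [K K0 hK] := @Lf_close c t i c0 c' d c'0 d0; exists K => //;
    apply: filterS2 hK (hT i c' d c'0 d0) => p h /= ->.
have tT' i : tame [:: i] Th'.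
  by apply: (close_tame c0') => c' d c'0 d0; have [K K0 hK] := @Lf_close c^-1 (- t) i c0' c' d c'0 d0; exists K => //;
    apply: filterS2 hK (hT' i c' d c'0 d0) => p h /= ->.
have inv c1 t1 i T1 T2 : c1 != 0 -> (forall i, tame [:: i] T1) -> (forall i, Sect [:: i] (fun p => T1 p = Lf c1 t1 i p)) ->
    (forall i, Sect [:: i] (fun p => T2 p = Lf c1^-1 (- t1) i p)) -> Sect [:: i] (fun p => T2 (T1 p) = p).
  move=> c10 tT1 hT1 hT2; have k1 := @Lf_conj c1 t1 i c10; have k2 := tame_Sect (tT1 i) (hT2 i).
  have [_ _ h1 _ _] := hSC i; have t1' := tame_Sect (Pt i) (@Sect_torus R varpi [:: i]).
  have t2' := tame_Sect (tame_comp (Pt i) (@model_tame R varpi [:: i] c1 t1 c10)) (@Sect_torus R varpi [:: i]).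
  apply: SectS (SectI (SectI (hT1 i) k1) (SectI k2 (SectI h1 (SectI t1' t2')))) => p.
  rewrite /comp => -[[e1 e2] [-> [[_ e3] [[_ y1] [_ y2]]]]].
  rewrite e1 {1}/Lf e2 model_comp//; first by rewrite mulVf// addNr model10 e3.
  by rewrite -(model_xi c1 t1 y1) invr_eq0.
exists Th; split; last exact: lift_formal.
split=> //.
- exists Th'; split.
  + by split.
  + by move=> _ [p [/= p1 p2] <-]; rewrite (surjective_pairing p) p2 h0 /Ctilde /= mulf_neq0.
  + by move=> _ [p [/= p1 p2] <-]; rewrite (surjective_pairing p) p2 h0' /Ctilde /= mulf_neq0.
  apply: (set_nbhs_of_Sect tau_im tau_arg).
    move=> i; apply: SectI; first exact: (inv c t i Th Th').
    apply: (inv c^-1 (- t) i Th' Th) => //; by rewrite invrK opprK.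
  by move=> z z0; rewrite /= h0 !h0' h0 mulKf// mulVKf.
apply: (set_nbhs_of_Sect tau_im tau_arg).
  move=> i; have tF := @F_tame R tau varpi F F_nbhd [:: i].
  have k1 := tame_Sect tF (hT i); have [_ _ h1 h2 h3] := hSC i.
  have tm := @model_tame R varpi [:: i] c t c0.
  have k2 := tame_Sect (tame_comp (Pt i) tm) (Q_F100 F_nbhd hSC i).
  have far : Sect [:: i] (fun q => q.2 != 0 /\ (q.2^-1 + t != 0 /\ q.2^-1 - 1 != 0)).
    move=> c' d _ _; apply: filterS (SF_far varpi [:: i] c' d (nm t + 1)) => q [q0' hq _]; split=> //; split.
      by rewrite -nm_gt0; have := nm_lbD q.2^-1 t; lra.
    by rewrite -nm_gt0; have := nm_lb q.2^-1 1; rewrite nm1; have := nm_ge0 t; lra.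
  apply: SectS (SectI (SectI k1 (hT i)) (SectI (SectI k2 h3) (tame_Sect (Pt i) far))) => p.
  rewrite /comp => -[[e1 e2] [[e3 e4] [y0 [y1 y2]]]].
  change (Th (F p) = F (Th p)); rewrite e1 e2 /Lf -e3 e4 /F100 model_comp// model_comp//.
  by rewrite mulrC [t + _]addrC.
by move=> z z0; rewrite /= F_axis// !h0 F_axis ?mulf_neq0// mulrCA.
Qed.

Hypothesis trivial_transition : forall i, \forall w \near ((0, 0) : C * C), w.1 != 0 -> w.2 != 0 -> u i w = 1 /\ v i w = 1.

Lemma P_agree_all i : Sect [:: i; i + 1] (fun p => P i p = P (i + 1) p).
Proof.
have e4 : (0 : R) < 4^-1 by rewrite invr_gt0 ltr0n.
have t1 := tame_Sect (tame_sub (@sub_l i) (Pt i)) (@Sect_torus R varpi [:: i; i + 1]).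
have t2 := tame_Sect (tame_sub (@sub_r i) (Pt (i + 1))) (@Sect_torus R varpi [:: i; i + 1]).
have wn := tame_Sect (tame_sub (@sub_r i) (Pt (i + 1))) (@W_near2 R tau varpi tau_im tau_arg i _ (trivial_transition i)).
apply: SectS (SectI (SectI (@hov i) (PP_xi i e4)) (SectI (SectI t1 t2) wn)) => p [[e x] [[[_ y1] [z2 y2]] w]].
apply: (@P_agree i) => //; rewrite e; rewrite /mUV; have [||-> ->] := w; try exact: W_neq0.
by rewrite !mulr1 kap_Pi.
Qed.

(** With trivial transitions the charts [P i] themselves agree on overlaps and glue to the
    conjugacy; it is the identity on [y = 0], whence [k = 0]. *)
Lemma trivial_equivalent : analytically_equivalent_100 tau F.
Proof.
have n1 := oner_neq0 C.
have dP i : Sect [:: i] (fun p => differentiable (P i) p) by have [_ _ h _ _] := hSC i; apply: SectS h => p [].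
have dQ i : Sect [:: i] (fun p => differentiable (Q i) p) by have [_ _ _ h _] := hSC i; apply: SectS h => p [].
have agQ i : Sect [:: i; i + 1] (fun q => Q i q = Q (i + 1) q).
  have [_ _ h1 _ _] := hSC i; have [_ _ _ h2 _] := hSC (i + 1).
  have tQ := tame_sub (@sub_r i) (Qt (i + 1)).
  have k1 := tame_Sect tQ (@P_agree_all i); have k2 := tame_Sect tQ (Sect_sub (@sub_l i) h1).
  by apply: SectS (SectI (SectI k1 k2) (Sect_sub (@sub_r i) h2)) => q [[e1 [_ e2]] [_ e3]]; rewrite -{1}e3 -e1 e2.
have [Phi [h0 hT]] := glue_sect tau_im tau_arg 1 P_agree_all.
have dT := glue_diff tau_im tau_arg (fun i => Pc i) dP h0 hT.
have [Phi' [h0' hT']] := glue_sect tau_im tau_arg 1 agQ.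
have dT' := glue_diff tau_im tau_arg Q_close dQ h0' hT'.
have tPhi i : tame [:: i] Phi.
  by apply: (close_tame n1) => c' d c'0 d0; have [K K0 hK] := Pc i c'0 d0; exists K => //;
    apply: filterS2 hK (hT i c' d c'0 d0) => p h /= ->.
have tPhi' i : tame [:: i] Phi'.
  by apply: (close_tame n1) => c' d c'0 d0; have [K K0 hK] := @Q_close i c' d c'0 d0; exists K => //;
    apply: filterS2 hK (hT' i c' d c'0 d0) => p h /= ->.
exists Phi; split.
- exists Phi'; split.
  + by split.
  + by move=> _ [p [/= p1 p2] <-]; rewrite (surjective_pairing p) p2 h0 /Ctilde /= mul1r.
  + by move=> _ [p [/= p1 p2] <-]; rewrite (surjective_pairing p) p2 h0' /Ctilde /= mul1r.
  apply: (set_nbhs_of_Sect tau_im tau_arg).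
    move=> i; have [_ _ h1 h2 _] := hSC i; apply: SectI.
      apply: SectS (SectI (SectI (hT i) (tame_Sect (tPhi i) (hT' i))) h1) => p [[e1 e2] [_ e3]].
      by rewrite e2 e1 e3.
    apply: SectS (SectI (SectI (hT' i) (tame_Sect (tPhi' i) (hT i))) h2) => p [[e1 e2] [_ e3]].
    by rewrite e2 e1 e3.
  by move=> z z0; rewrite /= h0 !h0' h0 !mul1r.
- apply: (set_nbhs_of_Sect tau_im tau_arg).
    move=> i; have tF := @F_tame R tau varpi F F_nbhd [:: i]; have [_ _ _ _ h3] := hSC i.
    by apply: SectS (SectI (SectI (hT i) (tame_Sect tF (hT i))) h3) => p [[e1 e2] e3]; rewrite /= e2 e1 e3.
  by move=> z z0; rewrite /= F_axis// !h0 /F100 /model /= !mul1r mulN1r mul0r.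
by exists 0 => z z0; rewrite h0 expr0z.
Qed.

End Backward.

(** * Characters and exponents *)

Section Characters.
Variable R : realType.
Local Notation C := (Cx R).
Implicit Types (e w : int * int) (g h : C * C) (m n p q : int).

Definition chi e g : C := g.1 ^ e.1 * g.2 ^ e.2.

Lemma chiD e w g : torus g -> chi (e.1 + w.1, e.2 + w.2) g = chi e g * chi w g.
Proof. by move=> [g1 g2]; rewrite /chi /= !expfzDr// mulrACA. Qed.

Lemma chiN e g : chi (- e.1, - e.2) g = (chi e g)^-1.
Proof. by rewrite /chi /= -!invr_expz invfM. Qed.

Lemma chiM e g h : chi e (g.1 * h.1, g.2 * h.2) = chi e g * chi e h.
Proof. by rewrite /chi /= !expfzMl mulrACA. Qed.

Lemma chiV e g : chi e (g.1^-1, g.2^-1) = (chi e g)^-1.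
Proof. by rewrite /chi /= !exprz_inv -!invr_expz invfM. Qed.

Lemma chi1 e : chi e (1, 1) = 1.
Proof. by rewrite /chi /= !exp1rz mulr1. Qed.

Lemma chi_exp n e g : chi (n * e.1, n * e.2) g = chi e g ^ n.
Proof. by rewrite /chi expfzMl !exprz_exp ![n * _]mulrC. Qed.

Lemma chi_e2ipi e (x y : C) : chi e (e2ipi x, e2ipi y) = e2ipi (x * e.1%:~R + y * e.2%:~R).
Proof. by rewrite /chi /= !e2ipiXz e2ipiD. Qed.

Lemma torus_e2ipi (x y : C) : torus (e2ipi x, e2ipi y). Proof. by split; exact: e2ipi_neq0. Qed.

Lemma torus_mul g h : torus g -> torus h -> torus (g.1 * h.1, g.2 * h.2).
Proof. by move=> [g1 g2] [h1 h2]; split; rewrite /= mulf_neq0. Qed.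

Lemma torus_inv g : torus g -> torus (g.1^-1, g.2^-1).
Proof. by move=> [g1 g2]; split; rewrite /= invr_eq0. Qed.

Definition annih (L : set (int * int)) : set (C * C) := [set g | torus g /\ forall e, L e -> chi e g = 1].

Lemma int_subgroup (S : set int) : S 0 -> (forall m n, S m -> S n -> S (m - n)) ->
  exists d, S d /\ forall m, S m -> exists k, m = k * d.
Proof.
move=> S0 SB; have SN m : S m -> S (- m) by move=> h; rewrite -[- m]add0r; exact: SB.
have SD m n : S m -> S n -> S (m + n) by move=> h1 h2; rewrite -[n]opprK; apply: SB => //; exact: SN.
have SM m (k : nat) : S m -> S (m *+ k).
  by move=> h; elim: k => [|k IH]; rewrite ?mulr0n// mulrS; exact: SD.
have SZ m k : S m -> S (k * m).
  move=> h; have SP (j : nat) : S (j%:Z * m) by have := SM m j h; rewrite -mulr_natl natz.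
  by case: k => k; [exact: SP|rewrite NegzE mulNr; apply: SN; exact: SP].
have [[n /andP[n0 Sn]]|none] := pselect (exists n : nat, (0 < n)%N && `[< S n >]); last first.
  exists 0; split=> // m Sm; exists 0; rewrite mul0r; apply/eqP; apply: contra_notT none => m0.
  exists `|m|%N; rewrite absz_gt0 m0 /=; apply/asboolP.
  by case: (m) Sm => k // /SN; rewrite NegzE opprK abszN.
have ex : exists n : nat, (0 < n)%N && `[< S n >] by exists n; rewrite n0.
case: (ex_minnP ex) => d /andP[d0 /asboolP Sd] min; exists d%:Z; split=> // m Sm.
exists (m %/ d)%Z; have dE := divz_eq m d.
have r0 : 0 <= (m %% d)%Z by apply: modz_ge0; rewrite eqz_nat -lt0n.
have rd : (m %% d)%Z < d by rewrite ltz_pmod.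
have Sr : S (m %% d)%Z.
  by rewrite (_ : (m %% d)%Z = m - (m %/ d)%Z * d); [apply: SB => //; exact: SZ|rewrite {2}dE addrAC subrr add0r].
move: r0 rd Sr dE; case: (m %% d)%Z => // [[|k]] _ kd Sk dE; first by rewrite {1}dE addr0.
have := min k.+1; rewrite /= (asboolT Sk) => /(_ isT); rewrite ltz_nat in kd.
by rewrite leqNgt kd.
Qed.

Lemma lattice_basis (H : set (int * int)) : H (0, 0) -> (forall e w, H e -> H w -> H (e.1 - w.1, e.2 - w.2)) ->
  exists d f n, [/\ H (d, f), H (0, n), d = 0 -> f = 0
    & forall e, H e -> exists k l, e = (k * d, k * f + l * n)].
Proof.
move=> H0 HB.
have [d [[f Hdf] hd]] := @int_subgroup [set m | exists n, H (m, n)] (ex_intro _ 0 H0)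
  (fun m n => fun '(ex_intro x hx) '(ex_intro y hy) => ex_intro _ (x - y) (HB _ _ hx hy)).
have [n [Hn hn]] := @int_subgroup [set n | H (0, n)] H0 (fun m n hm hn => HB (0, m) (0, n) hm hn).
have HZ (k : int) e : H e -> H (k * e.1, k * e.2).
  move=> he; have HN w : H w -> H (- w.1, - w.2).
    by move=> hw; have := HB _ _ H0 hw; rewrite /= !sub0r.
  have HD w : H w -> H (w.1 + e.1, w.2 + e.2).
    by move=> hw; have := HB _ _ hw (HN _ he); rewrite /= !opprK.
  elim/int_ind: k => [|k IH|k IH]; first by rewrite !mul0r.
    rewrite (_ : k.+1%:Z = k%:Z + 1); last by rewrite intS addrC.
    by rewrite !mulrDl !mul1r; exact: (HD (_, _) IH).
  have := HB _ _ IH he; rewrite /= (_ : - k.+1%:Z = - k%:Z - 1); last by rewrite intS opprD addrC.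
  by rewrite !mulrBl !mul1r.
have main e : H e -> exists k l, e = (k * d, k * f + l * n).
  case: e => x y he; have [k hk] := hd x (ex_intro _ y he).
  have h := HB _ _ he (HZ k _ Hdf); rewrite /= hk subrr in h.
  by have [l hl] := hn _ h; exists k, l; rewrite hk -hl addrC subrK.
have [d0|d0] := eqVneq d 0; last by exists d, f, n; split=> // /eqP; rewrite (negPf d0).
exists 0, 0, n; split=> //.
move=> e /main[k [l ->]]; rewrite d0 in Hdf *; have [l' hl'] := hn _ Hdf.
by exists 0, (k * l' + l); rewrite !mulr0 add0r hl' mulrDl mulrA.
Qed.

(** [H] consists of all characters trivial on the annihilator: a subgroup containing [L] with the
    same annihilator, to which [lattice_basis] applies. *)
Lemma annih_basis (L : set (int * int)) : exists d f n, [/\ d = 0 -> f = 0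
  & annih L = @char_kernel R d f `&` @char_kernel R 0 n].
Proof.
pose H : set (int * int) := [set e | forall g, annih L g -> chi e g = 1].
have H0 : H (0, 0) by move=> g _; rewrite /chi !expr0z mulr1.
have HB e w : H e -> H w -> H (e.1 - w.1, e.2 - w.2).
  move=> he hw g hg; have [tg _] := hg.
  by rewrite (chiD e (- w.1, - w.2) tg) chiN he// hw// invr1 mulr1.
have [d [f [n [h1 h2 h3 h4]]]] := lattice_basis H0 HB.
exists d, f, n; split=> //; apply/seteqP; split=> g.
  by move=> hg; have [tg _] := hg; split; split=> //; [exact: (h1 g hg)|exact: (h2 g hg)].
move=> [[tg c1] [_ c2]]; split=> // e Le.
have [k [l ->]] : exists k l, e = (k * d, k * f + l * n) by apply: h4 => g' [_]; exact.
have := chiD (k * d, k * f) (l * 0, l * n) tg; rewrite /= mulr0 addr0 => ->.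
have := chi_exp l (0, n) g; rewrite /= mulr0 => ->.
by rewrite (chi_exp k (d, f)) /chi c1 c2 !exp1rz mulr1.
Qed.

Lemma char_kernel_group p q : [/\ @char_kernel R p q (1, 1),
   forall g h, @char_kernel R p q g -> @char_kernel R p q h -> @char_kernel R p q (g.1 * h.1, g.2 * h.2)
 & forall g, @char_kernel R p q g -> @char_kernel R p q (g.1^-1, g.2^-1)].
Proof.
have t1 : torus ((1 : C), (1 : C)) by split; rewrite /= oner_neq0.
split; first by split=> //; exact: (chi1 (p, q)).
  move=> g h [tg hg] [th hh]; split; first exact: torus_mul.
  by rewrite -/(chi (p, q) _) chiM /chi hg hh mulr1.
move=> g [tg hg]; split; first exact: torus_inv.
by rewrite -/(chi (p, q) _) chiV /chi hg invr1.
Qed.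

(** Positive part; it clears the negative exponents in [char_poly]. *)
Definition intpos m : nat := `|Num.max m 0|%N.

Lemma intposE m : m = (intpos m)%:Z - (intpos (- m))%:Z.
Proof. by rewrite /intpos; case: m => [[|m]|m]; lia. Qed.

Definition char_poly p q : {poly {poly C}} :=
  ('X^(intpos p))%:P * 'X^(intpos q) - ('X^(intpos (- p)))%:P * 'X^(intpos (- q)).

Lemma char_polyE p q g : torus g -> (char_poly p q).[g.2%:P].[g.1] = 0 <-> g.1 ^ p * g.2 ^ q = 1.
Proof.
move=> [g1 g2]; rewrite /char_poly !hornerE /=.
have E (x : C) m : x != 0 -> x ^ m = x ^+ intpos m / x ^+ intpos (- m).
  by move=> x0; rewrite {1}(intposE m) expfzDr// exprnN.
rewrite (E _ p g1) (E _ q g2); have n1 : g.1 ^+ intpos (- p) != 0 by rewrite expf_neq0.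
have n2 : g.2 ^+ intpos (- q) != 0 by rewrite expf_neq0.
rewrite mulrACA -invfM; split=> [/eqP|e].
  by rewrite subr_eq0 => /eqP ->; rewrite divff// mulf_neq0.
apply/eqP; rewrite subr_eq0; apply/eqP.
by rewrite -[LHS](divfK (mulf_neq0 n1 n2)) e mul1r.
Qed.

Lemma kernels_algebraic p q p' q' : algebraic_subgroup (@char_kernel R p q `&` @char_kernel R p' q').
Proof.
have [a1 a2 a3] := char_kernel_group p q; have [b1 b2 b3] := char_kernel_group p' q'.
split.
- by move=> g [[]].
- by split.
- by move=> g h [g1 g2] [h1 h2]; split; [exact: a2|exact: b2].
- by move=> g [g1 g2]; split; [exact: a3|exact: b3].
exists [:: char_poly p q; char_poly p' q'] => g tg; split=> [[[_ h1] [_ h2]] P|h].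
  by rewrite !inE => /orP[] /eqP ->; apply/char_polyE.
by split; split=> //; apply/char_polyE => //; apply: h; rewrite !inE eqxx ?orbT.
Qed.

Lemma finite_roots m : m != 0 -> finite_set [set x : C | x ^ m = 1].
Proof.
have fin (k : nat) : finite_set [set x : C | x ^+ k.+1 = 1].
  have [rs hrs] := closed_field_poly_normal ('X^(k.+1) - 1 : {poly C}).
  apply: (sub_finite_set (B := [set x | x \in rs])); last exact: finite_seq.
  move=> x /= hx; have : root ('X^(k.+1) - 1) x by rewrite rootE !hornerE hx subrr.
  rewrite hrs rootZ; first by rewrite root_prod_XsubC.
  by rewrite lead_coef_eq0 -size_poly_eq0 size_XnsubC.
case: m => [[|k]|k] // _; first exact: (fin k).
apply: (sub_finite_set (B := [set x | x ^+ k.+1 = 1])); last exact: (fin k).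
by move=> x /= hx; rewrite -[LHS]invrK; move: hx; rewrite NegzE -exprnN => ->; rewrite invr1.
Qed.

Lemma kernels_finite d f n : d != 0 -> n != 0 -> finite_set (@char_kernel R d f `&` @char_kernel R 0 n).
Proof.
move=> d0 n0; have dn : d * n != 0 by rewrite mulf_neq0.
apply: (sub_finite_set (B := [set x : C | x ^ (d * n) = 1] `*` [set x : C | x ^ n = 1])); last first.
  by apply: finite_setX; exact: finite_roots.
move=> g [[[g1 g2] h1] [_ h2]]; rewrite expr0z mul1r in h2; split=> //=.
have e : g.1 ^ d = (g.2 ^ f)^-1.
  by apply: (mulIf (expfz_neq0 f g2)); rewrite h1 mulVf// expfz_neq0.
by rewrite -exprz_exp e -[_ ^ f]/(_ ^ f) invr_expz exprz_exp mulNr mulrC -mulrN -exprz_exp h2 exp1rz.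
Qed.

(** A value different from 1, used in [duality1] to separate [(p, q)] from exponents that are not
    parallel to it; 1/3 is within the range of [e2ipi_eq1]. *)
Lemma e2ipi_third : e2ipi (3^-1 : C) != 1.
Proof.
apply/eqP => h; have n3 : nm (3^-1 : C) = 3^-1.
  by rewrite nmV -[3]/(3%:R : C) -ofR_nat nm_ofR ger0_norm.
have := e2ipi_eq1 h; rewrite n3 => /(_ (ltac:(rewrite ltf_pV2 ?posrE// ltr_nat//) : 3^-1 < 2^-1 :> R)) /eqP.
by rewrite invr_eq0 pnatr_eq0.
Qed.

Lemma e2ipi_eq1_int (x : C) : e2ipi x = 1 -> exists k : int, x = k%:~R.
Proof.
move=> hx; have i0 : iM x = 0.
  have := congr1 (@nm R) hx; rewrite nm_e2ipi nm1 -[1]expR0 => /expR_inj/eqP.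
  by rewrite oppr_eq0 mulf_eq0 (gt_eqF (twopi_gt0 R)) => /eqP.
have xE : x = ofR (rE x) by apply: cx_eq; rewrite ?rE_ofR ?iM_ofR.
pose k := Num.floor (rE x + 2^-1); have /andP[k1 k2] := floor_itv (rE x + 2^-1).
rewrite -/k intrD in k1 k2; exists k.
have e : e2ipi (x - k%:~R) = 1 by rewrite e2ipiB hx e2ipi_int divr1.
have nE : nm (x - k%:~R) = `|rE x - k%:~R| by rewrite {1}xE -ofR_int -ofRB nm_ofR.
have [h|h] := eqVneq (rE x - k%:~R) (- 2^-1); last first.
  have : nm (x - k%:~R) < 2^-1.
    by rewrite nE ltr_norml; apply/andP; split; [rewrite lt_neqAle eq_sym h/=; lra|lra].
  by move=> /(e2ipi_eq1 e)/eqP; rewrite subr_eq0 => /eqP.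
exfalso; have e2 : x - k%:~R = - 2^-1.
  by rewrite {1}xE -ofR_int -ofRB h ofRN ofRV -[2]/(2%:R : R) ofR_nat.
have := congr1 (@rE R) e; rewrite e2ipiE rE_cexp rE_twopi_ii iM_twopi_ii e2.
rewrite -[2]/(2%:R : C) -ofR_nat -ofRV -ofRN iM_ofR rE_ofR mulr0 oppr0 expR0 mul1r mulrN cosN.
have -> : twopi R / 2%:R = pi by rewrite /twopi; field.
have r1 : rE (1 : C) = 1 by [].
by rewrite cospi r1; lra.
Qed.

Lemma duality2 p q p' q' e : p * q' != p' * q ->
  (forall g, @char_kernel R p q g -> @char_kernel R p' q' g -> chi e g = 1) ->
  exists k l, e = (k * p + l * p', k * q + l * q').
Proof.
move=> D0 h; pose D : C := (p * q' - p' * q)%:~R.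
have Dn : D != 0 by rewrite intr_eq0 subr_eq0.
have DE : D = p%:~R * q'%:~R - p'%:~R * q%:~R by rewrite /D intrB !intrM.
have ev (x y : C) k l : x * p%:~R + y * q%:~R = k%:~R -> x * p'%:~R + y * q'%:~R = l%:~R ->
    exists s, x * e.1%:~R + y * e.2%:~R = s%:~R :> C.
  move=> h1 h2; apply: e2ipi_eq1_int; rewrite -chi_e2ipi; apply: h.
    by split; [exact: torus_e2ipi|rewrite -[LHS]/(chi (p, q) _) chi_e2ipi h1 e2ipi_int].
  by split; [exact: torus_e2ipi|rewrite -[LHS]/(chi (p', q') _) chi_e2ipi h2 e2ipi_int].
(* The logarithms [(q', - p') / D] and [(- q, p) / D] form the basis dual to [(p, q)], [(p', q')];
   the values of [e] on it are the coefficients sought. *)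
have [s hs] : exists s, q'%:~R / D * e.1%:~R + - p'%:~R / D * e.2%:~R = s%:~R :> C.
  by apply: (ev _ _ 1 0); rewrite DE; field; rewrite -DE.
have [t ht] : exists s, - q%:~R / D * e.1%:~R + p%:~R / D * e.2%:~R = s%:~R :> C.
  by apply: (ev _ _ 0 1); rewrite DE; field; rewrite -DE.
exists s, t; rewrite (surjective_pairing e); congr pair; apply: (@intr_inj C); rewrite intrD !intrM -hs -ht DE; field; by rewrite -DE.
Qed.

Lemma duality1 p q e : (p, q) != (0, 0) -> (forall g, @char_kernel R p q g -> chi e g = 1) ->
  exists k, e = (k * p, k * q).
Proof.
move=> pq0 h; have ev (x y : C) k : x * p%:~R + y * q%:~R = k%:~R -> exists s, x * e.1%:~R + y * e.2%:~R = s%:~R :> C.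
  move=> h1; apply: e2ipi_eq1_int; rewrite -chi_e2ipi; apply: h.
  by split; [exact: torus_e2ipi|rewrite -[LHS]/(chi (p, q) _) chi_e2ipi h1 e2ipi_int].
have prop : e.1 * q = e.2 * p.
  apply/eqP; rewrite -subr_eq0; apply/negP => /negP d0; pose d : C := (e.1 * q - e.2 * p)%:~R.
  have dn : d != 0 by rewrite intr_eq0.
  have dE : d = e.1%:~R * q%:~R - e.2%:~R * p%:~R by rewrite /d intrB !intrM.
  (* The element with logarithms [(q, - p) / (3 d)] belongs to the kernel, and [e] takes the value
     [e2ipi (1/3)] on it. *)
  have := e2ipi_third; rewrite (_ : 3^-1 = q%:~R / (3 * d) * e.1%:~R + - p%:~R / (3 * d) * e.2%:~R); last first.
    by rewrite dE; field; rewrite -dE.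
  rewrite -chi_e2ipi h ?eqxx//; split; first exact: torus_e2ipi.
  rewrite -[LHS]/(chi (p, q) _) chi_e2ipi (_ : _ + _ = 0) ?e2ipi0//; field.
  by rewrite dE in dn.
have [p0|p0] := eqVneq p 0.
  have q0 : q != 0 by apply: contra_neq pq0 => q0; rewrite p0 q0.
  have qn : q%:~R != 0 :> C by rewrite intr_eq0.
  have [k hk] := ev 0 q%:~R^-1 1 (ltac:(by rewrite mul0r add0r mulVf)).
  exists k; rewrite (surjective_pairing e); congr pair.
    by move/eqP: prop; rewrite p0 mulr0 mulf_eq0 (negPf q0) orbF => /eqP ->; rewrite mulr0.
  by apply: (@intr_inj C); rewrite intrM -hk mul0r add0r mulrAC mulVf// mul1r.
have pn : p%:~R != 0 :> C by rewrite intr_eq0.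
have [k hk] := ev p%:~R^-1 0 1 (ltac:(by rewrite mul0r addr0 mulVf)).
have e1 : e.1 = k * p by apply: (@intr_inj C); rewrite intrM -hk mul0r addr0 mulrAC mulVf// mul1r.
exists k; rewrite (surjective_pairing e) e1; congr pair; apply: (mulIf p0).
by rewrite -prop e1 mulrAC.
Qed.

Lemma cexp_slope (c x s : C) (e : R) : 0 < e -> exists2 r, 0 < r & forall k : C, k != 0 -> nm k < r ->
  nm (k^-1 * (cexp (c * (k + s)) * x - cexp (c * s) * x) - c * (cexp (c * s) * x)) < e.
Proof.
move=> e0; pose M := nm (cexp (c * s) * x); pose Z := 2 * (M * nm c + 1).
have Mc : 0 <= M * nm c by rewrite mulr_ge0 ?nm_ge0.
have Z0 : 0 < Z by rewrite mulr_gt0// ltr_wpDl.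
have eZ : 0 < e / Z by rewrite divr_gt0.
have [r r0 hr] := cexp_small eZ; have c1 : 0 < nm c + 1 by rewrite ltr_wpDl ?nm_ge0.
exists (r / (nm c + 1)); first by rewrite divr_gt0.
move=> k k0; rewrite ltr_pdivlMr// => kr; have nk : 0 < nm k by rewrite nm_gt0.
have ck : nm (c * k) < r.
  by rewrite nmM mulrC (le_lt_trans _ kr)// ler_wpM2l ?nm_ge0// lerDl.
have -> : k^-1 * (cexp (c * (k + s)) * x - cexp (c * s) * x) - c * (cexp (c * s) * x) =
   (cexp (c * s) * x) * (cexp (c * k) - 1 - c * k) / k by rewrite [c * (k + s)]mulrDr cexpD; field.
rewrite nmM nmV ltr_pdivrMr// nmM -/M.
have M0 : 0 <= M by exact: nm_ge0.
apply: (le_lt_trans (ler_wpM2l M0 (hr _ ck))); rewrite [nm (c * k)]nmM.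
have -> : M * (e / Z * (nm c * nm k)) = e * nm k * (M * nm c / Z) by ring.
by rewrite gtr_pMr ?mulr_gt0// ltr_pdivrMr// mul1r /Z; lra.
Qed.

(** Move along the flow until one coordinate agrees, the one whose flow exponent is nonzero; the
    quotient then has only a root of unity in the other coordinate. *)
Lemma flow_index p q : (p, q) != (0, 0) -> flow_has_finite_index p q (@char_kernel R p q).
Proof.
move=> pq0; pose Phi (s : C) (x : C * C) : C * C := (cexp (q%:~R * s) * x.1, cexp (- p%:~R * s) * x.2).
exists Phi; split.
  move=> x; split; first by rewrite /Phi !mulr0 cexp0 !mul1r -surjective_pairing.
  move=> s; have cv : (h^-1 *: ((Phi^~ x \o shift s) (h *: (1 : C)) - Phi s x) @[h --> (0 : C)^']) -->
      ((q%:~R * (Phi s x).1, - (p%:~R * (Phi s x).2)) : C * C).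
    apply/cvgC2P => e e0; have [r1 r10 h1] := cexp_slope q%:~R x.1 s e0.
    have [r2 r20 h2] := cexp_slope (- p%:~R) x.2 s e0.
    have m0 : 0 < Num.min r1 r2 by rewrite lt_min r10.
    have nb : \forall k \near (0 : C), nm k < Num.min r1 r2.
      by apply/nbhsCP; exists (Num.min r1 r2) => // w; rewrite subr0.
    apply: filterS nb => k; rewrite lt_min => /andP[k1 k2] k0.
    by split; rewrite /= scaler1; [exact: h1|rewrite -mulNr; exact: h2].
  apply: DeriveDef; first by apply/cvg_ex; eexists; exact: cv.
  exact: (cvg_lim (@norm_hausdorff _ _) cv).
have ex (n : int) (s : C) : cexp (n%:~R * s) = cexp s ^ n.
  have nat_case (k : nat) : cexp (k%:~R * s) = cexp s ^+ k.
    elim: k => [|k IH]; first by rewrite mulr0z mul0r cexp0 expr0.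
    by rewrite intS intrD mulrDl mul1r cexpD IH exprS.
  case: n => n; first exact: nat_case.
  by rewrite NegzE mulrNz mulNr cexpN nat_case -exprnN.
have ker s : @char_kernel R p q (cexp (q%:~R * s), cexp (- p%:~R * s)).
  split; first by split; exact: cexp_neq0.
  by rewrite /= -mulrNz !ex !exprz_exp mulNr -invr_expz mulrC [q * p]mulrC mulVf// expfz_neq0// cexp_neq0.
have sub : flow_group Phi `<=` @char_kernel R p q.
  move=> g [tg [s hs]]; have := hs (1, 1); rewrite /Phi /= !mulr1 => -[e1 e2].
  by rewrite (surjective_pairing g) -e1 -e2; exact: ker.
have infl s : flow_group Phi (cexp (q%:~R * s), cexp (- p%:~R * s)).
  by split; [split; exact: cexp_neq0|exists s].
split=> //; have [p0|p0] := eqVneq p 0.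
  have q0 : q != 0 by apply: contra_neq pq0 => q0; rewrite p0 q0.
  have qn : q%:~R != 0 :> C by rewrite intr_eq0.
  exists ([set (1 : C)] `*` [set y : C | y ^ q = 1]); split.
  - by apply: finite_setX; [exact: finite_set1|exact: finite_roots].
  - move=> [x y] [/= -> hy]; split; last by rewrite /= exp1rz mul1r.
    split; rewrite /= ?oner_neq0//; apply: contra_eq_neq hy => ->; rewrite exp0rz (negPf q0) eq_sym oner_neq0//.
  move=> g [[g1 g2] hg]; have [s hs] := cexp_surj g1.
  exists (1, g.2), (g.1, 1); split=> /=; last by rewrite mul1r mulr1 -surjective_pairing.
    by split=> //=; rewrite p0 expr0z mul1r in hg.
  by have := infl (s / q%:~R); rewrite p0 oppr0 mul0r cexp0 mulrC divfK// hs.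
have pn : - p%:~R != 0 :> C by rewrite oppr_eq0 intr_eq0.
exists ([set x : C | x ^ p = 1] `*` [set (1 : C)]); split.
- by apply: finite_setX; [exact: finite_roots|exact: finite_set1].
- move=> [x y] [/= hx ->]; split; last by rewrite /= exp1rz mulr1.
  split; rewrite /= ?oner_neq0//; apply: contra_eq_neq hx => ->; rewrite exp0rz (negPf p0) eq_sym oner_neq0//.
move=> g [[g1 g2] hg]; have [s hs] := cexp_surj g2.
pose s' := s / - p%:~R; have es : - p%:~R * s' = s by rewrite mulrC divfK.
have n1 : cexp (q%:~R * s') != 0 := cexp_neq0 _.
exists (g.1 / cexp (q%:~R * s'), 1), (cexp (q%:~R * s'), g.2); split=> /=; last by rewrite mul1r divfK// -surjective_pairing.
  split=> //=; have [_ k] := ker s'; rewrite /= es hs in k.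
  rewrite expfzMl -expfV; apply: (mulIf (expfz_neq0 p n1)); rewrite divfK ?expfz_neq0// mul1r.
  by apply: (mulIf (expfz_neq0 q g2)); rewrite hg k.
by have := infl s'; rewrite es hs.
Qed.

End Characters.

(** * The group as an annihilator *)

Section CornerExponents.
Variable R : realType.
Local Notation C := (Cx R).
Implicit Types (i j : 'Z_4) (U : C * C -> C) (m n : int) (e : int * int).

Definition sgz j : int := if nside j then -1 else 1.
(** Passes from exponents of [(w_i, w_{i+1})] to exponents of [(X, Y)]; [ice] is the inverse. *)
Definition ce i e : int * int := if odd i then (sgz (i + 1) * e.2, sgz i * e.1) else (sgz i * e.1, sgz (i + 1) * e.2).
Definition ice i e : int * int := if odd i then (sgz i * e.2, sgz (i + 1) * e.1) else (sgz i * e.1, sgz (i + 1) * e.2).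

Lemma ceK i e : ce i (ice i e) = e /\ ice i (ce i e) = e.
Proof. by case: e => x y; move: i; apply: Z4P; rewrite /ce /ice /sgz /nside /= ?mul1r ?mulN1r ?opprK. Qed.

Lemma tw_ce i e (g : C * C) : tw i g ^ e.1 * tw (i + 1) g ^ e.2 = chi (ce i e) g.
Proof.
have te j m : tw j g ^ m = (if odd j then g.2 else g.1) ^ (sgz j * m).
  by rewrite /tw /pw /sgz; case: nside; rewrite ?mul1r ?mulN1r ?exprz_inv.
have oi (k : 'Z_4) : k = i + 1 -> odd k = ~~ odd i by move=> ->; move: (i); apply: Z4P.
by rewrite !te (oi _ erefl) /ce /chi; case: odd => //=; rewrite mulrC.
Qed.

Lemma hol0_pdb U : hol0 U -> exists r B, [/\ 0 < r, 0 <= B & pdb U r B].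
Proof.
move=> hU; have /cvgCP/(_ 1 ltr01) cU := differentiable_continuous (nbhs_singleton hU).
have hb : \forall w \near ((0, 0) : C * C), differentiable U w /\ nm (U w - U (0, 0)) < 1 by exact: (filterI hU cU).
have /near0P[r r0 hr] := hb.
exists r, (nm (U (0, 0)) + 1); split; [exact: r0|by rewrite addr_ge0 ?nm_ge0|].
move=> x y /andP[_ xr] /andP[_ yr]; have [d b] := hr x y xr yr; split; first exact: d.
by have := nm_lb (U (x, y)) (U (0, 0)); rewrite /= in b; lra.
Qed.

(** Only points with [|y| = |x|] are tested: [overlap_stab] provides these, and the tori on which
    [pcoef] is computed are of this kind. *)
Definition torus_stab i (g : C * C) U := exists2 e, 0 < e & forall x y : C, 0 < nm x < e -> nm y = nm x ->
  U (tw i g * x, tw (i + 1) g * y) = U (x, y).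

Lemma stab_support i g U r B m n : 0 < r -> pdb U r B -> torus g -> torus_stab i g U ->
  pcoef U r m n != 0 -> chi (ce i (m, n)) g = 1.
Proof.
move=> r0 hU [g1 g2] [e e0 he] c0; rewrite -tw_ce /=.
exact: (stab_pcoef r0 hU (tw_neq0 i g1 g2) (tw_neq0 (i + 1) g1 g2) e0 he c0).
Qed.

Lemma corner_near i (Q : C -> C -> P1xP1 R -> Prop) : (\forall w \near ((0, 0) : C * C), forall X Y : C, X != 0 -> Y != 0 ->
    w = (tw i (X, Y), tw (i + 1) (X, Y)) -> Q X Y (Some X, Some Y)) ->
  set_nbhs [set corner R i] [set p | forall X Y : C, X != 0 -> Y != 0 -> p = (Some X, Some Y) -> Q X Y p].
Proof.
move=> h p ->; rewrite -kap0; apply/nbhs_kap; apply: filterS h => w h X Y X0 Y0 e; rewrite e; apply: h => //.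
by rewrite -(kco_kap i w) e /kco !wc_torus.
Qed.

Lemma laurent_corner (I : choiceType) (mon : I -> C -> C -> C) (lat : I -> int * int) i U :
  hol0 U -> injective lat -> (forall k X Y, X != 0 -> Y != 0 -> mon k X Y = chi (lat k) (X, Y)) ->
  (forall r B m n, 0 < r -> pdb U r B -> pcoef U r m n != 0 -> exists k, lat k = ce i (m, n)) ->
  laurent_at mon i (fun X Y => U (tw i (X, Y), tw (i + 1) (X, Y))).
Proof.
move=> hU latI hmon supp; have [r [B [r0 B0 hr]]] := hol0_pdb hU.
pose io k := ice i (lat k); pose cf k := pcoef U r (io k).1 (io k).2; exists cf.
apply: (@corner_near i (fun X Y p => (partial_sum (fun k => cf k * mon k X Y) : {fset I} -> C) @ totally -->
   U (tw i (X, Y), tw (i + 1) (X, Y)))).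
have r4 : 0 < r / 4 by rewrite divr_gt0.
have near4 : \forall w \near ((0, 0) : C * C), nm w.1 < r / 4 /\ nm w.2 < r / 4 by apply/near0P; exists (r / 4).
apply: filterS near4 => w [w1 w2] X Y X0 Y0 e.
have t1 : 0 < nm (tw i (X, Y)) <= r / 4 by rewrite nm_gt0 tw_neq0//= ltW//; move: w1; rewrite e.
have t2 : 0 < nm (tw (i + 1) (X, Y)) <= r / 4 by rewrite nm_gt0 tw_neq0//= ltW//; move: w2; rewrite e.
have ioI : injective io by move=> k l h; apply: latI; rewrite -(ceK i (lat k)).1 -(ceK i (lat l)).1; congr ce.
have hs m n : pcoef U r m n != 0 -> exists k, io k = (m, n).
  by move=> c0; have [k hk] := supp r B m n r0 hr c0; exists k; rewrite /io hk; exact: (ceK i (m, n)).2.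
have := laurent_sum r0 B0 hr ioI hs t1 t2.
rewrite (_ : (fun k => _) = (fun k => cf k * mon k X Y))//; apply/funext => k.
by rewrite tw_ce /io (ceK i (lat k)).1 hmon.
Qed.

End CornerExponents.

(** * The group, its three cases and the normalized cocycle *)

Section Main.
Variables (R : realType) (tau : Cx R) (varpi : R) (F : Cx R * Cx R -> Cx R * Cx R) (a b : nat -> Cx R -> Cx R).
Local Notation C := (Cx R).
Local Notation Sect := (Sect varpi).
Local Notation tame := (tame varpi).
Local Notation W := (Wc tau).
Local Notation SC := (SC tau varpi F a b).
Hypothesis tau_im : 0 < iM tau.
Hypothesis tau_arg : tau = ofR (nm tau) * cexp (ofR varpi * ii R).
Hypothesis F_nbhd : neighbourhood_germ tau F.
Hypothesis ab : holomorphic_coefs a b.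
Variables (u v : 'Z_4 -> C * C -> C) (P Q : 'Z_4 -> C * C -> C * C).
Hypothesis huv : forall i, [/\ cg (u i) (v i), \forall w \near ((0, 0) : C * C), u i (w.1, 0) = 1
  & \forall w \near ((0, 0) : C * C), v i (w.1, 0) = 1].
Hypothesis hSC : forall i, SC i (P i) (Q i).
Hypothesis hov : forall i, Sect [:: i; i + 1] (fun p => Pimap tau (P i p) =
  kap i (mUV (u i) (v i) (W i (P (i + 1) p), W (i + 1) (P (i + 1) p)))).
Implicit Types (i j : 'Z_4) (p q : C * C) (U : C * C -> C).
Local Notation G := (aut_group tau F a b).
Local Notation fac := (fac u v).

Lemma fac_l i : fac i i (u i). Proof. by left. Qed.
Lemma fac_r i : fac i (i + 1) (v i). Proof. by right. Qed.

Lemma G_torus g : G g -> torus g.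
Proof.
move=> [c [t [Th [hT ->]]]]; have [[c0 _ _ _] _] := hT.
by split; [exact: e2ipi_neq0|apply: mulf_neq0; [exact: c0|exact: e2ipi_neq0]].
Qed.

Lemma G_stab g i j U : G g -> fac i j U -> torus_stab i g U.
Proof.
move=> [c [t [Th [hT ->]]]] hU; have [e e0 he] := overlap_stab tau_im tau_arg F_nbhd ab huv hSC hov hT hU.
by exists e.
Qed.

Definition supp : set (int * int) := [set e | exists i j U r B m n,
  [/\ fac i j U, 0 < r, pdb U r B, pcoef U r m n != 0 & e = ce i (m, n)]].

(** Invariance of the units is read on their coefficients: [stab_support] gives one inclusion; for
    the other, [pcoef_stab] makes the element and its inverse stabilize the units and [backward]
    lifts them. *)
Lemma G_annih : G = annih supp.
Proof.
apply/seteqP; split=> g.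
  move=> Gg; have tg := G_torus Gg; split=> // e [i [j [U [r [B [m [n [hU r0 hr c0 ->]]]]]]]].
  exact: (stab_support r0 hr tg (G_stab Gg hU) c0).
move=> [tg hg]; have [g1 g2] := tg.
have stabs h : torus h -> (forall e, supp e -> chi e h = 1) -> forall i j U, fac i j U ->
    exists2 e, 0 < e & forall x y : C, 0 < nm x < e -> 0 < nm y < e -> U (tw i h * x, tw (i + 1) h * y) = U (x, y).
  move=> [h1 h2] hh i j U hU; have [hU0 _] := fac_germ huv hU.
  have [r [B [r0 B0 hr]]] := hol0_pdb hU0.
  apply: (pcoef_stab r0 B0 hr (tw_neq0 i h1 h2) (tw_neq0 (i + 1) h1 h2)) => m n c0.
  rewrite -[tw i h ^ m * _]/(tw i h ^ (m, n).1 * tw (i + 1) h ^ (m, n).2) tw_ce; apply: hh.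
  by exists i, j, U, r, B, m, n.
have [t ht] := e2ipi_surj g1; pose c := g.2 / e2ipi (tau * t).
have c0 : c != 0 by rewrite mulf_neq0 ?invr_eq0 ?e2ipi_neq0.
have gE : multipliers tau c t = g by rewrite /multipliers ht /c divfK ?e2ipi_neq0// -surjective_pairing.
have gE' : multipliers tau c^-1 (- t) = (g.1^-1, g.2^-1).
  by rewrite /multipliers mulrN !e2ipiN ht /c invf_div mulrAC mulfV ?e2ipi_neq0// mul1r.
have s1 : stab tau u v c t by move=> i j U hU; rewrite gE; exact: (stabs g tg hg i j U hU).
have s2 : stab tau u v c^-1 (- t).
  move=> i j U hU; rewrite gE'; apply: (stabs _ (torus_inv tg) _ i j U hU) => e he.
  by rewrite chiV hg// invr1.
have [Th hT] := backward tau_im tau_arg F_nbhd ab hSC hov c0 s1 s2.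
by exists c, t, Th; rewrite gE.
Qed.

(** A character trivial on the whole torus is zero, so every unit is constant off the axes, equal to
    its value 1 at the corner. *)
Lemma torus_trivial : G = @torus R -> analytically_equivalent_100 tau F.
Proof.
move=> GT; apply: (trivial_equivalent tau_im tau_arg F_nbhd ab hSC hov).
suff one i j U : fac i j U -> \forall w \near ((0, 0) : C * C), w.1 != 0 -> w.2 != 0 -> U w = 1.
  move=> i; apply: filterS2 (one i i _ (fac_l i)) (one i (i + 1) _ (fac_r i)) => w h1 h2 w1 w2.
  by split; [exact: h1|exact: h2].
move=> hU; have [hU0 _] := fac_germ huv hU; have [r [B [r0 B0 hr]]] := hol0_pdb hU0.
have U0 : U (0, 0) = 1 by have [[k1 k2 _ _] _ _] := huv i; case: hU => -[_ ->].
have z0 m n : (m, n) != (0, 0) -> pcoef U r m n = 0.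
  move=> mn; apply/eqP; apply/negP => /negP c0.
  have ann e : supp e -> e = (0, 0).
    move=> he; have ceg (g : C * C) : torus g -> chi e g = 1 by move=> tg; have Gg : G g by [rewrite GT]; move: Gg; rewrite G_annih => -[_]; exact.
    have [|k hk] := @duality1 R 1 0 e _ (fun g hg => ceg g hg.1); first by [].
    have [|l hl] := @duality1 R 0 1 e _ (fun g hg => ceg g hg.1); first by [].
    by rewrite (surjective_pairing e) {1}hl hk /= !mulr0.
  have e0 := ann (ce i (m, n)) (ex_intro _ i (ex_intro _ j (ex_intro _ U (ex_intro _ r (ex_intro _ B
     (ex_intro _ m (ex_intro _ n (And5 hU r0 hr c0 erefl)))))))).
  by move/eqP: mn; apply; rewrite -(ceK i (m, n)).2 e0 /ice; case: odd; rewrite /= !mulr0.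
pose k := pcoef U r 0 0; pose g w := U w + - k * 1.
have hg : pdb g r (B + nm k).
  move=> x y hx hy; have [d1 d2] := hr x y hx hy; split.
    by apply: differentiableD; [exact: d1|exact: differentiable_cst].
  by rewrite (le_trans (nmD _ _))// mulr1 nmN lerD2r.
have cg0 m n : pcoef g r m n = 0.
  have D := edom_lnh r0; have eg : elift g = fun q => elift U q + - k * mono 0 0 q.
    by apply/funext => q; rewrite /elift /g mono00.
  rewrite /pcoef eg (@coefD _ (edom r) _ _ _ _ _ (lnh r, lnh r) (holper_elift hr) (holper_mono _ _ _) D).
  rewrite coef_mono -/(pcoef U r m n); have [e|e] := eqVneq (m, n) (0, 0).
    by case: e => -> ->; rewrite !eqxx /= mulr1 subrr.
  rewrite (z0 _ _ e) add0r ifF ?mulr0//; apply: contra_neqF e => /andP[/eqP <- /eqP <-] //.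
have BB : 0 <= B + nm k by rewrite addr_ge0 ?nm_ge0.
have UE x y : 0 < nm x < r -> 0 < nm y < r -> U (x, y) = k.
  move=> hx hy; have := pcoef_eq0 r0 BB hg cg0 hx hy; rewrite /g mulr1 => /eqP.
  by rewrite subr_eq0 => /eqP.
have k1 : k = 1.
  apply/eqP; rewrite -subr_eq0 -nm_eq0 eq_le nm_ge0 andbT; apply/ler_addgt0Pr => e e0; rewrite add0r.
  have /cvgCP/(_ e e0)/near0P[s s0 hs] := differentiable_continuous (nbhs_singleton hU0).
  pose x : C := ofR (Num.min r s / 2); have m0 : 0 < Num.min r s by rewrite lt_min r0.
  have nx : nm x = Num.min r s / 2 by rewrite nm_ofR ger0_norm// divr_ge0// ltW.
  have m2 : Num.min r s / 2 < Num.min r s by rewrite ltr_pdivrMr// ltr_pMr// ltr1n.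
  have x0 : 0 < nm x < r by rewrite nx divr_gt0//= (lt_le_trans m2)// ge_min lexx.
  have xs : nm x < s by rewrite nx (lt_le_trans m2)// ge_min lexx orbT.
  by have := hs x x xs xs; rewrite /= UE// U0 => /ltW.
apply/near0P; exists r => // x y xr yr x0 y0; rewrite -k1; apply: UE.
  by rewrite xr nm_gt0 x0.
by rewrite yr nm_gt0 y0.
Qed.

Variables (Psi : 'Z_4 -> C * C -> C * C) (phi : 'Z_4 -> P1xP1 R -> P1xP1 R) (A B : 'Z_4 -> C -> C).
Hypothesis hN : forall i, Diff1_line i (Nmap i (A i) (B i)).
Hypothesis hcoc : is_cocycle (fun i (p : P1xP1 R) => kap i (mUV (u i) (v i) (kco i p))).
Hypothesis hcomp : forall i, \forall p \near corner R i,
  kap i (mUV (u i) (v i) (kco i (Nmap (i + 1) (A (i + 1)) (B (i + 1)) p))) = Nmap i (A i) (B i) (phi i p).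
Hypothesis hPsi : forall i, Sect [:: i] (fun p => Pimap tau (P i p) = Nmap i (A i) (B i) (Pimap tau (Psi i p))).

Lemma phit0 (p : P1xP1 R) : phit tau 0 p = p.
Proof. by rewrite /phit mulr0 e2ipi0 lin11. Qed.

Lemma laurent_of_G (I : choiceType) (mon : I -> C -> C -> C) (lat : I -> int * int) :
  injective lat -> (forall k X Y, X != 0 -> Y != 0 -> mon k X Y = chi (lat k) (X, Y)) ->
  (forall e, (forall g, G g -> chi e g = 1) -> exists k, lat k = e) ->
  laurent_cocycle mon (fun i (p : P1xP1 R) => kap i (mUV (u i) (v i) (kco i p))).
Proof.
move=> latI hmon dual i; have [[u1 v1 hu hv] _ _] := huv i.
have un := hol0_neq0 (ltac:(by rewrite u1 oner_neq0) : u i (0, 0) != 0) hu.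
have vn := hol0_neq0 (ltac:(by rewrite v1 oner_neq0) : v i (0, 0) != 0) hv.
(* The units multiply [w_i] and [w_{i+1}]; the factors of [X] and [Y] are obtained by exchanging or
   inverting them. *)
pose U1 w := (unt i (u i w, v i w)).1; pose U2 w := (unt i (u i w, v i w)).2.
have hU1 : hol0 U1.
  apply: filterS2 (filterI hu hv) (filterI un vn) => w [du dv] [nu nv].
  by rewrite /U1 /unt /swp; case: odd; apply: diff_pw; [exact: dv|exact: nv|exact: du|exact: nu].
have hU2 : hol0 U2.
  apply: filterS2 (filterI hu hv) (filterI un vn) => w [du dv] [nu nv].
  by rewrite /U2 /unt /swp; case: odd; apply: diff_pw; [exact: du|exact: nu|exact: dv|exact: nv].
have inv g : G g -> torus_stab i g U1 /\ torus_stab i g U2.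
  move=> Gg; have [e e0 he] := G_stab Gg (fac_l i); have [e' e'0 he'] := G_stab Gg (fac_r i).
  have m0 : 0 < Num.min e e' by rewrite lt_min e0.
  split; exists (Num.min e e') => // x y; rewrite lt_min => /andP[x0 /andP[x1 x2]] yx.
    by rewrite /U1 he ?x0// he' ?x0.
  by rewrite /U2 he ?x0// he' ?x0.
have su U : (forall g, G g -> torus_stab i g U) -> forall r B m n, 0 < r -> pdb U r B -> pcoef U r m n != 0 ->
    exists k, lat k = ce i (m, n).
  move=> hUg r B' m n r0 hr c0; apply: dual => g Gg.
  exact: (stab_support r0 hr (G_torus Gg) (hUg g Gg) c0).
exists (fun X Y => U1 (tw i (X, Y), tw (i + 1) (X, Y))), (fun X Y => U2 (tw i (X, Y), tw (i + 1) (X, Y))); split.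
- exact: (laurent_corner hU1 latI hmon (su _ (fun g Gg => (inv g Gg).1))).
- exact: (laurent_corner hU2 latI hmon (su _ (fun g Gg => (inv g Gg).2))).
apply: (@corner_near R i (fun X Y (p : P1xP1 R) => kap i (mUV (u i) (v i) (kco i p)) =
  (Some (X * U1 (tw i (X, Y), tw (i + 1) (X, Y))), Some (Y * U2 (tw i (X, Y), tw (i + 1) (X, Y)))) :> P1xP1 R)).
apply: filterS2 un vn => w nu nv X Y X0 Y0 e; rewrite -e.
have kE : kco i (Some X, Some Y) = w by rewrite /kco !wc_torus e.
have [n1 n2] := @unt_neq0 R i (u i w, v i w) nu nv.
have X1 : X * U1 w != 0 by exact: mulf_neq0.
have Y1 : Y * U2 w != 0 by exact: mulf_neq0.
have d1 := wdom_torus i X1 Y1; have d2 := wdom_torus (i + 1) X1 Y1.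
rewrite kE -[RHS](kap_kco d1 d2); congr kap; rewrite /kco !wc_torus !tw_mul.
have [t1 t2] := tw_unt i (u i w, v i w); rewrite (surjective_pairing (unt _ _)) in t1 t2.
by rewrite t1 t2 /mUV e.
Qed.

Lemma normalizable_of_G (I : choiceType) (mon : I -> C -> C -> C) (lat : I -> int * int) :
  injective lat -> (forall k X Y, X != 0 -> Y != 0 -> mon k X Y = chi (lat k) (X, Y)) ->
  (forall e, (forall g, G g -> chi e g = 1) -> exists k, lat k = e) ->
  normalizable tau varpi F a b Psi phi mon.
Proof.
move=> latI hmon dual; exists 0, (fun i => Nmap i (A i) (B i)), (fun i (p : P1xP1 R) => kap i (mUV (u i) (v i) (kco i p))).
split=> //; last 2 first.
- exact: (laurent_of_G latI hmon dual).
- move=> c s Th hT; have tT := @Th_tame R varpi F a b c s Th hT.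
  move=> g i chi0; apply/sect1P.
  have fw := forward tau_im tau_arg F_nbhd ab huv hSC hov hT.
  apply: SectS (SectI (SectI (hPsi i) (tame_Sect (tT [:: i]) (hPsi i))) (fw i)) => p [[e1 e2] e3].
  by rewrite /= /chi0 !phit0 -e1 -e2 e3.
split=> // i p ->; apply: filterS (hcomp i) => q e.
by rewrite /= !phit0.
Qed.

Lemma mon2_lattice (p q p' q' : int) : p * q' != p' * q -> G = @char_kernel R p q `&` @char_kernel R p' q' ->
  normalizable tau varpi F a b Psi phi (@mon2 R p q p' q').
Proof.
move=> D0 GE; apply: (@normalizable_of_G _ _ (fun k => (k.1 * p + k.2 * p', k.1 * q + k.2 * q'))).
- move=> [k l] [k' l'] /= [e1 e2].
  have D1 : p * q' - p' * q != 0 by rewrite subr_eq0.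
  have E1 : (k - k') * (p * q' - p' * q) = 0.
    have -> : (k - k') * (p * q' - p' * q) = (k * p + l * p') * q' - (k * q + l * q') * p' - ((k' * p + l' * p') * q' - (k' * q + l' * q') * p') by ring.
    by rewrite e1 e2 subrr.
  have E2 : (l - l') * (p * q' - p' * q) = 0.
    have -> : (l - l') * (p * q' - p' * q) = (k * q + l * q') * p - (k * p + l * p') * q - ((k' * q + l' * q') * p - (k' * p + l' * p') * q) by ring.
    by rewrite e1 e2 subrr.
  move/eqP: E1; move/eqP: E2; rewrite !mulf_eq0 (negPf D1) !orbF !subr_eq0 => /eqP -> /eqP -> //.
- move=> [k l] X Y X0 Y0; have tXY : torus (X, Y) by [].
  by rewrite (chiD (k * p, k * q) (l * p', l * q') tXY) (chi_exp k (p, q)) (chi_exp l (p', q')).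
move=> e he; have [k [l hkl]] : exists k l, e = (k * p + l * p', k * q + l * q').
  by apply: (@duality2 R) => // g h1 h2; apply: he; rewrite GE.
by exists (k, l).
Qed.

Lemma mon1_lattice (p q : int) : (p, q) != (0, 0) -> G = @char_kernel R p q ->
  normalizable tau varpi F a b Psi phi (@mon1 R p q).
Proof.
move=> pq0 GE; apply: (@normalizable_of_G _ _ (fun k => (k * p, k * q))).
- move=> k l /= [e1 e2]; have [p0|p0] := eqVneq p 0; last exact: (mulIf p0).
  have q0 : q != 0 by apply: contra_neq pq0 => q0; rewrite p0 q0.
  exact: (mulIf q0).
- by move=> k X Y X0 Y0; rewrite (chi_exp k (p, q)).
move=> e he; have [k hk] : exists k, e = (k * p, k * q) by apply: (duality1 pq0) => g hg; apply: he; rewrite GE.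
by exists k.
Qed.

Lemma G_cases : algebraic_subgroup G /\
  [\/ exists p q p' q' : int, [/\ finite_set G, (p, q) != (0, 0), (p', q') != (0, 0), p * q' != p' * q
        & G = @char_kernel R p q `&` @char_kernel R p' q'],
      exists p q : int, [/\ (p, q) != (0, 0), G = @char_kernel R p q & flow_has_finite_index p q G]
    | G = @torus R /\ analytically_equivalent_100 tau F].
Proof.
have [d [f [n [df GE]]]] := annih_basis R supp; rewrite -G_annih in GE.
split; first by rewrite GE; exact: kernels_algebraic.
have k00 : @char_kernel R 0 0 = @torus R.
  by apply/seteqP; split=> g; [case|split=> //; rewrite !expr0z mulr1].
have sub (p q : int) : @char_kernel R p q `&` @torus R = @char_kernel R p q.
  by apply/seteqP; split=> g; [case|move=> h; split=> //; case: h].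
(* The rank of the lattice spanned by [(d, f)] and [(0, n)] decides: 0 gives the torus, 1 a single
   kernel, 2 a finite group; [df] makes [d = 0] imply [(d, f) = (0, 0)]. *)
have [n0|n0] := eqVneq n 0; have [d0|d0] := eqVneq d 0.
- rewrite n0 d0 (df d0) k00 setIid in GE; constructor 3; split=> //; exact: torus_trivial.
- rewrite n0 k00 sub in GE; have df0 : (d, f) != (0, 0) by apply: contra_neq d0 => -[].
  by constructor 2; exists d, f; split=> //; rewrite GE; exact: flow_index.
- rewrite d0 (df d0) k00 setIC sub in GE; have n00 : ((0, n) : int * int) != (0, 0) by apply: contra_neq n0 => -[].
  by constructor 2; exists 0, n; split=> //; rewrite GE; exact: flow_index.
constructor 1; exists d, f, 0, n; split=> //.
- by rewrite GE; exact: kernels_finite.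
- by apply: contra_neq d0 => -[].
by rewrite mul0r mulf_neq0.
Qed.

End Main.

Theorem theorem8p1 (R : realType) (tau : Cx R) (varpi : R)
  (F : Cx R * Cx R -> Cx R * Cx R) (a b : nat -> Cx R -> Cx R)
  (S : 'Z_4 -> set (Cx R * Cx R)) (Psi : 'Z_4 -> Cx R * Cx R -> Cx R * Cx R)
  (phi : 'Z_4 -> P1xP1 R -> P1xP1 R)
  (tau_im : 0 < 'Im tau)
  (varpi_range : 0 < varpi < pi)
  (tau_arg : tau = `|tau| * cexp (ofR varpi * (0 +i* 1)%C))
  (F_nbhd : neighbourhood_germ tau F)
  (hatPsi_coefs : holomorphic_coefs a b)
  (hatPsi_conj : formal_conj a b F (q0 tau) (- 1))
  (Psi_norm : forall i, sectorial_normalization tau varpi F a b i (S i) (Psi i))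
  (phi_cocycle : is_cocycle phi)
  (Psi_cocycle : has_cocycle tau varpi Psi phi) :
  let G := aut_group tau F a b in
  [/\ algebraic_subgroup G,
      [\/ exists p q p' q' : int,
            [/\ finite_set G, (p, q) != (0, 0), (p', q') != (0, 0),
                p * q' != p' * q
              & G = char_kernel p q `&` char_kernel p' q'],
          exists p q : int,
            [/\ (p, q) != (0, 0), G = char_kernel p q
              & flow_has_finite_index p q G]
        | G = @torus R /\ analytically_equivalent_100 tau F],
      forall p q p' q' : int, p * q' != p' * q ->
        G = char_kernel p q `&` char_kernel p' q' ->
        normalizable tau varpi F a b Psi phi (@mon2 R p q p' q')
    & forall p q : int, (p, q) != (0, 0) -> G = char_kernel p q ->
        normalizable tau varpi F a b Psi phi (@mon1 R p q)].
Proof.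
move=> G; have im : 0 < iM tau by move: tau_im; rewrite -complexIm -/(ofR (iM tau)) -[0]/(ofR 0) ofR_lt.
have ag : tau = ofR (nm tau) * cexp (ofR varpi * ii R) by rewrite -nmE.
have [A [B [u [v [P [Q [[hN hcoc] huv hcomp hP hov]]]]]]] :=
  normalized_charts im ag F_nbhd hatPsi_coefs Psi_norm phi_cocycle Psi_cocycle.
have hSC i := (hP i).1; have hPsi i := (hP i).2.
have [alg cases] := G_cases im ag F_nbhd hatPsi_coefs huv hSC hov.
split=> //.
- move=> p q p' q'; exact: (mon2_lattice im ag F_nbhd hatPsi_coefs huv hSC hov hN hcoc hcomp hPsi).
move=> p q; exact: (mon1_lattice im ag F_nbhd hatPsi_coefs huv hSC hov hN hcoc hcomp hPsi).
Qed.
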